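(* Assume (A1), (A2), (A3), let $\bar\varepsilon>0$, $u_0^{\bar\varepsilon}\in H^1(\mathbb{T}^d)$ and $\ell\in L^2([0,T];\mathcal H)$. Then there exists a weak solution of $$du_{\bar\varepsilon}+\mathrm{div}F(u_{\bar\varepsilon})\,dt+(-\Delta)^\theta[\Phi(u_{\bar\varepsilon})]\,dt=\bar\varepsilon\Delta u_{\bar\varepsilon}\,dt+h(u_{\bar\varepsilon})\,\ell(t)\,dt,\qquad u_{\bar\varepsilon}(0,x)=u_0^{\bar\varepsilon}(x),\qquad(x,t)\in\mathbb{T}^d\times[0,T].$$
   Context: **Setting.** $T>0$, $\theta\in(0,1)$, $\mathbb{T}^d$ is the $d$-dimensional torus with period $1$; functions on it are identified with periodic functions on $\mathbb{R}^d$. $(-\Delta)^\theta[\Gamma](x)=-\mathrm{P.V.}\int_{\mathbb{R}^d}(\Gamma(x+z)-\Gamma(x))|z|^{-d-2\theta}\,dz$. $\mathcal H$ is a separable Hilbert space with orthonormal basis $(e_k)_{k\ge1}$; $h(u)e_k=h_k(\cdot,u)$, so $h(u)\ell=\sum_kh_k(\cdot,u)\ell_k$ for $\ell=\sum_k\ell_ke_k$. **Assumptions.** (A1) $F:\mathbb{R}\to\mathbb{R}^d$ is $C^2$ and Lipschitz. (A2) $\Phi:\mathbb{R}\to\mathbb{R}$ is non-decreasing and Lipschitz. (A3) $h_k\in C(\mathbb{T}^d\times\mathbb{R})$ and for some $C$, for all $x,\bar x\in\mathbb{T}^d$, $y,\bar y\in\mathbb{R}$: $\sum_k|h_k(x,y)|^2\le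 C(1+|y|^2)$ and $\sum_k|h_k(x,y)-h_k(\bar x,\bar y)|^2\le C(|x-\bar x|^2+|y-\bar y|^2)$. **Weak solution.** $u\in L^\infty([0,T];L^2(\mathbb{T}^d))$ such that for every $\psi\in C^\infty(\mathbb{T}^d)$ and a.e. $t\in[0,T]$, with $\langle\cdot,\cdot\rangle$ the $L^2(\mathbb{T}^d)$ pairing, $$\langle u(t),\psi\rangle-\langle u_0^{\bar\varepsilon},\psi\rangle=\int_0^t\langle F(u),\nabla\psi\rangle dr-\int_0^t\langle\Phi(u),(-\Delta)^\theta[\psi]\rangle dr+\bar\varepsilon\int_0^t\langle u,\Delta\psi\rangle dr+\int_0^t\langle h(u)\ell(r),\psi\rangle dr.$$ *)

(* Defs.v *)
From HB Require Import structures.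
From mathcomp Require Import all_boot all_order all_algebra.
From mathcomp Require Import all_classical all_reals all_analysis.

Set Implicit Arguments.
Unset Strict Implicit.
Unset Printing Implicit Defensive.

Import Order.TTheory GRing.Theory Num.Theory.
Import numFieldNormedType.Exports.

Local Open Scope classical_set_scope.
Local Open Scope ring_scope.

Definition measure_rV_display : measure_display.
Proof. exact: default_measure_display. Qed.

(* The sigma-algebra on R^n is the product of the Borel sigma-algebras. *)
Section measurable_rV.
Context {R : realType} (n : nat).

Let coor (i : 'I_n) (x : 'rV[R]_n) : measurableTypeR R := x ord0 i.

Let rV_set0 : g_sigma_preimage coor set0.
Proof. exact: sigma_algebra0. Qed.

Let rV_setC A : g_sigma_preimage coor A -> g_sigma_preimage coor (~` A).
Proof. exact: sigma_algebraC. Qed.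

Let rV_bigcup (F : (set 'rV[R]_n)^nat) :
  (forall i, g_sigma_preimage coor (F i)) ->
  g_sigma_preimage coor (\bigcup_i (F i)).
Proof. exact: sigma_algebra_bigcup. Qed.

HB.instance Definition _ := @isMeasurable.Build measure_rV_display
  'rV[R]_n (g_sigma_preimage coor) rV_set0 rV_setC rV_bigcup.

End measurable_rV.

Section rV_measurability.
Context {R : realType}.

Lemma measurable_coord n (i : 'I_n) :
  measurable_fun [set: 'rV[R]_n]
    (fun x : 'rV[R]_n => x ord0 i : measurableTypeR R).
Proof.
move=> _ Y mY; rewrite setTI; apply: sub_sigma_algebra => /=.
rewrite -bigcup_seq/=; exists i => /=; first by rewrite mem_index_enum.
by exists Y => //; rewrite setTI.
Qed.

Lemma measurable_fun_rV d (T : measurableType d) n (f : T -> 'rV[R]_n) :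
  (forall i, measurable_fun [set: T]
    (fun t => f t ord0 i : measurableTypeR R)) ->
  measurable_fun [set: T] f.
Proof.
move=> mf _ A mA; rewrite setTI.
pose G : set (set 'rV[R]_n) := [set B | measurable (f @^-1` B)].
suff : G A by [].
move: A mA; apply: smallest_sub.
  split.
  - by rewrite /G/= preimage_set0.
  - by move=> B GB; rewrite /G/= setTD preimage_setC; exact: measurableC.
  - move=> F GF; rewrite /G/= preimage_bigcup.
    by apply: bigcupT_measurable => k; exact: GF.
rewrite -bigcup_seq => B [i /= _ [C mC <-]].
rewrite /G/= setTI.
by have := mf i measurableT C mC; rewrite setTI.
Qed.

Definition rV_cons n (p : measurableTypeR R * 'rV[R]_n) : 'rV[R]_n.+1 :=
  row_mx (p.1 : R)%:M p.2 : 'rV[R]_(1 + n).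

Lemma measurable_rV_cons n : measurable_fun [set: _] (@rV_cons n).
Proof.
apply: measurable_fun_rV => i; rewrite /rV_cons.
have [j ij|j ij] := split_ordP (i : 'I_(1 + n)).
- rewrite (_ : (fun _ => _) = fst); first exact: measurable_fst.
  apply/funext => p; rewrite ij; apply: etrans (row_mxEl _ _ _ _) _.
  by rewrite mxE (ord1 j) eqxx mulr1n.
- rewrite (_ : (fun _ => _) = (fun x : 'rV[R]_n => x ord0 j) \o snd).
    exact: (measurableT_comp (measurable_coord j) measurable_snd).
  by apply/funext => p; rewrite ij; exact: row_mxEr.
Qed.

End rV_measurability.

Section measure_rV_cons.
Context {R : realType} (n : nat) (mu : {measure set 'rV[R]_n -> \bar R}).

Let prod_mu : {measure set (measurableTypeR R * 'rV[R]_n) -> \bar R} :=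
  (@lebesgue_measure R \x^ mu)%E.

Definition measure_rV_cons : set 'rV[R]_n.+1 -> \bar R :=
  pushforward prod_mu (@rV_cons R n).

Let cons_preimage A : measurable A -> measurable (@rV_cons R n @^-1` A).
Proof.
by move=> mA; rewrite -[X in measurable X]setTI; exact: measurable_rV_cons.
Qed.

Let cons0 : measure_rV_cons set0 = 0%E.
Proof. by rewrite /measure_rV_cons /pushforward preimage_set0 measure0. Qed.

Let cons_ge0 A : (0 <= measure_rV_cons A)%E.
Proof. exact: (measure_ge0 prod_mu). Qed.

Let cons_sigma_additive : semi_sigma_additive measure_rV_cons.
Proof.
move=> F mF tF mUF; rewrite /measure_rV_cons /pushforward preimage_bigcup.
apply: measure_semi_sigma_additive.
- by move=> k; exact: cons_preimage.
- apply/trivIsetP => /= i j _ _ ij; rewrite -preimage_setI.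
  by move/trivIsetP : tF => /(_ _ _ _ _ ij) ->//; rewrite preimage_set0.
- by rewrite -preimage_bigcup; exact: cons_preimage.
Qed.

HB.instance Definition _ := isMeasure.Build _ _ _ measure_rV_cons
  cons0 cons_ge0 cons_sigma_additive.

End measure_rV_cons.

(* Lebesgue measure on R^n, by recursion on n: the unit mass for n = 0, and the
   image of the product of the one- and n-dimensional Lebesgue measures under
   (x, v) |-> (x, v_1, ..., v_n) for n + 1. *)
Fixpoint lebesgue_rV {R : realType} (n : nat) :
    {measure set 'rV[R]_n -> \bar R} :=
  match n with
  | 0 => \d_(0 : 'rV[R]_0)
  | m.+1 => measure_rV_cons (lebesgue_rV m)
  end.

(* The norm of 'rV[R]_n in the library is the sup norm; |x| is [enorm x]. *)
Section euclidean.
Context {R : realType} {d : nat}.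
Implicit Types x y : 'rV[R]_d.

Definition basis_vec (i : 'I_d) : 'rV[R]_d := delta_mx ord0 i.

Definition edot x y : R := \sum_i x ord0 i * y ord0 i.

Definition enorm x : R := Num.sqrt (edot x x).

(* distance on R^d / Z^d *)
Definition torus_dist x y : R :=
  inf [set enorm (x - y + \row_i (m i)%:~R) | m in [set: 'I_d -> int]].

End euclidean.

(* Functions on the torus are periodic functions on R^d, integrated over the
   unit cube; elements of L^2 are Borel representatives. *)
Section torus.
Context {R : realType} {d : nat}.
Implicit Types f g : 'rV[R]_d -> R.

Definition periodic f := forall x i, f (x + basis_vec i) = f x.

Definition unit_cube : set 'rV[R]_d := [set x | forall i, 0 <= x ord0 i < 1].

Lemma measurable_unit_cube : measurable unit_cube.
Proof.
rewrite (_ : unit_cube = \bigcap_(i in [set: 'I_d])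
    ((fun x => x ord0 i : measurableTypeR R) @^-1` `[0, 1[%classic)).
  apply: fin_bigcap_measurable => // i _.
  rewrite -[X in measurable X]setTI.
  by apply: (measurable_coord i) => //; exact: measurable_itv.
apply/seteqP; split => x /= cx i; have := cx i.
  by move=> cxi _ /=; rewrite in_itv.
by move=> /(_ I) /=; rewrite in_itv.
Qed.

Definition torus_measure : {measure set 'rV[R]_d -> \bar R} :=
  mrestr (lebesgue_rV d) measurable_unit_cube.

Definition torus_L2 : set ('rV[R]_d -> R) :=
  [set f | periodic f /\ f \in Lfun torus_measure 2%:E].

Definition torus_L2norm f : \bar R := 'N[torus_measure]_2%:E[EFin \o f]%E.

Definition L2dot f g : R := \int[torus_measure]_x (f x * g x).

Definition partial (i : 'I_d) f : 'rV[R]_d -> R := 'D_(basis_vec i) f.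

Definition grad f : 'rV[R]_d -> 'rV[R]_d := fun x => \row_i partial i f x.

Definition laplacian f : 'rV[R]_d -> R :=
  fun x => \sum_i partial i (partial i f) x.

(* C^oo: the partial derivatives of all orders (the list [s] gives the order of
   differentiation) exist and are differentiable, hence continuous. *)
Definition smooth f := forall (s : seq 'I_d) (x : 'rV[R]_d),
  differentiable (foldr partial f s) x.

Definition torus_smooth : set ('rV[R]_d -> R) :=
  [set f | periodic f /\ smooth f].

Definition torus_H1 : set ('rV[R]_d -> R) :=
  [set f | torus_L2 f /\ forall i, exists2 g, torus_L2 g &
    forall psi, torus_smooth psi -> L2dot f (partial i psi) = - L2dot g psi].

(* The principal value excludes Euclidean balls centred at 0. *)
Definition frac_laplacian (theta : R) f : 'rV[R]_d -> R := fun x =>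
  - lim ((fun eps : R => \int[lebesgue_rV d]_(z in [set z | eps < enorm z])
      ((f (x + z) - f x) * enorm z `^ (- (d%:R + 2 * theta)))) @ 0^'+).

End torus.

(* Bochner spaces L^p([0, T]; E), where E is a subset of V with norm N. *)
Section bochner.
Context {R : realType} {V : zmodType} (N : V -> \bar R) (E : set V).

Definition time_measure (T : R) : {measure set (measurableTypeR R) -> \bar R} :=
  mrestr (@lebesgue_measure R) (measurable_itv `[0, T]).

Definition simple (s : measurableTypeR R -> V) :=
  [/\ finite_set (range s), range s `<=` E &
      forall v, measurable (s @^-1` [set v])].

Definition bochner_measurable (T : R) (f : R -> V) :=
  exists2 s : nat -> R -> V, forall n, simple (s n) &
    {ae time_measure T, forall t, N (s n t - f t) @[n --> \oo] --> 0%E}.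

Definition bochner_L (p : \bar R) (T : R) (f : R -> V) :=
  [/\ forall t, 0 <= t <= T -> E (f t), bochner_measurable T f &
      ('N[time_measure T]_p[N \o f] < +oo)%E].

End bochner.

Section hilbert.
Context {R : realType} {H : completeNormedModType R}.

(* [ip] makes H a Hilbert space for its norm. *)
Definition hilbert_norm (ip : {dot H for idfun}) :=
  forall v : H, `|v| ^+ 2 = ip v v.

(* e k is the basis vector with index k + 1. *)
Definition orthonormal_basis (ip : {dot H for idfun}) (e : nat -> H) :=
  (forall j k, ip (e j) (e k) = (j == k)%:R) /\
  (forall v, series (fun k => ip v (e k) *: e k) @ \oo --> v).

Definition hnorm (v : H) : \bar R := `|v|%:E.

End hilbert.

Section assumptions.
Context {R : realType} {d : nat}.

Definition A1 (F : R -> 'rV[R]_d) :=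
  [/\ forall y, derivable F y 1, forall y, derivable (derive1 F) y 1,
      continuous (derive1 (derive1 F)) & lipschitz F].

Definition A2 (Phi : R -> R) :=
  {homo Phi : y z / y <= z} /\ lipschitz Phi.

Definition A3 (h : nat -> 'rV[R]_d -> R -> R) :=
  [/\ forall k y, periodic (h k ^~ y),
      forall k, continuous (fun p : 'rV[R]_d * R => h k p.1 p.2) &
      exists C : R,
        (forall x y, \sum_(0 <= k <oo) (`|h k x y| ^+ 2)%:E <=
           (C * (1 + `|y| ^+ 2))%:E)%E /\
        (forall x x' y y',
           \sum_(0 <= k <oo) (`|h k x y - h k x' y'| ^+ 2)%:E <=
           (C * (torus_dist x x' ^+ 2 + `|y - y'| ^+ 2))%:E)%E].

End assumptions.

Section weak_solution.
Context {R : realType} {d : nat} {H : completeNormedModType R}.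
Variables (ip : {dot H for idfun}) (e : nat -> H).

(* h(u)l = \sum_k h_k(., u) l_k, where l_k = <l, e_k> *)
Definition noise (h : nat -> 'rV[R]_d -> R -> R) (u : 'rV[R]_d -> R) (l : H) :
    'rV[R]_d -> R :=
  fun x => limn (series (fun k => h k x (u x) * ip l (e k))).

Definition weak_solution (T theta : R) (F : R -> 'rV[R]_d) (Phi : R -> R)
    (h : nat -> 'rV[R]_d -> R -> R) (eps : R) (u0 : 'rV[R]_d -> R)
    (l : R -> H) (u : R -> 'rV[R]_d -> R) :=
  bochner_L torus_L2norm torus_L2 +oo%E T u /\
  forall psi, torus_smooth psi -> {ae time_measure T, forall t,
    L2dot (u t) psi - L2dot u0 psi =
      \int[lebesgue_measure]_(r in `[0, t])
        (\int[torus_measure]_x edot (F (u r x)) (grad psi x))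
      - \int[lebesgue_measure]_(r in `[0, t])
          L2dot (Phi \o u r) (frac_laplacian theta psi)
      + eps * (\int[lebesgue_measure]_(r in `[0, t])
          L2dot (u r) (laplacian psi))
      + \int[lebesgue_measure]_(r in `[0, t])
          L2dot (noise h (u r) (l r)) psi}.

End weak_solution.

(* Main.v *)
(* Fix a with theta < a < 1 and 1/2 <= a, and expand in the real trigonometric basis (phi_n),
   where - Laplacian phi_n = lam_n phi_n.  Dividing the n-th coefficients of div F(u) and of
   (-Delta)^theta Phi(u) by w_n = (1 + lam_n)^a leaves maps that are Lipschitz from L^2 to l^2,
   and u |-> h(u) l(s) is Lipschitz in L^2 with constant O(|l(s)|).  So the mild equation
     u_n(t) = e^(- eps lam_n t) u0_n
              + int_0^t e^(- eps lam_n (t - s)) (w_n P_n(u(s)) + Q_n(s, u(s))) ds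
   is a contraction for the norm sup_t e^(- M t) |u(t)| when M is large, because
   w_n e^(- eps lam_n (t - s)) is at most a multiple of the integrable (t - s)^(- a).  Its fixed
   point satisfies the weak equation tested against every phi_n.  The Fejer means of a smooth psi
   approximate psi, its derivatives up to order two and its second differences uniformly, hence
   also (-Delta)^theta psi, so the equation passes to all smooth psi. *)

From HB Require Import structures.
Require Import Defs.
From mathcomp Require Import all_boot all_order all_algebra.
From mathcomp Require Import all_classical all_reals all_analysis.
From mathcomp Require Import measurable_realfun ess_sup_inf.
From mathcomp Require Import lra ring zify.

Set Implicit Arguments.
Unset Strict Implicit.
Unset Printing Implicit Defensive.

Import Order.TTheory GRing.Theory Num.Theory.
Import numFieldNormedType.Exports.

Local Open Scope classical_set_scope.
Local Open Scope ring_scope.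

(** * Square-integrable functions *)

(** [Phi] may be constant on intervals, so the fractional term gives no regularity, and with [u]
    merely in L^2 the terms div F(u) and (-Delta)^theta Phi(u) make sense only through pairings with
    smooth functions. All derivatives are therefore put on the basis functions, and w_n measures how
    many are lost. The viscosity pays for them: 1/2 <= a covers the one derivative of the
    divergence, theta < a the 2 theta derivatives of the fractional term, and a < 1 keeps (t - s)^(-
    a) integrable. The room left below 1 is spent on an exponent c with a + c < 1, which buys a
    factor Th^(- c). It serves twice: with Th = M it makes the map contract, and on modes with large
    eigenvalue it makes the tails of all iterates uniformly small. The factor |l(s)| is only square
    integrable in time; a weighted arithmetic-geometric inequality gives it the same gain. The
    Lipschitz constants being global, a single M works on all of [0, T]. Elements of L^2 are actual
    functions here, so the solution is an explicit pointwise limit along subsequences, which keeps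
    periodicity exact. *)

Section real_integrable.
Context {dX : measure_display} {X : measurableType dX} {R : realType}.
Variable mu : {measure set X -> \bar R}.
Variable D : set X.
Hypothesis mD : measurable D.
Implicit Types f g : X -> R.

Lemma integrableZ_EFin k f : mu.-integrable D (EFin \o f) ->
  mu.-integrable D (EFin \o (fun x => k * f x)).
Proof. by move=> fi; have := integrableZl mD k fi; apply: eq_integrable. Qed.

Lemma integrableD_EFin f g : mu.-integrable D (EFin \o f) ->
  mu.-integrable D (EFin \o g) -> mu.-integrable D (EFin \o (fun x => f x + g x)).
Proof. by move=> fi gi; have := integrableD mD fi gi; apply: eq_integrable. Qed.

Lemma integrableB_EFin f g : mu.-integrable D (EFin \o f) ->
  mu.-integrable D (EFin \o g) -> mu.-integrable D (EFin \o (fun x => f x - g x)).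
Proof. by move=> fi gi; have := integrableB mD fi gi; apply: eq_integrable. Qed.

Lemma integrable_sum_EFin (I : Type) (s : seq I) (f : I -> X -> R) :
  (forall i, mu.-integrable D (EFin \o f i)) ->
  mu.-integrable D (EFin \o (fun x => \sum_(i <- s) f i x)).
Proof.
move=> fi; elim: s => [|i s IH].
  by under eq_fun do rewrite big_nil; exact: integrable0.
under eq_fun do rewrite big_cons; exact: integrableD_EFin.
Qed.

Lemma Rintegral_sum (I : Type) (s : seq I) (f : I -> X -> R) :
  (forall i, mu.-integrable D (EFin \o f i)) ->
  \int[mu]_(x in D) (\sum_(i <- s) f i x) = \sum_(i <- s) \int[mu]_(x in D) f i x.
Proof.
move=> fi; elim: s => [|i s IH].
  under eq_Rintegral do rewrite big_nil; rewrite big_nil.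
  by rewrite Rintegral_cst// mul0r.
under eq_Rintegral do rewrite big_cons; rewrite big_cons RintegralD ?IH//.
exact: integrable_sum_EFin.
Qed.

Lemma le_integrable_EFin f g : measurable_fun D f ->
  (forall x, D x -> `|f x| <= g x) ->
  mu.-integrable D (EFin \o g) -> mu.-integrable D (EFin \o f).
Proof.
move=> mf fg gi; apply: le_integrable gi => //; first exact/measurable_EFinP.
by move=> x Dx /=; rewrite lee_fin; apply: le_trans (fg x Dx) (ler_norm _).
Qed.

Lemma eq_integrable_EFin f g : (forall x, D x -> f x = g x) ->
  mu.-integrable D (EFin \o f) -> mu.-integrable D (EFin \o g).
Proof. by move=> fg; apply: eq_integrable => // x /[!inE] /fg /= ->. Qed.

End real_integrable.

Section square_integrable.
Context {dX : measure_display} {X : measurableType dX} {R : realType}.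
Variable mu : {measure set X -> \bar R}.
Implicit Types (f g h : X -> R) (a b : R).

Local Notation L2 := (Lfun mu 2%:E).

Definition ip f g : R := \int[mu]_x (f x * g x).

Definition nrm f : R := Num.sqrt (ip f f).

Lemma L2_measurable f : f \in L2 -> measurable_fun [set: X] f.
Proof. by rewrite inE => /andP[]; rewrite inE. Qed.

Lemma L2_sqr f : f \in L2 -> mu.-integrable setT (EFin \o (fun x => f x ^+ 2)).
Proof. exact: Lfun2_integrable_sqr. Qed.

Lemma L2I f : measurable_fun [set: X] f ->
  mu.-integrable setT (EFin \o (fun x => f x ^+ 2)) -> f \in L2.
Proof.
move=> mf /integrableP[_ fi].
rewrite inE; apply/andP; split; rewrite inE//=.
rewrite /finite_norm unlock poweR_lty//.
apply: le_lt_trans fi; rewrite le_eqVlt; apply/orP; left; apply/eqP.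
apply: eq_integral => x _ /=.
by rewrite powR_mulrn// normrX.
Qed.

Lemma L2_linear a f g : f \in L2 -> g \in L2 -> (fun x => a * f x + g x) \in L2.
Proof.
move=> fL gL.
have [_ /(_ a f g fL gL)] := @Lfun_submod_closed _ X R mu 2%:E ltac:(by rewrite lee1n).
by [].
Qed.

Lemma L2_0 : (fun=> 0) \in L2.
Proof. by have [] := @Lfun_submod_closed _ X R mu 2%:E ltac:(by rewrite lee1n). Qed.

Lemma L2Z a f : f \in L2 -> (fun x => a * f x) \in L2.
Proof.
move=> fL; have := L2_linear a fL L2_0.
by under eq_fun do rewrite addr0.
Qed.

Lemma L2D f g : f \in L2 -> g \in L2 -> (fun x => f x + g x) \in L2.
Proof.
move=> fL gL; have := L2_linear 1 fL gL.
by under eq_fun do rewrite mul1r.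
Qed.

Lemma L2B f g : f \in L2 -> g \in L2 -> (fun x => f x - g x) \in L2.
Proof.
move=> fL gL; have := L2_linear (-1) gL fL.
by under eq_fun do rewrite mulN1r addrC.
Qed.

Lemma L2_sum (I : Type) (s : seq I) (P : pred I) (F : I -> X -> R) :
  (forall i, P i -> F i \in L2) -> (fun x => \sum_(i <- s | P i) F i x) \in L2.
Proof.
move=> FL; elim: s => [|i s IH].
  by under eq_fun do rewrite big_nil; exact: L2_0.
case: (boolP (P i)) => [Pi|/negbTE Pi]; under eq_fun do rewrite big_cons Pi.
  by apply: L2D; [exact: FL|exact: IH].
exact: IH.
Qed.

Lemma L2_le f g c : measurable_fun [set: X] f -> g \in L2 ->
  (forall x, `|f x| <= c * `|g x|) -> f \in L2.
Proof.
move=> mf gL fg; apply: L2I => //.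
apply: le_integrable (L2_sqr (L2Z c gL)) => //.
  by apply/measurable_EFinP; exact: measurable_funX.
move=> x _ /=; rewrite lee_fin !normrX normrM ler_sqr ?nnegrE//.
by apply: le_trans (fg x) _; rewrite ler_wpM2r// ler_norm.
Qed.

Lemma ip_integrable f g : f \in L2 -> g \in L2 ->
  mu.-integrable setT (EFin \o (fun x => f x * g x)).
Proof. by move=> fL gL; apply/Lfun1_integrable; exact: Lfun2_mul_Lfun1. Qed.

Lemma ipC f g : ip f g = ip g f.
Proof. by apply: eq_Rintegral => x _; rewrite mulrC. Qed.

Lemma ip_linear a f g h : f \in L2 -> g \in L2 -> h \in L2 ->
  ip (fun x => a * f x + g x) h = a * ip f h + ip g h.
Proof.
move=> fL gL hL; rewrite /ip.
under eq_Rintegral do rewrite mulrDl -mulrA.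
rewrite RintegralD//; last exact: ip_integrable.
  by rewrite RintegralZl//; exact: ip_integrable.
have := ip_integrable (L2Z a fL) hL.
by apply: eq_integrable => // x _; rewrite /= mulrA.
Qed.

Lemma ip0l f : ip (fun=> 0) f = 0.
Proof.
rewrite /ip; under eq_Rintegral do rewrite mul0r.
by rewrite Rintegral_cst// mul0r.
Qed.

Lemma ipZl a f h : f \in L2 -> h \in L2 -> ip (fun x => a * f x) h = a * ip f h.
Proof.
move=> fL hL; have := ip_linear a fL L2_0 hL; rewrite ip0l addr0 => <-.
by congr ip; apply/funext => x; rewrite addr0.
Qed.

Lemma ipDl f g h : f \in L2 -> g \in L2 -> h \in L2 ->
  ip (fun x => f x + g x) h = ip f h + ip g h.
Proof.
move=> fL gL hL; have := ip_linear 1 fL gL hL; rewrite mul1r => <-.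
by congr ip; apply/funext => x; rewrite mul1r.
Qed.

Lemma ipBl f g h : f \in L2 -> g \in L2 -> h \in L2 ->
  ip (fun x => f x - g x) h = ip f h - ip g h.
Proof.
move=> fL gL hL; have := ip_linear (-1) gL fL hL; rewrite mulN1r addrC => <-.
by congr ip; apply/funext => x; rewrite mulN1r addrC.
Qed.

Lemma ip_suml (I : Type) (s : seq I) (P : pred I) (F : I -> X -> R) h :
  (forall i, P i -> F i \in L2) -> h \in L2 ->
  ip (fun x => \sum_(i <- s | P i) F i x) h = \sum_(i <- s | P i) ip (F i) h.
Proof.
move=> FL hL; elim: s => [|i s IH].
  by under eq_fun do rewrite big_nil; rewrite big_nil ip0l.
rewrite big_cons; case: (boolP (P i)) => [Pi|/negbTE Pi].
  under eq_fun do rewrite big_cons Pi.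
  by rewrite ipDl ?IH//; [exact: FL|exact: L2_sum].
by under eq_fun do rewrite big_cons Pi.
Qed.

Lemma ip_ge0 f : 0 <= ip f f.
Proof. by apply: Rintegral_ge0 => x _; rewrite -expr2 sqr_ge0. Qed.

Lemma nrm_ge0 f : 0 <= nrm f.
Proof. exact: sqrtr_ge0. Qed.

Lemma sqr_nrm f : nrm f ^+ 2 = ip f f.
Proof. by rewrite sqr_sqrtr// ip_ge0. Qed.

Lemma ipZZ a f : f \in L2 -> ip (fun x => a * f x) (fun x => a * f x) = a ^+ 2 * ip f f.
Proof. by move=> fL; rewrite ipZl ?L2Z// ipC ipZl// mulrA expr2. Qed.

Lemma ip_addsqr f g : f \in L2 -> g \in L2 ->
  ip (fun x => f x + g x) (fun x => f x + g x) = ip f f + ip f g *+ 2 + ip g g.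
Proof.
move=> fL gL; have fgL := L2D fL gL.
rewrite ipDl// ipC (ipC g) !ipDl// (ipC g f) mulr2n; ring.
Qed.

Lemma nrmZ a f : f \in L2 -> nrm (fun x => a * f x) = `|a| * nrm f.
Proof. by move=> fL; rewrite /nrm ipZZ// sqrtrM ?sqr_ge0// sqrtr_sqr. Qed.

(** The quadratic form |a f + b g|^2 is nonnegative for all real a, b. If <g, g> is not 0, the
    choice (<g, g>, - <f, g>) gives the claim. Otherwise (- <f, g>, <f, f> + 1) leaves - <f, g>^2
    (<f, f> + 2) >= 0, which forces <f, g> = 0. *)
Lemma cauchy_schwarz f g : f \in L2 -> g \in L2 -> `|ip f g| <= nrm f * nrm g.
Proof.
move=> fL gL.
rewrite -ler_sqr ?nnegrE ?mulr_ge0 ?nrm_ge0// (real_normK (num_real _)) exprMn !sqr_nrm.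
have P a b : 0 <= a ^+ 2 * ip f f + (a * b * ip f g) *+ 2 + b ^+ 2 * ip g g.
  have := ip_ge0 (fun x => a * f x + b * g x).
  rewrite ip_addsqr ?L2Z// !ipZZ// ipZl ?L2Z// (ipC f) ipZl// (ipC g).
  by rewrite mulrA.
have [gg0|gg0] := eqVneq (ip g g) 0; last first.
  have gg : 0 < ip g g by rewrite lt_def gg0 ip_ge0.
  rewrite -subr_ge0 -(pmulr_rge0 _ gg).
  by apply: le_trans (P (ip g g) (- ip f g)) _; rewrite mulr2n; nra.
rewrite gg0 mulr0.
have := P (- ip f g) (ip f f + 1); rewrite gg0 mulr0 addr0.
have := ip_ge0 f; set A := ip f f; set B := ip f g => A0 H.
suff : B ^+ 2 * (A + 2) <= 0 by rewrite pmulr_lle0//; lra.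
by move: H; rewrite mulr2n; nra.
Qed.

Lemma nrm_triangle f g : f \in L2 -> g \in L2 ->
  nrm (fun x => f x + g x) <= nrm f + nrm g.
Proof.
move=> fL gL.
rewrite -ler_sqr ?nnegrE ?addr_ge0 ?nrm_ge0// sqr_nrm ip_addsqr// sqrrD !sqr_nrm.
rewrite lerD2r lerD2l lerMn2r/=.
exact: le_trans (ler_norm _) (cauchy_schwarz fL gL).
Qed.

Lemma nrmB f g : nrm (fun x => f x - g x) = nrm (fun x => g x - f x).
Proof.
by congr Num.sqrt; apply: eq_Rintegral => x _; rewrite -!expr2 -opprB sqrrN.
Qed.

Lemma nrm_dist_triangle f g h : f \in L2 -> g \in L2 -> h \in L2 ->
  nrm (fun x => f x - h x) <= nrm (fun x => f x - g x) + nrm (fun x => g x - h x).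
Proof.
move=> fL gL hL; apply: le_trans (nrm_triangle (L2B fL gL) (L2B gL hL)).
rewrite le_eqVlt; apply/orP; left; apply/eqP; congr nrm.
by apply/funext => x; ring.
Qed.

Lemma nrm0 : nrm (fun=> 0) = 0.
Proof. by rewrite /nrm ip0l sqrtr0. Qed.

Lemma nrm_subrr f : nrm (fun x => f x - f x) = 0.
Proof. by rewrite -[RHS]nrm0; congr nrm; apply/funext => x; rewrite subrr. Qed.

Lemma ler_nrm_add f g : f \in L2 -> g \in L2 ->
  nrm f <= nrm g + nrm (fun x => f x - g x).
Proof.
move=> fL gL; apply: le_trans (nrm_triangle gL (L2B fL gL)).
by rewrite le_eqVlt; apply/orP; left; apply/eqP; congr nrm; apply/funext => x; ring.
Qed.

Lemma nrm_le f g c : 0 <= c -> measurable_fun [set: X] f -> g \in L2 ->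
  (forall x, `|f x| <= c * `|g x|) -> nrm f <= c * nrm g.
Proof.
move=> c0 mf gL fg.
have fL : f \in L2 by exact: L2_le fg.
rewrite -ler_sqr ?nnegrE ?mulr_ge0 ?nrm_ge0// exprMn !sqr_nrm -ipZZ//.
apply: le_Rintegral => //; try by apply: ip_integrable => //; exact: L2Z.
move=> x _; rewrite -!expr2 -(real_normK (num_real (f x))) -(real_normK (num_real (_ * _))).
rewrite ler_sqr ?nnegrE// normrM (ger0_norm c0); exact: fg.
Qed.

End square_integrable.
Arguments ip {dX X R} mu f g.
Arguments nrm {dX X R} mu f.

(** * Orthogonal families and Bessel's inequality *)

Section orthogonal_family.
Context {dX : measure_display} {X : measurableType dX} {R : realType}.
Variable mu : {measure set X -> \bar R}.
Local Notation L2 := (Lfun mu 2%:E).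
Variable phi : nat -> X -> R.
Hypothesis phiL : forall m, phi m \in L2.
Hypothesis phi_orth : forall m n, m != n -> ip mu (phi m) (phi n) = 0.
Hypothesis phi_le1 : forall m, ip mu (phi m) (phi m) <= 1.

Lemma L2_comb (a : nat -> R) (s : seq nat) :
  (fun x => \sum_(i <- s) a i * phi i x) \in L2.
Proof. by apply: L2_sum => i _; exact: L2Z. Qed.

Lemma ip_comb (a : nat -> R) (s : seq nat) h : h \in L2 ->
  ip mu (fun x => \sum_(i <- s) a i * phi i x) h =
  \sum_(i <- s) a i * ip mu (phi i) h.
Proof.
move=> hL; rewrite ip_suml//; last by move=> i _; exact: L2Z.
by apply: eq_bigr => i _; rewrite ipZl.
Qed.

Lemma ip_comb_coef (a : nat -> R) (s : seq nat) j : uniq s -> j \in s ->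
  ip mu (fun x => \sum_(i <- s) a i * phi i x) (phi j) =
  a j * ip mu (phi j) (phi j).
Proof.
move=> us js; rewrite ip_comb// (bigD1_seq j)//= big1 ?addr0// => i ij.
by rewrite phi_orth// mulr0.
Qed.

Lemma sqr_nrm_comb (a : nat -> R) (s : seq nat) : uniq s ->
  nrm mu (fun x => \sum_(i <- s) a i * phi i x) ^+ 2 <= \sum_(i <- s) a i ^+ 2.
Proof.
move=> us; rewrite sqr_nrm ip_comb ?L2_comb//.
rewrite big_seq [leRHS]big_seq; apply: ler_sum => i si.
by rewrite ipC ip_comb_coef// mulrA -expr2 ler_piMr ?sqr_ge0.
Qed.

(** Expand |f - g|^2 >= 0 for the sum g of the <f, phi_i> phi_i: the cross term is exactly the sum
    of squares, and <g, g> is at most that sum. Norms at most 1 suffice, which admits the zero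
    functions of the trigonometric family. *)
Lemma bessel f (s : seq nat) : uniq s -> f \in L2 ->
  \sum_(i <- s) ip mu f (phi i) ^+ 2 <= nrm mu f ^+ 2.
Proof.
move=> us fL; set c := fun i => ip mu f (phi i).
have gL := L2_comb c s; set g := (X in X \in _) in gL.
have gg : ip mu g g <= \sum_(i <- s) c i ^+ 2 by rewrite -sqr_nrm sqr_nrm_comb.
have fg : ip mu f g = \sum_(i <- s) c i ^+ 2.
  by rewrite ipC ip_comb//; apply: eq_bigr => i _; rewrite ipC -expr2.
have := ip_ge0 mu (fun x => f x - g x).
rewrite ipBl ?L2B// (ipC mu f (fun _ => _)) (ipC mu g (fun _ => _)) !ipBl// (ipC mu g f) fg sqr_nrm.
move: gg; rewrite /c; set S := \sum_(_ <- _) _; lra.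
Qed.

End orthogonal_family.

(** * Completeness of L^2 on a finite measure, with an explicit limit *)

Section completeness.
Context {dX : measure_display} {X : measurableType dX} {R : realType}.
Variable mu : {measure set X -> \bar R}.
Local Notation L2 := (Lfun mu 2%:E).
Hypothesis one_L2 : (fun=> 1) \in L2.

Lemma L2_integrable f : f \in L2 -> mu.-integrable setT (EFin \o f).
Proof.
move=> fL; have := ip_integrable fL one_L2.
by apply: eq_integrable => // x _; rewrite /= mulr1.
Qed.

Lemma integral_norm_le f : f \in L2 ->
  (\int[mu]_x `|f x|%:E <= (nrm mu f * nrm mu (fun=> 1))%:E)%E.
Proof.
move=> fL.
have afL : (fun x => `|f x|) \in L2.
  apply: (@L2_le _ _ _ _ _ f 1) => //.
    by apply: measurableT_comp => //; exact: L2_measurable fL.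
  by move=> x; rewrite normr_id mul1r.
have := cauchy_schwarz afL one_L2.
rewrite /ip; under eq_Rintegral do rewrite mulr1.
move=> /(le_trans (ler_norm _)); rewrite -lee_fin fineK; last first.
  by apply: integrable_fin_num => //; exact: L2_integrable.
move=> H; apply: le_trans H _; rewrite lee_fin ler_wpM2r ?nrm_ge0//.
rewrite /nrm ler_wsqrtr// /ip le_eqVlt; apply/orP; left; apply/eqP.
by apply: eq_Rintegral => x _; rewrite -!expr2 real_normK ?num_real.
Qed.

(** A total substitute for the limit. As an upper limit it is measurable in a parameter even where
    the sequence diverges, and it depends on the sequence alone, so pointwise symmetries of the
    terms pass to it. *)
Definition lim_of (u : nat -> R) : R := fine (limn_esup (EFin \o u)).

Lemma lim_ofP (u : nat -> R) l : u @ \oo --> l -> lim_of u = l.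
Proof.
move=> ul; rewrite /lim_of.
have : (EFin \o u) @ \oo --> l%:E by apply/fine_cvgP; split; [exact: nearW|].
by move/cvg_limn_einf_sup => [_ ->].
Qed.

Lemma geometric_half_sum (n : nat) : \sum_(0 <= k < n) (2^-1 : R) ^+ k <= 2.
Proof.
suff -> : \sum_(0 <= k < n) (2^-1 : R) ^+ k = 2 - 2 * 2^-1 ^+ n.
  by rewrite gerBl mulr_ge0// exprn_ge0.
elim: n => [|n IH]; first by rewrite big_geq// expr0; lra.
by rewrite big_nat_recr//= IH exprS; lra.
Qed.

(** On a finite measure the L^1 norm is at most a multiple of the L^2 norm, so the sum of |w_k -
    w_(k+1)| has finite integral and is finite almost everywhere; there the telescoping series
    converges absolutely. *)
Lemma ae_cvg_fast_cauchy (w : nat -> X -> R) : (forall k, w k \in L2) ->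
  (forall k, nrm mu (fun x => w k x - w k.+1 x) <= 2^-1 ^+ k) ->
  {ae mu, forall x, cvgn (fun k => w k x)}.
Proof.
move=> wL wc; pose D k x := w k x - w k.+1 x.
have DL k : D k \in L2 by exact: L2B.
have mD k : measurable_fun setT (fun x => `|D k x|%:E).
  by apply/measurable_EFinP/measurableT_comp => //; exact: L2_measurable (DL k).
pose S x := (\sum_(0 <= k <oo) `|D k x|%:E)%E.
have S0 x : (0 <= S x)%E by exact: nneseries_ge0.
have iS : mu.-integrable setT S.
  apply/integrableP; split; first exact: ge0_emeasurable_sum.
  under eq_integral do rewrite gee0_abs//.
  rewrite /S integral_nneseries//.
  apply: (@le_lt_trans _ _ (2 * nrm mu (fun=> 1))%:E); last by rewrite ltry.
  apply: lime_le; first by apply: is_cvg_nneseries => *; exact: integral_ge0.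
  apply: nearW => n /=.
  apply: (@le_trans _ _ (\sum_(0 <= k < n) (2^-1 ^+ k * nrm mu (fun=> 1))%:E)%E).
    apply: lee_sum => k _; apply: le_trans (integral_norm_le (DL k)) _.
    by rewrite lee_fin ler_wpM2r ?nrm_ge0//; exact: wc.
  rewrite sumEFin lee_fin -mulr_suml ler_wpM2r ?nrm_ge0//.
  exact: geometric_half_sum.
have := integrable_ae measurableT iS; apply: filterS => x /(_ I) Sx.
have cs : cvgn (series (fun k => D k x : R^o)).
  apply: normed_cvg; apply: nondecreasing_is_cvgn.
    apply: nondecreasing_series => k _ _ /=; exact: normr_ge0.
  exists (fine (S x)) => _ [n _ <-] /=.
  rewrite -lee_fin fineK// /series/= -sumEFin.
  exact: nneseries_lim_ge.
have E : (fun k => w k x) = (fun k => w 0%N x - series (fun k => D k x) k).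
  apply/funext => n; rewrite /series/= /D.
  elim: n => [|n IH]; first by rewrite big_geq// subr0.
  by rewrite big_nat_recr//= opprD addrA -IH; ring.
by rewrite E; apply: is_cvgB => //; exact: is_cvg_cst.
Qed.

(** Fatou's lemma for the squares (f - w_k)^2, whose integrals are eventually at most c^2; the bound
    on the limit also gives its membership in L^2. *)
Lemma nrm_fatou (w : nat -> X -> R) (v f : X -> R) (c : R) : (forall k, w k \in L2) ->
  measurable_fun setT v -> f \in L2 -> 0 <= c ->
  {ae mu, forall x, w k x @[k --> \oo] --> v x} ->
  (\forall k \near \oo, nrm mu (fun x => f x - w k x) <= c) ->
  (fun x => f x - v x) \in L2 /\ nrm mu (fun x => f x - v x) <= c.
Proof.
move=> wL mv fL c0 wv wc.
pose g k x := ((f x - w k x) ^+ 2)%:E.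
have mg k : measurable_fun setT (g k).
  by apply/measurable_EFinP/measurable_funX; exact: L2_measurable (L2B fL (wL k)).
have mfv : measurable_fun setT (fun x => f x - v x).
  by apply: measurable_funB => //; exact: L2_measurable fL.
have le : (\int[mu]_x ((f x - v x) ^+ 2)%:E <= (c ^+ 2)%:E)%E.
  rewrite (@ge0_ae_eq_integral _ _ _ _ _ _ (fun x => limn_einf (g ^~ x)))//.
  - apply: le_trans (fatou mu measurableT mg _) _; first by move=> *; rewrite lee_fin sqr_ge0.
    rewrite limn_einf_lim; apply: lime_le; first exact: is_cvg_einfs.
    apply: nearW => n.
    have [N _ HN] := wc.
    apply: (@le_trans _ _ (\int[mu]_x g (maxn n N) x)%E).
      by apply: ereal_inf_lbound; exists (maxn n N) => //=; rewrite leq_maxl.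
    have := HN (maxn n N) (leq_maxr n N).
    rewrite -ler_sqr ?nnegrE ?nrm_ge0// sqr_nrm /ip -lee_fin fineK.
      by under eq_integral do rewrite -expr2.
    by apply: integrable_fin_num => //; apply: ip_integrable => //; exact: L2B.
  - by apply/measurable_EFinP; exact: measurable_funX.
  - rewrite /limn_einf; apply: measurableT_comp => //.
    by apply: measurable_fun_limn_esup => k; exact: measurableT_comp.
  - by move=> x _; rewrite lee_fin sqr_ge0.
  - move=> x _; rewrite limn_einf_lim; apply: lime_ge; first exact: is_cvg_einfs.
    apply: nearW => n; apply: le_ereal_inf_tmp => _ [m _ <-]; by rewrite lee_fin sqr_ge0.
  - move: wv; apply: filterS => x wv _.
    have : g k x @[k --> \oo] --> ((f x - v x) ^+ 2)%:E.
      apply/fine_cvgP; split; first exact: nearW.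
      by apply: cvgM; apply: cvgB => //; exact: cvg_cst.
    by move=> /cvg_limn_einf_sup[-> _].
have fvL : (fun x => f x - v x) \in L2.
  apply: L2I => //; apply/integrableP; split.
    by apply/measurable_EFinP; exact: measurable_funX.
  apply: le_lt_trans (ltry (c ^+ 2)); apply: le_trans le.
  by under eq_integral do rewrite /= ger0_norm ?sqr_ge0//.
split => //; rewrite -ler_sqr ?nnegrE ?nrm_ge0// sqr_nrm -lee_fin fineK.
  by under eq_integral do rewrite -expr2.
by apply: integrable_fin_num => //; exact: ip_integrable.
Qed.

(** The limit is given by a formula rather than merely asserted, so that periodicity can be read off
    it. Every Cauchy rate (e, N) passes to the limit unchanged, which later makes the convergence
    uniform in time. *)
Theorem L2_complete (u : nat -> X -> R) : (forall n, u n \in L2) ->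
  (forall e, 0 < e -> exists N, forall n m, (N <= n)%N -> (N <= m)%N ->
     nrm mu (fun x => u n x - u m x) <= e) ->
  exists kappa : nat -> nat,
    let v x := lim_of (fun k => u (kappa k) x) in
    v \in L2 /\ forall e N, (forall n m, (N <= n)%N -> (N <= m)%N ->
      nrm mu (fun x => u n x - u m x) <= e) ->
      forall n, (N <= n)%N -> nrm mu (fun x => u n x - v x) <= e.
Proof.
move=> uL uC.
have ex k : exists N, forall n m, (N <= n)%N -> (N <= m)%N ->
    nrm mu (fun x => u n x - u m x) <= 2^-1 ^+ k.
  by apply: uC; rewrite exprn_gt0// invr_gt0.
have [N HN] := choice ex.
(* The maximum makes [kappa] nondecreasing and at least N k, so consecutive terms are 2^-k close;
   the summand j makes it at least k, so it tends to infinity. *)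
pose kappa k := (\max_(j < k.+1) (N j + j))%N.
have kN k : (N k <= kappa k)%N by rewrite /kappa big_ord_recr/= leq_max leq_addr orbT.
have kS k : (kappa k <= kappa k.+1)%N.
  by rewrite /kappa [leqRHS]big_ord_recr/= leq_maxl.
exists kappa => /=; set v := (fun x => _).
have wL k : u (kappa k) \in L2 by exact: uL.
have mv : measurable_fun setT v.
  apply: measurableT_comp => //; apply: measurable_fun_limn_esup => k.
  by apply/measurable_EFinP; exact: L2_measurable (wL k).
have wv : {ae mu, forall x, u (kappa k) x @[k --> \oo] --> v x}.
  have : {ae mu, forall x, cvgn (fun k => u (kappa k) x)}.
    apply: ae_cvg_fast_cauchy => // k.
    by apply: HN => //; exact: leq_trans (kN k) (kS k).
  by apply: filterS => x /[dup] cx /lim_ofP E; rewrite /v E.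
have kge k : (k <= kappa k)%N by rewrite /kappa big_ord_recr/= leq_max leq_addl orbT.
have lim_le e M : (forall n m, (M <= n)%N -> (M <= m)%N ->
    nrm mu (fun x => u n x - u m x) <= e) -> forall n, (M <= n)%N ->
    (fun x => u n x - v x) \in L2 /\ nrm mu (fun x => u n x - v x) <= e.
  move=> He n Mn; apply: nrm_fatou wL mv (uL n) _ wv _.
    by apply: le_trans (He n n Mn Mn); exact: nrm_ge0.
  by exists M => // k /= Mk; apply: He => //; exact: leq_trans (kge k).
split.
  have [vL _] := lim_le _ _ (HN 0%N) _ (leqnn _).
  by have := L2B (uL (N 0%N)) vL; under eq_fun do rewrite subKr.
by move=> e M He n Mn; have [] := lim_le e M He n Mn.
Qed.

End completeness.

(** * Duhamel's formula with a singular kernel *)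

Section singular_kernel.
Context {R : realType}.
Local Notation leb := (@lebesgue_measure R).

Lemma powR_expRN_le1 (b x : R) : 0 <= b <= 1 -> 0 <= x -> x `^ b * expR (- x) <= 1.
Proof.
move=> /andP[b0 b1] x0.
rewrite expRN ler_pdivrMr ?expR_gt0// mul1r.
have [x1|x1] := leP 1 x.
  apply: (@le_trans _ _ x); first exact: ler1_powR.
  by apply: le_trans (expR_ge1Dx _); rewrite lerDr.
apply: (@le_trans _ _ 1); last by rewrite -expR0 ler_expR.
have [->|xN0] := eqVneq x 0; first by rewrite /powR eqxx lern1 leq_b1.
have : x `^ b <= 1 `^ b by rewrite ge0_ler_powR ?nnegrE// ltW.
by rewrite powR1.
Qed.

(* The exponent [c] is traded for the factor [Th `^ (- c)], which is small both on high modes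
   and for a large exponential weight. *)
Lemma smoothing_bound (a c B Th tau : R) : 0 < c -> 0 <= a -> a + c <= 1 ->
  0 < tau -> 1 <= Th -> Th <= B ->
  B `^ a * expR (- (B * tau)) <= Th `^ (- c) * tau `^ (- (a + c)).
Proof.
move=> c0 a0 ac tau0 Th1 ThB.
have B0 : 0 < B by apply: lt_le_trans ThB; apply: lt_le_trans Th1.
have Th0 : 0 < Th by apply: lt_le_trans Th1.
(* The factor (B tau)^(a + c) is split off to be absorbed by the exponential through
   [powR_expRN_le1]; what remains decreases in B. *)
have -> : B `^ a = B `^ (- c) * tau `^ (- (a + c)) * (B * tau) `^ (a + c).
  rewrite powRM ?ltW// mulrACA -powRD; last by rewrite (gt_eqF B0) implybT.
  rewrite -powRD; last by rewrite (gt_eqF tau0) implybT.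
  by rewrite addNr powRr0 mulr1; congr (_ `^ _); ring.
rewrite -mulrA -[leRHS]mulr1; apply: ler_pM.
- by rewrite mulr_ge0 ?powR_ge0.
- by rewrite mulr_ge0 ?powR_ge0 ?expR_ge0.
- by rewrite ler_wpM2r ?powR_ge0// !powRN lef_pV2 ?posrE ?powR_gt0// ge0_ler_powR ?nnegrE// ltW.
- by apply: powR_expRN_le1; [rewrite ac addr_ge0// ltW|rewrite mulr_ge0// ltW].
Qed.

(** Meant for E = e^(- Th tau) and a factor r that is only square integrable: the weights are such
    that both halves end up with the gain Th^(- c). *)
Lemma amgm_weight (c Th E r : R) : 0 < Th ->
  E * r <= 2^-1 * (Th `^ c * E ^+ 2 + Th `^ (- c) * r ^+ 2).
Proof.
move=> Th0; rewrite powRN.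
have p0 : 0 < Th `^ c by rewrite powR_gt0.
set p := Th `^ c in p0 *.
rewrite -subr_ge0 (_ : _ - _ = 2^-1 * p^-1 * (p * E - r) ^+ 2); last by field; rewrite gt_eqF.
by rewrite mulr_ge0 ?sqr_ge0// mulr_ge0// invr_ge0 ltW.
Qed.

(** The interval is exhausted by closed intervals that stay away from the singularity at t; the
    fundamental theorem bounds each integral, and monotone convergence passes to the union. *)
Lemma integral_singular (b t : R) : 0 < b < 1 -> 0 < t ->
  (\int[leb]_(s in `[0%R, t[) ((t - s) `^ (- b))%:E <= ((1 - b)^-1 * t `^ (1 - b))%:E)%E.
Proof.
move=> /andP[b0 b1] t0.
(* Starting at n + 2 keeps t / (n + 2) strictly below t, so that no interval is reduced to a
   point. *)
pose F (n : nat) : set R := `[0, t - t / n.+2%:R]%classic.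
have sub n : 0 < t / n.+2%:R < t.
  rewrite divr_gt0//= ltr_pdivrMr// ltr_pMr// ltr1n//.
have UF : \bigcup_n F n = `[0, t[%classic.
  apply/seteqP; split => s /=.
    move=> [n _]; rewrite /F/= !in_itv/= => /andP[-> /le_lt_trans]; apply.
    by have /andP[? _] := sub n; rewrite ltrBlDr ltrDl.
  rewrite in_itv/= => /andP[s0 st].
  have ts : 0 < (t - s) / t by rewrite divr_gt0// subr_gt0.
  have [n] := ltr_add_invr ts; rewrite add0r => Hn.
  exists n; rewrite // /F/= in_itv/= s0/= lerBrDr -lerBrDl.
  have : n.+2%:R^-1 <= (t - s) / t.
    by apply: le_trans (ltW Hn); rewrite lef_pV2 ?posrE// ler_nat.
  by rewrite ler_pdivlMr// mulrC.
have dpow (p s : R) : s < t -> is_derive s 1 (fun s : R => (t - s) `^ p) (- (p * (t - s) `^ (p - 1))).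
  move=> st.
  have ts : 0 < t - s by rewrite subr_gt0.
  have dp := is_derive1_powR p ts.
  have ds : is_derive s 1 (fun s : R => t - s) (-1).
    by have := is_deriveB (is_derive_cst t s 1) (is_derive_id s 1); rewrite sub0r.
  have := @is_derive1_comp R (fun x => x `^ p) (fun s => t - s) _ _ _ dp ds.
  by rewrite mulrN1.
pose G (s : R) := - ((1 - b)^-1 * (t - s) `^ (1 - b)).
have dG s : s < t -> is_derive s 1 G ((t - s) `^ (- b)).
  move=> st; have := dpow (1 - b) s st => dp.
  have := is_deriveN (is_deriveZ (1 - b)^-1 dp).
  rewrite /G /GRing.scale/= => H; apply: is_derive_eq H _.
  rewrite mulrN opprK mulrA mulVf ?mul1r; last by rewrite subr_eq0 gt_eqF.
  by congr (_ `^ _); ring.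
have FTC n : (\int[leb]_(s in F n) ((t - s) `^ (- b))%:E <= ((1 - b)^-1 * t `^ (1 - b))%:E)%E.
  have /andP[n0 nt] := sub n.
  have lt s : s <= t - t / n.+2%:R -> s < t.
    by move/le_lt_trans; apply; rewrite ltrBlDr ltrDl.
  rewrite (@continuous_FTC2 _ _ G).
  - rewrite -EFinB lee_fin /G opprK subr0 gerDr.
    by rewrite oppr_le0 mulr_ge0 ?powR_ge0// invr_ge0 subr_ge0 ltW.
  - by rewrite subr_gt0.
  - apply: derivable_within_continuous => s; rewrite in_itv/= => /andP[_ /lt st].
    by have [] := dpow (- b) s st.
  - have cG s : s < t -> {for s, continuous G}.
      by move=> st; apply: differentiable_continuous; apply/derivable1_diffP; have [] := dG s st.
    split.
    + by move=> s; rewrite in_itv/= => /andP[_ /ltW /lt st]; have [] := dG s st.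
    + by apply: cvg_at_right_filter; exact: cG.
    + by apply: cvg_at_left_filter; exact/cG/lt.
  - move=> s; rewrite in_itv/= => /andP[_ /ltW /lt st].
    by rewrite derive1E; have [_ ->] := dG s st.
have mf (D : set R) : measurable D -> measurable_fun D (fun s => ((t - s) `^ (- b))%:E).
  move=> mD; apply/measurable_EFinP/measurable_funTS.
  by apply: (measurableT_comp (measurable_powR _)); exact: measurable_funB.
have cvg : (\int[leb]_(s in F n) ((t - s) `^ (- b))%:E)%E @[n --> \oo] -->
    (\int[leb]_(s in \bigcup_n F n) ((t - s) `^ (- b))%:E)%E.
  apply: ge0_nondecreasing_set_cvg_integral.
  - move=> n m nm; rewrite /F; apply/subsetPset => s /=; rewrite !in_itv/= => /andP[-> /le_trans]; apply.
    by apply: lerB => //; apply: ler_wpM2l; [exact: ltW|rewrite lef_pV2 ?posrE// ler_nat !ltnS].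
  - by move=> n; exact: measurable_itv.
  - by move=> n; apply: mf; exact: measurable_itv.
  - by move=> n s _; rewrite lee_fin powR_ge0.
rewrite -UF; apply: (cvge_le _ cvg).
by apply: nearW => n; exact: FTC.
Qed.

End singular_kernel.

Section duhamel.
Context {R : realType}.
Local Notation leb := (@lebesgue_measure R).

Lemma restrictT (T : Type) (D : set T) (f : T -> R) x : D x -> (f \_ D) x = f x.
Proof. by move=> Dx; rewrite patchE mem_set. Qed.

Lemma restrictF (T : Type) (D : set T) (f : T -> R) x : ~ D x -> (f \_ D) x = 0.
Proof. by move=> Dx; rewrite patchE memNset. Qed.

Lemma integrable_restrictT (D : set (measurableTypeR R)) (f : measurableTypeR R -> R) :
  measurable D -> leb.-integrable D (EFin \o f) ->
  leb.-integrable setT (EFin \o (f \_ D)).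
Proof. by move=> mD /(integrable_mkcond _ mD); rewrite -restrict_EFin. Qed.

Lemma integral_expRN (A s t : R) : s <= t ->
  \int[leb]_(r in `[s, t]) (A * expR (- (A * r))) = expR (- (A * s)) - expR (- (A * t)).
Proof.
rewrite le_eqVlt => /orP[/eqP ->|st].
  by rewrite set_itv1 Rintegral_set1 subrr.
pose F (r : R) := - expR (- (A * r)).
have dF (r : R) : is_derive r 1 F (A * expR (- (A * r))).
  have dl : is_derive r 1 (fun r : R => - (A * r)) (- A).
    by have := is_deriveN (is_deriveZ A (is_derive_id r 1)); rewrite /GRing.scale/= mulr1.
  have := is_deriveN (@is_derive1_comp R expR (fun r => - (A * r)) _ _ _ (is_derive_expR _) dl).
  by rewrite mulrN opprK mulrC.
have ce : continuous (fun r => A * expR (- (A * r))).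
  move=> r; apply: cvgM; first exact: cvg_cst.
  apply: continuous_comp; last exact: continuous_expR.
  by apply: cvgN; apply: cvgM; [exact: cvg_cst|exact: cvg_id].
have cF : continuous F.
  by move=> r; apply: differentiable_continuous; apply/derivable1_diffP; have [] := dF r.
rewrite /Rintegral (@continuous_FTC2 _ _ F)//.
- by rewrite -EFinB /= /F opprK addrC.
- by apply: continuous_subspaceT.
- split.
  + by move=> r _; have [] := dF r.
  + by apply: cvg_at_right_filter; exact: cF.
  + by apply: cvg_at_left_filter; exact: cF.
- by move=> r _; rewrite derive1E; have [_ ->] := dF r.
Qed.

Lemma integrable_expR_mul (A a b : R) (g : R -> R) :
  leb.-integrable `[a, b] (EFin \o g) ->
  leb.-integrable `[a, b] (EFin \o (fun s => expR (A * s) * g s)).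
Proof.
move=> ig; have := @integrableMr _ _ _ leb `[a, b]%classic (measurable_itv _) (fun s => expR (A * s)) (EFin \o g).
apply => //.
  apply: measurable_funTS; apply: measurableT_comp => //; exact: measurable_funM.
exists (expR (`|A| * (`|a| + `|b|))); split; first exact: num_real.
move=> x Mx s /=; rewrite in_itv/= => /andP[as_ sb].
rewrite ger0_norm ?expR_ge0//; apply: le_trans (ltW Mx); rewrite ler_expR.
apply: le_trans (ler_norm _) _; rewrite normrM ler_wpM2l//.
by rewrite ler_norml; have := ler_norm b; have := ler_norm (- a); rewrite normrN; have := normr_ge0 a; have := normr_ge0 b; lra.
Qed.

(* The integrated form of k' = g - A k for k(t) = int_0^t e^(- A (t - s)) g(s) ds. *)
Lemma duhamel_fubini (A t : R) (g : R -> R) : 0 <= t ->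
  leb.-integrable `[0, t] (EFin \o g) ->
  \int[leb]_(r in `[0, t]) (A * expR (- (A * r)) * \int[leb]_(s in `[0, r]) (expR (A * s) * g s))
  = \int[leb]_(s in `[0, t]) g s - expR (- (A * t)) * \int[leb]_(s in `[0, t]) (expR (A * s) * g s).
Proof.
move=> t0 ig.
pose E (s : R) := expR (A * s) * g s.
pose G := E \_ `[0, t].
pose k (r : R) := A * expR (- (A * r)).
pose K := k \_ `[0, t].
have iE : leb.-integrable `[0, t] (EFin \o E) by exact: integrable_expR_mul.
have iG := integrable_restrictT (measurable_itv _) iE; rewrite -/G in iG.
have ik (D : set R) : compact D -> leb.-integrable D (EFin \o k).
  move=> cD; apply: continuous_compact_integrable => //.
  apply: continuous_subspaceT => r; apply: cvgM; first exact: cvg_cst.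
  apply: continuous_comp; last exact: continuous_expR.
  by apply: cvgN; apply: cvgM; [exact: cvg_cst|exact: cvg_id].
have iK := integrable_restrictT (measurable_itv _) (ik _ (@segment_compact _ 0 t)).
rewrite -/K in iK.
have mG : measurable_fun setT G by apply/measurable_EFinP; case/integrableP : iG.
have mK : measurable_fun setT K by apply/measurable_EFinP; case/integrableP : iK.
(* Both sides are iterated integrals over the triangle 0 <= s <= r <= t. Extended by zero to the
   plane, the integrand is dominated by |K r| |G s|, so Fubini's theorem applies. *)
pose f (z : R * R) := if z.2 <= z.1 then K z.1 * G z.2 else 0.
have mf : measurable_fun setT (fun z : measurableTypeR R * measurableTypeR R => (f z)%:E).
  apply/measurable_EFinP; apply: measurable_fun_ifT => //.
    by apply: measurable_fun_ler; [exact: measurable_snd|exact: measurable_fst].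
  apply: measurable_funM.
    exact: (measurableT_comp mK measurable_fst).
  exact: (measurableT_comp mG measurable_snd).
have fle r s : `|f (r, s)| <= `|K r| * `|G s|.
  by rewrite /f/=; case: ifP => _; rewrite ?normrM// normr0 mulr_ge0.
have if_ : (leb \x leb)%E.-integrable setT (fun z => (f z)%:E).
  apply/integrable12ltyP => //.
  apply: (@le_lt_trans _ _ (\int[leb]_r \int[leb]_s (`|K r|%:E * `|G s|%:E))%E).
    apply: ge0_le_integral => //.
    - by move=> r _; exact: integral_ge0.
    - apply: (@measurable_fun_fubini_tonelli_F _ _ _ _ _ leb (fun z => `|(f z)%:E|%E)) => //.
      exact: measurableT_comp.
    - apply: (@measurable_fun_fubini_tonelli_F _ _ _ _ _ leb (fun z => (`|K z.1|%:E * `|G z.2|%:E)%E)).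
      + apply/measurable_EFinP; apply: measurable_funM; apply: measurableT_comp => //.
          exact: (measurableT_comp mK measurable_fst).
        exact: (measurableT_comp mG measurable_snd).
      + by move=> z; rewrite mule_ge0.
    - move=> r _; apply: ge0_le_integral => //.
      + apply: measurableT_comp => //; exact: measurableT_comp mf (measurable_pair1 r).
      + apply/measurable_EFinP; apply: measurable_funM => //; exact: measurableT_comp.
      + by move=> s _; rewrite lee_fin; exact: fle.
  have iGa := integrable_abse iG; have iKa := integrable_abse iK.
  have [J JE] : exists J, (\int[leb]_s `|G s|%:E)%E = J%:E.
    by exists (fine (\int[leb]_s `|G s|%:E)%E); rewrite fineK//; exact: (integrable_fin_num _ iGa).
  have [J' JE'] : exists J, (\int[leb]_s `|K s|%:E)%E = J%:E.
    by exists (fine (\int[leb]_s `|K s|%:E)%E); rewrite fineK//; exact: (integrable_fin_num _ iKa).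
  under eq_integral do rewrite integralZl// JE.
  by rewrite (integralZr measurableT iKa)// JE' -EFinM ltry.
have L r : (\int[leb]_s (f (r, s))%:E)%E = ((fun r => k r * \int[leb]_(s in `[0, r]) E s) \_ `[0, t] r)%:E.
  have [rt|rt] := pselect (`[0, t]%classic r); last first.
    rewrite restrictF//; apply: integral0_eq => s _.
    by rewrite /f/= /K restrictF// mul0r if_same.
  rewrite restrictT//.
  have /andP[r0 rt'] : 0 <= r <= t by move: rt; rewrite /= in_itv.
  have iEr : leb.-integrable `[0, r] (EFin \o E).
    by apply: integrableS iE => //; apply: subset_itvl; rewrite bnd_simp.
  have iEr' := integrable_restrictT (measurable_itv _) iEr.
  transitivity (\int[leb]_s ((k r)%:E * ((E \_ `[0, r]) s)%:E))%E.
    apply: eq_integral => s _; rewrite -EFinM; congr EFin; rewrite /f/= /K restrictT//.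
    have [s0|s0] := leP 0 s; last first.
      rewrite /G !restrictF ?mulr0 ?if_same//= in_itv/= => /andP[]; by rewrite leNgt s0.
    have [sr|sr] := leP s r; last first.
      by rewrite restrictF ?mulr0//= in_itv/= (leNgt s) sr andbF.
    by rewrite /G !restrictT//= in_itv/= s0// (le_trans sr).
  transitivity ((k r)%:E * \int[leb]_s ((E \_ `[0%R, r]) s)%:E)%E; first exact: (integralZl measurableT iEr').
  by rewrite Rintegral_mkcond [RHS]EFinM /Rintegral fineK//; exact: integrable_fin_num.
(* For fixed s the integral in r is explicit, e^(- A s) - e^(- A t), and its first term cancels the
   factor e^(A s). *)
have Rr s : (\int[leb]_r (f (r, s))%:E)%E = ((fun s => g s - expR (- (A * t)) * E s) \_ `[0, t] s)%:E.
  have [st|st] := pselect (`[0, t]%classic s); last first.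
    rewrite restrictF//; apply: integral0_eq => r _.
    by rewrite /f/= /G restrictF// mulr0 if_same.
  rewrite restrictT//.
  have /andP[s0 st'] : 0 <= s <= t by move: st; rewrite /= in_itv.
  have ik' := integrable_restrictT (measurable_itv _) (ik _ (@segment_compact _ s t)).
  transitivity (\int[leb]_r ((E s)%:E * ((k \_ `[s, t]) r)%:E))%E.
    apply: eq_integral => r _; rewrite -EFinM; congr EFin; rewrite /f/= /G restrictT//.
    have [sr|sr] := leP s r; last first.
      by rewrite restrictF ?mulr0//= in_itv/= (leNgt s) sr.
    have [rt|rt] := leP r t; last first.
      by rewrite /K !restrictF ?mulr0 ?mul0r//= in_itv/= (leNgt r) rt andbF.
    by rewrite /K !restrictT 1?mulrC//= in_itv/= ?sr ?rt// (le_trans s0).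
  transitivity ((E s)%:E * \int[leb]_r ((k \_ `[s, t]) r)%:E)%E; first exact: (integralZl measurableT ik').
  have -> : (\int[leb]_x ((k \_ `[s, t]) x)%:E)%E = (expR (- (A * s)) - expR (- (A * t)))%:E.
    rewrite -integral_expRN// [in RHS]Rintegral_mkcond /Rintegral fineK//.
    exact: integrable_fin_num.
  rewrite -EFinM /E mulrBr; congr EFin; congr (_ - _); last by rewrite mulrC.
  by rewrite mulrAC -expRD addrN expR0 mul1r.
have F := Fubini if_; clear if_.
transitivity (fine (\int[leb]_r \int[leb]_s (f (r, s))%:E)%E).
  by rewrite Rintegral_mkcond /Rintegral; congr fine; apply: eq_integral => r _; rewrite L.
rewrite F; clear L F; transitivity (\int[leb]_(s in `[0, t]) (g s - expR (- (A * t)) * E s)).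
  by rewrite [RHS]Rintegral_mkcond /Rintegral; congr fine; apply: eq_integral => s _; rewrite Rr.
clear Rr; rewrite RintegralB//; first by rewrite RintegralZl.
exact: integrableZ_EFin.
Qed.

(** With SA and SB the two roots on the right, 2 |a_i| |b_i| <= (SB / SA) a_i^2 + (SA / SB) b_i^2,
    and the sum over i balances to 2 SA SB. The cases SA = 0 and SB = 0 are separate. *)
Lemma sum_cauchy_schwarz (I : eqType) (s : seq I) (a b : I -> R) :
  \sum_(i <- s) `|a i| * `|b i| <=
  Num.sqrt (\sum_(i <- s) a i ^+ 2) * Num.sqrt (\sum_(i <- s) b i ^+ 2).
Proof.
have S0 (c : I -> R) : 0 <= \sum_(i <- s) c i ^+ 2 by apply: sumr_ge0 => *; exact: sqr_ge0.
have [a0|a0] := eqVneq (\sum_(i <- s) a i ^+ 2) 0.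
  rewrite a0 sqrtr0 mul0r big_seq big1// => i si.
  move/eqP : a0; rewrite psumr_eq0; last by move=> *; exact: sqr_ge0.
  by move=> /allP/(_ i si)/=; rewrite sqrf_eq0 => /eqP->; rewrite normr0 mul0r.
have [b0|b0] := eqVneq (\sum_(i <- s) b i ^+ 2) 0.
  rewrite b0 sqrtr0 mulr0 big_seq big1// => i si.
  move/eqP : b0; rewrite psumr_eq0; last by move=> *; exact: sqr_ge0.
  by move=> /allP/(_ i si)/=; rewrite sqrf_eq0 => /eqP->; rewrite normr0 mulr0.
set SA := Num.sqrt _; set SB := Num.sqrt (\sum_(i <- s) b i ^+ 2).
have SA0 : 0 < SA by rewrite sqrtr_gt0 lt_def a0 S0.
have SB0 : 0 < SB by rewrite sqrtr_gt0 lt_def b0 S0.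
apply: (@le_trans _ _ (\sum_(i <- s) (2^-1 * (SB / SA) * a i ^+ 2 + 2^-1 * (SA / SB) * b i ^+ 2))).
  apply: ler_sum => i _.
  rewrite -(real_normK (num_real (a i))) -(real_normK (num_real (b i))).
  set x := `|a i|; set y := `|b i|.
  rewrite -subr_ge0 (_ : _ - _ = 2^-1 * (SA * SB)^-1 * (SB * x - SA * y) ^+ 2); last first.
    by field; rewrite !gt_eqF.
  by rewrite mulr_ge0 ?sqr_ge0// mulr_ge0// invr_ge0 mulr_ge0// ltW.
rewrite big_split/= -!mulr_sumr.
rewrite -[X in _ * X + _](sqr_sqrtr (S0 a)) -[X in _ + _ * X](sqr_sqrtr (S0 b)) -/SA -/SB.
rewrite le_eqVlt; apply/orP; left; apply/eqP; by field; rewrite !gt_eqF.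
Qed.

End duhamel.

(** * Estimates in l^2 for the time convolution *)

Section duhamel_estimate.
Context {R : realType}.
Local Notation leb := (@lebesgue_measure R).
Variables (T a c : R) (A w : nat -> R) (Cw : R) (r : R -> R).
Hypothesis T0 : 0 < T.
Hypothesis c0 : 0 < c.
Hypothesis ca : c <= a.
Hypothesis ac1 : a + c < 1.
Hypothesis A0 : forall i, 0 <= A i.
Hypothesis wA : forall i, `|w i| <= Cw * (1 + A i) `^ a.
Hypothesis r0 : forall t, 0 <= r t.
Hypothesis r2 : leb.-integrable `[0, T] (EFin \o (fun t => r t ^+ 2)).

(** Majorant of the time integrand: the singular power comes from the weights w_i, and r^2 is what
    [amgm_weight] leaves of the factor r. *)
Let ker (t s : R) := (t - s) `^ (- (a + c)) + r s ^+ 2.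

Definition kernel_mass : R :=
  (1 - (a + c))^-1 * T `^ (1 - (a + c)) + \int[leb]_(t in `[0, T]) (r t ^+ 2).

Let a0 : 0 <= a. Proof. by apply: le_trans ca; exact: ltW. Qed.

Let Cw0 : 0 <= Cw.
Proof.
have := le_trans (normr_ge0 _) (wA 0); rewrite pmulr_lge0// powR_gt0//.
by apply: ltr_pwDl.
Qed.

Let b01 : 0 < a + c < 1.
Proof. by rewrite ac1 andbT; apply: ltr_wpDl. Qed.

Let ac1_ge0 : 0 <= (1 - (a + c))^-1 * T `^ (1 - (a + c)).
Proof. by rewrite mulr_ge0 ?powR_ge0// invr_ge0 subr_ge0 ltW. Qed.

Lemma kernel_mass_ge0 : 0 <= kernel_mass.
Proof. by rewrite addr_ge0//; apply: Rintegral_ge0 => *; exact: sqr_ge0. Qed.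

Let r2t t : 0 <= t <= T -> leb.-integrable `[0, t[ (EFin \o (fun t => r t ^+ 2)).
Proof.
move=> /andP[t0 tT]; apply: integrableS r2 => //; apply: subset_itvl.
by rewrite bnd_simp.
Qed.

Let singular_integrable t : 0 < t ->
  leb.-integrable `[0, t[ (EFin \o (fun s => (t - s) `^ (- (a + c)))).
Proof.
move=> t0; apply/integrableP; split.
  apply/measurable_EFinP/measurable_funTS.
  by apply: (measurableT_comp (measurable_powR _)); exact: measurable_funB.
apply: le_lt_trans (ltry ((1 - (a + c))^-1 * t `^ (1 - (a + c)))).
apply: le_trans (integral_singular b01 t0).
by under eq_integral do rewrite /= ger0_norm ?powR_ge0//.
Qed.

Lemma kernel_integrable t : 0 < t <= T -> leb.-integrable `[0, t[ (EFin \o ker t).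
Proof.
move=> /andP[t0 tT]; apply: integrableD_EFin => //; first exact: singular_integrable.
by apply: r2t; rewrite (ltW t0).
Qed.

Lemma kernel_integral t : 0 < t <= T -> \int[leb]_(s in `[0, t[) ker t s <= kernel_mass.
Proof.
move=> /andP[t0 tT]; rewrite RintegralD//; last 2 first.
- exact: singular_integrable.
- by apply: r2t; rewrite (ltW t0).
apply: lerD.
  rewrite -lee_fin fineK; last first.
    by apply: integrable_fin_num => //; exact: singular_integrable.
  apply: le_trans (integral_singular b01 t0) _.
  rewrite lee_fin ler_wpM2l// ?invr_ge0 ?subr_ge0 ?(ltW ac1)//.
  by rewrite ge0_ler_powR ?nnegrE ?subr_ge0 ?(ltW ac1)// ltW.
rewrite -lee_fin !fineK; last 2 first.
- exact: integrable_fin_num.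
- by apply: integrable_fin_num => //; apply: r2t; rewrite (ltW t0).
apply: ge0_subset_integral => //.
- by case/integrableP : r2.
- by move=> *; rewrite lee_fin sqr_ge0.
- by apply: subset_itvl; rewrite bnd_simp.
Qed.

Lemma duhamel_weight t (g : R -> R) i : 0 <= t <= T ->
  leb.-integrable `[0, T] (EFin \o g) ->
  leb.-integrable `[0, t] (EFin \o (fun s => expR (- (A i * (t - s))) * g s)).
Proof.
move=> /andP[t0 tT] ig.
have : leb.-integrable `[0, t] (EFin \o g).
  by apply: integrableS ig => //; apply: subset_itvl; rewrite bnd_simp.
move=> igt.
have : leb.-integrable `[0, t] (EFin \o (fun s => expR (- (A i * t)) * (expR (A i * s) * g s))).
  by apply: integrableZ_EFin => //; exact: integrable_expR_mul.
apply: eq_integrable => // s _ /=; congr EFin.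
by rewrite mulrA -expRD; congr (expR _ * _); ring.
Qed.

(** The vector [dl] is a dual variable, later the vector of convolutions itself. With tau = t - u,
    writing e^(- A_i tau) as e^(M tau) e^(- (A_i + M) tau) turns the weight e^(M u) into e^(M t),
    and A_i + M >= Th provides the small factor. *)
Lemma duhamel_pointwise (s : seq nat) (M Th Y Z t u : R) (dl y z : nat -> R) :
  1 <= M -> 1 <= Th -> (forall i, i \in s -> Th <= A i + M) -> 0 <= Y -> 0 <= Z ->
  u < t ->
  \sum_(i <- s) y i ^+ 2 <= (Y * expR (M * u)) ^+ 2 ->
  \sum_(i <- s) z i ^+ 2 <= (Z * r u * expR (M * u)) ^+ 2 ->
  \sum_(i <- s) dl i * (expR (- (A i * (t - u))) * (w i * y i + z i)) <=
  Num.sqrt (\sum_(i <- s) dl i ^+ 2) *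
    (expR (M * t) * ((Cw + 1) * Th `^ (- c) * (Y + Z))) * ker t u.
Proof.
move=> M1 Th1 ThA Y0 Z0 ut ySum zSum.
have tau0 : 0 < t - u by rewrite subr_gt0.
have Th0 : 0 < Th by apply: lt_le_trans Th1.
set S := Num.sqrt _; have S0 : 0 <= S by exact: sqrtr_ge0.
set tau := t - u in tau0 *; set q := Th `^ (- c).
have q0 : 0 <= q by exact: powR_ge0.
have eM : expR (M * tau) * expR (M * u) = expR (M * t).
  by rewrite -expRD /tau; congr expR; ring.
have sqrt_le (X : R) (v : nat -> R) : 0 <= X -> \sum_(i <- s) v i ^+ 2 <= X ^+ 2 ->
    \sum_(i <- s) `|dl i| * `|v i| <= S * X.
  move=> X0 vX; apply: le_trans (sum_cauchy_schwarz _ _ _) _.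
  apply: ler_wpM2l => //; rewrite -[leRHS]ger0_norm// -sqrtr_sqr.
  exact: ler_wsqrtr.
have Y' := sqrt_le _ y (mulr_ge0 Y0 (expR_ge0 _)) ySum.
have Z' := sqrt_le _ z (mulr_ge0 (mulr_ge0 Z0 (r0 u)) (expR_ge0 _)) zSum.
set k := ker t u.
have sk : q * tau `^ (- (a + c)) <= q * k.
  by rewrite ler_wpM2l// lerDl sqr_ge0.
have k0 : 0 <= k by rewrite addr_ge0 ?powR_ge0 ?sqr_ge0.
have wE i : i \in s -> expR (- (A i * tau)) * `|w i| <= expR (M * tau) * (Cw * (q * k)).
  move=> si.
  have -> : expR (- (A i * tau)) = expR (M * tau) * expR (- ((A i + M) * tau)).
    by rewrite -expRD; congr expR; ring.
  rewrite -mulrA ler_wpM2l ?expR_ge0//.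
  apply: (@le_trans _ _ (Cw * ((A i + M) `^ a * expR (- ((A i + M) * tau))))).
    rewrite [leRHS]mulrA mulrC ler_wpM2r ?expR_ge0//.
    apply: le_trans (wA i) _; rewrite ler_wpM2l// ge0_ler_powR ?nnegrE//.
    - by rewrite addr_ge0.
    - by rewrite addr_ge0//; apply: le_trans M1.
    - by rewrite addrC lerD2l.
  rewrite ler_wpM2l//; apply: le_trans sk.
  by apply: smoothing_bound => //; [exact: ltW|exact: ThA].
(* In the first half of [amgm_weight] one exponential is dropped and Th^c is raised to Th^a, using c
   <= a; then [smoothing_bound] applies with B = Th. *)
have eR : expR (- (Th * tau)) * r u <= q * k.
  apply: le_trans (amgm_weight c _ _ Th0) _.
  apply: (@le_trans _ _ (2^-1 * (q * k + q * k))); last by lra.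
  rewrite ler_wpM2l//; apply: lerD; last first.
    by rewrite ler_wpM2l// lerDr powR_ge0.
  apply: le_trans sk.
  have H := smoothing_bound c0 a0 (ltW ac1) tau0 Th1 (lexx Th).
  rewrite expr2 mulrA; apply: (@le_trans _ _ (Th `^ a * expR (- (Th * tau)))); last exact: H.
  apply: (@le_trans _ _ (Th `^ c * expR (- (Th * tau)))).
    rewrite ler_piMr ?mulr_ge0 ?powR_ge0 ?expR_ge0// -expR0 ler_expR oppr_le0.
    by rewrite mulr_ge0// ltW.
  by rewrite ler_wpM2r ?expR_ge0// ler_powR.
have zE i : i \in s -> expR (- (A i * tau)) <= expR (M * tau) * expR (- (Th * tau)).
  move=> si; rewrite -expRD ler_expR -subr_ge0.
  have -> : M * tau + - (Th * tau) - - (A i * tau) = (A i + M - Th) * tau by ring.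
  by rewrite mulr_ge0 ?subr_ge0 ?ThA// ltW.
apply: (@le_trans _ _ (\sum_(i <- s) (expR (M * tau) * (Cw * (q * k)) * (`|dl i| * `|y i|) +
   expR (M * tau) * expR (- (Th * tau)) * (`|dl i| * `|z i|)))).
  rewrite big_seq [leRHS]big_seq; apply: ler_sum => i si.
  apply: le_trans (ler_norm _) _; rewrite normrM normrM (ger0_norm (expR_ge0 _)).
  apply: (@le_trans _ _ (`|dl i| * (expR (- (A i * tau)) * (`|w i| * `|y i| + `|z i|)))).
    do 2 (rewrite ler_wpM2l ?expR_ge0//).
    by apply: le_trans (ler_normD _ _) _; rewrite normrM.
  rewrite [leRHS](_ : _ = `|dl i| * (expR (M * tau) * (Cw * (q * k)) * `|y i| +
    expR (M * tau) * expR (- (Th * tau)) * `|z i|)); last by ring.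
  rewrite ler_wpM2l// mulrDr [X in X + _ <= _]mulrA; apply: lerD; rewrite ler_wpM2r//; [exact: wE|exact: zE].
rewrite big_split/= -!mulr_sumr.
apply: (@le_trans _ _ (expR (M * tau) * (Cw * (q * k)) * (S * (Y * expR (M * u))) +
   expR (M * tau) * expR (- (Th * tau)) * (S * (Z * r u * expR (M * u))))).
  apply: lerD; rewrite ler_wpM2l ?mulr_ge0 ?expR_ge0//.
rewrite (_ : _ + _ = S * expR (M * t) * (Cw * (q * k) * Y + expR (- (Th * tau)) * r u * Z)); last first.
  by rewrite -eM; ring.
rewrite (_ : S * _ * k = S * expR (M * t) * ((Cw + 1) * (q * k) * (Y + Z))); last by ring.
rewrite ler_wpM2l ?mulr_ge0 ?expR_ge0//.
apply: (@le_trans _ _ (Cw * (q * k) * Y + q * k * Z)).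
  by rewrite lerD2l ler_wpM2r.
rewrite -subr_ge0 (_ : _ - _ = q * k * Y + Cw * (q * k) * Z); last by ring.
by rewrite addr_ge0 ?mulr_ge0.
Qed.

(* [Th] bounds [A i + M] from below, where [M] is the rate of the exponential weight and [A i]
   the decay rate of the mode: taking either one large makes the factor [Th `^ (- c)] small. *)
Lemma duhamel_estimate (s : seq nat) (M Th Y Z t : R) (y z : nat -> R -> R) :
  1 <= M -> 1 <= Th -> (forall i, i \in s -> Th <= A i + M) -> 0 <= Y -> 0 <= Z ->
  0 <= t <= T ->
  (forall i, leb.-integrable `[0, T] (EFin \o (fun u => w i * y i u + z i u))) ->
  (forall u, 0 <= u <= T -> \sum_(i <- s) y i u ^+ 2 <= (Y * expR (M * u)) ^+ 2) ->
  (forall u, 0 <= u <= T -> \sum_(i <- s) z i u ^+ 2 <= (Z * r u * expR (M * u)) ^+ 2) ->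
  \sum_(i <- s) (\int[leb]_(u in `[0, t]) (expR (- (A i * (t - u))) * (w i * y i u + z i u))) ^+ 2
  <= (expR (M * t) * ((Cw + 1) * kernel_mass * Th `^ (- c) * (Y + Z))) ^+ 2.
Proof.
move=> M1 Th1 ThA Y0 Z0 /andP[t0 tT] ig yS zS.
pose f i u := expR (- (A i * (t - u))) * (w i * y i u + z i u).
have ifc i : leb.-integrable `[0, t] (EFin \o f i).
  by apply: (@duhamel_weight t (fun u => w i * y i u + z i u)) => //; rewrite t0.
have ifo i : leb.-integrable `[0, t[ (EFin \o f i).
  by apply: integrableS (ifc i) => //; apply: subset_itvl; rewrite bnd_simp.
(* The endpoint u = t is removed, since the pointwise bound holds for u < t. *)
pose dl i := \int[leb]_(u in `[0, t[) f i u.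
have dlE i : \int[leb]_(u in `[0, t]) (expR (- (A i * (t - u))) * (w i * y i u + z i u)) = dl i.
  by rewrite -Rintegral_itv_bndo_bndc//; exact: ifo.
under eq_bigr do rewrite dlE.
have S20 : 0 <= \sum_(i <- s) dl i ^+ 2 by apply: sumr_ge0 => *; exact: sqr_ge0.
set S := Num.sqrt (\sum_(i <- s) dl i ^+ 2).
have S0 : 0 <= S by exact: sqrtr_ge0.
have S2 : \sum_(i <- s) dl i ^+ 2 = S ^+ 2 by rewrite sqr_sqrtr.
set D := expR (M * t) * ((Cw + 1) * Th `^ (- c) * (Y + Z)).
have Cw1 : 0 <= Cw + 1 by rewrite addr_ge0.
have D0 : 0 <= D by rewrite mulr_ge0 ?expR_ge0// mulr_ge0 ?addr_ge0// mulr_ge0 ?powR_ge0 ?addr_ge0.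
rewrite S2 (_ : expR _ * _ = D * kernel_mass); last by rewrite /D; ring.
have km := kernel_mass_ge0.
have X0 : 0 <= D * kernel_mass by exact: mulr_ge0.
rewrite ler_sqr ?nnegrE//.
have [t00|tp] := eqVneq t 0.
  suff -> : S = 0 by [].
  rewrite /S (eq_bigr (fun=> 0)) ?big1_eq ?sqrtr0// => i _.
  by rewrite /dl t00 set_itvco0 Rintegral_set0 expr0n.
have {tp}tp : 0 < t by rewrite lt_def tp.
have ik : leb.-integrable `[0, t[ (EFin \o ker t) by apply: kernel_integrable; rewrite tp.
(* Duality: pairing the vector of integrals with itself writes S^2 as one integral, to which the
   pointwise bound applies; one factor S then cancels. *)
suff : S ^+ 2 <= S * (D * kernel_mass).
  have [->|SN0] := eqVneq S 0; first by [].
  by rewrite expr2 ler_pM2l// lt_def SN0.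
rewrite -S2; under eq_bigr do rewrite expr2.
rewrite (eq_bigr (fun i => \int[leb]_(u in `[0, t[) (dl i * f i u))); last first.
  by move=> i _; rewrite RintegralZl.
have idf i : leb.-integrable `[0, t[ (EFin \o (fun u => dl i * f i u)).
  exact: integrableZ_EFin.
rewrite -Rintegral_sum//.
apply: (@le_trans _ _ (\int[leb]_(u in `[0, t[) (S * D * ker t u))).
  apply: le_Rintegral => //.
  - exact: integrable_sum_EFin.
  - exact: integrableZ_EFin.
  - move=> u; rewrite /= in_itv/= => /andP[u0 ut].
    have uT : 0 <= u <= T by rewrite u0 (le_trans (ltW ut)).
    by apply: duhamel_pointwise => //; [exact: yS|exact: zS].
rewrite RintegralZl// -mulrA ler_wpM2l// ler_wpM2l//.
by apply: kernel_integral; rewrite tp.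
Qed.

End duhamel_estimate.

(** * Continuity in time with values in L^2 *)

Section L2_continuity.
Context {dX : measure_display} {X : measurableType dX} {R : realType}.
Variable mu : {measure set X -> \bar R}.
Variable T : R.
Local Notation L2 := (Lfun mu 2%:E).
Local Notation leb := (@lebesgue_measure R).

(** Spelled out with epsilon and delta because [nrm] is only a seminorm on representatives; values
    outside [0, T] are left free. *)
Definition L2cont (u : R -> X -> R) :=
  (forall t, 0 <= t <= T -> u t \in L2) /\
  forall t, 0 <= t <= T -> forall e, 0 < e -> exists2 dl, 0 < dl &
    forall s, 0 <= s <= T -> `|t - s| < dl -> nrm mu (fun x => u t x - u s x) <= e.

Lemma within_itvP (f : R -> R) : {within `[0, T], continuous f} <->
  forall t, 0 <= t <= T -> forall e, 0 < e -> exists2 dl, 0 < dl &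
    forall s, 0 <= s <= T -> `|t - s| < dl -> `|f t - f s| <= e.
Proof.
split.
  move=> cf t tT e e0; have t_in : `[0, T]%classic t by rewrite /= in_itv.
  have := cf t; rewrite /continuous_at /prop_for/=; move/cvgrPdist_le => /(_ e e0).
  rewrite /nbhs/= -nbhs_subspace_in// => /nbhs_ballP[dl /= dl0 H]; exists dl => // s sT ts.
  by apply: H => //=; rewrite in_itv.
move=> H t; have [tT|tT] := pselect (`[0, T]%classic t).
  apply/cvgrPdist_le => e e0; rewrite /nbhs/= -nbhs_subspace_in//.
  have [|dl dl0 Hd] := H t _ e e0; first by move: tT; rewrite /= in_itv.
  apply/nbhs_ballP; exists dl => // s ts /=; rewrite in_itv/= => sT.
  exact: Hd.
by apply/cvgrPdist_le => e e0; rewrite /nbhs/= -nbhs_subspace_out// => s ->; rewrite subrr normr0 ltW.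
Qed.

Lemma L2cont_cst v : v \in L2 -> L2cont (fun=> v).
Proof.
by move=> vL; split => // t _ e e0; exists 1 => // s _ _; rewrite nrm_subrr ltW.
Qed.

Lemma L2contD u v : L2cont u -> L2cont v -> L2cont (fun t x => u t x + v t x).
Proof.
move=> [uL uc] [vL vc]; split => [t tT|t tT e e0]; first exact: L2D (uL t tT) (vL t tT).
have e2 : 0 < e / 2 by rewrite divr_gt0.
have [d1 d10 H1] := uc t tT _ e2; have [d2 d20 H2] := vc t tT _ e2.
exists (Order.min d1 d2); first by rewrite lt_min d10.
move=> s sT; rewrite lt_min => /andP[td1 td2].
have -> : (fun x => u t x + v t x - (u s x + v s x)) =
    (fun x => (u t x - u s x) + (v t x - v s x)) by apply/funext => x; ring.
apply: le_trans (nrm_triangle (L2B (uL t tT) (uL s sT)) (L2B (vL t tT) (vL s sT))) _.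
by rewrite (splitr e) lerD ?H1 ?H2.
Qed.

Lemma L2contZ (a : R -> R) v : {within `[0, T], continuous a} -> v \in L2 ->
  L2cont (fun t x => a t * v x).
Proof.
move=> /within_itvP ac vL; split => [t _|t tT e e0]; first exact: L2Z.
have n1 : 0 < nrm mu v + 1 by rewrite ltr_pwDr// nrm_ge0.
have [dl dl0 H] := ac t tT (e / (nrm mu v + 1)) (divr_gt0 e0 n1).
exists dl => // s sT ts.
have -> : (fun x => a t * v x - a s * v x) = (fun x => (a t - a s) * v x).
  by apply/funext => x; ring.
rewrite nrmZ//; apply: (@le_trans _ _ (e / (nrm mu v + 1) * (nrm mu v + 1))).
  by rewrite ler_pM ?nrm_ge0 ?H// lerDl.
by rewrite divfK// gt_eqF.
Qed.

Lemma L2cont_comb (a : nat -> R -> R) (v : nat -> X -> R) (s : seq nat) :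
  (forall i, {within `[0, T], continuous (a i)}) -> (forall i, v i \in L2) ->
  L2cont (fun t x => \sum_(i <- s) a i t * v i x).
Proof.
move=> ac vL; elim: s => [|i s IH].
  under eq_fun do under eq_fun do rewrite big_nil; exact/L2cont_cst/L2_0.
under eq_fun do under eq_fun do rewrite big_cons.
by apply: L2contD => //; exact: L2contZ.
Qed.

Lemma L2cont_unif (U : nat -> R -> X -> R) u :
  (forall n, L2cont (U n)) -> (forall t, 0 <= t <= T -> u t \in L2) ->
  (forall e, 0 < e -> exists n, forall t, 0 <= t <= T ->
     nrm mu (fun x => U n t x - u t x) <= e) -> L2cont u.
Proof.
move=> Uc uL Uu; split => // t tT e e0.
have e3 : 0 < e / 3 by rewrite divr_gt0.
have [n Hn] := Uu _ e3; have [UL Un] := Uc n.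
have [dl dl0 H] := Un t tT _ e3; exists dl => // s sT ts.
apply: le_trans (nrm_dist_triangle (uL t tT) (UL t tT) (uL s sT)) _.
rewrite nrmB; apply: (@le_trans _ _ (e / 3 + (e / 3 + e / 3))); last by lra.
rewrite lerD ?Hn//.
apply: le_trans (nrm_dist_triangle (UL t tT) (UL s sT) (uL s sT)) _.
by rewrite lerD ?H ?Hn.
Qed.

Lemma lipschitz_L2cont (p : (X -> R) -> R) u K : 0 <= K ->
  (forall v v', v \in L2 -> v' \in L2 -> `|p v - p v'| <= K * nrm mu (fun x => v x - v' x)) ->
  L2cont u -> {within `[0, T], continuous (fun t => p (u t))}.
Proof.
move=> K0 pL [uL uc]; apply/within_itvP => t tT e e0.
have K1 : 0 < K + 1 by rewrite ltr_pwDr.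
have [dl dl0 H] := uc t tT _ (divr_gt0 e0 K1); exists dl => // s sT ts.
apply: le_trans (pL _ _ (uL t tT) (uL s sT)) _.
apply: (@le_trans _ _ ((K + 1) * (e / (K + 1)))).
  by rewrite ler_pM ?nrm_ge0 ?H// lerDl.
by rewrite mulrC divfK// gt_eqF.
Qed.

End L2_continuity.

(** * The mild equation *)

Section mild_solution.
Context {dX : measure_display} {X : measurableType dX} {R : realType}.
Variable mu : {measure set X -> \bar R}.
Local Notation L2 := (Lfun mu 2%:E).
Local Notation leb := (@lebesgue_measure R).
Hypothesis one_L2 : (fun=> 1) \in L2.
Variable phi : nat -> X -> R.
Hypothesis phiL : forall m, phi m \in L2.
Hypothesis phi_orth : forall m n, m != n -> ip mu (phi m) (phi n) = 0.
Hypothesis phi_le1 : forall m, ip mu (phi m) (phi m) <= 1.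
Variables (T a c : R) (A w : nat -> R) (Cw : R) (r : R -> R).
Hypothesis T0 : 0 < T.
Hypothesis c0 : 0 < c.
Hypothesis ca : c <= a.
Hypothesis ac1 : a + c < 1.
Hypothesis A0 : forall i, 0 <= A i.
Hypothesis A_unbounded : forall Th, exists N, forall i, (N <= i)%N -> Th <= A i.
Hypothesis wA : forall i, `|w i| <= Cw * (1 + A i) `^ a.
Hypothesis r0 : forall t, 0 <= r t.
Hypothesis r2 : leb.-integrable `[0, T] (EFin \o (fun t => r t ^+ 2)).
Variables (P : nat -> (X -> R) -> R) (Q : nat -> R -> (X -> R) -> R) (L : R).
Hypothesis L0 : 0 <= L.
Hypothesis P_lip : forall s v v', uniq s -> v \in L2 -> v' \in L2 ->
  \sum_(i <- s) (P i v - P i v') ^+ 2 <= (L * nrm mu (fun x => v x - v' x)) ^+ 2.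
Hypothesis P_growth : forall s v, uniq s -> v \in L2 ->
  \sum_(i <- s) P i v ^+ 2 <= (L * (1 + nrm mu v)) ^+ 2.
Hypothesis Q_lip : forall s t v v', uniq s -> 0 <= t <= T -> v \in L2 -> v' \in L2 ->
  \sum_(i <- s) (Q i t v - Q i t v') ^+ 2 <= (L * r t * nrm mu (fun x => v x - v' x)) ^+ 2.
Hypothesis Q_growth : forall s t v, uniq s -> 0 <= t <= T -> v \in L2 ->
  \sum_(i <- s) Q i t v ^+ 2 <= (L * r t * (1 + nrm mu v)) ^+ 2.
Hypothesis Q_measurable : forall i u, L2cont mu T u ->
  measurable_fun `[0, T] (fun t => Q i t (u t)).
Variables (k0 : nat -> R) (C0 : R).
Hypothesis C00 : 0 <= C0.
Hypothesis k0_bound : forall s, uniq s -> \sum_(i <- s) k0 i ^+ 2 <= C0 ^+ 2.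

Lemma P_lip1 i v v' : v \in L2 -> v' \in L2 ->
  `|P i v - P i v'| <= L * nrm mu (fun x => v x - v' x).
Proof.
move=> vL v'L; have := P_lip (s := [:: i]) isT vL v'L; rewrite big_seq1.
by rewrite -(real_normK (num_real _)) ler_sqr ?nnegrE// mulr_ge0 ?nrm_ge0.
Qed.

Lemma Q_lip1 i t v v' : 0 <= t <= T -> v \in L2 -> v' \in L2 ->
  `|Q i t v - Q i t v'| <= L * r t * nrm mu (fun x => v x - v' x).
Proof.
move=> tT vL v'L; have := Q_lip (s := [:: i]) isT tT vL v'L; rewrite big_seq1.
by rewrite -(real_normK (num_real _)) ler_sqr ?nnegrE// !mulr_ge0 ?nrm_ge0.
Qed.

Lemma Q_growth1 i t v : 0 <= t <= T -> v \in L2 -> `|Q i t v| <= L * r t * (1 + nrm mu v).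
Proof.
move=> tT vL; have := Q_growth (s := [:: i]) isT tT vL; rewrite big_seq1.
by rewrite -(real_normK (num_real _)) ler_sqr ?nnegrE// !mulr_ge0// addr_ge0 ?nrm_ge0.
Qed.

Definition admissible (u : R -> X -> R) :=
  L2cont mu T u /\ exists B, forall t, 0 <= t <= T -> nrm mu (u t) <= B.

Definition forcing (u : R -> X -> R) i t := w i * P i (u t) + Q i t (u t).

Definition coef (u : R -> X -> R) i t := expR (- (A i * t)) * k0 i +
  \int[leb]_(s in `[0, t]) (expR (- (A i * (t - s))) * forcing u i s).

Lemma integrable_cst_itv (k : R) : leb.-integrable `[0, T] (EFin \o (fun=> k)).
Proof.
apply: continuous_compact_integrable; first exact: segment_compact.
by apply: continuous_subspaceT => t; exact: cvg_cst.
Qed.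

Lemma Q_integrable u i : admissible u ->
  leb.-integrable `[0, T] (EFin \o (fun t => Q i t (u t))).
Proof.
move=> [uc [B uB]]; have uL := uc.1.
pose K t := L * (1 + B) * (1 + r t ^+ 2).
apply: (@le_integrable_EFin _ _ _ leb _ _ _ K) => //.
- exact: Q_measurable.
- move=> t; rewrite /= in_itv/= => tT.
  have B0 : 0 <= 1 + B by rewrite addr_ge0// (le_trans _ (uB t tT)) ?nrm_ge0.
  apply: le_trans (Q_growth1 i tT (uL t tT)) _.
  rewrite /K -mulrA -[leRHS]mulrA ler_wpM2l// mulrC ler_pM ?addr_ge0 ?nrm_ge0//.
    by rewrite lerD2l uB.
  rewrite -subr_ge0 (_ : _ - _ = (r t - 2^-1) ^+ 2 + 3 / 4); last by field.
  by rewrite addr_ge0 ?sqr_ge0// divr_ge0.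
- apply: integrableZ_EFin => //; apply: integrableD_EFin => //.
  exact: integrable_cst_itv.
Qed.

Lemma P_integrable u i : L2cont mu T u ->
  leb.-integrable `[0, T] (EFin \o (fun t => P i (u t))).
Proof.
move=> uc; apply: continuous_compact_integrable; first exact: segment_compact.
by apply: lipschitz_L2cont uc; [exact: L0|exact: P_lip1].
Qed.

Lemma forcing_integrable u i : admissible u ->
  leb.-integrable `[0, T] (EFin \o forcing u i).
Proof.
move=> ua; apply: integrableD_EFin => //; last exact: Q_integrable.
by apply: integrableZ_EFin => //; apply: P_integrable; exact: ua.1.
Qed.

(** Taking e^(- A t) out of the integral reduces continuity in t to that of an indefinite
    integral. *)
Lemma coefE u i t : admissible u -> 0 <= t <= T -> coef u i t = expR (- (A i * t)) *
  (k0 i + \int[leb]_(s in `[0, t]) (expR (A i * s) * forcing u i s)).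
Proof.
move=> ua /andP[t_ge0 tT]; rewrite /coef mulrDr; congr (_ + _).
rewrite -RintegralZl//.
  apply: eq_Rintegral => s _; rewrite mulrA -expRD; congr (expR _ * _); ring.
apply: integrable_expR_mul; apply: integrableS (forcing_integrable i ua) => //.
by apply: subset_itvl; rewrite bnd_simp.
Qed.

Lemma expRN_continuous i : continuous (fun t => expR (- (A i * t))).
Proof.
move=> t; apply: continuous_comp; last exact: continuous_expR.
by apply: cvgN; apply: cvgM; [exact: cvg_cst|exact: cvg_id].
Qed.

Lemma coef_continuous u i : admissible u -> {within `[0, T], continuous (coef u i)}.
Proof.
move=> ua.
have ig := integrable_expR_mul (A i) (forcing_integrable i ua).
have cJ := parameterized_integral_continuous (ltW T0) ig.
apply/within_itvP => t tT.
have /within_itvP/(_ t tT) : {within `[0, T], continuous (fun t => expR (- (A i * t)) *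
    (k0 i + \int[leb]_(s in `[0, t]) (expR (A i * s) * forcing u i s)))}.
  move=> s; apply: cvgM; first by apply: continuous_subspaceT; exact: expRN_continuous.
  by apply: cvgD; [exact: cvg_cst|exact: cJ].
move=> H e e0; have [dl dl0 Hd] := H e e0; exists dl => // s sT ts.
by rewrite !coefE// Hd.
Qed.

Lemma coef_integrable u i : admissible u -> leb.-integrable `[0, T] (EFin \o coef u i).
Proof.
by move=> ua; apply: continuous_compact_integrable; [exact: segment_compact|exact: coef_continuous].
Qed.

(** Passage from the mild form to the integrated form of k' = f - A k, by [duhamel_fubini]. This is
    the form in which a mode of the fixed point becomes the weak equation tested with that mode. *)
Lemma coef_volterra u i t : admissible u -> 0 <= t <= T ->
  coef u i t - k0 i = \int[leb]_(s in `[0, t]) (forcing u i s - A i * coef u i s).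
Proof.
move=> ua tT; have /andP[t_ge0 tT'] := tT.
have sub (f : R -> R) : leb.-integrable `[0, T] (EFin \o f) -> leb.-integrable `[0, t] (EFin \o f).
  by move=> fi; apply: integrableS fi => //; apply: subset_itvl; rewrite bnd_simp.
have fi := sub _ (forcing_integrable i ua); have ci := sub _ (coef_integrable i ua).
rewrite RintegralB//; last exact: integrableZ_EFin.
pose J s := \int[leb]_(v in `[0, s]) (expR (A i * v) * forcing u i v).
have E s : 0 <= s <= T -> A i * coef u i s =
    k0 i * (A i * expR (- (A i * s))) + A i * expR (- (A i * s)) * J s.
  by move=> sT; rewrite coefE//; rewrite -/(J s); ring.
have ie : leb.-integrable `[0, t] (EFin \o (fun s => A i * expR (- (A i * s)))).
  apply: continuous_compact_integrable; first exact: segment_compact.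
  apply: continuous_subspaceT => s; apply: cvgM; first exact: cvg_cst.
  exact: expRN_continuous.
have tin s : s \in `[0, t]%classic -> 0 <= s <= T.
  by rewrite inE/= in_itv/= => /andP[-> /le_trans]; exact.
have iJ : leb.-integrable `[0, t] (EFin \o (fun s => A i * expR (- (A i * s)) * J s)).
  apply: (@eq_integrable_EFin _ _ _ leb _ _ (fun s => A i * coef u i s - k0 i * (A i * expR (- (A i * s))))) => //.
    by move=> s /mem_set/tin sT /=; rewrite E//; ring.
  by apply: integrableB_EFin => //; exact: integrableZ_EFin.
rewrite [X in _ = _ - X](_ : _ = \int[leb]_(s in `[0, t])
    (k0 i * (A i * expR (- (A i * s))) + A i * expR (- (A i * s)) * J s)); last first.
  by apply: eq_Rintegral => s /tin; exact: E.
have ike : leb.-integrable `[0, t] (EFin \o (fun s => k0 i * (A i * expR (- (A i * s))))).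
  exact: integrableZ_EFin.
rewrite [X in _ = _ - X]RintegralD//.
rewrite [X in _ = _ - (X + _)]RintegralZl// integral_expRN// duhamel_fubini// coefE// -/(J t).
by rewrite mulr0 oppr0 expR0; ring.
Qed.

(** Both Lipschitz terms enter [duhamel_estimate] with Y = Z = L D, hence L + L. The factor Th^(- c)
    is kept apart because contraction and tails use different values of Th. *)
Let K0 := (Cw + 1) * kernel_mass T a c r * (L + L).

Lemma sum_minkowski (s : seq nat) (x y : nat -> R) (B B' : R) : 0 <= B -> 0 <= B' ->
  \sum_(i <- s) x i ^+ 2 <= B ^+ 2 -> \sum_(i <- s) y i ^+ 2 <= B' ^+ 2 ->
  \sum_(i <- s) (x i + y i) ^+ 2 <= (B + B') ^+ 2.
Proof.
move=> B0 B'0 xB yB.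
have xy : \sum_(i <- s) x i * y i <= B * B'.
  apply: (@le_trans _ _ (\sum_(i <- s) `|x i| * `|y i|)).
    by apply: ler_sum => i _; rewrite -normrM ler_norm.
  apply: le_trans (sum_cauchy_schwarz _ _ _) _; apply: ler_pM; rewrite ?sqrtr_ge0//.
    by rewrite -[leRHS]ger0_norm// -sqrtr_sqr ler_wsqrtr.
  by rewrite -[leRHS]ger0_norm// -sqrtr_sqr ler_wsqrtr.
under eq_bigr do rewrite sqrrD mulr2n; rewrite !big_split/= sqrrD mulr2n.
by apply: lerD => //; apply: lerD => //; exact: lerD.
Qed.

Lemma K0_ge0 : 0 <= K0.
Proof.
have Cw_ge0 : 0 <= Cw.
  have := le_trans (normr_ge0 _) (wA 0); rewrite pmulr_lge0// powR_gt0//.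
  by apply: ltr_pwDl.
apply: mulr_ge0; last by rewrite addr_ge0.
apply: mulr_ge0; first by rewrite addr_ge0.
exact: kernel_mass_ge0.
Qed.

(** The initial data cancel in the difference, leaving a convolution of differences. With Th = M
    this is the contraction estimate. As everywhere in this section, l^2 norms are finite sums over
    duplicate-free lists of modes. *)
Lemma coef_lip s M Th D u v t : uniq s -> admissible u -> admissible v ->
  1 <= M -> 1 <= Th -> (forall i, i \in s -> Th <= A i + M) -> 0 <= D -> 0 <= t <= T ->
  (forall t, 0 <= t <= T -> nrm mu (fun x => u t x - v t x) <= expR (M * t) * D) ->
  \sum_(i <- s) (coef u i t - coef v i t) ^+ 2 <= (expR (M * t) * (K0 * Th `^ (- c) * D)) ^+ 2.
Proof.
move=> us ua va M1 Th1 ThA D0 tT uvD.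
pose y i t := P i (u t) - P i (v t); pose z i t := Q i t (u t) - Q i t (v t).
have ig i : leb.-integrable `[0, T] (EFin \o (fun t => w i * y i t + z i t)).
  apply: (@eq_integrable_EFin _ _ _ leb _ _ (fun t => forcing u i t - forcing v i t)).
  - exact: measurable_itv.
  - by move=> x _; rewrite /forcing /y /z; ring.
  - by apply: integrableB_EFin => //; exact: forcing_integrable.
have LD0 : 0 <= L * D by rewrite mulr_ge0.
have := @duhamel_estimate _ T a c A w Cw r T0 c0 ca ac1 A0 wA r0 r2 s M Th (L * D) (L * D) t y z
  M1 Th1 ThA LD0 LD0 tT ig.
have uL t' : 0 <= t' <= T -> u t' \in L2 by exact: ua.1.1.
have vL t' : 0 <= t' <= T -> v t' \in L2 by exact: va.1.1.
have -> : K0 * Th `^ (- c) * D = (Cw + 1) * kernel_mass T a c r * Th `^ (- c) * (L * D + L * D).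
  by rewrite /K0; ring.
move=> H; apply: le_trans (H _ _); last 2 first.
- move=> t' t'T; apply: le_trans (P_lip us (uL _ t'T) (vL _ t'T)) _.
  rewrite ler_sqr ?nnegrE ?mulr_ge0 ?nrm_ge0 ?expR_ge0//.
  by rewrite -mulrA ler_wpM2l// mulrC uvD.
- move=> t' t'T; apply: le_trans (Q_lip us t'T (uL _ t'T) (vL _ t'T)) _.
  rewrite ler_sqr ?nnegrE ?mulr_ge0 ?nrm_ge0 ?expR_ge0//.
  rewrite (_ : L * D * r t' * _ = L * r t' * (expR (M * t') * D)); last by ring.
  by rewrite ler_wpM2l ?mulr_ge0// uvD.
rewrite le_eqVlt; apply/orP; left; apply/eqP; apply: eq_bigr => i _; congr (_ ^+ 2).
rewrite /coef opprD addrACA subrr add0r -RintegralB//.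
- by apply: eq_Rintegral => x _; rewrite /forcing /y /z; ring.
- exact: (duhamel_weight A i tT (forcing_integrable i ua)).
- exact: (duhamel_weight A i tT (forcing_integrable i va)).
Qed.

(** Used with Th = M to keep the iterates in a fixed ball, and with Th large on high modes to make
    their tails small. *)
Lemma coef_growth s M Th D u t : uniq s -> admissible u ->
  1 <= M -> 1 <= Th -> (forall i, i \in s -> Th <= A i + M) -> 0 <= D -> 0 <= t <= T ->
  (forall t, 0 <= t <= T -> nrm mu (u t) <= expR (M * t) * D) ->
  \sum_(i <- s) (coef u i t - expR (- (A i * t)) * k0 i) ^+ 2 <=
  (expR (M * t) * (K0 * Th `^ (- c) * (1 + D))) ^+ 2.
Proof.
move=> us ua M1 Th1 ThA D0 tT uD.
pose y i t := P i (u t); pose z i t := Q i t (u t).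
have ig i : leb.-integrable `[0, T] (EFin \o (fun t => w i * y i t + z i t)).
  exact: forcing_integrable.
have LD0 : 0 <= L * (1 + D) by rewrite mulr_ge0// addr_ge0.
have := @duhamel_estimate _ T a c A w Cw r T0 c0 ca ac1 A0 wA r0 r2 s M Th (L * (1 + D)) (L * (1 + D)) t y z
  M1 Th1 ThA LD0 LD0 tT ig.
have uL t' : 0 <= t' <= T -> u t' \in L2 by exact: ua.1.1.
have e1 t' : 0 <= t' <= T -> 1 + nrm mu (u t') <= expR (M * t') * (1 + D).
  move=> /[dup] t'T /andP[t'0 _]; rewrite mulrDr mulr1 lerD ?uD//.
  by rewrite -expR0 ler_expR mulr_ge0// (le_trans _ M1).
have -> : K0 * Th `^ (- c) * (1 + D) =
    (Cw + 1) * kernel_mass T a c r * Th `^ (- c) * (L * (1 + D) + L * (1 + D)).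
  by rewrite /K0; ring.
have n0 t' : 0 <= 1 + nrm mu (u t') by rewrite addr_ge0 ?nrm_ge0.
have D1 : 0 <= 1 + D by rewrite addr_ge0.
move=> H; apply: le_trans (H _ _); last 2 first.
- move=> t' t'T; apply: le_trans (P_growth us (uL _ t'T)) _.
  rewrite ler_sqr ?nnegrE ?mulr_ge0 ?expR_ge0//.
  by rewrite -mulrA ler_wpM2l// mulrC e1.
- move=> t' t'T; apply: le_trans (Q_growth us t'T (uL _ t'T)) _.
  rewrite ler_sqr ?nnegrE ?mulr_ge0 ?expR_ge0//.
  rewrite (_ : L * (1 + D) * r t' * _ = L * r t' * (expR (M * t') * (1 + D))); last by ring.
  by rewrite ler_wpM2l ?mulr_ge0// e1.
rewrite le_eqVlt; apply/orP; left; apply/eqP; apply: eq_bigr => i _; congr (_ ^+ 2).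
by rewrite /coef addrC addKr.
Qed.

Lemma powRN_small (K e : R) : 0 <= K -> 0 < e ->
  exists2 M, 1 <= M & forall Th, M <= Th -> K * Th `^ (- c) <= e.
Proof.
move=> K_ge0 e0; exists (Order.max 1 ((K / e) `^ c^-1)); first by rewrite le_max lexx.
move=> Th; rewrite ge_max => /andP[Th1 ThK].
have Th0 : 0 < Th by apply: lt_le_trans Th1.
rewrite powRN ler_pdivrMr ?powR_gt0// mulrC -ler_pdivrMr//.
have : ((K / e) `^ c^-1) `^ c <= Th `^ c.
  by rewrite ge0_ler_powR ?nnegrE ?powR_ge0 ?(ltW c0)// ltW.
by rewrite -powRrM mulVf ?gt_eqF// powRr1// divr_ge0// ltW.
Qed.

(* The [n]-th iterate keeps [n] modes only, so that it is a finite sum. *)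
Fixpoint picard n : R -> X -> R :=
  if n is n'.+1 then fun t x => \sum_(0 <= i < n'.+1) coef (picard n') i t * phi i x
  else fun _ _ => 0.

Lemma nrm_comb_le (b : nat -> R) (s : seq nat) (K : R) : uniq s -> 0 <= K ->
  \sum_(i <- s) b i ^+ 2 <= K ^+ 2 ->
  nrm mu (fun x => \sum_(i <- s) b i * phi i x) <= K.
Proof.
move=> us K_ge0 bK; rewrite -ler_sqr ?nnegrE ?nrm_ge0//.
exact: le_trans (sqr_nrm_comb phiL phi_orth phi_le1 b us) bK.
Qed.

Lemma ler_sqr_weight (E x y : R) : 0 <= E -> 0 <= x -> x <= y ->
  (E * x) ^+ 2 <= (E * y) ^+ 2.
Proof.
move=> E0 x0 xy; have y0 := le_trans x0 xy.
by rewrite ler_sqr ?nnegrE ?mulr_ge0// ler_wpM2l.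
Qed.

Lemma initial_bound s t : uniq s -> 0 <= t ->
  \sum_(i <- s) (expR (- (A i * t)) * k0 i) ^+ 2 <= \sum_(i <- s) k0 i ^+ 2.
Proof.
move=> us t_ge0; apply: ler_sum => i _; rewrite exprMn ler_piMl ?sqr_ge0//.
by rewrite exprn_ile1 ?expR_ge0// -expR0 ler_expR oppr_le0 mulr_ge0.
Qed.

(** Choose a finite list whose sum is within e of the supremum over all finite lists. A list of
    indices beyond its maximum is disjoint from it, so it can add at most e. *)
Lemma initial_tail e : 0 < e -> exists N, forall s, uniq s ->
  (forall i, i \in s -> (N <= i)%N) -> \sum_(i <- s) k0 i ^+ 2 <= e.
Proof.
move=> e0; pose E := [set \sum_(i <- s) k0 i ^+ 2 | s in [set s : seq nat | uniq s]].
have supE : has_sup E.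
  split; first by exists (\sum_(i <- [::]) k0 i ^+ 2); exists [::].
  by exists (C0 ^+ 2) => _ [s us <-]; exact: k0_bound.
have [_ [s0 us0 <-] Hs0] := sup_adherent e0 supE.
exists (\max_(i <- s0) i).+1 => s us sN.
have : \sum_(i <- s0 ++ s) k0 i ^+ 2 <= sup E.
  apply: ub_le_sup; first by case: supE.
  exists (s0 ++ s) => //=; rewrite cat_uniq us0 us andbT/=.
  apply/hasPn => i /sN Ni; apply/negP => is0.
  by have := @leq_bigmax_seq _ s0 predT id i is0 isT; rewrite leqNgt Ni.
rewrite big_cat/=; lra.
Qed.

(** * Picard iterates in an exponentially weighted norm *)

Section fixed_weight.
Variable M : R.
Hypothesis M1 : 1 <= M.
Hypothesis M_half : forall Th, M <= Th -> K0 * Th `^ (- c) <= 2^-1.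

(** The radius with C0 + (1 + B0) / 2 = B0: the data contribute at most C0, the forcing at most half
    of 1 + B0. *)
Let B0 := 2 * C0 + 1.

Let B0_ge0 : 0 <= B0. Proof. by rewrite addr_ge0// mulr_ge0. Qed.

Let expM_ge1 t : 0 <= t -> 1 <= expR (M * t).
Proof. by move=> t_ge0; rewrite -expR0 ler_expR mulr_ge0// (le_trans _ M1). Qed.

Lemma picard_bound n : admissible (picard n) /\
  forall t, 0 <= t <= T -> nrm mu (picard n t) <= expR (M * t) * B0.
Proof.
elim: n => [|n [ua ub]].
  have b0 t : 0 <= t <= T -> nrm mu (picard 0 t) <= expR (M * t) * B0.
    by move=> _; rewrite nrm0 mulr_ge0 ?expR_ge0.
  split => //; split; first exact/L2cont_cst/L2_0.
  by exists 0 => t _; rewrite nrm0.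
have b1 t : 0 <= t <= T -> nrm mu (picard n.+1 t) <= expR (M * t) * B0.
  move=> /[dup] tT /andP[t_ge0 _]; have us := iota_uniq 0 (n.+1 - 0).
  have e1 := expM_ge1 t_ge0.
  have K_ge0 : 0 <= C0 + expR (M * t) * (2^-1 * (1 + B0)).
    by rewrite addr_ge0// mulr_ge0 ?expR_ge0// mulr_ge0// addr_ge0.
  apply: (@le_trans _ _ (C0 + expR (M * t) * (2^-1 * (1 + B0)))); last first.
    rewrite -subr_ge0 (_ : _ - _ = (expR (M * t) - 1) * C0); last by rewrite /B0; field.
    by rewrite mulr_ge0 ?subr_ge0.
  apply: (@nrm_comb_le (fun i => coef (picard n) i t)) => //.
  have ThA i : i \in index_iota 0 n.+1 -> M <= A i + M by move=> _; rewrite lerDr.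
  have H := coef_growth us ua M1 M1 ThA B0_ge0 tT ub.
  rewrite (eq_bigr (fun i => (expR (- (A i * t)) * k0 i +
    (coef (picard n) i t - expR (- (A i * t)) * k0 i)) ^+ 2)); last first.
    by move=> i _; rewrite addrC subrK.
  apply: sum_minkowski => //.
  - by rewrite mulr_ge0 ?expR_ge0// mulr_ge0// addr_ge0.
  - exact: le_trans (initial_bound us t_ge0) (k0_bound us).
  - apply: le_trans H _; have KM : 0 <= K0 * M `^ (- c) by exact: mulr_ge0 K0_ge0 (powR_ge0 _ _).
    have D1 : 0 <= 1 + B0 by rewrite addr_ge0.
    apply: ler_sqr_weight; [exact: expR_ge0|exact: mulr_ge0 KM D1|].
    by rewrite ler_wpM2r// M_half.
split => //; split.
  by apply: L2cont_comb => // i; exact: coef_continuous.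
exists (expR (M * T) * B0) => t /[dup] tT /andP[t_ge0 tT'].
apply: le_trans (b1 t tT) _; rewrite ler_wpM2r// ler_expR ler_wpM2l//.
exact: le_trans M1.
Qed.

(** High modes are small uniformly over the ball of radius B0: the data by [initial_tail], the
    forcing because A_i tends to infinity and Th may then be taken large. *)
Lemma coef_tail e : 0 < e -> exists N, forall s u t, uniq s ->
  (forall i, i \in s -> (N <= i)%N) -> admissible u ->
  (forall t, 0 <= t <= T -> nrm mu (u t) <= expR (M * t) * B0) -> 0 <= t <= T ->
  \sum_(i <- s) coef u i t ^+ 2 <= (expR (M * t) * e) ^+ 2.
Proof.
move=> e0; have e2 : 0 < e / 2 by rewrite divr_gt0.
have [N1 HN1] := initial_tail (exprn_gt0 2 e2).
have D1 : 0 <= 1 + B0 by rewrite addr_ge0.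
have [Th Th1 HTh] := powRN_small (mulr_ge0 K0_ge0 D1) e2.
have [N2 HN2] := A_unbounded Th.
exists (maxn N1 N2) => s u t us sN ua ub /[dup] tT /andP[t_ge0 _].
have e1 := expM_ge1 t_ge0.
apply: (@le_trans _ _ ((e / 2 + expR (M * t) * (e / 2)) ^+ 2)); last first.
  have e20 := ltW e2; have ee0 : 0 <= expR (M * t) * e by rewrite mulr_ge0 ?expR_ge0 ?(ltW e0).
  have ee2 : 0 <= e / 2 + expR (M * t) * (e / 2).
    by apply: addr_ge0 => //; apply: mulr_ge0 => //; exact: expR_ge0.
  rewrite ler_sqr ?nnegrE//.
  rewrite -subr_ge0 (_ : _ - _ = (expR (M * t) - 1) * (e / 2)); last by field.
  by rewrite mulr_ge0 ?subr_ge0 ?(ltW e2).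
rewrite (eq_bigr (fun i => (expR (- (A i * t)) * k0 i +
  (coef u i t - expR (- (A i * t)) * k0 i)) ^+ 2)); last first.
  by move=> i _; rewrite addrC subrK.
apply: sum_minkowski; [exact: ltW|by rewrite mulr_ge0 ?expR_ge0 ?(ltW e2)| |].
  apply: le_trans (initial_bound us t_ge0) _; apply: HN1 => // i /sN.
  by apply: leq_trans; rewrite leq_maxl.
have ThA i : i \in s -> Th <= A i + M.
  move=> /sN iN; rewrite -[Th]addr0 lerD//; last exact: le_trans M1.
  by apply: HN2; apply: leq_trans iN; rewrite leq_maxr.
apply: le_trans (coef_growth us ua M1 Th1 ThA B0_ge0 tT ub) _.
have KM : 0 <= K0 * Th `^ (- c) by exact: mulr_ge0 K0_ge0 (powR_ge0 _ _).
apply: ler_sqr_weight; [exact: expR_ge0|exact: mulr_ge0 KM D1|].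
by rewrite mulrAC; exact: HTh.
Qed.

(** The modes 0, ..., n occur in both iterates and contract by 1/2; the modes n + 1, ..., m occur
    only in the later one and fall under the tail bound e. *)
Lemma picard_diff D e N n m t : 0 <= D -> 0 <= e ->
  (forall s u t, uniq s -> (forall i, i \in s -> (N <= i)%N) -> admissible u ->
    (forall t, 0 <= t <= T -> nrm mu (u t) <= expR (M * t) * B0) -> 0 <= t <= T ->
    \sum_(i <- s) coef u i t ^+ 2 <= (expR (M * t) * e) ^+ 2) ->
  (forall t, 0 <= t <= T ->
    nrm mu (fun x => picard n t x - picard m t x) <= expR (M * t) * D) ->
  (N <= n)%N -> (n <= m)%N -> 0 <= t <= T ->
  nrm mu (fun x => picard n.+1 t x - picard m.+1 t x) <= expR (M * t) * (2^-1 * D + e).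
Proof.
move=> D0 e0 tailN nmD Nn nm tT.
have [ua ub] := picard_bound n; have [va vb] := picard_bound m.
have us := iota_uniq 0 (n.+1 - 0); have us' := iota_uniq n.+1 (m.+1 - n.+1).
pose f x := \sum_(i <- index_iota 0 n.+1) (coef (picard n) i t - coef (picard m) i t) * phi i x.
pose g x := \sum_(i <- index_iota n.+1 m.+1) coef (picard m) i t * phi i x.
have -> : (fun x => picard n.+1 t x - picard m.+1 t x) = (fun x => f x - g x).
  apply/funext => x; rewrite /= /f /g [X in _ - X](@big_cat_nat _ _ _ n.+1)//= opprD addrA; congr (_ - _).
  by rewrite -sumrB; apply: eq_bigr => i _; rewrite mulrBl.
have fL : f \in L2 by exact: L2_comb.
have gL : g \in L2 by exact: L2_comb.
have -> : (fun x => f x - g x) = (fun x => f x + (-1) * g x).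
  by apply/funext => x; rewrite mulN1r.
apply: le_trans (nrm_triangle fL (L2Z (-1) gL)) _; rewrite nrmZ// normrN1 mul1r mulrDr.
apply: lerD.
  apply: nrm_comb_le => //; first by rewrite mulr_ge0 ?expR_ge0// mulr_ge0.
  have ThA i : i \in index_iota 0 n.+1 -> M <= A i + M by move=> _; rewrite lerDr.
  apply: le_trans (coef_lip us ua va M1 M1 ThA D0 tT nmD) _.
  have KM : 0 <= K0 * M `^ (- c) by exact: mulr_ge0 K0_ge0 (powR_ge0 _ _).
  apply: ler_sqr_weight; [exact: expR_ge0|exact: mulr_ge0 KM D0|].
  by rewrite ler_wpM2r// M_half.
apply: nrm_comb_le => //; first by rewrite mulr_ge0 ?expR_ge0.
apply: tailN => // i; rewrite mem_index_iota => /andP[ni _].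
by apply: leq_trans Nn (ltnW ni).
Qed.

(** Each use of [picard_diff] replaces D by D / 2 + e and raises the starting index by one. The
    fixed point of that map is 2 e, and the distance to it, initially at most 2 B0, halves each
    time. *)
Lemma picard_cauchy_step e k : 0 < e -> exists N, forall n m t,
  (N <= n)%N -> (N <= m)%N -> 0 <= t <= T ->
  nrm mu (fun x => picard n t x - picard m t x) <=
    expR (M * t) * (2^-1 ^+ k * (2 * B0) + 2 * e).
Proof.
move=> e0; have [N0 HN0] := coef_tail e0.
have uL n t : 0 <= t <= T -> picard n t \in L2.
  by move=> tT; have [[[uL _] _] _] := picard_bound n; exact: uL.
elim: k => [|k [N HN]].
  exists 0%N => n m t _ _ tT; rewrite expr0 mul1r.
  have [_ ub] := picard_bound n; have [_ vb] := picard_bound m.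
  have -> : (fun x => picard n t x - picard m t x) = (fun x => picard n t x + (-1) * picard m t x).
    by apply/funext => x; rewrite mulN1r.
  apply: le_trans (nrm_triangle (uL _ _ tT) (L2Z (-1) (uL _ _ tT))) _.
  rewrite nrmZ ?uL// normrN1 mul1r.
  apply: le_trans (lerD (ub t tT) (vb t tT)) _; rewrite -mulrDr ler_wpM2l ?expR_ge0//.
  by have := B0_ge0; lra.
pose D := 2^-1 ^+ k * (2 * B0) + 2 * e.
have D0 : 0 <= D by rewrite addr_ge0 ?mulr_ge0 ?exprn_ge0 ?(ltW e0).
have DE : 2^-1 * D + e = 2^-1 ^+ k.+1 * (2 * B0) + 2 * e by rewrite /D exprS; field.
exists (maxn N N0).+1 => -[//|n] [//|m] t; rewrite !ltnS !geq_max => /andP[Nn N0n] /andP[Nm N0m] tT.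
rewrite -DE; have [nm|/ltnW mn] := leqP n m.
  by apply: (@picard_diff D e N0) => //; [exact: ltW|move=> t' t'T; exact: HN].
rewrite nrmB; apply: (@picard_diff D e N0) => //; [exact: ltW|move=> t' t'T; exact: HN].
Qed.

End fixed_weight.

Lemma picard_cauchy e : 0 < e -> exists N, forall n m t,
  (N <= n)%N -> (N <= m)%N -> 0 <= t <= T ->
  nrm mu (fun x => picard n t x - picard m t x) <= e.
Proof.
move=> e0.
have [M M1 M_half] : exists2 M, 1 <= M & forall Th, M <= Th -> K0 * Th `^ (- c) <= 2^-1.
  by apply: powRN_small; rewrite ?K0_ge0.
have E0 : 0 < expR (M * T) by exact: expR_gt0.
(* The weighted bound is at most e' + 2 e', and removing the weight costs at most e^(M T). *)
pose e' := e / expR (M * T) / 3.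
have e'0 : 0 < e' by rewrite !divr_gt0.
have [k Hk] : exists k, 2^-1 ^+ k * (2 * (2 * C0 + 1)) <= e'.
  have : (fun k => (2^-1 : R) ^+ k * (2 * (2 * C0 + 1))) @ \oo --> 0 * (2 * (2 * C0 + 1)).
    apply: cvgM; last exact: cvg_cst.
    by apply: cvg_expr; rewrite ger0_norm ?invr_ge0// invf_lt1// ltr1n.
  rewrite mul0r => /cvgrPdist_le/(_ e' e'0)[k _ /(_ k (leqnn k))].
  by rewrite /= sub0r normrN => H; exists k; apply: le_trans (ler_norm _) H.
have [N HN] := picard_cauchy_step M1 M_half k e'0.
exists N => n m t Nn Nm /[dup] tT /andP[_ tT'].
apply: le_trans (HN n m t Nn Nm tT) _.
apply: (@le_trans _ _ (expR (M * T) * (3 * e'))).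
  apply: ler_pM; rewrite ?expR_ge0//.
  - by rewrite addr_ge0// mulr_ge0// ?exprn_ge0 ?mulr_ge0 ?addr_ge0 ?mulr_ge0// ltW.
  - by rewrite ler_expR ler_wpM2l// (le_trans _ M1).
  - by move: Hk; lra.
by rewrite /e' le_eqVlt; apply/orP; left; apply/eqP; field; rewrite gt_eqF.
Qed.

(** The second clause holds because the iterates see x only through the values phi i x and the limit
    is taken pointwise; it will yield periodicity. The third passes [coef_volterra] to the limit
    with the uniform convergence in time. *)
Theorem mild_solution : exists u : R -> X -> R,
  [/\ admissible u,
      (forall t x y, (forall i, phi i x = phi i y) -> u t x = u t y) &
      forall i t, ip mu (phi i) (phi i) = 1 -> 0 <= t <= T ->
        ip mu (u t) (phi i) - k0 i =
        \int[leb]_(s in `[0, t]) (forcing u i s - A i * ip mu (u s) (phi i))].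
Proof.
have [M M1 M_half] : exists2 M, 1 <= M & forall Th, M <= Th -> K0 * Th `^ (- c) <= 2^-1.
  by apply: powRN_small; rewrite ?K0_ge0.
have pa n : admissible (picard n) by have [] := picard_bound M1 M_half n.
have UL n t : 0 <= t <= T -> picard n t \in L2 by exact: (pa n).1.1.
(* The subsequence may depend on t; times outside [0, T] receive a dummy. *)
have lim t : exists kappa : nat -> nat, 0 <= t <= T ->
    let v x := lim_of (fun k => picard (kappa k) t x) in
    v \in L2 /\ forall e N, (forall n m, (N <= n)%N -> (N <= m)%N ->
      nrm mu (fun x => picard n t x - picard m t x) <= e) ->
      forall n, (N <= n)%N -> nrm mu (fun x => picard n t x - v x) <= e.
  have [tT|tT] := boolP (0 <= t <= T); last by exists id.
  have [|e e0|kappa H] := @L2_complete _ _ _ mu one_L2 (fun n => picard n t); last by exists kappa.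
    by move=> n; exact: UL.
  by have [N HN] := picard_cauchy e0; exists N => n m Nn Nm; exact: HN.
have [kappa Hk] := choice lim.
pose u t x := lim_of (fun k => picard (kappa t k) t x).
have uL t : 0 <= t <= T -> u t \in L2 by move=> tT; have [] := Hk t tT.
have Uu e : 0 < e -> exists N, forall n t, (N <= n)%N -> 0 <= t <= T ->
    nrm mu (fun x => picard n t x - u t x) <= e.
  move=> e0; have [N HN] := picard_cauchy e0; exists N => n t Nn tT.
  by have [_ H] := Hk t tT; apply: H Nn => n' m' *; exact: HN.
have uc : L2cont mu T u.
  apply: (@L2cont_unif _ _ _ _ _ picard) => //; first by move=> n; exact: (pa n).1.
  by move=> e e0; have [N HN] := Uu e e0; exists N => t tT; exact: HN.
have ua : admissible u.
  split => //; have [N HN] := Uu 1 ltr01; have [_ [B HB]] := pa N.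
  exists (B + 1) => t tT.
  apply: le_trans (ler_nrm_add (uL t tT) (UL N t tT)) _.
  by rewrite nrmB lerD ?HB ?HN.
exists u; split => // [t x y xy|i t phi1 /[dup] tT /andP[t_ge0 tT']].
  congr lim_of; apply/funext => k; case: (kappa t k) => // n /=.
  by apply: eq_bigr => i _; rewrite xy.
have nphi : nrm mu (phi i) = 1 by rewrite /nrm phi1 sqrtr1.
have ip_dist v v' : v \in L2 -> v' \in L2 ->
    `|ip mu v (phi i) - ip mu v' (phi i)| <= 1 * nrm mu (fun x => v x - v' x).
  move=> vL v'L; rewrite -ipBl//; apply: le_trans (cauchy_schwarz (L2B vL v'L) (phiL i)) _.
  by rewrite nphi mulr1 mul1r.
have tin s : `[0, t]%classic s -> 0 <= s <= T.
  by rewrite /= in_itv/= => /andP[-> /le_trans]; exact.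
have sub (f : R -> R) : leb.-integrable `[0, T] (EFin \o f) -> leb.-integrable `[0, t] (EFin \o f).
  by move=> fi; apply: integrableS fi => //; apply: subset_itvl; rewrite bnd_simp.
have iip : leb.-integrable `[0, T] (EFin \o (fun s => ip mu (u s) (phi i))).
  apply: continuous_compact_integrable; first exact: segment_compact.
  exact: lipschitz_L2cont ip_dist uc.
have iu : leb.-integrable `[0, t] (EFin \o (fun s => forcing u i s - A i * ip mu (u s) (phi i))).
  apply: sub; apply: integrableB_EFin => //; first exact: forcing_integrable.
  exact: integrableZ_EFin.
(* e G(s) dominates the change of the integrand when u is replaced by iterates within e of it: one
   term for P, two for Q through r <= 1 + r^2, and A i for the linear decay. *)
pose G s := `|w i| * L + L + L * r s ^+ 2 + A i.
have iG : leb.-integrable `[0, t] (EFin \o G).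
  apply: sub; apply: integrableD_EFin => //; last exact: integrable_cst_itv.
  apply: integrableD_EFin => //; first exact: integrable_cst_itv.
  exact: integrableZ_EFin.
have G0 : 0 <= \int[leb]_(s in `[0, t]) G s.
  by apply: Rintegral_ge0 => s _; rewrite !addr_ge0 ?mulr_ge0 ?sqr_ge0.
suff close e : 0 < e -> `|ip mu (u t) (phi i) - k0 i -
    \int[leb]_(s in `[0, t]) (forcing u i s - A i * ip mu (u s) (phi i))| <=
    e * (1 + \int[leb]_(s in `[0, t]) G s).
  apply/eqP; rewrite -subr_eq0 -normr_eq0 eq_le normr_ge0 andbT.
  apply/ler_addgt0Pl => e e0; rewrite addr0.
  have G1 : 0 < 1 + \int[leb]_(s in `[0, t]) G s by rewrite ltr_pwDl.
  by apply: le_trans (close _ (divr_gt0 e0 G1)) _; rewrite divfK// gt_eqF.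
move=> e0; have [N HN] := Uu e e0.
(* [picard n.+1] keeps the modes 0, ..., n, so n >= i makes mode i present. *)
pose n := maxn N i.
have Nn : (N <= n)%N by rewrite leq_maxl.
have ipU s : ip mu (picard n.+1 s) (phi i) = coef (picard n) i s.
  rewrite (@ip_comb_coef _ _ _ mu phi phiL phi_orth (fun j => coef (picard n) j s)).
  - by rewrite phi1 mulr1.
  - exact: iota_uniq.
  - by rewrite mem_index_iota leq0n/= ltnS leq_maxr.
have iU : leb.-integrable `[0, t] (EFin \o (fun s => forcing (picard n) i s - A i * coef (picard n) i s)).
  apply: sub; apply: integrableB_EFin => //; first exact: forcing_integrable.
  by apply: integrableZ_EFin => //; exact: coef_integrable.
rewrite mulrDr mulr1.
have -> : ip mu (u t) (phi i) - k0 i -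
    \int[leb]_(s in `[0, t]) (forcing u i s - A i * ip mu (u s) (phi i)) =
    (ip mu (u t) (phi i) - ip mu (picard n.+1 t) (phi i)) +
    (\int[leb]_(s in `[0, t]) (forcing (picard n) i s - A i * coef (picard n) i s) -
     \int[leb]_(s in `[0, t]) (forcing u i s - A i * ip mu (u s) (phi i))).
  by rewrite ipU -coef_volterra//; ring.
apply: le_trans (ler_normD _ _) _; apply: lerD.
  apply: le_trans (ip_dist _ _ (uL t tT) (UL _ t tT)) _.
  by rewrite mul1r nrmB HN// ltnW.
rewrite -RintegralB// -RintegralZl//.
have iD : leb.-integrable `[0, t] (EFin \o (fun s => forcing (picard n) i s - A i * coef (picard n) i s -
    (forcing u i s - A i * ip mu (u s) (phi i)))) by exact: integrableB_EFin.
apply: le_trans (le_normr_Rintegral _ iD) _ => //.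
apply: le_Rintegral => //; [exact: integrable_norm|exact: integrableZ_EFin|].
move=> s /tin sT /=.
rewrite (_ : _ - _ = w i * (P i (picard n s) - P i (u s)) + (Q i s (picard n s) - Q i s (u s)) +
  - (A i * (coef (picard n) i s - ip mu (u s) (phi i)))); last by rewrite /forcing; ring.
have Ps := P_lip1 i (UL n s sT) (uL s sT).
have Qs := Q_lip1 i sT (UL n s sT) (uL s sT).
have Is := ip_dist _ _ (UL n.+1 s sT) (uL s sT); rewrite ipU mul1r in Is.
have Hn := HN n s Nn sT; have Hn1 := HN n.+1 s (leq_trans Nn (leqnSn n)) sT.
apply: (@le_trans _ _ (`|w i| * (L * e) + L * (1 + r s ^+ 2) * e + A i * e)); last first.
  by rewrite /G le_eqVlt; apply/orP; left; apply/eqP; ring.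
apply: le_trans (ler_normD _ _) _; apply: lerD.
  apply: le_trans (ler_normD _ _) _; apply: lerD.
    by rewrite normrM ler_wpM2l//; apply: le_trans Ps _; rewrite ler_wpM2l.
  apply: le_trans Qs _; apply: ler_pM; rewrite ?mulr_ge0 ?nrm_ge0//.
  rewrite ler_wpM2l// -subr_ge0 (_ : _ - _ = (r s - 2^-1) ^+ 2 + 3 / 4); last by field.
  by rewrite addr_ge0 ?sqr_ge0// divr_ge0.
rewrite normrN normrM (ger0_norm (A0 i)) ler_wpM2l//.
exact: le_trans Is Hn1.
Qed.

End mild_solution.

(** * Lebesgue measure on R^n and on the torus *)

Section mrestr_integral.
Context {dX : measure_display} {X : measurableType dX} {R : realType}.
Variables (mu : {measure set X -> \bar R}) (D : set X) (mD : measurable D).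

Lemma ge0_integral_mrestr (f : X -> \bar R) : measurable_fun setT f ->
  (forall x, (0 <= f x)%E) ->
  (\int[mrestr mu mD]_x f x = \int[mu]_(x in D) f x)%E.
Proof.
move=> mf f0; rewrite -(setUv D) ge0_integral_setU//; last 3 first.
- exact: measurableC.
- by rewrite setUv.
- exact/disj_setPCl.
rewrite [X in (_ + X)%E](_ : _ = 0%E) ?adde0.
  apply: eq_measure_integral => A mA AD; rewrite /mrestr/=.
  by congr (mu _); exact/setIidPl.
rewrite (@eq_measure_integral _ _ _ _ mzero); first exact: integral_measure_zero.
move=> A mA AD; transitivity (mu (A `&` D)) => //; rewrite (_ : A `&` D = set0) ?measure0//.
by apply/seteqP; split => // x [/AD].
Qed.

End mrestr_integral.

(** * Translation, reflection and periodicity on the line *)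

Section one_dimensional.
Context {R : realType}.
Local Notation leb := (@lebesgue_measure R).

(** By uniqueness it is enough to give half-open intervals their length under the image measure; the
    reflection moves the closed endpoint to the other side, which leaves the length unchanged. *)
Lemma lebesgue_measure_reflect (c : R) (A : set R) : measurable A ->
  leb ((fun t : R => c - t) @^-1` A) = leb A.
Proof.
move=> mA; apply/esym.
have mf : measurable_fun setT (fun t : measurableTypeR R => (c - t : measurableTypeR R)).
  exact: measurable_funB.
have := @lebesgue_measure_unique R (pushforward leb (fun t : measurableTypeR R => (c - t : measurableTypeR R))).
apply => //= _ [[a b]] _ <-.
rewrite /pushforward (_ : _ @^-1` _ = `[c - b, c - a[%classic).
  by rewrite !lebesgue_measure_itv/= !lte_fin ltrD2l ltrN2 -!EFinB; case: ifP => // _; congr EFin; ring.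
apply/seteqP; split => t /=; rewrite !in_itv/=; lra.
Qed.

Lemma lebesgue_measure_translate (c : R) (A : set R) : measurable A ->
  leb ((fun t : R => c + t) @^-1` A) = leb A.
Proof.
move=> mA; apply/esym.
have mf : measurable_fun setT (fun t : measurableTypeR R => (c + t : measurableTypeR R)).
  exact: measurable_funD.
have := @lebesgue_measure_unique R (pushforward leb (fun t : measurableTypeR R => (c + t : measurableTypeR R))).
apply => //= _ [[a b]] _ <-.
rewrite /pushforward (_ : _ @^-1` _ = `]a - c, b - c]%classic).
  by rewrite !lebesgue_measure_itv/= !lte_fin ltrD2r -!EFinB; case: ifP => // _; congr EFin; ring.
apply/seteqP; split => t /=; rewrite !in_itv/=; lra.
Qed.

Lemma ge0_integral_reflect (c : R) (f : R -> \bar R) : measurable_fun setT f ->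
  (forall t, (0 <= f t)%E) -> (\int[leb]_t f (c - t)%R = \int[leb]_t f t)%E.
Proof.
move=> mf f0.
have mg : measurable_fun setT (fun t : measurableTypeR R => (c - t : measurableTypeR R)).
  exact: measurable_funB.
transitivity (\int[pushforward leb (fun t : measurableTypeR R => (c - t)%R : measurableTypeR R)]_t f t)%E.
  by rewrite ge0_integral_pushforward//= preimage_setT.
by apply: eq_measure_integral => A mA _; exact: lebesgue_measure_reflect.
Qed.

Lemma ge0_integral_translate (c : R) (f : R -> \bar R) : measurable_fun setT f ->
  (forall t, (0 <= f t)%E) -> (\int[leb]_t f (c + t)%R = \int[leb]_t f t)%E.
Proof.
move=> mf f0.
have mg : measurable_fun setT (fun t : measurableTypeR R => (c + t : measurableTypeR R)).
  exact: measurable_funD.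
transitivity (\int[pushforward leb (fun t : measurableTypeR R => (c + t)%R : measurableTypeR R)]_t f t)%E.
  by rewrite ge0_integral_pushforward//= preimage_setT.
by apply: eq_measure_integral => A mA _; exact: lebesgue_measure_translate.
Qed.

Lemma integral_itv_translate (c : R) (f : R -> \bar R) (D E : set R) :
  measurable D -> measurable E -> measurable_fun setT f -> (forall t, (0 <= f t)%E) ->
  (forall t, D (c + t) <-> E t) ->
  (\int[leb]_(t in E) f (c + t)%R = \int[leb]_(t in D) f t)%E.
Proof.
move=> mD mE mf f0 DE; rewrite [LHS]integral_mkcond [RHS]integral_mkcond.
rewrite -(@ge0_integral_translate c (f \_ D)).
- apply: eq_integral => t _; rewrite !patchE.
  by case: ifPn; case: ifPn => //; rewrite ?notin_setE ?inE => /DE.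
- by apply/(measurable_restrictT _ _).1 => //; exact: measurable_funS mf.
- by move=> t; rewrite patchE; case: ifP.
Qed.

Lemma integral_itv_reflect (c : R) (f : R -> \bar R) (D E : set R) :
  measurable D -> measurable E -> measurable_fun setT f -> (forall t, (0 <= f t)%E) ->
  (forall t, D (c - t) <-> E t) ->
  (\int[leb]_(t in E) f (c - t)%R = \int[leb]_(t in D) f t)%E.
Proof.
move=> mD mE mf f0 DE; rewrite [LHS]integral_mkcond [RHS]integral_mkcond.
rewrite -(@ge0_integral_reflect c (f \_ D)).
- apply: eq_integral => t _; rewrite !patchE.
  by case: ifPn; case: ifPn => //; rewrite ?notin_setE ?inE => /DE.
- by apply/(measurable_restrictT _ _).1 => //; exact: measurable_funS mf.
- by move=> t; rewrite patchE; case: ifP.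
Qed.

Lemma periodic_int (T : Type) (g : R -> T) : (forall t, g (t + 1) = g t) ->
  forall (n : int) t, g (t + n%:~R) = g t.
Proof.
move=> g1.
have gn (n : nat) t : g (t + n%:R) = g t.
  by elim: n => [|n IH]; rewrite ?addr0// -natr1 addrA g1.
case=> n t; first exact: gn.
have -> : t + (Negz n)%:~R = t - n.+1%:R by [].
by rewrite -[LHS](gn n.+1) subrK.
Qed.

(** Cut the window at the integer m below x. Its left piece, moved by one period, completes the
    right piece to the interval from m to m + 1, which is an integer translate of the unit
    interval. *)
Lemma integral_periodic_window (x : R) (g : R -> \bar R) : measurable_fun setT g ->
  (forall t, (0 <= g t)%E) -> (forall t, g (t + 1)%R = g t) ->
  (\int[leb]_(t in `](x - 1)%R, x]) g t = \int[leb]_(t in `[0%R, 1%R[) g t)%E.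
Proof.
move=> mg g0 g1; pose m : int := Num.floor x.
have /andP[mx xm] := floor_itv x; rewrite -/m in mx xm.
have xm' : x < m%:~R + 1 by move: xm; rewrite intrD.
have -> : `]x - 1, x]%classic = `]x - 1, m%:~R[%classic `|` `[m%:~R, x]%classic.
  apply/seteqP; split => t /=; rewrite !in_itv/=.
    by move=> /andP[-> ->]; case: (ltP t m%:~R) => _; [left|right].
  move=> [/andP[-> tm]|/andP[mt ->]]/=; first by apply: le_trans (ltW tm) mx.
  by rewrite andbT; lra.
rewrite ge0_integral_setU//=; last 2 first.
- exact: measurable_funS mg.
- by apply/disj_setPS => t [/=]; rewrite !in_itv/= => /andP[_ ?] /andP[]; lra.
transitivity (\int[leb]_(t in `]x, (m%:~R + 1)%R[) g t + \int[leb]_(t in `[m%:~R, x]) g t)%E.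
  congr (_ + _)%E.
  rewrite -(@integral_itv_translate 1 g `]x, m%:~R + 1[%classic `]x - 1, m%:~R[%classic)//.
  - by apply: eq_integral => t _; rewrite addrC g1.
  - move=> t /=; rewrite !in_itv/=; split => /andP[? ?]; apply/andP; split; lra.
transitivity (\int[leb]_(t in `[m%:~R, (m%:~R + 1)%R[) g t)%E.
  have -> : `[m%:~R, m%:~R + 1[%classic = `]x, m%:~R + 1[%classic `|` `[m%:~R, x]%classic :> set R.
    apply/seteqP; split => t /=; rewrite !in_itv/=.
      by move=> /andP[-> ->]; case: (leP t x) => _; [right|left].
    move=> [/andP[xt ->]|/andP[-> tx]]/=; first by rewrite andbT (le_trans mx)// ltW.
    by apply: le_lt_trans tx xm'.
  rewrite ge0_integral_setU//=; first exact: measurable_funS mg.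
  by apply/disj_setPS => t [/=]; rewrite !in_itv/= => /andP[? _] /andP[_]; lra.
rewrite -(@integral_itv_translate m%:~R g `[m%:~R, m%:~R + 1[%classic `[0, 1[%classic)//.
- by apply: eq_integral => t _; rewrite addrC periodic_int.
- move=> t /=; rewrite !in_itv/=; split => /andP[? ?]; apply/andP; split; lra.
Qed.

Lemma integral_periodic_reflect (x : R) (g : R -> \bar R) : measurable_fun setT g ->
  (forall t, (0 <= g t)%E) -> (forall t, g (t + 1)%R = g t) ->
  (\int[leb]_(t in `[0%R, 1%R[) g (x - t)%R = \int[leb]_(t in `[0%R, 1%R[) g t)%E.
Proof.
move=> mg g0 g1; rewrite -(integral_periodic_window x mg g0 g1).
apply: integral_itv_reflect => // t.
by rewrite /= !in_itv/=; split => /andP[? ?]; apply/andP; split; lra.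
Qed.

(** Adding 1 keeps the integrand nonnegative, so that the version on the torus can iterate integrals
    by Tonelli without integrability conditions. *)
Lemma integral_cos_period (a : R) (m : int) :
  (\int[leb]_(t in `[0%R, 1%R[) ((1 + cos (a + 2 * pi * m%:~R * t))%R)%:E =
  ((1 + (m == 0)%:R * cos a)%R)%:E)%E.
Proof.
have cosper (g : R -> R) (gper : trigo.periodic g (pi *+ 2)) :
    g (a + 2 * pi * m%:~R) = g a.
  have := @periodic_int R (fun t => g (a + 2 * pi * t)).
  have E t : g (a + 2 * pi * (t + 1)) = g (a + 2 * pi * t).
    by rewrite (_ : _ + _ = a + 2 * pi * t + pi *+ 2) ?gper// mulr2n; ring.
  by move=> /(_ E m 0); rewrite add0r mulr0 addr0.
have mC : measurable_fun setT (fun t => 1 + cos (a + 2 * pi * m%:~R * t)).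
  apply: continuous_measurable_fun => t; apply: cvgD; first exact: cvg_cst.
  apply: continuous_comp; last exact: continuous_cos.
  by apply: cvgD; [exact: cvg_cst|apply: cvgM; [exact: cvg_cst|exact: cvg_id]].
have [->|m0] := eqVneq m 0.
  rewrite (eq_integral (fun=> (1 + cos a)%:E)); last by move=> t _; rewrite mulr0 mul0r addr0.
  transitivity ((1 + cos a)%:E * leb `[0%R, 1%R[%classic)%E; first exact: integral_cst.
  by rewrite lebesgue_measure_itv/= lte_fin ltr01 -EFinB subr0 -EFinM mulr1 mul1r.
rewrite mul0r addr0 integral_itv_bndo_bndc; last first.
  by apply/measurable_EFinP; exact: measurable_funS mC.
pose k : R := 2 * pi * m%:~R.
have k0 : k != 0 by rewrite !mulf_neq0// ?intr_eq0// gt_eqF// pi_gt0.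
pose F (t : R) := t + k^-1 * sin (a + k * t).
have dF (t : R) : is_derive t 1 F (1 + cos (a + k * t)).
  have dl : is_derive t 1 (fun t : R => a + k * t) k.
    have := is_deriveD (is_derive_cst a t 1) (is_deriveZ k (is_derive_id t 1)).
    by rewrite /GRing.scale/= mulr1 add0r.
  have ds := @is_derive1_comp R sin (fun t => a + k * t) _ _ _ (is_derive_sin _) dl.
  have := is_deriveD (is_derive_id t 1) (is_deriveZ k^-1 ds).
  by rewrite /GRing.scale/= mulrCA mulVf// mulr1.
have cF : continuous F.
  by move=> t; apply: differentiable_continuous; apply/derivable1_diffP; have [] := dF t.
rewrite (@continuous_FTC2 _ _ F)//.
- rewrite -EFinB /F mulr0 addr0 mulr1 cosper; last exact: sinD2pi.
  by congr EFin; ring.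
- apply: continuous_subspaceT => t; apply: cvgD; first exact: cvg_cst.
  apply: continuous_comp; last exact: continuous_cos.
  by apply: cvgD; [exact: cvg_cst|apply: cvgM; [exact: cvg_cst|exact: cvg_id]].
- split.
  + by move=> t _; have [] := dF t.
  + by apply: cvg_at_right_filter; exact: cF.
  + by apply: cvg_at_left_filter; exact: cF.
- by move=> t _; rewrite derive1E; have [_ ->] := dF t.
Qed.

End one_dimensional.

(** * Integration over R^n and the torus by induction on the dimension *)

Section lebesgue_rV_theory.
Context {R : realType}.
Local Notation leb := (@lebesgue_measure R).

Definition rV_box n (a b : R) : set 'rV[R]_n := [set x | forall i, a <= x ord0 i < b].

Lemma measurable_rV_box n a b : measurable (@rV_box n a b).
Proof.
rewrite (_ : rV_box a b = \bigcap_(i in [set: 'I_n])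
    ((fun x => x ord0 i : measurableTypeR R) @^-1` `[a, b[%classic)).
  apply: fin_bigcap_measurable => // i _.
  rewrite -[X in measurable X]setTI.
  by apply: (measurable_coord i) => //; exact: measurable_itv.
apply/seteqP; split => x /= cx i; have := cx i.
  by move=> cxi _ /=; rewrite in_itv.
by move=> /(_ I) /=; rewrite in_itv.
Qed.

Lemma rV_cons0 n (s : R) (v : 'rV[R]_n) : @rV_cons R n (s, v) ord0 ord0 = s.
Proof.
rewrite /rV_cons/= (_ : ord0 = lshift n (ord0 : 'I_1)); last exact: val_inj.
by apply: etrans (row_mxEl _ _ _ _) _; rewrite mxE eqxx mulr1n.
Qed.

Lemma rV_consS n (s : R) (v : 'rV[R]_n) (i : 'I_n) :
  @rV_cons R n (s, v) ord0 (lift ord0 i) = v ord0 i.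
Proof.
rewrite /rV_cons/= (_ : lift ord0 i = rshift 1 i); last exact: val_inj.
by apply: etrans (row_mxEr _ _ _ _) _.
Qed.

Lemma rV_cons_forall n (P : R -> Prop) (s : R) (v : 'rV[R]_n) :
  (forall i, P (@rV_cons R n (s, v) ord0 i)) <-> P s /\ forall i, P (v ord0 i).
Proof.
split => [H|[Ps Pv] i].
  by split => [|i]; [have := H ord0; rewrite rV_cons0|have := H (lift ord0 i); rewrite rV_consS].
have [j ->|->] := unliftP ord0 i; first by rewrite rV_consS.
by rewrite rV_cons0.
Qed.

Lemma lebesgue_rV_box n a b : a <= b ->
  lebesgue_rV n (@rV_box n a b) = ((b - a) ^+ n)%:E.
Proof.
move=> ab; elim: n => [|n IH].
  rewrite /= diracE mem_set// => i; by case: i.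
transitivity ((leb \x^ lebesgue_rV n)%E (`[a, b[%classic `*` @rV_box n a b)).
  have <- // : @rV_cons R n @^-1` rV_box a b = `[a, b[%classic `*` rV_box a b.
  apply/seteqP; split => -[s v]; rewrite /= in_itv/=.
    by move=> /(rV_cons_forall (fun y => a <= y < b)).
  by move=> H; apply/(rV_cons_forall (fun y => a <= y < b)).
transitivity (leb `[a, b[%classic * lebesgue_rV n (@rV_box n a b))%E.
  by apply: product_measure2E => //; exact: measurable_rV_box.
rewrite lebesgue_measure_itv/= IH exprS EFinM; case: ifPn => //.
rewrite lte_fin -leNgt => ba.
have -> : b = a by apply/eqP; rewrite eq_le ba ab.
by rewrite subrr !mul0e.
Qed.

Lemma lebesgue_rV_sigma_finite n : sigma_finite setT (@lebesgue_rV R n).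
Proof.
exists (fun k => @rV_box n (- k%:R) k%:R).
  apply/seteqP; split => // x _.
  pose M := \sum_(i < n) `|x ord0 i|.
  exists (Num.bound M) => // i.
  have xM : `|x ord0 i| < (Num.bound M)%:R.
    apply: le_lt_trans (archi_boundP _); last by apply: sumr_ge0.
    by rewrite /M (bigD1 i)//= lerDl sumr_ge0.
  by move: xM; rewrite ltr_norml => /andP[/ltW -> ->].
move=> k; split; first exact: measurable_rV_box.
rewrite lebesgue_rV_box ?ltry//.
by rewrite -subr_ge0 opprK addr_ge0.
Qed.

(** A copy of [lebesgue_rV] that carries the sigma-finite structure required by Tonelli's
    theorem. *)
Definition lebesgue_rV_sf n : set 'rV[R]_n -> \bar R := lebesgue_rV n.
HB.instance Definition _ n := Measure.copy (@lebesgue_rV_sf n) (lebesgue_rV n).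
HB.instance Definition _ n := @Measure_isSigmaFinite.Build _ _ _ (@lebesgue_rV_sf n)
  (@lebesgue_rV_sigma_finite n).

Lemma integral_rV_cons n (G : 'rV[R]_n.+1 -> \bar R) : measurable_fun setT G ->
  (forall x, (0 <= G x)%E) ->
  (\int[lebesgue_rV n.+1]_x G x =
   \int[leb]_s \int[lebesgue_rV n]_v G (rV_cons (s, v)))%E.
Proof.
move=> mG G0.
pose mu2 : {sigma_finite_measure set 'rV[R]_n -> \bar R} := @lebesgue_rV_sf n.
transitivity (\int[(leb \x mu2)%E]_z (G (rV_cons z)))%E; last first.
  rewrite fubini_tonelli1//.
  by apply: measurableT_comp => //; exact: measurable_rV_cons.
have mc := @measurable_rV_cons R n.
(* The recursion uses the product [\x^], Tonelli's theorem the product [\x]; the two agree on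
   rectangles and hence coincide. *)
transitivity (\int[(leb \x^ lebesgue_rV n)%E]_z (G (rV_cons z)))%E.
  exact: (ge0_integral_pushforward mc _ measurableT mG).
apply: eq_measure_integral => A mA _; apply/esym.
apply: (product_measure_unique _ mA) => B C mB mC.
exact: product_measure2E.
Qed.

Lemma measurable_partial_integral n (G : 'rV[R]_n.+1 -> \bar R) : measurable_fun setT G ->
  (forall x, (0 <= G x)%E) ->
  measurable_fun setT (fun s => \int[lebesgue_rV n]_v G (rV_cons (s, v)))%E.
Proof.
move=> mG G0.
pose mu2 : {sigma_finite_measure set 'rV[R]_n -> \bar R} := @lebesgue_rV_sf n.
apply: (@measurable_fun_fubini_tonelli_F _ _ _ _ _ mu2 (fun z => G (rV_cons z))) => //.
by apply: measurableT_comp => //; exact: measurable_rV_cons.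
Qed.

Lemma measurable_cons_section n (G : 'rV[R]_n.+1 -> \bar R) s : measurable_fun setT G ->
  measurable_fun setT (fun v => G (rV_cons (s, v))).
Proof.
move=> mG; apply: measurableT_comp => //.
by apply: (measurableT_comp (@measurable_rV_cons R n)); exact: measurable_pair1.
Qed.

Lemma measurable_rV_addr n (c : 'rV[R]_n) : measurable_fun setT (fun x : 'rV[R]_n => c + x).
Proof.
apply: measurable_fun_rV => i; under eq_fun do rewrite mxE.
by apply: measurable_funD => //; exact: measurable_coord.
Qed.

Lemma measurable_rV_opp n : measurable_fun setT (fun x : 'rV[R]_n => - x).
Proof.
apply: measurable_fun_rV => i; under eq_fun do rewrite mxE.
by apply: measurable_funN; exact: measurable_coord.
Qed.

Lemma measurable_rV_sub n (c : 'rV[R]_n) : measurable_fun setT (fun x : 'rV[R]_n => c - x).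
Proof. exact: (measurableT_comp (measurable_rV_addr c) (@measurable_rV_opp n)). Qed.

Lemma rV_addE n (x y : 'rV[R]_n) i : (x + y) ord0 i = x ord0 i + y ord0 i.
Proof. by rewrite mxE. Qed.

Lemma rV_subE n (x y : 'rV[R]_n) i : (x - y) ord0 i = x ord0 i - y ord0 i.
Proof. by rewrite !mxE. Qed.

Lemma rV_oppE n (x : 'rV[R]_n) i : (- x) ord0 i = - x ord0 i.
Proof. by rewrite mxE. Qed.

Lemma basis_vecE n (i j : 'I_n) : basis_vec i ord0 j = (j == i)%:R :> R.
Proof. by rewrite mxE eqxx. Qed.

Lemma rV_cons_ext n (x y : 'rV[R]_n.+1) : x ord0 ord0 = y ord0 ord0 ->
  (forall j, x ord0 (lift ord0 j) = y ord0 (lift ord0 j)) -> x = y.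
Proof. by move=> x0 xS; apply/rowP => i; have [j ->|->] := unliftP ord0 i. Qed.

Lemma rV_cons_eta n (x : 'rV[R]_n.+1) :
  x = rV_cons (x ord0 ord0, \row_i x ord0 (lift ord0 i)).
Proof. by apply: rV_cons_ext => [|j]; rewrite ?rV_cons0// rV_consS mxE. Qed.

Lemma rV_consB n (s t : R) (v w : 'rV[R]_n) :
  rV_cons (s, v) - rV_cons (t, w) = rV_cons (s - t, v - w).
Proof.
by apply: rV_cons_ext => [|j]; rewrite rV_subE ?rV_cons0// !rV_consS rV_subE.
Qed.

Lemma rV_consN n (s : R) (v : 'rV[R]_n) : - rV_cons (s, v) = rV_cons (- s, - v).
Proof.
by apply: rV_cons_ext => [|j]; rewrite rV_oppE ?rV_cons0// !rV_consS rV_oppE.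
Qed.

Lemma rV_cons_basis0 n (s : R) (v : 'rV[R]_n) :
  rV_cons (s + 1, v) = rV_cons (s, v) + basis_vec ord0.
Proof.
by apply: rV_cons_ext => [|j]; rewrite rV_addE basis_vecE ?rV_cons0// !rV_consS/= addr0.
Qed.

Lemma rV_cons_basisS n (s : R) (v : 'rV[R]_n) i :
  rV_cons (s, v + basis_vec i) = rV_cons (s, v) + basis_vec (lift ord0 i).
Proof.
apply: rV_cons_ext => [|j]; rewrite rV_addE basis_vecE ?rV_cons0/= ?addr0//.
by rewrite !rV_consS rV_addE basis_vecE (inj_eq (@lift_inj _ ord0)).
Qed.

Lemma ge0_integral_rV_opp n (G : 'rV[R]_n -> \bar R) : measurable_fun setT G ->
  (forall x, (0 <= G x)%E) ->
  (\int[lebesgue_rV n]_x G (- x)%R = \int[lebesgue_rV n]_x G x)%E.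
Proof.
elim: n G => [|n IH] G mG G0.
  by apply: eq_integral => x _; rewrite (thinmx0 x) oppr0.
have mGN : measurable_fun setT (fun x : 'rV[R]_n.+1 => G (- x)).
  by apply: measurableT_comp => //; exact: measurable_rV_opp.
rewrite (integral_rV_cons mGN (fun x => G0 _)) (integral_rV_cons mG G0).
transitivity (\int[leb]_s \int[lebesgue_rV n]_v G (rV_cons ((0 - s)%R, v)))%E.
  apply: eq_integral => s _; rewrite sub0r -(IH (fun v => G (rV_cons (- s, v))))//; last exact: (measurable_cons_section _ mG).
  by apply: eq_integral => v _; rewrite rV_consN.
apply: (ge0_integral_reflect 0 (measurable_partial_integral mG G0)).
by move=> s; exact: integral_ge0.
Qed.

Lemma ge0_integral_torus n (G : 'rV[R]_n -> \bar R) : measurable_fun setT G ->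
  (forall x, (0 <= G x)%E) ->
  (\int[torus_measure]_x G x = \int[lebesgue_rV n]_(x in unit_cube) G x)%E.
Proof. by move=> mG G0; exact: ge0_integral_mrestr. Qed.

(** The cut-off concerns all coordinates except the first. It turns an integral over the torus in
    the remaining variables into a full Lebesgue integral, whose measurability in the first variable
    is known. *)
Definition cube_restrict n (G : 'rV[R]_n.+1 -> \bar R) (x : 'rV[R]_n.+1) : \bar R :=
  if [forall i : 'I_n, 0 <= x ord0 (lift ord0 i) < 1] then G x else 0%E.

Lemma measurable_cube_restrict n (G : 'rV[R]_n.+1 -> \bar R) : measurable_fun setT G ->
  measurable_fun setT (cube_restrict G).
Proof.
move=> mG; rewrite (_ : cube_restrict G = G \_ [set x : 'rV[R]_n.+1 | forall i : 'I_n, 0 <= x ord0 (lift ord0 i) < 1]).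
  apply/(measurable_restrictT _ _).1; last exact: measurable_funS mG.
  rewrite (_ : [set _ | _] = \bigcap_(i in [set: 'I_n])
    ((fun x : 'rV[R]_n.+1 => x ord0 (lift ord0 i) : measurableTypeR R) @^-1` `[0, 1[%classic)).
    apply: fin_bigcap_measurable => // i _.
    rewrite -[X in measurable X]setTI.
    by apply: (measurable_coord (lift ord0 i)) => //; exact: measurable_itv.
  apply/seteqP; split => x /= cx i; have := cx i.
    by move=> cxi _ /=; rewrite in_itv.
  by move=> /(_ I) /=; rewrite in_itv.
apply/funext => x; rewrite patchE /cube_restrict.
by case: ifPn => [/forallP H|/forallPn[i Hi]]; [rewrite mem_set|rewrite memNset// => /(_ i); exact/negP].
Qed.

Lemma partial_integral_torus n (G : 'rV[R]_n.+1 -> \bar R) s : measurable_fun setT G ->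
  (forall x, (0 <= G x)%E) ->
  (\int[torus_measure]_v G (rV_cons (s, v)) =
   \int[lebesgue_rV n]_v cube_restrict G (rV_cons (s, v)))%E.
Proof.
move=> mG G0; rewrite ge0_integral_torus//; last exact: measurable_cons_section.
rewrite integral_mkcond; apply: eq_integral => v _; rewrite patchE /cube_restrict.
case: ifPn => [|vc]; first by rewrite inE => vc; rewrite (introT forallP)// => i; rewrite rV_consS; exact: vc.
case: ifPn => // /forallP H; move/negP : vc; case; rewrite inE => i.
by have := H i; rewrite rV_consS.
Qed.

Lemma cube_restrict_ge0 n (G : 'rV[R]_n.+1 -> \bar R) x :
  (forall x, (0 <= G x)%E) -> (0 <= cube_restrict G x)%E.
Proof. by rewrite /cube_restrict; case: ifP. Qed.

Lemma measurable_partial_torus n (G : 'rV[R]_n.+1 -> \bar R) : measurable_fun setT G ->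
  (forall x, (0 <= G x)%E) ->
  measurable_fun setT (fun s => \int[torus_measure]_v G (rV_cons (s, v)))%E.
Proof.
move=> mG G0; under eq_fun do rewrite partial_integral_torus//.
apply: measurable_partial_integral; first exact: measurable_cube_restrict.
by move=> x; exact: cube_restrict_ge0.
Qed.

Lemma integral_torus_cons n (G : 'rV[R]_n.+1 -> \bar R) : measurable_fun setT G ->
  (forall x, (0 <= G x)%E) ->
  (\int[torus_measure]_x G x =
   \int[leb]_(s in `[0%R, 1%R[) \int[torus_measure]_v G (rV_cons (s, v)))%E.
Proof.
move=> mG G0; rewrite ge0_integral_torus// integral_mkcond integral_rV_cons; last 2 first.
- apply/(measurable_restrictT _ _).1; first exact: measurable_unit_cube.
  exact: measurable_funS mG.
- by move=> x; rewrite patchE; case: ifP.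
rewrite [RHS]integral_mkcond; apply: eq_integral => s _; rewrite patchE.
case: ifPn => [|s01]; last first.
  apply: integral0_eq => v _; rewrite patchE memNset// => /(rV_cons_forall (fun y => 0 <= y < 1))[s01' _].
  by move/negP : s01; apply; rewrite inE/= in_itv.
rewrite inE/= in_itv/= => s01; rewrite partial_integral_torus//.
apply: eq_integral => v _; rewrite patchE /cube_restrict; case: ifPn.
  rewrite inE => /(rV_cons_forall (fun y => 0 <= y < 1))[_ H].
  by rewrite (introT forallP)// => i; rewrite rV_consS.
move=> vc; case: ifPn => // /forallP H; move/negP : vc; case; rewrite inE.
by apply/(rV_cons_forall (fun y => 0 <= y < 1)); split => // i; have := H i; rewrite rV_consS.
Qed.

(** Induction on the dimension: the first coordinate by [integral_periodic_reflect], the others by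
    the induction hypothesis at a fixed first coordinate. *)
Lemma integral_torus_reflect n (x : 'rV[R]_n) (G : 'rV[R]_n -> \bar R) :
  measurable_fun setT G -> (forall x, (0 <= G x)%E) ->
  (forall x i, G (x + basis_vec i) = G x) ->
  (\int[torus_measure]_y G (x - y)%R = \int[torus_measure]_y G y)%E.
Proof.
elim: n x G => [|n IH] x G mG G0 Gper.
  by apply: eq_integral => y _; rewrite (thinmx0 (x - y)) (thinmx0 y).
have mGN : measurable_fun setT (fun y : 'rV[R]_n.+1 => G (x - y)).
  by apply: measurableT_comp => //; exact: measurable_rV_sub.
rewrite (integral_torus_cons mGN (fun x => G0 _)) (integral_torus_cons mG G0) {1}(rV_cons_eta x).
set x0 := x ord0 ord0; set x' := \row_i _.
pose g s := (\int[torus_measure]_v G (rV_cons (s, v)))%E.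
transitivity (\int[leb]_(s in `[0%R, 1%R[) g (x0 - s)%R)%E.
  apply: eq_integral => s _; rewrite /g -(IH x' (fun v => G (rV_cons (x0 - s, v)))); last 3 first.
  - exact: (measurable_cons_section _ mG).
  - by [].
  - by move=> v i; rewrite rV_cons_basisS Gper.
  by apply: eq_integral => v _; rewrite rV_consB.
apply: integral_periodic_reflect.
- exact: measurable_partial_torus.
- by move=> s; exact: integral_ge0.
- by move=> s; apply: eq_integral => v _; rewrite rV_cons_basis0 Gper.
Qed.

Lemma torus_measureT n : @torus_measure R n setT = 1%E.
Proof.
rewrite /torus_measure/= /mrestr setTI.
by have := @lebesgue_rV_box n 0 1 ler01; rewrite subr0 expr1n.
Qed.

Definition freq n (k : 'I_n -> int) (x : 'rV[R]_n) : R :=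
  2 * pi * \sum_i (k i)%:~R * x ord0 i.

Lemma measurable_cos_freq n (k : 'I_n -> int) a :
  measurable_fun setT (fun x : 'rV[R]_n => cos (a + freq k x)).
Proof.
have mc : measurable_fun setT (@cos R).
  by apply: continuous_measurable_fun; exact: continuous_cos.
apply: (measurableT_comp mc); apply: measurable_funD => //.
apply: measurable_funM => //; apply: measurable_sum => i.
by apply: measurable_funM => //; exact: measurable_coord.
Qed.

Lemma integral_torus_cos n (k : 'I_n -> int) a :
  (\int[torus_measure]_x ((1 + cos (a + freq k x))%R)%:E =
  ((1 + [forall i, k i == 0]%:R * cos a)%R)%:E)%E.
Proof.
have c0 (y : R) : (0 <= (1 + cos y)%:E)%E.
  by rewrite lee_fin; have := cos_geN1 y; lra.
have mcos m (l : 'I_m -> int) b : measurable_fun setT (fun x => ((1 + cos (b + freq l x))%R)%:E).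
  by apply/measurable_EFinP; apply: measurable_funD => //; exact: measurable_cos_freq.
elim: n k a => [|n IH] k a.
  have E (x : 'rV[R]_0) : freq k x = 0 by rewrite /freq big_ord0 mulr0.
  rewrite (introT forallP); last by case.
  under eq_integral do rewrite E addr0.
  transitivity ((1 + cos a)%:E * @torus_measure R 0 setT)%E; first exact: integral_cst.
  by rewrite torus_measureT mule1 mul1r.
rewrite integral_torus_cons//.
pose k' i := k (lift ord0 i).
have fE s v : freq k (rV_cons (s, v)) = 2 * pi * (k ord0)%:~R * s + freq k' v.
  rewrite /freq big_ord_recl rV_cons0 mulrDr mulrA; congr (_ + _ * _).
  by apply: eq_bigr => i _; rewrite rV_consS.
transitivity (\int[leb]_(s in `[0%R, 1%R[)
    ((1 + [forall i, k' i == 0]%:R * cos (a + 2 * pi * (k ord0)%:~R * s))%R)%:E)%E.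
  apply: eq_integral => s _; rewrite -IH.
  by apply: eq_integral => v _; rewrite fE addrA.
case: (boolP [forall i, k' i == 0]) => k'0.
  under eq_integral do rewrite mul1r.
  rewrite integral_cos_period; congr ((1 + (nat_of_bool _)%:R * _)%:E).
  apply/idP/idP => [/eqP k0|/forallP/(_ ord0)//].
  apply/forallP => i; have [j ->|->] := unliftP ord0 i; last exact/eqP.
  by move/forallP : k'0 => /(_ j).
rewrite (_ : [forall i, k i == 0] = false); last first.
  by apply/negbTE; move: k'0; apply: contra => /forallP H; apply/forallP => i; exact: H.
under eq_integral do rewrite mul0r addr0.
transitivity (1%:E * leb `[0%R, 1%R[%classic)%E; first exact: integral_cst.
by rewrite lebesgue_measure_itv/= lte_fin ltr01 -EFinB subr0 mule1 mul0r addr0.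
Qed.

End lebesgue_rV_theory.

(** * The fractional Laplacian *)

Section radial_profile.
Context {R : realType}.
Local Notation leb := (@lebesgue_measure R).
Variable eta : R.
Hypothesis eta01 : 0 < eta < 1.

(** The exponents lie just above -1 at the origin and just below -1 at infinity, so the integral is
    finite. The value at 0 is set to +oo because [powR] gives 0 there, which would break
    monotonicity in |r|. *)
Definition profile (r : R) : \bar R :=
  if r == 0 then +oo%E else
  (if `|r| < 1 then `|r| `^ (eta - 1) else `|r| `^ (- eta - 1))%:E.

Lemma profile_gt0 r : (0 < profile r)%E.
Proof.
rewrite /profile; case: eqP => [//|/eqP r0].
by case: ifP => _; rewrite lte_fin powR_gt0// normr_gt0.
Qed.

Let eta0 : 0 < eta. Proof. by case/andP: eta01. Qed.
Let eta1 : eta < 1. Proof. by case/andP: eta01. Qed.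

Lemma measurable_profile : measurable_fun setT profile.
Proof.
apply: measurable_fun_ifT; [|exact: measurable_cst|].
  by apply: measurable_fun_eqr.
apply/measurable_EFinP; apply: measurable_fun_ifT.
- by apply: measurable_fun_ltr => //; exact: normr_measurable.
- by apply: (measurableT_comp (measurable_powR _)); exact: normr_measurable.
- by apply: (measurableT_comp (measurable_powR _)); exact: normr_measurable.
Qed.

(** The reflection r -> 1 - r moves the singularity to the right endpoint, where [integral_singular]
    applies with exponent 1 - eta. *)
Lemma integral_profile_inner : (\int[leb]_(r in `[0%R, 1%R[) profile r < +oo)%E.
Proof.
have mp (D : set R) : measurable_fun D profile by exact: measurable_funTS measurable_profile.
rewrite -integral_itv_obnd_cbnd//.
rewrite (eq_integral (fun r : measurableTypeR R => (r `^ (- (1 - eta)))%:E)); last first.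
  move=> r; rewrite inE/= in_itv/= => /andP[r0 r1].
  by rewrite /profile gt_eqF// ger0_norm ?ltW// r1 opprB.
have mq (D : set R) : measurable_fun D (fun r : R => (r `^ (- (1 - eta)))%:E).
  by apply/measurable_EFinP; apply: measurable_funTS; exact: measurable_powR.
have b01 : 0 < 1 - eta < 1 by rewrite subr_gt0 eta1 gtrBl.
apply: le_lt_trans (ltry ((1 - (1 - eta))^-1 * 1 `^ (1 - (1 - eta)))).
apply: le_trans (integral_singular b01 ltr01).
rewrite (@integral_itv_reflect _ 1 (fun r => (r `^ (- (1 - eta)))%:E) `]0, 1] `[0, 1[)//.
- apply: ge0_subset_integral => //.
  + exact: mq.
  + by move=> r _; rewrite lee_fin powR_ge0.
  + by move=> r /=; rewrite !in_itv/= => /andP[-> /ltW].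
- by move=> r; rewrite lee_fin powR_ge0.
- by move=> t; rewrite /= !in_itv/=; split => /andP[? ?]; apply/andP; split; lra.
Qed.

Lemma integral_profile_outer : (\int[leb]_(r in `[1%R, +oo[) profile r < +oo)%E.
Proof.
rewrite (eq_integral (fun r : measurableTypeR R => (r `^ (- eta - 1))%:E)); last first.
  move=> r; rewrite inE/= in_itv/= andbT => r1.
  have r0 : 0 < r by apply: lt_le_trans r1.
  by rewrite /profile gt_eqF// ger0_norm ?ltW// ltNge r1.
pose F (r : R) := - eta^-1 * r `^ (- eta).
have dpow (p r : R) : 0 < r -> is_derive r 1 (fun r : R => r `^ p) (p * r `^ (p - 1)).
  by move=> r0; exact: is_derive1_powR.
have dF (r : R) : 0 < r -> is_derive r 1 F (r `^ (- eta - 1)).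
  move=> r0; have := is_deriveZ (- eta^-1) (dpow (- eta) r r0).
  by rewrite /GRing.scale/= mulrA mulrNN mulVf ?mul1r// gt_eqF.
rewrite (@ge0_continuous_FTC2y _ _ F 1 0).
- by rewrite -EFinB ltry.
- by move=> x _; exact: powR_ge0.
- apply: derivable_within_continuous => r; rewrite in_itv/= andbT => r1.
  by have [] := dpow (- eta - 1) r (lt_le_trans ltr01 r1).
- rewrite -[X in _ --> X](mulr0 (- eta^-1)); apply: cvgM; first exact: cvg_cst.
  have : (fun r : R => (r `^ eta)^-1) @ +oo --> (0 : R).
    apply/gtr0_cvgV0; first by near=> r; rewrite powR_gt0.
    apply/cvgryPge => M; near=> r.
    have M0 : 0 <= `|M| + 1 by rewrite addr_ge0.
    apply: (@le_trans _ _ (`|M| + 1)); first by apply: le_trans (ler_norm M) _; rewrite lerDl.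
    have -> : `|M| + 1 = ((`|M| + 1) `^ eta^-1) `^ eta.
      by rewrite -powRrM mulVf ?gt_eqF// powRr1.
    rewrite ge0_ler_powR ?nnegrE ?powR_ge0 ?(ltW eta0)//.
  by apply: cvg_trans; apply: near_eq_cvg; near=> r; rewrite powRN.
- by move=> r r1; have [] := dF r (lt_trans ltr01 r1).
- apply: cvg_at_right_filter; apply: differentiable_continuous; apply/derivable1_diffP.
  by have [] := dF 1 ltr01.
- move=> r; rewrite in_itv/= andbT => r1.
  by rewrite derive1E; have [_ ->] := dF r (lt_trans ltr01 r1).
Unshelve. all: end_near. Qed.

Lemma integral_profile : (\int[leb]_r profile r < +oo)%E.
Proof.
have mp (D : set R) : measurable_fun D profile by exact: measurable_funTS measurable_profile.
have p0 r : (0 <= profile r)%E by exact/ltW/profile_gt0.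
have half : (\int[leb]_(r in `[0%R, +oo[) profile r < +oo)%E.
  have -> : `[0, +oo[%classic = `[0, 1[%classic `|` `[1, +oo[%classic :> set R.
    apply/seteqP; split => r /=; rewrite !in_itv/= ?andbT.
      by move=> ->; case: (ltP r 1) => _; [left|right].
    by move=> [/andP[]//|]; apply: le_trans.
  rewrite ge0_integral_setU//=; last 2 first.
  - exact: mp.
  - by apply/disj_setPS => t [/=]; rewrite !in_itv/= andbT => /andP[_ ?]; lra.
  by apply: lte_add_pinfty; [exact: integral_profile_inner|exact: integral_profile_outer].
rewrite (_ : setT = `]-oo, 0[%classic `|` `[0, +oo[%classic :> set R); last first.
  apply/seteqP; split => // r _ /=; rewrite !in_itv/= andbT.
  by case: (ltP r 0) => _; [left|right].
rewrite ge0_integral_setU//=; last 2 first.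
- exact: mp.
- by apply/disj_setPS => t [/=]; rewrite !in_itv/= andbT ltNge => /negP.
apply: lte_add_pinfty => //; apply: le_lt_trans half.
have neg : (\int[leb]_(t in `]0%R, +oo[) profile (0 - t)%R =
    \int[leb]_(t in `]-oo, 0%R[) profile t)%E.
  apply: (integral_itv_reflect _ _ measurable_profile p0) => // t.
  by rewrite /= !in_itv/= !andbT sub0r oppr_lt0.
rewrite -neg.
have -> : (\int[leb]_(t in `]0%R, +oo[) profile (0 - t)%R = \int[leb]_(t in `]0%R, +oo[) profile t)%E.
  by apply: eq_integral => r _; rewrite sub0r /profile oppr_eq0 normrN.
apply: ge0_subset_integral => //; first exact: mp.
by move=> r /=; rewrite !in_itv/= !andbT; exact: ltW.
Qed.

Lemma profile_mono (r m : R) : `|r| <= m -> (profile m <= profile r)%E.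
Proof.
rewrite /profile => rm; case: (eqVneq r 0) => [_|r0]; first by rewrite leey.
have r0' : 0 < `|r| by rewrite normr_gt0.
have m0 : 0 < m by apply: lt_le_trans rm.
rewrite gt_eqF// lee_fin (ger0_norm (ltW m0)).
have dec (p x y : R) : p <= 0 -> 0 < x -> x <= y -> y `^ p <= x `^ p.
  move=> p0 x0 xy; have y0 := lt_le_trans x0 xy.
  rewrite -[p]opprK !(powRN _ (- p)) lef_pV2 ?posrE ?powR_gt0//.
  by rewrite ge0_ler_powR ?nnegrE ?oppr_ge0 ?(ltW x0) ?(ltW y0).
have e1 : eta - 1 <= 0 by rewrite subr_le0 ltW.
have e2 : - eta - 1 <= 0 by rewrite subr_le0; apply: le_trans (ler01); rewrite oppr_le0 ltW.
case: (ltP m 1) => m1; first by rewrite (le_lt_trans rm m1) dec.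
case: (ltP `|r| 1) => r1; last by rewrite dec.
apply: (@le_trans _ _ 1).
  by have := dec _ _ _ e2 ltr01 m1; rewrite powR1.
by have := dec _ _ _ e1 r0' (ltW r1); rewrite powR1.
Qed.

Lemma measurable_prod_profile n :
  measurable_fun setT (fun x : 'rV[R]_n => \prod_(i < n) profile (x ord0 i))%E.
Proof.
elim: n => [|n IH].
  by under eq_fun do rewrite big_ord0; exact: measurable_cst.
under eq_fun do rewrite big_ord_recl.
apply: emeasurable_funM.
  exact: (measurableT_comp measurable_profile (measurable_coord ord0)).
have mtl : measurable_fun setT (fun x : 'rV[R]_n.+1 => \row_i x ord0 (lift ord0 i) : 'rV[R]_n).
  apply: measurable_fun_rV => i; under eq_fun do rewrite mxE.
  exact: measurable_coord.
have := measurableT_comp IH mtl; apply: eq_measurable_fun => x _ /=.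
by apply: eq_bigr => i _; rewrite mxE.
Qed.

Lemma prod_profile_ge0 n (x : 'rV[R]_n) : (0 <= \prod_(i < n) profile (x ord0 i))%E.
Proof. by apply: prode_ge0 => i _; exact/ltW/profile_gt0. Qed.

Lemma integral_prod_profile n :
  (\int[lebesgue_rV n]_x \prod_(i < n) profile (x ord0 i) < +oo)%E.
Proof.
elim: n => [|n IH].
  rewrite (eq_integral (fun=> 1%E)); last by move=> x _; rewrite big_ord0.
  by rewrite integral_cst//= diracT mul1e ltry.
rewrite integral_rV_cons; [|exact: measurable_prod_profile|by move=> x; exact: prod_profile_ge0].
have tail0 : (0 <= \int[lebesgue_rV n]_x \prod_(i < n) profile (x ord0 i))%E.
  by apply: integral_ge0 => x _; exact: prod_profile_ge0.
rewrite (eq_integral (fun s : measurableTypeR R => profile s *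
    \int[lebesgue_rV n]_v \prod_(i < n) profile (v ord0 i))%E); last first.
  move=> s _; rewrite -ge0_integralZl//; last 3 first.
  - exact: measurable_prod_profile.
  - by move=> v _; exact: prod_profile_ge0.
  - exact/ltW/profile_gt0.
  apply: eq_integral => v _; rewrite big_ord_recl rV_cons0; congr (_ * _)%E.
  by apply: eq_bigr => i _; rewrite rV_consS.
rewrite ge0_integralZr//; last 2 first.
- exact: measurable_profile.
- by move=> s _; exact/ltW/profile_gt0.
apply: lte_mul_pinfty => //.
- by apply: integral_ge0 => s _; exact/ltW/profile_gt0.
- rewrite ge0_fin_numE; first exact: integral_profile.
  by apply: integral_ge0 => s _; exact/ltW/profile_gt0.
Qed.

End radial_profile.

Section euclidean_norm.
Context {R : realType}.

Lemma edot_ge0 n (x : 'rV[R]_n) : 0 <= edot x x.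
Proof. by apply: sumr_ge0 => i _; rewrite -expr2 sqr_ge0. Qed.

Lemma enorm_ge0 n (x : 'rV[R]_n) : 0 <= enorm x.
Proof. exact: sqrtr_ge0. Qed.

Lemma sqr_enorm n (x : 'rV[R]_n) : enorm x ^+ 2 = \sum_i x ord0 i ^+ 2.
Proof. by rewrite sqr_sqrtr ?edot_ge0. Qed.

Lemma enormN n (x : 'rV[R]_n) : enorm (- x) = enorm x.
Proof. by congr Num.sqrt; apply: eq_bigr => i _; rewrite !mxE mulrNN. Qed.

Lemma enorm0 n : enorm (0 : 'rV[R]_n) = 0.
Proof. by rewrite /enorm /edot big1 ?sqrtr0// => i _; rewrite mxE mul0r. Qed.

Lemma coord_le_enorm n (x : 'rV[R]_n) i : `|x ord0 i| <= enorm x.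
Proof.
rewrite -ler_sqr ?nnegrE ?enorm_ge0// sqr_enorm real_normK ?num_real//.
by rewrite (bigD1 i)//= lerDl; apply: sumr_ge0 => j _; exact: sqr_ge0.
Qed.

Lemma enorm_le_coord n (x : 'rV[R]_n) m : 0 <= m ->
  (forall i, `|x ord0 i| <= m) -> enorm x <= n%:R * m.
Proof.
move=> m0 xm; rewrite -ler_sqr ?nnegrE ?enorm_ge0 ?mulr_ge0// sqr_enorm.
apply: (@le_trans _ _ (\sum_(i < n) m ^+ 2)).
  by apply: ler_sum => i _; rewrite -(real_normK (num_real (x ord0 i))) lerXn2r ?nnegrE.
rewrite sumr_const card_ord -[leLHS]mulr_natl exprMn ler_wpM2r ?sqr_ge0//.
by rewrite -natrX ler_nat; case: n x xm => // n _ _; rewrite leq_pmulr.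
Qed.

Lemma measurable_enorm n : measurable_fun setT (fun x : 'rV[R]_n => enorm x).
Proof.
have ms : measurable_fun setT (@Num.sqrt R).
  by apply: continuous_measurable_fun; exact: sqrt_continuous.
apply: (measurableT_comp ms); apply: measurable_sum => i.
by apply: measurable_funM; exact: measurable_coord.
Qed.

Lemma edot_le n (x y : 'rV[R]_n) : `|edot x y| <= enorm x * enorm y.
Proof.
apply: le_trans (ler_norm_sum _ _ _) _.
have := sum_cauchy_schwarz (index_enum 'I_n) (fun i => x ord0 i) (fun i => y ord0 i).
by under eq_bigr do rewrite -normrM; rewrite -!sqr_enorm !sqrtr_sqr !ger0_norm ?enorm_ge0.
Qed.

End euclidean_norm.

Lemma Rintegral_rV_opp {R : realType} n (g : 'rV[R]_n -> R) : measurable_fun setT g ->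
  \int[lebesgue_rV n]_x g (- x) = \int[lebesgue_rV n]_x g x.
Proof.
move=> mg; rewrite /Rintegral [in LHS]integralE [in RHS]integralE; congr fine.
have mE : measurable_fun setT (EFin \o g) by exact/measurable_EFinP.
have := ge0_integral_rV_opp (measurable_funepos mE) (fun x => funepos_ge0 _ x).
have := ge0_integral_rV_opp (measurable_funeneg mE) (fun x => funeneg_ge0 _ x).
move=> eqm eqp; congr (_ - _)%E; [rewrite -eqp|rewrite -eqm]; apply: eq_integral => x _.
- by rewrite !funeposE.
- by rewrite !funenegE.
Qed.

(** * The principal value through second differences *)

Section fractional_kernel.
Context {R : realType} (d : nat).
Variables (theta a : R).
Hypothesis hd : (0 < d)%N.
Hypothesis theta0 : 0 < theta.
Hypothesis theta_a : theta < a.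
Hypothesis a1 : a < 1.

Local Notation lebd := (@lebesgue_rV R d).

Let a0 : 0 < a. Proof. exact: lt_trans theta_a. Qed.

Definition frac_kernel (z : 'rV[R]_d) := enorm z `^ (- (d%:R + 2 * theta)).

Definition frac_weight (z : 'rV[R]_d) :=
  Num.min 1 (enorm z `^ (2 * a)) * frac_kernel z.

Lemma frac_kernel_ge0 z : 0 <= frac_kernel z. Proof. exact: powR_ge0. Qed.

Lemma frac_weight_ge0 z : 0 <= frac_weight z.
Proof. by rewrite mulr_ge0 ?frac_kernel_ge0// le_min ler01 powR_ge0. Qed.

Lemma measurable_frac_kernel : measurable_fun setT frac_kernel.
Proof. exact: (measurableT_comp (measurable_powR _) (@measurable_enorm R d)). Qed.

Lemma measurable_frac_weight : measurable_fun setT frac_weight.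
Proof.
apply: measurable_funM; last exact: measurable_frac_kernel.
apply: measurable_minr => //.
exact: (measurableT_comp (measurable_powR _) (@measurable_enorm R d)).
Qed.

(** For m = max |z_i| the comparison needs m^(2 a - 2 theta - d) <= m^(d (eta - 1)) when m < 1 and
    m^(- 2 theta - d) <= m^(- d (eta + 1)) when m >= 1, so d eta must stay below 2 a - 2 theta and
    below 2 theta. *)
Let eta := Num.min (2 * theta) (2 * a - 2 * theta) / d%:R.

Let d0 : 0 < d%:R :> R. Proof. by rewrite ltr0n. Qed.

Let eta01 : 0 < eta < 1.
Proof.
have m0 : 0 < Num.min (2 * theta) (2 * a - 2 * theta).
  by rewrite lt_min !mulr_gt0//= -mulrBr mulr_gt0// subr_gt0.
rewrite divr_gt0//= ltr_pdivrMr// mul1r.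
apply: (@lt_le_trans _ _ 1); last by rewrite ler1n.
by rewrite gt_min; case: (ltP (2 * theta) 1) => //= ?; move: theta_a a1 => ? ?; lra.
Qed.

(* With m = max_i |z_i|, the left-hand side is at most a multiple of [profile eta m ^+ d], and
   the profile decreases with |r|; so integrability reduces to dimension one. *)
Lemma frac_weight_le_profile z :
  ((frac_weight z)%:E <= (d%:R `^ (2 * a))%:E * \prod_(i < d) profile eta (z ord0 i))%E.
Proof.
have D0 : (0 <= (d%:R `^ (2 * a))%:E :> \bar R)%E by rewrite lee_fin powR_ge0.
have [->|z0] := eqVneq z 0.
  rewrite {1}/frac_weight enorm0 powR0 ?gt_eqF ?mulr_gt0// min_r// mul0r.
  by rewrite mule_ge0//; exact: prod_profile_ge0.
have [i0 hi0] : exists i0, forall i, `|z ord0 i| <= `|z ord0 i0|.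
  case: (@arg_maxP _ R _ (Ordinal hd) xpredT (fun i => `|z ord0 i|) isT) => i _ H.
  by exists i => j; exact: H.
set m := `|z ord0 i0| in hi0.
have m0 : 0 < m.
  rewrite lt_neqAle normr_ge0 andbT; apply: contraNN z0 => /eqP m0.
  apply/eqP/rowP => i; rewrite mxE; apply/eqP; rewrite -normr_le0.
  by rewrite m0; exact: hi0.
have mz : m <= enorm z by exact: coord_le_enorm.
have zm : enorm z <= d%:R * m by apply: enorm_le_coord => //; exact: ltW.
have z0' : 0 < enorm z by exact: lt_le_trans mz.
have prodm (q : R) : profile eta m = q%:E -> 0 <= q ->
    ((q ^+ d)%:E <= \prod_(i < d) profile eta (z ord0 i))%E.
  move=> qE q0; rewrite -[d in leLHS]card_ord -prodr_const -prodEFin.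
  suff : (0 <= \prod_(i < d) q%:E)%E /\
      (\prod_(i < d) q%:E <= \prod_(i < d) profile eta (z ord0 i))%E by case.
  elim/big_ind2 : _ => // [x1 x2 y1 y2 [h1 h1'] [h2 h2']|i _].
    by rewrite mule_ge0 ?lee_pmul.
  by rewrite -{2}qE profile_mono.
have kz : frac_kernel z <= m `^ (- (d%:R + 2 * theta)).
  rewrite /frac_kernel !powRN lef_pV2 ?posrE ?powR_gt0//.
  by rewrite ge0_ler_powR ?nnegrE ?addr_ge0 ?mulr_ge0 ?ler0n ?(ltW theta0) ?(ltW m0) ?(ltW z0').
have etad : eta * d%:R = Num.min (2 * theta) (2 * a - 2 * theta).
  by rewrite /eta divfK// gt_eqF.
have a20 : 0 <= 2 * a by rewrite mulr_ge0// ltW.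
have [m1|m1] := ltP m 1.
- have qE : profile eta m = (m `^ (eta - 1))%:E by rewrite /profile gt_eqF// gtr0_norm// m1.
  apply: le_trans (lee_wpmul2l D0 (prodm _ qE (powR_ge0 _ _))).
  rewrite -EFinM lee_fin -powR_mulrn ?powR_ge0// -powRrM mulrBl mul1r etad.
  apply: (@le_trans _ _ ((d%:R * m) `^ (2 * a) * m `^ (- (d%:R + 2 * theta)))).
    apply: ler_pM => //; [by rewrite le_min ler01 powR_ge0|exact: frac_kernel_ge0|].
    rewrite ge_min; apply/orP; right.
    by rewrite ge0_ler_powR ?nnegrE ?enorm_ge0// mulr_ge0 ?(ltW d0) ?(ltW m0).
  rewrite powRM ?(ltW d0) ?(ltW m0)// -mulrA ler_wpM2l ?powR_ge0//.
  rewrite -powRD; last by rewrite (gt_eqF m0) implybT.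
  rewrite ger_powR ?m0 ?(ltW m1)//.
  have := ge_min (2 * a - 2 * theta) (2 * theta) (2 * a - 2 * theta).
  by rewrite lexx orbT => ?; lra.
- have qE : profile eta m = (m `^ (- eta - 1))%:E.
    by rewrite /profile gt_eqF// gtr0_norm// ltNge m1.
  apply: le_trans (lee_wpmul2l D0 (prodm _ qE (powR_ge0 _ _))).
  rewrite -EFinM lee_fin -powR_mulrn ?powR_ge0// -powRrM mulrBl mul1r mulNr etad.
  apply: (@le_trans _ _ (1 * m `^ (- (d%:R + 2 * theta)))).
    apply: ler_pM => //; [by rewrite le_min ler01 powR_ge0|exact: frac_kernel_ge0].
  apply: ler_pM => //; first exact: powR_ge0.
    by rewrite -[leLHS](powRr0 d%:R) ler_powR// ler1n.
  rewrite ler_powR//.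
  have := ge_min (2 * theta) (2 * theta) (2 * a - 2 * theta).
  by rewrite lexx => ?; lra.
Qed.

Lemma integrable_frac_weight : lebd.-integrable setT (EFin \o frac_weight).
Proof.
apply/integrableP; split; first by apply/measurable_EFinP; exact: measurable_frac_weight.
have D0 : (0 <= (d%:R `^ (2 * a))%:E :> \bar R)%E by rewrite lee_fin powR_ge0.
apply: (@le_lt_trans _ _ (\int[lebd]_z ((d%:R `^ (2 * a))%:E * \prod_(i < d) profile eta (z ord0 i)))%E).
  apply: ge0_le_integral => //.
  - by apply: measurableT_comp => //; apply/measurable_EFinP; exact: measurable_frac_weight.
  - by apply: measurable_funeM; exact: measurable_prod_profile.
  - by move=> z _ /=; rewrite ger0_norm ?frac_weight_ge0// frac_weight_le_profile.
rewrite ge0_integralZl//; last 2 first.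
- exact: measurable_prod_profile.
- by move=> z _; exact: prod_profile_ge0.
apply: lte_mul_pinfty => //.
exact: integral_prod_profile.
Qed.

Definition second_diff (f : 'rV[R]_d -> R) x z := f (x + z) + f (x - z) - 2 * f x.

Section formula.
Variables (f : 'rV[R]_d -> R) (x : 'rV[R]_d) (M C : R).
Hypothesis mf : measurable_fun setT f.
Hypothesis fM : forall y, `|f y| <= M.
Hypothesis fC : forall z, `|second_diff f x z| <= C * Num.min 1 (enorm z `^ (2 * a)).

Lemma integrable_second_diff :
  lebd.-integrable setT (EFin \o (fun z => second_diff f x z * frac_kernel z)).
Proof.
apply: (@le_integrable_EFin _ _ _ lebd _ _ _ (fun z => C * frac_weight z)) => //.
- apply: measurable_funM; last exact: measurable_frac_kernel.
  apply: measurable_funB => //; apply: measurable_funD.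
    by apply: (measurableT_comp mf); exact: measurable_rV_addr.
  by apply: (measurableT_comp mf); exact: measurable_rV_sub.
- move=> z _; rewrite normrM (ger0_norm (frac_kernel_ge0 z)) mulrA.
  by rewrite ler_wpM2r ?frac_kernel_ge0.
- by apply: integrableZ_EFin => //; exact: integrable_frac_weight.
Qed.

Lemma measurable_enorm_gt (r : R) : measurable [set z : 'rV[R]_d | r < enorm z].
Proof.
rewrite (_ : [set _ | _] = (fun z => enorm z : measurableTypeR R) @^-1` `]r, +oo[).
  by rewrite -[X in measurable X]setTI; apply: measurable_enorm.
by apply/seteqP; split => z /=; rewrite in_itv/= andbT.
Qed.

(** Outside a ball of radius r the factor min(1, |z|^(2 a)) is bounded below by a positive constant,
    so the kernel there is a multiple of [frac_weight]. *)
Lemma integrable_cutoff (g : 'rV[R]_d -> R) (r K : R) : 0 < r -> measurable_fun setT g ->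
  (forall z, `|g z| <= K) ->
  lebd.-integrable [set z | r < enorm z] (EFin \o (fun z => g z * frac_kernel z)).
Proof.
move=> r0 mg gK; have mD := measurable_enorm_gt r.
pose c := Num.min 1 (r `^ (2 * a)).
have c0 : 0 < c by rewrite lt_min ltr01 powR_gt0.
apply: (@le_integrable_EFin _ _ _ lebd _ _ _ (fun z => (K / c) * frac_weight z)) => //.
- by apply: measurable_funTS; apply: measurable_funM => //; exact: measurable_frac_kernel.
- move=> z /= rz; rewrite normrM (ger0_norm (frac_kernel_ge0 z)) mulrA.
  rewrite ler_wpM2r ?frac_kernel_ge0//; apply: le_trans (gK z) _.
  have K0 : 0 <= K by exact: le_trans (gK z).
  rewrite -mulrA ler_peMr//.
  rewrite ler_pdivlMl// mulr1.
  rewrite le_min !ge_min lexx/=; apply/orP; right.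
  by rewrite ge0_ler_powR ?nnegrE ?mulr_ge0 ?enorm_ge0 ?(ltW a0) ?(ltW r0)// ltW.
- apply: integrableZ_EFin => //.
  exact: integrableS integrable_frac_weight.
Qed.

(** The excluded ball and the kernel are even, so z may be replaced by -z; the average of both forms
    contains the second difference. *)
Lemma cutoff_integralE (r : R) : 0 < r ->
  \int[lebd]_(z in [set z | r < enorm z]) ((f (x + z) - f x) * frac_kernel z) =
  2^-1 * \int[lebd]_z ((second_diff f x z * frac_kernel z) * \1_[set z | r < enorm z] z).
Proof.
move=> r0; have mD := measurable_enorm_gt r.
set D := [set z | r < enorm z] in mD *.
have indD (g : 'rV[R]_d -> R) : \int[lebd]_(z in D) g z = \int[lebd]_z (g z * \1_D z).
  rewrite Rintegral_mkcond; apply: eq_Rintegral => z _.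
  by rewrite patchE indicE; case: ifP; rewrite ?mulr1 ?mulr0.
have mfp : measurable_fun setT (fun z : 'rV[R]_d => f (x + z) - f x).
  by apply: measurable_funB => //; apply: (measurableT_comp mf); exact: measurable_rV_addr.
have mfm : measurable_fun setT (fun z : 'rV[R]_d => f (x - z) - f x).
  by apply: measurable_funB => //; apply: (measurableT_comp mf); exact: measurable_rV_sub.
have fK y : `|f y - f x| <= M + M by apply: le_trans (ler_normB _ _) _; exact: lerD.
have ip := integrable_cutoff r0 mfp (fun z => fK (x + z)).
have im := integrable_cutoff r0 mfm (fun z => fK (x - z)).
have sym : \int[lebd]_(z in D) ((f (x - z) - f x) * frac_kernel z) =
           \int[lebd]_(z in D) ((f (x + z) - f x) * frac_kernel z).
  rewrite !indD -[RHS]Rintegral_rV_opp; last first.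
    apply: measurable_funM => //; apply: measurable_funM => //.
    exact: measurable_frac_kernel.
  apply: eq_Rintegral => z _; rewrite /frac_kernel enormN; congr (_ * _).
  by rewrite !indicE; congr (nat_of_bool _)%:R; apply/idP/idP; rewrite !inE /D/= enormN.
rewrite -indD.
transitivity (2^-1 * (\int[lebd]_(z in D) ((f (x + z) - f x) * frac_kernel z) +
  \int[lebd]_(z in D) ((f (x - z) - f x) * frac_kernel z))); first by rewrite sym; lra.
rewrite -RintegralD//; congr (_ * _); apply: eq_Rintegral => z _.
by rewrite /second_diff; ring.
Qed.

(* Averaging over z and -z turns the principal value into an absolutely convergent integral. *)
Lemma frac_laplacianE :
  frac_laplacian theta f x = - 2^-1 * \int[lebd]_z (second_diff f x z * frac_kernel z).
Proof.
rewrite /frac_laplacian mulNr; congr (- _); apply: cvg_lim => //.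
(* Along positive radii tending to 0 the truncated integrands are dominated by the full one. At z =
   0 the second difference vanishes; elsewhere the indicator is eventually 1. *)
apply/cvg_at_rightP => u [u0 ucv].
rewrite (_ : (fun n => _) = (fun n => 2^-1 * \int[lebd]_z
    ((second_diff f x z * frac_kernel z) * \1_[set z | u n < enorm z] z))); last first.
  by apply/funext => n; exact: cutoff_integralE.
apply: cvgMr.
have := @dominated_convergence _ _ _ lebd setT measurableT
  (fun n z => ((second_diff f x z * frac_kernel z) * \1_[set z | u n < enorm z] z)%:E)
  (fun z => (second_diff f x z * frac_kernel z)%:E)
  (fun z => `|(second_diff f x z * frac_kernel z)%:E|%E).
have iS := integrable_second_diff.
have mS := measurable_int _ iS.
case => //.
- move=> n; apply/measurable_EFinP; apply: measurable_funM; first exact/measurable_EFinP.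
  by apply: measurable_indic; exact: measurable_enorm_gt.
- apply: aeW => z _; have [->|z0] := eqVneq z 0.
    rewrite (_ : second_diff f x 0 = 0); last by rewrite /second_diff addr0 subr0; ring.
    rewrite mul0r (_ : (fun n => _) = (fun=> 0%E)); first exact: cvg_cst.
    by apply/funext => n; rewrite mul0r.
  have z0' : 0 < enorm z.
    rewrite lt_neqAle enorm_ge0 andbT eq_sym; apply: contraNN z0 => /eqP ez.
    apply/eqP/rowP => i; rewrite mxE; apply/eqP; rewrite -normr_le0 -ez.
    exact: coord_le_enorm.
  apply: cvg_trans (cvg_cst _ : (fun=> (second_diff f x z * frac_kernel z)%:E) @ \oo --> _).
  apply: near_eq_cvg; near=> n.
  rewrite indicE mem_set ?mulr1//=.
  by near: n; apply: (cvgr_lt (0 : R)).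
- exact: integrable_abse.
- apply: aeW => z n _; rewrite lee_fin normrM ler_piMr//.
  by rewrite indicE; case: (_ \in _); rewrite ?normr1 ?normr0.
- move=> iS' _ cv.
  have fin : (\int[lebd]_z (second_diff f x z * frac_kernel z)%:E)%E \is a fin_num.
    exact: integrable_fin_num iS.
  move: cv; rewrite -(fineK fin) => /fine_cvg.
  exact.
Unshelve. all: end_near. Qed.

End formula.

(** A bound of order 2 a on second differences, uniform in x. Since theta < a it makes the principal
    value converge absolutely, and since a < 1 Fejer means converge in the corresponding
    seminorm. *)
Definition frac_admissible (f : 'rV[R]_d -> R) :=
  [/\ measurable_fun setT f, exists M, forall y, `|f y| <= M &
      exists C, forall x z, `|second_diff f x z| <= C * Num.min 1 (enorm z `^ (2 * a))].

Definition frac_mass := \int[lebd]_z frac_weight z.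

Lemma frac_admissible_linear c f g : frac_admissible f -> frac_admissible g ->
  frac_admissible (fun x => c * f x + g x).
Proof.
move=> [mf [M fM] [C fC]] [mg [N gN] [D gD]]; split.
- by apply: measurable_funD => //; apply: measurable_funM.
- exists (`|c| * M + N) => y; apply: le_trans (ler_normD _ _) _.
  by rewrite normrM lerD// ler_wpM2l.
- exists (`|c| * C + D) => x z.
  rewrite (_ : second_diff _ x z = c * second_diff f x z + second_diff g x z); last first.
    by rewrite /second_diff; ring.
  apply: le_trans (ler_normD _ _) _; rewrite normrM mulrDl -mulrA.
  by rewrite lerD// ler_wpM2l.
Qed.

Lemma frac_admissible0 : frac_admissible (fun=> 0).
Proof.
split => //; first by exists 0 => y; rewrite normr0.
by exists 0 => x z; rewrite /second_diff addr0 mulr0 subr0 normr0 mul0r.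
Qed.

Lemma frac_laplacian_linear c f g x : frac_admissible f -> frac_admissible g ->
  frac_laplacian theta (fun x => c * f x + g x) x =
  c * frac_laplacian theta f x + frac_laplacian theta g x.
Proof.
move=> hf hg; have [m [M fM] [C fC]] := frac_admissible_linear c hf hg.
case: hf hg => mf [Mf fMf] [Cf fCf] [mg [Mg gMg] [Cg gCg]].
rewrite (frac_laplacianE m fM (fC x)) (frac_laplacianE mf fMf (fCf x)).
rewrite (frac_laplacianE mg gMg (gCg x)).
have fi := integrable_second_diff mf (fCf x).
have gi := integrable_second_diff mg (gCg x).
transitivity (- 2^-1 * (c * \int[lebd]_z (second_diff f x z * frac_kernel z) +
  \int[lebd]_z (second_diff g x z * frac_kernel z))); last by lra.
rewrite -RintegralZl// -RintegralD//; last exact: integrableZ_EFin.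
by congr (_ * _); apply: eq_Rintegral => z _; rewrite /second_diff; ring.
Qed.

Lemma frac_laplacian_le f C x : frac_admissible f ->
  (forall z, `|second_diff f x z| <= C * Num.min 1 (enorm z `^ (2 * a))) ->
  `|frac_laplacian theta f x| <= C * frac_mass.
Proof.
move=> [mf [M fM] _] fC; rewrite (frac_laplacianE mf fM fC).
have h2 : `|- 2^-1| = 2^-1 :> R by rewrite normrN ger0_norm ?invr_ge0.
rewrite normrM h2.
have i1 := integrable_second_diff mf fC.
have i2 : lebd.-integrable setT (EFin \o (fun z => C * frac_weight z)).
  by apply: integrableZ_EFin => //; exact: integrable_frac_weight.
have le1 : `|\int[lebd]_z (second_diff f x z * frac_kernel z)| <= C * frac_mass.
  apply: le_trans (le_normr_Rintegral _ i1) _ => //.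
  rewrite /frac_mass -RintegralZl//; last exact: integrable_frac_weight.
  apply: le_Rintegral => //.
    by have := integrable_abse i1; apply: eq_integrable.
  move=> z _ /=; rewrite normrM (ger0_norm (frac_kernel_ge0 z)) /frac_weight mulrA.
  by rewrite ler_wpM2r ?frac_kernel_ge0.
apply: le_trans le1; rewrite ler_piMl//; lra.
Qed.

(** The Fourier multiplier of (-Delta)^theta at frequency k, a constant times |k|^(2 theta). Below
    it is controlled by its sign and the bound [frac_symbol_le]. *)
Definition frac_symbol (k : 'I_d -> int) :=
  \int[lebd]_z ((1 - cos (freq k z)) * frac_kernel z).

Definition laplace_symbol (k : 'I_d -> int) : R := (2 * pi) ^+ 2 * \sum_i (k i)%:~R ^+ 2.

Lemma laplace_symbol_ge0 k : 0 <= laplace_symbol k.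
Proof. by rewrite mulr_ge0 ?sqr_ge0//; apply: sumr_ge0 => i _; rewrite sqr_ge0. Qed.

Lemma freqD k (x y : 'rV[R]_d) : freq k (x + y) = freq k x + freq k y.
Proof.
rewrite /freq -mulrDr -big_split; congr (_ * _); apply: eq_bigr => i _ /=.
by rewrite mxE mulrDr.
Qed.

Lemma freqN k (x : 'rV[R]_d) : freq k (- x) = - freq k x.
Proof.
rewrite /freq -mulrN -sumrN; congr (_ * _); apply: eq_bigr => i _ /=.
by rewrite mxE mulrN.
Qed.

Lemma freq_le k (z : 'rV[R]_d) : `|freq k z| <= Num.sqrt (laplace_symbol k) * enorm z.
Proof.
have tp : 0 <= 2 * pi :> R by rewrite mulr_ge0// pi_ge0.
have -> : Num.sqrt (laplace_symbol k) = 2 * pi * enorm (\row_i (k i)%:~R).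
  rewrite /laplace_symbol sqrtrM ?sqr_ge0// sqrtr_sqr ger0_norm//; congr (_ * Num.sqrt _).
  by apply: eq_bigr => i _; rewrite mxE expr2.
rewrite /freq normrM (ger0_norm tp) -[leRHS]mulrA ler_wpM2l//.
apply: le_trans (edot_le _ _); rewrite le_eqVlt; apply/orP; left; apply/eqP.
by congr `|_|; apply: eq_bigr => i _; rewrite mxE.
Qed.

Lemma sin_le_norm (t : R) : 0 <= t -> `|sin t| <= t.
Proof.
move=> t0; have [] := @MVT_segment R sin cos 0 t t0.
- by apply: continuous_subspaceT => x; exact: continuous_sin.
move=> c _; rewrite sin0 !subr0 => ->; rewrite normrM (ger0_norm t0).
by rewrite ler_piMl// cos_max.
Qed.

Lemma one_sub_cos_ge0 (t : R) : 0 <= 1 - cos t.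
Proof. by rewrite subr_ge0 cos_le1. Qed.

(** The half-angle formula gives 1 - cos t = 2 sin(t / 2)^2 <= t^2 / 2, which is at most 2 |t|^(2 a)
    for |t| < 1 because a < 1. For larger |t| the bound 2 is enough. *)
Lemma one_sub_cos_le (t : R) : 1 - cos t <= 2 * Num.min 1 (`|t| `^ (2 * a)).
Proof.
have [t1|t1] := leP 1 `|t|.
  rewrite min_l.
    by have := cos_geN1 t; lra.
  by rewrite -(powRr0 `|t|) ler_powR// mulr_ge0// ltW.
have [->|t0] := eqVneq t 0.
  rewrite cos0 subrr mulr_ge0// le_min ler01 powR_ge0//.
have t0' : 0 < `|t| by rewrite normr_gt0.
rewrite min_r; last first.
  by rewrite -[leRHS](powRr0 `|t|) ger_powR ?t0' ?(ltW t1)// mulr_ge0// ltW.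
apply: (@le_trans _ _ (2 * `|t| ^+ 2)); last first.
  rewrite ler_wpM2l// -powR_mulrn// ger_powR ?t0' ?(ltW t1)//.
  by move: a1 => ?; lra.
have ht : 0 <= `|t| / 2 by rewrite divr_ge0.
have := sin_le_norm ht; rewrite -ler_sqr ?nnegrE// real_normK ?num_real//.
have -> : cos t = cos (`|t| / 2 + `|t| / 2).
  by rewrite -splitr; case: (ger0P t) => _; rewrite ?cosN.
rewrite cosD -!expr2 => h; have := cos2Dsin2 (`|t| / 2).
have : 0 <= `|t| ^+ 2 by exact: sqr_ge0.
by move: h; rewrite expr_div_n; lra.
Qed.

Lemma one_sub_cos_freq_le k (z : 'rV[R]_d) : 1 - cos (freq k z) <=
  2 * (1 + laplace_symbol k) `^ a * Num.min 1 (enorm z `^ (2 * a)).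
Proof.
apply: le_trans (one_sub_cos_le _) _; rewrite -mulrA ler_wpM2l//.
have L1 : 1 <= 1 + laplace_symbol k by rewrite lerDl laplace_symbol_ge0.
have P1 : 1 <= (1 + laplace_symbol k) `^ a.
  by rewrite -[leLHS](powRr0 (1 + laplace_symbol k)) ler_powR// ltW.
have fl : `|freq k z| `^ (2 * a) <= (1 + laplace_symbol k) `^ a * enorm z `^ (2 * a).
  apply: (@le_trans _ _ ((Num.sqrt (laplace_symbol k) * enorm z) `^ (2 * a))).
    rewrite ge0_ler_powR ?nnegrE ?mulr_ge0 ?sqrtr_ge0 ?enorm_ge0 ?(ltW a0)// freq_le//.
  rewrite powRM ?sqrtr_ge0 ?enorm_ge0// ler_wpM2r ?powR_ge0//.
  rewrite -powR12_sqrt ?laplace_symbol_ge0// -powRrM mulrA mulVf// mul1r.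
  by rewrite ge0_ler_powR ?nnegrE ?(ltW a0) ?laplace_symbol_ge0 ?(le_trans ler01 L1)// lerDr.
rewrite minr_pMr ?powR_ge0// mulr1 le_min !ge_min P1/=.
by apply/orP; right.
Qed.

Lemma second_diff_cos k alpha x z :
  second_diff (fun x => cos (alpha + freq k x)) x z =
  - 2 * cos (alpha + freq k x) * (1 - cos (freq k z)).
Proof.
rewrite /second_diff !freqD freqN !addrA.
by set t := alpha + freq k x; rewrite cosB (cosD t); ring.
Qed.

Lemma frac_admissible_cos k alpha : frac_admissible (fun x => cos (alpha + freq k x)).
Proof.
split; first exact: measurable_cos_freq.
  by exists 1 => y; exact: cos_max.
exists (2 * (2 * (1 + laplace_symbol k) `^ a)) => x z.
have h2 : `|- 2| = 2 :> R by rewrite normrN ger0_norm.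
rewrite second_diff_cos !normrM h2 (ger0_norm (one_sub_cos_ge0 _)).
rewrite -[leLHS]mulrA -[leRHS]mulrA ler_wpM2l//.
apply: le_trans (one_sub_cos_freq_le _ _).
by rewrite ler_piMl ?one_sub_cos_ge0 ?cos_max.
Qed.

Lemma frac_laplacian_cos k alpha x :
  frac_laplacian theta (fun x => cos (alpha + freq k x)) x =
  frac_symbol k * cos (alpha + freq k x).
Proof.
have [mf [M fM] [C fC]] := frac_admissible_cos k alpha.
rewrite (frac_laplacianE mf fM (fC x)) /frac_symbol.
have i1 : lebd.-integrable setT (EFin \o (fun z => (1 - cos (freq k z)) * frac_kernel z)).
  apply: (@le_integrable_EFin _ _ _ lebd _ _ _
    (fun z => 2 * (1 + laplace_symbol k) `^ a * frac_weight z)) => //.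
  - apply: measurable_funM; last exact: measurable_frac_kernel.
    apply: measurable_funB => //.
    by apply: eq_measurable_fun (measurable_cos_freq k 0) => z _; rewrite add0r.
  - move=> z _; rewrite ger0_norm ?mulr_ge0 ?one_sub_cos_ge0 ?frac_kernel_ge0//.
    by rewrite mulrA ler_wpM2r ?frac_kernel_ge0 ?one_sub_cos_freq_le.
  - by apply: integrableZ_EFin => //; exact: integrable_frac_weight.
rewrite -[LHS]RintegralZl//; last exact: (integrable_second_diff mf (fC x)).
rewrite [RHS]mulrC -[RHS]RintegralZl//.
by apply: eq_Rintegral => z _; rewrite second_diff_cos; lra.
Qed.

Lemma frac_symbol_ge0 k : 0 <= frac_symbol k.
Proof.
by apply: Rintegral_ge0 => z _; rewrite mulr_ge0 ?one_sub_cos_ge0 ?frac_kernel_ge0.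
Qed.

Lemma frac_mass_ge0 : 0 <= frac_mass.
Proof. by apply: Rintegral_ge0 => z _; exact: frac_weight_ge0. Qed.

(** At phase 0 and x = 0 the eigenfunction equals 1, so the symbol is the value of the fractional
    Laplacian there, and [frac_laplacian_le] bounds it. *)
Lemma frac_symbol_le k : frac_symbol k <= 4 * frac_mass * (1 + laplace_symbol k) `^ a.
Proof.
have := @frac_laplacian_le (fun x => cos (0 + freq k x)) (2 * (2 * (1 + laplace_symbol k) `^ a)) 0
  (frac_admissible_cos k 0).
rewrite frac_laplacian_cos (_ : freq k 0 = 0); last first.
  by rewrite /freq big1 ?mulr0// => i _; rewrite mxE mulr0.
rewrite addr0 cos0 mulr1 => H; apply: le_trans (ler_norm _) _; apply: le_trans (H _) _; last by lra.
move=> z; have h2 : `|- 2| = 2 :> R by rewrite normrN ger0_norm.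
rewrite second_diff_cos !normrM h2 (ger0_norm (one_sub_cos_ge0 _)).
rewrite -[leLHS]mulrA -[leRHS]mulrA ler_wpM2l//.
apply: (@le_trans _ _ (1 * (1 - cos (freq k z)))); last by rewrite mul1r one_sub_cos_freq_le.
by rewrite ler_wpM2r ?one_sub_cos_ge0 ?cos_max.
Qed.

End fractional_kernel.

(** * The trigonometric basis *)

Section trigonometric_basis.
Context {R : realType} (d : nat).
Local Notation tor := (@torus_measure R d).
Local Notation L2 := (Lfun tor 2%:E).
Implicit Types k l : {ffun 'I_d -> int}.

Lemma bounded_L2 (f : 'rV[R]_d -> R) M : measurable_fun setT f ->
  (forall x, `|f x| <= M) -> f \in L2.
Proof.
move=> mf fM; have M0 : 0 <= M by exact: le_trans (fM 0).
apply: L2I => //; apply: (@le_integrable_EFin _ _ _ tor _ _ _ (fun=> M ^+ 2)) => //.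
- by apply: measurable_funX.
- by move=> x _; rewrite normrX lerXn2r ?nnegrE.
- apply/integrableP; split; first exact: measurable_cst.
  by rewrite integral_cst//= torus_measureT mule1 ltry.
Qed.

Lemma one_L2 : (fun=> 1) \in L2.
Proof. by apply: (@bounded_L2 _ 1) => // x; rewrite normr1. Qed.

Lemma bounded_torus_integrable (f : 'rV[R]_d -> R) M : measurable_fun setT f ->
  (forall x, `|f x| <= M) -> tor.-integrable setT (EFin \o f).
Proof.
move=> mf fM; apply: (@le_integrable_EFin _ _ _ tor _ _ _ (fun=> M)) => //.
apply/integrableP; split; first exact: measurable_cst.
by rewrite integral_cst//= torus_measureT mule1 ltry.
Qed.

Lemma Rintegral_torus_cst (c : R) : \int[tor]_x c = c.
Proof. by rewrite Rintegral_cst//= torus_measureT mulr1. Qed.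

Lemma cos_freq_integrable k alpha :
  tor.-integrable setT (EFin \o (fun x => cos (alpha + freq k x))).
Proof.
apply: (@bounded_torus_integrable _ 1); first exact: measurable_cos_freq.
by move=> x; exact: cos_max.
Qed.

Lemma Rintegral_torus_cos k alpha :
  \int[tor]_x cos (alpha + freq k x) = (k == 0)%:R * cos alpha.
Proof.
have := @integral_torus_cos R d k alpha => /(congr1 fine)/=.
rewrite -[LHS]/(\int[tor]_x (1 + cos (alpha + freq k x))) RintegralD//; last 2 first.
- by have := @bounded_torus_integrable (fun=> 1) 1; apply => // x; rewrite normr1.
- exact: cos_freq_integrable.
rewrite Rintegral_torus_cst => /addrI ->; congr (_%:R * _); congr (nat_of_bool _).
apply/forallP/eqP => [k0|-> i]; last by rewrite ffunE.
by apply/ffunP => i; rewrite (eqP (k0 i)) ffunE.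
Qed.

Lemma freq_ffunD k l (x : 'rV[R]_d) : freq (k + l) x = freq k x + freq l x.
Proof.
rewrite /freq -mulrDr -big_split; congr (_ * _); apply: eq_bigr => i _ /=.
by rewrite ffunE intrD mulrDl.
Qed.

Lemma freq_ffunN k (x : 'rV[R]_d) : freq (- k) x = - freq k x.
Proof.
rewrite /freq -mulrN -sumrN; congr (_ * _); apply: eq_bigr => i _ /=.
by rewrite ffunE intrN mulNr.
Qed.

Lemma cosM (x y : R) : cos x * cos y = 2^-1 * (cos (x + y) + cos (x - y)).
Proof. by rewrite cosB cosD; lra. Qed.

Lemma Rintegral_torus_cosM k l alpha beta :
  \int[tor]_x (cos (alpha + freq k x) * cos (beta + freq l x)) =
  2^-1 * ((k + l == 0)%:R * cos (alpha + beta) + (k - l == 0)%:R * cos (alpha - beta)).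
Proof.
transitivity (\int[tor]_x (2^-1 * (cos (alpha + beta + freq (k + l) x)
    + cos (alpha - beta + freq (k - l) x)))).
  apply: eq_Rintegral => x _; rewrite cosM !freq_ffunD freq_ffunN.
  by congr (_ * (cos _ + cos _)); ring.
rewrite RintegralZl//; last first.
  by apply: integrableD_EFin => //; exact: cos_freq_integrable.
by rewrite RintegralD// ?Rintegral_torus_cos//; exact: cos_freq_integrable.
Qed.

(* One frequency is kept in each pair {k, -k}. *)
Definition half_freq k := (pickle k <= pickle (- k))%N.

Lemma half_freqN k : half_freq k || half_freq (- k).
Proof. by rewrite /half_freq opprK leq_total. Qed.

Lemma half_freq_antisym k : half_freq k -> half_freq (- k) -> k = - k.
Proof.
rewrite /half_freq opprK => k1 k2.
by apply: (pcan_inj (@pickleK _)); apply/eqP; rewrite eqn_leq k1.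
Qed.

Lemma ffun_int_opp_eq k : k = - k -> k = 0.
Proof.
move=> kN; apply/ffunP => i; have := congr1 (fun f : {ffun _} => f i) kN.
by rewrite /= !ffunE => /eqP; rewrite -addr_eq0 -mulr2n mulrn_eq0 => /eqP.
Qed.

(** cos^2 has mean 1/2 over the torus at every nonzero frequency, hence the factor sqrt 2. *)
Definition trig_weight k : R := if k == 0 then 1 else Num.sqrt 2.

Section phase.
Variable p : bool -> R.
Hypothesis p_sub : cos (p true - p false) = 0.
Hypothesis p_add : cos (p true + p false) = 0.

(** The boolean selects one of two phases at the same frequency. The phases are kept abstract
    because two systems are needed: the basis, and its derivatives up to scalars. *)
Definition trig_mode (kb : {ffun 'I_d -> int} * bool) (x : 'rV[R]_d) : R :=
  if half_freq kb.1 then trig_weight kb.1 * cos (p kb.2 + freq kb.1 x) else 0.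

(* Indices that code no kept frequency give the zero function: with the phases below, a member
   has norm 0 or 1. *)
Definition trig_family (n : nat) : 'rV[R]_d -> R :=
  oapp trig_mode (fun=> 0) (pickle_inv n).

Lemma trig_weight_ge0 k : 0 <= trig_weight k.
Proof. by rewrite /trig_weight; case: ifP. Qed.

Lemma measurable_trig_family n : measurable_fun setT (trig_family n).
Proof.
rewrite /trig_family; case: pickle_inv => [kb|]//=; rewrite /trig_mode.
case: half_freq => //; apply: measurable_funM => //; exact: measurable_cos_freq.
Qed.

Lemma trig_family_bounded n : exists M, forall x, `|trig_family n x| <= M.
Proof.
rewrite /trig_family; case: pickle_inv => [[k b]|]/=; last by exists 0 => x; rewrite normr0.
exists (trig_weight k) => x; rewrite /trig_mode; case: ifP => _ /=.
  by rewrite normrM (ger0_norm (trig_weight_ge0 k)) ler_piMr ?trig_weight_ge0 ?cos_max.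
by rewrite normr0 trig_weight_ge0.
Qed.

Lemma trig_family_L2 n : trig_family n \in L2.
Proof.
by have [M] := trig_family_bounded n; apply: bounded_L2; exact: measurable_trig_family.
Qed.

Lemma ip_trig_mode k b l c : half_freq k -> half_freq l ->
  ip tor (trig_mode (k, b)) (trig_mode (l, c)) =
  trig_weight k * trig_weight l * (2^-1 *
   ((k + l == 0)%:R * cos (p b + p c) + (k - l == 0)%:R * cos (p b - p c))).
Proof.
move=> hk hl; rewrite -Rintegral_torus_cosM -RintegralZl//.
  by apply: eq_Rintegral => x _; rewrite /trig_mode /= hk hl mulrACA.
apply: (@bounded_torus_integrable _ 1).
  by apply: measurable_funM; exact: measurable_cos_freq.
by move=> x; rewrite normrM mulr_ile1 ?cos_max.
Qed.

(** For equal frequencies the phases differ, and the two phase conditions annihilate both cosines of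
    the product formula. For distinct ones only k = -l could contribute, and two kept frequencies
    with k = -l are equal. *)
Lemma trig_family_orth m n : m != n -> ip tor (trig_family m) (trig_family n) = 0.
Proof.
move=> mn; rewrite /trig_family.
case Em: (pickle_inv m) => [[k b]|] /=; last by rewrite ip0l.
case En: (pickle_inv n) => [[l c]|] /=; last by rewrite ipC ip0l.
have [hk|hk] := boolP (half_freq k); last first.
  by rewrite (_ : trig_mode (k, b) = fun=> 0) ?ip0l//; apply/funext => x; rewrite /trig_mode/= (negbTE hk).
have [hl|hl] := boolP (half_freq l); last first.
  by rewrite ipC (_ : trig_mode (l, c) = fun=> 0) ?ip0l//; apply/funext => x; rewrite /trig_mode/= (negbTE hl).
have kblc : (k, b) != (l, c).
  apply: contraNneq mn => E.
  have := @pickle_invK ({ffun 'I_d -> int} * bool)%type m.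
  have := @pickle_invK ({ffun 'I_d -> int} * bool)%type n.
  by rewrite Em En /= E => -> ->.
rewrite ip_trig_mode//.
have [kl|kl] := eqVneq k l.
  subst l; have bc : b != c by move: kblc; rewrite xpair_eqE eqxx.
  have -> : cos (p b - p c) = 0.
    by case: b c bc {kblc Em En} => -[]//= _; rewrite // -cosN opprB.
  have -> : cos (p b + p c) = 0.
    by case: b c bc {kblc Em En} => -[]//= _; rewrite // addrC.
  by rewrite !mulr0 addr0 !mulr0.
rewrite (subr_eq0 k l) (negbTE kl) mul0r addr0 addr_eq0.
have [kNl|] := eqVneq k (- l); last by rewrite mul0r !mulr0.
have kN : l = - l by apply: half_freq_antisym; rewrite -?kNl.
by move: kl; rewrite kNl -kN eqxx.
Qed.

Lemma trig_family_normE n k b : pickle_inv n = Some (k, b) -> half_freq k ->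
  ip tor (trig_family n) (trig_family n) =
  if k == 0 then 2^-1 * (1 + cos (p b + p b)) else 1.
Proof.
move=> En hk; rewrite /trig_family En /= ip_trig_mode// /trig_weight !subrr eqxx cos0 mul1r.
have [->|k0] := eqVneq k 0; first by rewrite addr0 eqxx !mul1r addrC.
rewrite (_ : k + k == 0 = false); last first.
  by apply/negbTE; apply: contraNN k0; rewrite addr_eq0 => /eqP/ffun_int_opp_eq/eqP.
by rewrite mul0r add0r mulr1 -expr2 sqr_sqrtr// mulfV.
Qed.

Lemma trig_family_le1 n : ip tor (trig_family n) (trig_family n) <= 1.
Proof.
case En: (@pickle_inv ({ffun 'I_d -> int} * bool)%type n) => [[k b]|]; last by rewrite /trig_family En ip0l.
have [hk|hk] := boolP (half_freq k); last first.
  rewrite (_ : trig_family n = fun=> 0) ?ip0l//; apply/funext => x.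
  by rewrite /trig_family En /trig_mode/= (negbTE hk).
rewrite (trig_family_normE En hk); case: ifP => // _.
by have := cos_le1 (p b + p b); lra.
Qed.

End phase.

Definition cos_phase (b : bool) : R := if b then - (pi / 2) else 0.
(** Differentiation shifts the phase by pi / 2, so derivatives of the basis are multiples of this
    second family with the same index. It is orthogonal too, which makes Bessel's inequality
    available for the divergence term. *)
Definition sin_phase (b : bool) : R := cos_phase b + pi / 2.

Lemma cos_phase_sub : cos (cos_phase true - cos_phase false) = 0.
Proof. by rewrite /cos_phase subr0 cosN cos_pihalf. Qed.

Lemma cos_phase_add : cos (cos_phase true + cos_phase false) = 0.
Proof. by rewrite /cos_phase addr0 cosN cos_pihalf. Qed.

Lemma sin_phase_sub : cos (sin_phase true - sin_phase false) = 0.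
Proof. by rewrite /sin_phase /cos_phase addNr !add0r cosN cos_pihalf. Qed.

Lemma sin_phase_add : cos (sin_phase true + sin_phase false) = 0.
Proof. by rewrite /sin_phase /cos_phase addNr !add0r cos_pihalf. Qed.

(** Only modes of norm 1 are assumed to lie in W, since the mild equation speaks of those alone.
    Frequencies that were not kept are reached by cos(alpha + k) = cos(- alpha - k), other phases by
    the addition formula, and at k = 0 the cosine mode suffices. *)
Lemma trig_span (W : ('rV[R]_d -> R) -> Prop) :
  (forall c f g, W f -> W g -> W (fun x => c * f x + g x)) -> W (fun=> 0) ->
  (forall n, ip tor (trig_family cos_phase n) (trig_family cos_phase n) = 1 ->
     W (trig_family cos_phase n)) ->
  forall k alpha, W (fun x => cos (alpha + freq k x)).
Proof.
move=> Wlin W0 Wphi.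
have Wmode k b : half_freq k -> (k == 0 -> b = false) -> W (trig_mode cos_phase (k, b)).
  move=> hk kb; have En := @pickleK_inv _ (k, b).
  have -> : trig_mode cos_phase (k, b) = trig_family cos_phase (pickle (k, b)).
    by rewrite /trig_family En.
  apply: Wphi; rewrite (trig_family_normE _ En hk); case: ifP => // k0.
  by rewrite (kb k0) /= addr0 cos0; lra.
suff Whalf k alpha : half_freq k -> W (fun x => cos (alpha + freq k x)).
  move=> k alpha; case/orP : (half_freqN k) => hk; first exact: Whalf.
  rewrite (_ : (fun _ => _) = (fun x => cos (- alpha + freq (- k) x))); first exact: Whalf.
  by apply/funext => x; rewrite freq_ffunN -opprD cosN.
move=> hk; have [k0|k0] := boolP (k == 0).
  have := Wlin (cos alpha) _ _ (Wmode k false hk (fun=> erefl)) W0.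
  congr W; apply/funext => x; rewrite /trig_mode /= hk /trig_weight k0 mul1r addr0 add0r.
  by rewrite (eqP k0) /freq big1 ?mulr0 ?addr0 ?cos0 ?mulr1// => i _; rewrite ffunE mul0r.
have w0 : trig_weight k != 0 by rewrite /trig_weight (negbTE k0) gt_eqF// sqrtr_gt0.
have h := Wmode k false hk (fun=> erefl).
have h' : W (trig_mode cos_phase (k, true)) by apply: Wmode => //; rewrite (negbTE k0).
have := Wlin (cos alpha / trig_weight k) _ _ h (Wlin (- sin alpha / trig_weight k) _ _ h' W0).
congr W; apply/funext => x; rewrite /trig_mode /= hk addr0 add0r.
have -> : cos (- (pi / 2) + freq k x) = sin (freq k x) by rewrite addrC -sinDpihalf subrK.
by rewrite !mulrA !divfK// cosD; ring.
Qed.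

(** Indices that code no frequency get the value n, so that the eigenvalues tend to infinity along
    all indices. *)
Definition mode_eigenvalue n : R :=
  oapp (fun kb : {ffun 'I_d -> int} * bool => laplace_symbol kb.1) n%:R
    (pickle_inv n).

Lemma mode_eigenvalue_ge0 n : 0 <= mode_eigenvalue n.
Proof. by rewrite /mode_eigenvalue; case: pickle_inv => //= kb; exact: laplace_symbol_ge0. Qed.

Lemma laplace_symbol_ge k i : ((k i)%:~R : R) ^+ 2 <= laplace_symbol k.
Proof.
apply: (@le_trans _ _ (1 * \sum_i ((k i)%:~R : R) ^+ 2)).
  by rewrite mul1r (bigD1 i)//= lerDl; apply: sumr_ge0 => j _; exact: sqr_ge0.
rewrite ler_wpM2r//; first by apply: sumr_ge0 => j _; exact: sqr_ge0.
by have := @pi_ge2 R => p2; rewrite -[leLHS](expr1n _ 2) lerXn2r ?nnegrE//; lra.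
Qed.

(** An eigenvalue below Th confines every |k_i| to at most M, which leaves finitely many
    frequencies; N exceeds all their codes. The map g enumerates them by shifting the k_i into {0,
    ..., 2 M}. *)
Lemma mode_eigenvalue_unbounded Th : exists N, forall n, (N <= n)%N ->
  Th <= mode_eigenvalue n.
Proof.
pose M := Num.bound (`|Th| + 1).
have ThM : `|Th| + 1 < M%:R.
  by apply: archi_boundP; rewrite addr_ge0.
pose g (q : {ffun 'I_d -> 'I_(M + M).+1} * bool) : nat :=
  pickle ([ffun i => (q.1 i)%:Z - M%:Z] : {ffun 'I_d -> int}, q.2).
exists (maxn M (\max_q g q).+1) => n; rewrite geq_max => /andP[Mn gn].
rewrite leNgt; apply/negP; rewrite /mode_eigenvalue.
have := @pickle_invK ({ffun 'I_d -> int} * bool)%type n.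
case: (pickle_inv n) => [[k b]|] /= En.
  move=> lamTh; suff : exists q, g q = n.
    by move=> [q gq]; have := @leq_bigmax _ g q; rewrite gq leqNgt => /negP; apply.
  pose z i : int := k i.
  have kM i : (`|z i| <= M)%N.
    have k2 : ((k i)%:~R : R) ^+ 2 < M%:R.
      apply: le_lt_trans (laplace_symbol_ge k i) _; apply: lt_trans lamTh _.
      by apply: le_lt_trans (ler_norm _) _; apply: lt_trans ThM; rewrite ltrDl.
    rewrite -(@ler_nat R) natr_absz intr_norm.
    rewrite -(real_normK (num_real _)) in k2.
    have M1 : 1 <= M%:R :> R by apply: le_trans (ltW ThM); rewrite lerDr.
    by rewrite leNgt; apply/negP => Mk; nra.
  have kM' i : (`|(z i + M%:Z)%R| < (M + M).+1)%N by have := kM i; lia.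
  exists ([ffun i => Ordinal (kM' i)], b); rewrite /g -En; congr (pickle (_, _)).
  by apply/ffunP => i; rewrite !ffunE /= -/(z i); have := kM i; lia.
move=> nTh; have : (M%:R : R) <= n%:R by rewrite ler_nat.
by have := ler_norm Th; lra.
Qed.

End trigonometric_basis.

(** * Continuous and smooth periodic functions *)

Section rV_topology.
Context {R : realType} (n : nat).
Implicit Types x z : 'rV[R]_n.

Lemma rV_norm_lt x e : 0 < e -> (forall i, `|x ord0 i| < e) -> `|x| < e.
Proof.
move=> e0 xe; have -> : `|x| = mx_norm x by [].
have [->//|/mx_norm_neq0 [[i j] /= ->]] := eqVneq (mx_norm x) 0.
by rewrite (ord1 i).
Qed.

(** Rounding down to a lattice of mesh 1 / (N + 1). It has countably many values with measurable
    fibres, so any function composed with it is measurable. That links continuity with a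
    sigma-algebra generated by coordinates rather than open sets. *)
Definition grid (N : nat) x : 'rV[R]_n := \row_i ((Num.floor (N.+1%:R * x ord0 i))%:~R / N.+1%:R).

Lemma cvg_grid x : grid N x @[N --> \oo] --> x.
Proof.
apply/cvgrPdist_lt => e e0; near=> N.
apply: rV_norm_lt => // i; rewrite rV_subE mxE.
have N0 : 0 < N.+1%:R :> R by rewrite ltr0n.
have /andP[h1 h2] := floor_itv (N.+1%:R * x ord0 i).
rewrite intrD in h2.
rewrite -[X in X - _](mulKf (lt0r_neq0 N0)) [X in X - _]mulrC -mulrBl.
rewrite normrM ger0_norm ?subr_ge0// gtr0_norm ?invr_gt0//.
apply: (@lt_trans _ _ (1 / N.+1%:R)).
  by rewrite ltr_pM2r ?invr_gt0// ltrBlDl.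
rewrite div1r invf_plt ?posrE//.
apply: (@lt_trans _ _ N%:R); last by rewrite ltr_nat.
by near: N; exact: nbhs_infty_gtr.
Unshelve. all: end_near. Qed.

Lemma measurable_grid_fiber (N : nat) (q : 'I_n -> int) :
  measurable [set x : 'rV[R]_n | forall i, Num.floor (N.+1%:R * x ord0 i) = q i].
Proof.
rewrite (_ : [set x | _] = \bigcap_(i in [set: 'I_n])
   ((fun x : 'rV[R]_n => x ord0 i : measurableTypeR R) @^-1`
    `[(q i)%:~R / N.+1%:R, ((q i)%:~R + 1) / N.+1%:R[%classic)).
  apply: fin_bigcap_measurable => // i _.
  rewrite -[X in measurable X]setTI; apply: (measurable_coord i) => //.
have fE (i : 'I_n) (t : R) : (`[(q i)%:~R / N.+1%:R, ((q i)%:~R + 1) / N.+1%:R[%classic t : Prop) =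
    ((q i)%:~R <= N.+1%:R * t < (q i)%:~R + 1 : Prop).
  by rewrite /= in_itv/= ler_pdivrMr// ltr_pdivlMr// mulrC.
apply/seteqP; split => x /= H i.
  move=> _; have := floor_itv (N.+1%:R * x ord0 i); rewrite H intrD.
  by have := fE i (x ord0 i); rewrite /= => ->.
apply: floor_def; have := H i I; have := fE i (x ord0 i); rewrite /= => ->.
by rewrite intrD.
Qed.

Lemma measurable_grid_comp (N : nat) (T : Type) (g : 'rV[R]_n -> T) (A : set T) :
  measurable ((g \o grid N) @^-1` A).
Proof.
pose z (q : {ffun 'I_n -> int}) : 'rV[R]_n := \row_i ((q i)%:~R / N.+1%:R).
pose S q : set 'rV[R]_n := [set _ | A (g (z q))] `&`
   [set x | forall i, Num.floor (N.+1%:R * x ord0 i) = q i].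
rewrite (_ : _ @^-1` _ = \bigcup_q S q).
  apply: countable_bigcupT_measurable; first exact: countableP.
  move=> q; have [Aq|Aq] := pselect (A (g (z q))).
    rewrite (_ : S q = [set x | forall i, Num.floor (N.+1%:R * x ord0 i) = q i]).
      exact: measurable_grid_fiber.
    by apply/seteqP; split => x => [[]|].
  by rewrite (_ : S q = set0)//; apply/seteqP; split => x // [].
apply/seteqP; split => x /=.
  move=> Ax; exists [ffun i => Num.floor (N.+1%:R * x ord0 i)] => //.
  have zE : z [ffun i => Num.floor (N.+1%:R * x ord0 i)] = grid N x.
    by apply/rowP => i; rewrite !mxE ffunE.
  by rewrite /S/= zE; split => // i; rewrite ffunE.
move=> [q _ [/= Aq xq]]; rewrite (_ : grid N x = z q)//.
by apply/rowP => i; rewrite !mxE xq.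
Qed.

Lemma continuous_measurable_rV (f : 'rV[R]_n -> R) : continuous f -> measurable_fun setT f.
Proof.
move=> cf; apply: (@measurable_fun_cvg _ _ _ _ (fun N => f \o grid N)).
  by move=> N _ A mA; rewrite setTI; exact: measurable_grid_comp.
move=> x _; apply: continuous_cvg; [exact: cf|exact: cvg_grid].
Qed.

End rV_topology.

Section periodic_functions.
Context {R : realType} (n : nat).
Implicit Types (x z : 'rV[R]_n) (f : 'rV[R]_n -> R).

Lemma periodic_lattice f (m : 'I_n -> int) x : Defs.periodic f ->
  f (x + \row_i (m i)%:~R) = f x.
Proof.
move=> pf.
have step (i : 'I_n) (k : int) y : f (y + k%:~R *: basis_vec i) = f y.
  have := @periodic_int R _ (fun t => f (y + t *: basis_vec i)) _ k 0.
  rewrite add0r scale0r addr0; apply => t.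
  by rewrite scalerDl scale1r addrA pf.
rewrite (row_sum_delta (\row_i (m i)%:~R)).
elim/big_ind : _ (x) => [y|u v Hu Hv y|i _ y]; first by rewrite addr0.
  by rewrite addrA Hv Hu.
by rewrite mxE step.
Qed.

Definition l1norm z := \sum_i `|z ord0 i|.

Lemma l1norm_ge0 z : 0 <= l1norm z. Proof. exact: sumr_ge0. Qed.

Lemma l1norm_le_enorm z : l1norm z <= n%:R * enorm z.
Proof.
apply: (@le_trans _ _ (\sum_(i < n) enorm z)).
  by apply: ler_sum => i _; exact: coord_le_enorm.
by rewrite sumr_const card_ord -[leLHS]mulr_natl.
Qed.

Lemma periodic_bounded f : continuous f -> Defs.periodic f -> exists M, forall x, `|f x| <= M.
Proof.
move=> cf pf.
pose K : set 'rV[R]_n := [set v | forall i, `[0, 1]%classic (v ord0 i)].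
have cK : compact K by apply: (@rV_compact R n (fun=> `[0, 1]%classic)) => i; exact: segment_compact.
have /compact_bounded [M [_ HM]] : compact (f @` K).
  by apply: continuous_compact => //; exact: continuous_subspaceT.
exists (M + 1) => x.
pose m i := - Num.floor (x ord0 i).
rewrite -(periodic_lattice m x pf); apply: (HM (M + 1)); first by rewrite ltrDl.
exists (x + \row_i (m i)%:~R) => // i; rewrite /= in_itv/= rV_addE mxE intrN.
by have /andP[] := floor_itv (x ord0 i); rewrite intrD => ? ?; apply/andP; split; lra.
Qed.

End periodic_functions.

Section smooth_functions.
Context {R : realType} (n : nat).
Implicit Types (x z : 'rV[R]_n) (f : 'rV[R]_n -> R).

Lemma smooth_differentiable f x : smooth f -> differentiable f x.
Proof. by move=> /(_ [::]). Qed.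

Lemma smooth_continuous f : smooth f -> continuous f.
Proof. by move=> sf x; apply: differentiable_continuous; exact: smooth_differentiable. Qed.

Lemma smooth_partial i f : smooth f -> smooth (partial i f).
Proof. by move=> sf s x; have := sf (rcons s i) x; rewrite foldr_rcons. Qed.

Lemma periodic_partial i f : Defs.periodic f -> Defs.periodic (partial i f).
Proof.
move=> pf x j; rewrite /partial /derive.
suff -> : (fun h : R => h^-1 *: ((f \o shift (x + basis_vec j)) (h *: basis_vec i) - f (x + basis_vec j)))
  = (fun h => h^-1 *: ((f \o shift x) (h *: basis_vec i) - f x)) by [].
by apply/funext => h /=; rewrite addrA !pf.
Qed.

Lemma torus_smooth_partial i f : torus_smooth f -> torus_smooth (partial i f).
Proof. by move=> [pf sf]; split; [exact: periodic_partial|exact: smooth_partial]. Qed.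

Lemma deriveE_partial f x z : differentiable f x -> 'D_z f x = \sum_i z ord0 i * partial i f x.
Proof.
move=> df; rewrite deriveE// {1}(row_sum_delta z) linear_sum; apply: eq_bigr => i _.
by rewrite linearZ/= /partial deriveE.
Qed.

Lemma is_derive_line f x z t : differentiable f (x + t *: z) ->
  is_derive (t : R) 1 (fun t => f (x + t *: z)) (\sum_i z ord0 i * partial i f (x + t *: z)).
Proof.
move=> df; have dv : derivable f (x + t *: z) z by exact: diff_derivable.
have E : (fun h : R => h^-1 *: (((fun t : R => f (x + t *: z)) \o shift t) (h *: (1 : R)) - f (x + t *: z)))
  = (fun h => h^-1 *: ((f \o shift (x + t *: z)) (h *: z) - f (x + t *: z))).
  apply/funext => h /=; congr (_ *: (f _ - _)).
  by rewrite [h%:A]mulr1 scalerDl addrCA.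
rewrite -(deriveE_partial z df).
apply: DeriveDef.
  by rewrite /derivable E.
by rewrite /derive E.
Qed.

Lemma line_mean_value f x z : (forall y, differentiable f y) ->
  exists2 c, 0 <= c <= 1 & f (x + z) - f x = \sum_i z ord0 i * partial i f (x + c *: z).
Proof.
move=> df; have dl t := @is_derive_line f x z t (df _).
have [] := @MVT_segment R _ _ 0 1 ler01 (fun t _ => dl t).
  apply: derivable_within_continuous => t _; by have [] := dl t.
by move=> c; rewrite in_itv/= scale1r scale0r addr0 subr0 mulr1 => c01 ->; exists c.
Qed.

Lemma torus_smooth_bounded f : torus_smooth f -> exists2 M, 0 <= M & forall x, `|f x| <= M.
Proof.
move=> [pf sf]; have [M HM] := periodic_bounded (smooth_continuous sf) pf.
by exists M => //; apply: le_trans (HM 0).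
Qed.

Lemma torus_smooth_partial_bounded f : torus_smooth f ->
  exists2 M, 0 <= M & forall i x, `|partial i f x| <= M.
Proof.
move=> tf.
have /choice [M HM] : forall i, exists M, 0 <= M /\ forall x, `|partial i f x| <= M.
  by move=> i; have [M ? ?] := torus_smooth_bounded (torus_smooth_partial i tf); exists M.
exists (\sum_i M i); first by apply: sumr_ge0 => i _; exact: (HM i).1.
move=> i x; apply: le_trans ((HM i).2 x) _.
by rewrite (bigD1 i)//= lerDl; apply: sumr_ge0 => j _; exact: (HM j).1.
Qed.

Lemma torus_smooth_lipschitz f : torus_smooth f ->
  exists2 L, 0 <= L & forall x z, `|f (x + z) - f x| <= L * l1norm z.
Proof.
move=> tf; have [M M0 HM] := torus_smooth_partial_bounded tf.
exists M => // x z; have [c _ ->] := line_mean_value x z (fun y => smooth_differentiable y tf.2).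
apply: le_trans (ler_norm_sum _ _ _) _; rewrite mulr_sumr; apply: ler_sum => i _.
by rewrite normrM mulrC ler_wpM2r.
Qed.

Lemma l1normZ c z : l1norm (c *: z) = `|c| * l1norm z.
Proof. by rewrite /l1norm mulr_sumr; apply: eq_bigr => i _; rewrite mxE normrM. Qed.

Lemma l1normN z : l1norm (- z) = l1norm z.
Proof. by apply: eq_bigr => i _; rewrite mxE normrN. Qed.

Lemma l1norm_basis i : l1norm (basis_vec i : 'rV[R]_n) = 1.
Proof.
rewrite /l1norm (bigD1 i)//= basis_vecE eqxx normr1 big1 ?addr0// => j ji.
by rewrite basis_vecE (negbTE ji) normr0.
Qed.

Lemma torus_smooth_partial_lipschitz f : torus_smooth f -> exists2 L, 0 <= L &
  forall i x z, `|partial i f (x + z) - partial i f x| <= L * l1norm z.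
Proof.
move=> tf.
have /choice [L HL] : forall i, exists L, 0 <= L /\
    forall x z, `|partial i f (x + z) - partial i f x| <= L * l1norm z.
  by move=> i; have [L ? ?] := torus_smooth_lipschitz (torus_smooth_partial i tf); exists L.
exists (\sum_i L i); first by apply: sumr_ge0 => i _; exact: (HL i).1.
move=> i x z; apply: le_trans ((HL i).2 x z) _; rewrite ler_wpM2r ?l1norm_ge0//.
by rewrite (bigD1 i)//= lerDl; apply: sumr_ge0 => j _; exact: (HL j).1.
Qed.

(** The error is uniform in x, as needed to differentiate under the integral of the Fejer mean. *)
Lemma torus_smooth_quotient f : torus_smooth f -> exists2 C, 0 <= C &
  forall i x h, `|f (x + h *: basis_vec i) - f x - h * partial i f x| <= C * h ^+ 2.
Proof.
move=> tf; have [L L0 HL] := torus_smooth_partial_lipschitz tf.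
exists L => // i x h.
have [c /andP[c0 c1] ->] := line_mean_value x (h *: basis_vec i)
  (fun y => smooth_differentiable y tf.2).
rewrite (bigD1 i)//= big1 ?addr0; last first.
  by move=> j ji; rewrite mxE basis_vecE (negbTE ji) mulr0 mul0r.
rewrite mxE basis_vecE eqxx mulr1 -mulrBr normrM scalerA.
apply: (@le_trans _ _ (`|h| * (L * l1norm ((c * h) *: basis_vec i : 'rV[R]_n)))).
  by rewrite ler_wpM2l.
rewrite l1normZ l1norm_basis mulr1 mulrCA ler_wpM2l// normrM (ger0_norm c0).
by rewrite -(real_normK (num_real h)) expr2 ler_wpM2l// ler_piMl.
Qed.

(** The forward and the backward increment are both mean values of the gradient; their sum is z
    paired with a difference of gradients, which is again of order |z|. *)
Lemma torus_smooth_second_diff f : torus_smooth f -> exists2 C, 0 <= C &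
  forall x z, `|second_diff f x z| <= C * l1norm z ^+ 2.
Proof.
move=> tf; have [L L0 HL] := torus_smooth_partial_lipschitz tf.
exists (2 * L); first by rewrite mulr_ge0.
move=> x z.
have [c /andP[c0 c1] Ep] := line_mean_value x z (fun y => smooth_differentiable y tf.2).
have [c' /andP[c0' c1'] Em] := line_mean_value x (- z) (fun y => smooth_differentiable y tf.2).
have -> : second_diff f x z = \sum_i z ord0 i *
    ((partial i f (x + c *: z) - partial i f x) - (partial i f (x + c' *: - z) - partial i f x)).
  transitivity ((f (x + z) - f x) + (f (x - z) - f x)); first by rewrite /second_diff; ring.
  by rewrite Ep Em -big_split; apply: eq_bigr => i _ /=; rewrite mxE; ring.
apply: le_trans (ler_norm_sum _ _ _) _.
rewrite expr2 mulrA mulr_sumr; apply: ler_sum => i _.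
rewrite normrM mulrC ler_wpM2r//; apply: le_trans (ler_normB _ _) _.
have b (e : R) (y : 'rV[R]_n) : 0 <= e -> e <= 1 -> l1norm y = l1norm z ->
    `|partial i f (x + e *: y) - partial i f x| <= L * l1norm z.
  move=> e0 e1 yz; apply: le_trans (HL _ _ _) _; rewrite ler_wpM2l// l1normZ ger0_norm// yz.
  by rewrite ler_piMl ?l1norm_ge0.
have := b c z c0 c1 erefl; have := b c' (- z) c0' c1' (l1normN z); lra.
Qed.

(** For |z| >= 1 the sup bound is enough; for |z| < 1 the quadratic bound is, since |z|^2 <= |z|^(2
    a). *)
Lemma torus_smooth_frac_admissible a f : 0 < a < 1 -> torus_smooth f -> frac_admissible a f.
Proof.
move=> /andP[a0 a1] tf; have [M M0 HM] := torus_smooth_bounded tf.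
have [C C0 HC] := torus_smooth_second_diff tf.
split; first by apply: continuous_measurable_rV; apply: smooth_continuous; case: tf.
  by exists M.
exists (C * n%:R ^+ 2 + 4 * M) => x z.
have [z1|z1] := leP 1 (enorm z).
  rewrite min_l; last by rewrite -[leLHS](powRr0 (enorm z)) ler_powR// mulr_ge0// ltW.
  rewrite mulr1 /second_diff; apply: (@le_trans _ _ (4 * M)); last first.
    by rewrite lerDr mulr_ge0// sqr_ge0.
  apply: le_trans (ler_normB _ _) _; rewrite normrM (ger0_norm (ler0n _ 2)).
  have := ler_normD (f (x + z)) (f (x - z)); have := HM (x + z); have := HM (x - z); have := HM x.
  lra.
have [z0|z0] := eqVneq (enorm z) 0.
  have l0 : l1norm z = 0.
    by apply/eqP; rewrite eq_le l1norm_ge0 andbT; have := l1norm_le_enorm z; rewrite z0 mulr0.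
  have := HC x z; rewrite l0 expr0n/= mulr0 => /le_trans; apply.
  by rewrite mulr_ge0 ?addr_ge0 ?mulr_ge0 ?sqr_ge0// le_min ler01 powR_ge0.
have ez : 0 < enorm z by rewrite lt_neqAle eq_sym z0 enorm_ge0.
have p1 : enorm z ^+ 2 <= Num.min 1 (enorm z `^ (2 * a)).
  rewrite le_min expr_le1 ?enorm_ge0 ?(ltW z1)//=.
  by rewrite -powR_mulrn ?enorm_ge0// ger_powR ?ez ?(ltW z1)// ler_piMr// ltW.
apply: le_trans (HC x z) _.
apply: (@le_trans _ _ (C * (n%:R * enorm z) ^+ 2)).
  by rewrite ler_wpM2l// lerXn2r ?nnegrE ?l1norm_ge0 ?mulr_ge0 ?enorm_ge0 ?l1norm_le_enorm.
rewrite exprMn mulrA; apply: ler_pM => //; rewrite ?mulr_ge0 ?sqr_ge0 ?enorm_ge0//.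
by rewrite lerDl mulr_ge0.
Qed.

End smooth_functions.

(** * Fejer means *)

Section fejer.
Context {R : realType} (d : nat).
Local Notation tor := (@torus_measure R d).
Implicit Types (k : {ffun 'I_d -> int}) (f g : 'rV[R]_d -> R).

Lemma cos_freq_periodic k alpha :
  Defs.periodic (fun x : 'rV[R]_d => cos (alpha + freq k x)).
Proof.
move=> x i; rewrite freqD.
have -> : freq k (basis_vec i : 'rV[R]_d) = 2 * pi * (k i)%:~R.
  rewrite /freq (bigD1 i)//= basis_vecE eqxx mulr1 big1 ?addr0// => j ji.
  by rewrite basis_vecE (negbTE ji) mulr0.
have := @periodic_int R _ (fun t => cos (alpha + freq k x + 2 * pi * t)) _ (k i) 0.
rewrite add0r mulr0 addr0 addrA; apply => t.
rewrite mulrDr mulr1 addrA [2 * pi]mulrC.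
by have := @cosD2pi R; rewrite mulr_natr => ->.
Qed.

Variable N : nat.
Local Notation J := {ffun 'I_d -> 'I_N.+1}.

Definition fejer_index (j : J) : {ffun 'I_d -> int} := [ffun i => (j i : nat)%:Z].

Lemma fejer_index_inj : injective fejer_index.
Proof.
move=> j l jl; apply/ffunP => i; apply/val_inj.
by have := congr1 (fun f : {ffun 'I_d -> int} => f i) jl; rewrite !ffunE => -[].
Qed.

Definition fejer_card : R := N.+1%:R ^+ d.

Lemma fejer_card_gt0 : 0 < fejer_card.
Proof. by rewrite exprn_gt0// ltr0n. Qed.

Lemma fejer_cardE : \sum_(j : J) (1 : R) = fejer_card.
Proof. by rewrite sumr_const card_ffun !card_ord /fejer_card natrX. Qed.

(* The squared modulus of \sum_j e^(2 i pi j.y) over the frequencies j in {0, ..., N}^d. *)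
Definition fejer_kernel (y : 'rV[R]_d) : R :=
  fejer_card^-1 * ((\sum_(j : J) cos (freq (fejer_index j) y)) ^+ 2 +
                   (\sum_(j : J) sin (freq (fejer_index j) y)) ^+ 2).

Lemma fejer_kernel_ge0 y : 0 <= fejer_kernel y.
Proof. by rewrite mulr_ge0 ?invr_ge0 ?(ltW fejer_card_gt0)// addr_ge0 ?sqr_ge0. Qed.

Lemma fejer_kernelE y : fejer_kernel y = fejer_card^-1 *
  \sum_(j : J) \sum_(l : J) cos (0 + freq (fejer_index j - fejer_index l) y).
Proof.
congr (_ * _); rewrite !expr2 !mulr_suml -big_split; apply: eq_bigr => j _ /=.
rewrite !mulr_sumr -big_split; apply: eq_bigr => l _ /=.
by rewrite add0r freq_ffunD freq_ffunN cosB.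
Qed.

Lemma measurable_fejer : measurable_fun setT fejer_kernel.
Proof.
rewrite (funext fejer_kernelE); apply: measurable_funM => //.
by apply: measurable_sum => j; apply: measurable_sum => l; exact: measurable_cos_freq.
Qed.

Lemma fejer_le y : `|fejer_kernel y| <= fejer_card.
Proof.
rewrite fejer_kernelE normrM ger0_norm ?invr_ge0 ?(ltW fejer_card_gt0)//.
rewrite ler_pdivrMl ?fejer_card_gt0//.
apply: le_trans (ler_norm_sum _ _ _) _; rewrite -{1}fejer_cardE mulr_suml.
apply: ler_sum => j _; rewrite mul1r -fejer_cardE; apply: le_trans (ler_norm_sum _ _ _) _.
by apply: ler_sum => l _; exact: cos_max.
Qed.

Lemma fejer_periodic : Defs.periodic fejer_kernel.
Proof.
move=> y i; rewrite !fejer_kernelE; congr (_ * _).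
by apply: eq_bigr => j _; apply: eq_bigr => l _; exact: cos_freq_periodic.
Qed.

Lemma fejer_integrable : tor.-integrable setT (EFin \o fejer_kernel).
Proof. exact: bounded_torus_integrable measurable_fejer fejer_le. Qed.

Lemma fejer_mass : \int[tor]_y fejer_kernel y = 1.
Proof.
under eq_Rintegral do rewrite fejer_kernelE.
rewrite RintegralZl//; last first.
  by apply: integrable_sum_EFin => // j; apply: integrable_sum_EFin => // l; exact: cos_freq_integrable.
rewrite Rintegral_sum//; last first.
  by move=> j; apply: integrable_sum_EFin => // l; exact: cos_freq_integrable.
rewrite (eq_bigr (fun=> 1)) ?fejer_cardE ?mulVf ?gt_eqF ?fejer_card_gt0// => j _.
rewrite Rintegral_sum//; last by move=> l; exact: cos_freq_integrable.
rewrite (bigD1 j)//= big1 ?addr0; last first.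
  move=> l lj; rewrite Rintegral_torus_cos subr_eq0 (inj_eq fejer_index_inj) eq_sym.
  by rewrite (negbTE lj) mul0r.
by rewrite Rintegral_torus_cos subrr eqxx cos0 mulr1.
Qed.

Definition unit_index (i : 'I_d) : {ffun 'I_d -> int} := [ffun j => (j == i)%:Z].

Lemma freq_unit_index i (y : 'rV[R]_d) : freq (unit_index i) y = 2 * pi * y ord0 i.
Proof.
rewrite /freq (bigD1 i)//= ffunE eqxx mul1r big1 ?addr0// => j ji.
by rewrite ffunE (negbTE ji) mul0r.
Qed.

(** Counting: prescribing one coordinate leaves (N + 1)^(d - 1) frequencies, written as a product
    over coordinates of the numbers of allowed values. *)
Lemma fejer_face i : \sum_(j : J) ((j i == ord_max)%:R : R) = fejer_card / N.+1%:R.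
Proof.
pose F (x : 'I_d) : pred 'I_N.+1 := if x == i then pred1 ord_max else predT.
have cF : #|(family F : pred J)| = (\prod_x #|F x|)%N.
  by rewrite card_family /image_mem foldrE big_map big_enum.
apply: (@mulIf _ N.+1%:R); first by rewrite pnatr_eq0.
rewrite divfK ?pnatr_eq0//.
transitivity ((#|(family F : pred J)| * N.+1)%:R : R).
  rewrite natrM; congr (_ * _); rewrite -sum1_card natr_sum [RHS]big_mkcond; apply: eq_bigr => j _ /=.
  rewrite (_ : (j \in _) = (j i == ord_max)); first by case: eqP.
  apply/familyP/idP => [/(_ i)|ji x]; first by rewrite /F eqxx.
  by rewrite /F; case: eqP => // ->.
rewrite cF (bigD1 i)//= (_ : #|F i| = 1%N); last by rewrite /F eqxx card1.
rewrite mul1n (eq_bigr (fun=> N.+1)); last first.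
  by move=> x xi; rewrite /F (negbTE xi) card_ord.
rewrite /fejer_card -natrX; congr (_%:R).
rewrite -[RHS](_ : \prod_(x < d) N.+1 = _)%N; last by rewrite prod_nat_const card_ord.
by rewrite [RHS](bigD1 i)//= mulnC.
Qed.

(* Multiplying by [cos (2 * pi * y_i)] shifts the cube of frequencies by one step along axis
   [i], and the two cubes differ by a face only. *)
Lemma fejer_moment i :
  \int[tor]_y (fejer_kernel y * (1 - cos (2 * pi * y ord0 i))) <= N.+1%:R^-1.
Proof.
have mc : measurable_fun setT (fun y : 'rV[R]_d => cos (2 * pi * y ord0 i)).
  apply: eq_measurable_fun (measurable_cos_freq (unit_index i) 0) => y _.
  by rewrite add0r freq_unit_index.
have ic : tor.-integrable setT (EFin \o (fun y => fejer_kernel y * cos (2 * pi * y ord0 i))).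
  apply: (@bounded_torus_integrable _ _ _ fejer_card).
    by apply: measurable_funM => //; exact: measurable_fejer.
  by move=> y; rewrite normrM -[leRHS]mulr1 ler_pM ?fejer_le ?cos_max.
under eq_Rintegral do rewrite mulrBr mulr1.
rewrite RintegralB ?fejer_integrable// fejer_mass.
suff : 1 - N.+1%:R^-1 <= \int[tor]_y (fejer_kernel y * cos (2 * pi * y ord0 i)) by rewrite !lerBlDr => ?; rewrite addrC.
have E y : fejer_kernel y * cos (2 * pi * y ord0 i) = fejer_card^-1 *
    \sum_(j : J) \sum_(l : J) (cos (0 + freq (fejer_index j - fejer_index l) y) *
      cos (0 + freq (unit_index i) y)).
  rewrite fejer_kernelE add0r freq_unit_index -[LHS]mulrA; congr (_ * _).
  by rewrite mulr_suml; apply: eq_bigr => j _; rewrite mulr_suml.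
have icc k l : tor.-integrable setT (EFin \o (fun y => cos (0 + freq k y) * cos (0 + freq l y))).
  apply: (@bounded_torus_integrable _ _ _ 1).
    by apply: measurable_funM; exact: measurable_cos_freq.
  by move=> y; rewrite normrM mulr_ile1 ?cos_max.
under eq_Rintegral do rewrite E.
rewrite RintegralZl//; last first.
  by apply: integrable_sum_EFin => // j; exact: integrable_sum_EFin.
rewrite Rintegral_sum//; last by move=> j; exact: integrable_sum_EFin.
rewrite ler_pdivlMl ?fejer_card_gt0// mulrBr mulr1.
have -> : fejer_card - fejer_card / N.+1%:R = \sum_(j : J) ((1 : R) - (j i == ord_max)%:R).
  by rewrite sumrB fejer_cardE fejer_face.
have shift (j : J) : j i != ord_max -> exists l : J, fejer_index l = fejer_index j + unit_index i.
  move=> ji; have lt x : ((j x : nat) + (x == i) < N.+1)%N.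
    have [->|xi] := eqVneq x i; last by rewrite addn0.
    by rewrite addn1 ltnS ltn_neqAle ji -ltnS ltn_ord.
  by exists [ffun x => Ordinal (lt x)]; apply/ffunP => x; rewrite !ffunE /= PoszD.
(* Off the face j_i = N the neighbour of j along axis i lies in the cube and contributes 1; on the
   face the left-hand side is 0. *)
have le1 (j : J) : (1 : R) - (j i == ord_max)%:R <=
    \sum_(l : J) (fejer_index j - fejer_index l + unit_index i == 0)%:R.
  have [_|/shift [l fl]] := eqVneq (j i) ord_max; first by rewrite subrr sumr_ge0.
  rewrite (bigD1 l)//= fl opprD addrA subrr sub0r addNr eqxx subr0 lerDl.
  exact: sumr_ge0.
have le2 (l : J) : (1 : R) - (l i == ord_max)%:R <=
    \sum_(j : J) (fejer_index j - fejer_index l - unit_index i == 0)%:R.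
  have [_|/shift [j fj]] := eqVneq (l i) ord_max; first by rewrite subrr sumr_ge0.
  have E0 : fejer_index j - fejer_index l - unit_index i = 0 by rewrite fj -addrA -opprD subrr.
  rewrite (bigD1 j)//= E0 eqxx subr0 lerDl.
  exact: sumr_ge0.
have s1 : \sum_(j : J) ((1 : R) - (j i == ord_max)%:R) <= \sum_(j : J) \sum_(l : J)
    (fejer_index j - fejer_index l + unit_index i == 0)%:R by apply: ler_sum => j _; exact: le1.
have s2 : \sum_(l : J) ((1 : R) - (l i == ord_max)%:R) <= \sum_(l : J) \sum_(j : J)
    (fejer_index j - fejer_index l - unit_index i == 0)%:R by apply: ler_sum => l _; exact: le2.
rewrite exchange_big/= in s2.
(* The integral of a product of two cosines is half the sum of two Kronecker symbols, one for each
   direction of the shift; each direction accounts for all frequencies off a face. *)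
rewrite [leRHS](eq_bigr (fun j : J => 2^-1 *
    (\sum_(l : J) (fejer_index j - fejer_index l + unit_index i == 0)%:R +
     \sum_(l : J) (fejer_index j - fejer_index l - unit_index i == 0)%:R))); last first.
  move=> j _; rewrite Rintegral_sum// -big_split mulr_sumr; apply: eq_bigr => l _ /=.
  by rewrite Rintegral_torus_cosM addr0 subr0 cos0 !mulr1.
rewrite -mulr_sumr [X in _ <= _ * X]big_split/=.
by move: s1 s2 => /= s1 s2; lra.
Qed.

Definition fejer_mean f (x : 'rV[R]_d) : R := \int[tor]_y (fejer_kernel y * f (x - y)).

Definition bounded_measurable f := measurable_fun setT f /\ exists M, forall x, `|f x| <= M.

Lemma fejer_mean_integrable f x : bounded_measurable f ->
  tor.-integrable setT (EFin \o (fun y => fejer_kernel y * f (x - y))).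
Proof.
move=> [mf [M fM]]; apply: (@bounded_torus_integrable _ _ _ (fejer_card * M)).
  apply: measurable_funM; first exact: measurable_fejer.
  by apply: (measurableT_comp mf); exact: measurable_rV_sub.
by move=> y; rewrite normrM ler_pM ?fejer_le.
Qed.

Lemma fejer_mean_linear c f g x : bounded_measurable f -> bounded_measurable g ->
  fejer_mean (fun y => c * f y + g y) x = c * fejer_mean f x + fejer_mean g x.
Proof.
move=> bf bg; rewrite /fejer_mean -RintegralZl; [|by []|exact: fejer_mean_integrable].
rewrite -RintegralD; [|by []| |exact: fejer_mean_integrable]; last first.
  by apply: integrableZ_EFin => //; exact: fejer_mean_integrable.
by apply: eq_Rintegral => y _; ring.
Qed.

(** The kernel is nonnegative with integral 1, so the mean is an average. This positivity transfers
    every uniform bound on f, its difference quotients and its second differences without loss. *)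
Lemma fejer_mean_le f x M : bounded_measurable f -> (forall y, `|f y| <= M) ->
  `|fejer_mean f x| <= M.
Proof.
move=> bf fM; have i1 := fejer_mean_integrable x bf.
apply: le_trans (le_normr_Rintegral _ i1) _ => //.
apply: (@le_trans _ _ (\int[tor]_y (M * fejer_kernel y))).
  apply: le_Rintegral => //.
  - by have := integrable_abse i1; apply: eq_integrable.
  - by apply: integrableZ_EFin => //; exact: fejer_integrable.
  - by move=> y _; rewrite normrM (ger0_norm (fejer_kernel_ge0 y)) mulrC ler_wpM2r ?fejer_kernel_ge0.
by rewrite RintegralZl ?fejer_mass ?mulr1 ?fejer_integrable.
Qed.

Lemma fejer_mean_shift f x z : fejer_mean f (x + z) = fejer_mean (fun y => f (y + z)) x.
Proof. by apply: eq_Rintegral => y _; rewrite addrAC. Qed.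

Lemma fejer_mean_cst c x : fejer_mean (fun=> c) x = c.
Proof.
rewrite /fejer_mean; under eq_Rintegral do rewrite mulrC.
by rewrite RintegralZl ?fejer_mass ?mulr1 ?fejer_integrable.
Qed.

Lemma bounded_measurable_linear c f g : bounded_measurable f -> bounded_measurable g ->
  bounded_measurable (fun y => c * f y + g y).
Proof.
move=> [mf [M fM]] [mg [K gK]]; split.
  by apply: measurable_funD => //; apply: measurable_funM.
exists (`|c| * M + K) => x; apply: le_trans (ler_normD _ _) _.
by rewrite normrM lerD// ler_wpM2l.
Qed.

Lemma bounded_measurable_shift f z : bounded_measurable f ->
  bounded_measurable (fun y => f (y + z)).
Proof.
move=> [mf [M fM]]; split; last by exists M.
apply: (measurableT_comp mf); under eq_fun do rewrite addrC.
exact: measurable_rV_addr.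
Qed.

Lemma torus_smooth_bounded_measurable f : torus_smooth f -> bounded_measurable f.
Proof.
move=> tf; have [M _ fM] := torus_smooth_bounded tf; split; last by exists M.
by apply: continuous_measurable_rV; apply: smooth_continuous; case: tf.
Qed.

Lemma Rintegral_torus_reflect (G : 'rV[R]_d -> R) x : measurable_fun setT G ->
  Defs.periodic G -> \int[tor]_y G (x - y) = \int[tor]_y G y.
Proof.
move=> mG pG; rewrite /Rintegral [in LHS]integralE [in RHS]integralE; congr fine.
have mE : measurable_fun setT (EFin \o G) by exact/measurable_EFinP.
have eqp := integral_torus_reflect x (measurable_funepos mE) (fun x => funepos_ge0 _ x).
have eqm := integral_torus_reflect x (measurable_funeneg mE) (fun x => funeneg_ge0 _ x).
congr (_ - _)%E; [rewrite -eqp|rewrite -eqm].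
- by apply: eq_integral => y _; rewrite !funeposE.
- by move=> y i; rewrite !funeposE /= pG.
- by apply: eq_integral => y _; rewrite !funenegE.
- by move=> y i; rewrite !funenegE /= pG.
Qed.

(** Reflection moves x into the kernel, whose terms cos(k.(x - y)) then split by the addition
    formula into functions of x times integrals in y. The sine is the cosine with phase - pi / 2. *)
Lemma fejer_mean_trig (W : ('rV[R]_d -> R) -> Prop) f :
  (forall c f g, W f -> W g -> W (fun x => c * f x + g x)) -> W (fun=> 0) ->
  (forall k alpha, W (fun x => cos (alpha + freq k x))) ->
  bounded_measurable f -> Defs.periodic f -> W (fejer_mean f).
Proof.
move=> Wlin W0 Wcos bf pf; have [mf [M fM]] := bf.
have Wsum (I : Type) (s : seq I) (F : I -> 'rV[R]_d -> R) :
    (forall i, W (F i)) -> W (fun x => \sum_(i <- s) F i x).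
  move=> WF; elim: s => [|i s IH].
    by rewrite (_ : (fun _ => _) = fun=> 0)//; apply/funext => x; rewrite big_nil.
  have := Wlin 1 _ _ (WF i) IH; congr W; apply/funext => x.
  by rewrite big_cons mul1r.
have WZ c g : W g -> W (fun x => c * g x).
  by move=> Wg; have := Wlin c _ _ Wg W0; congr W; apply/funext => x; rewrite addr0.
have fi k alpha : tor.-integrable setT (EFin \o (fun y => cos (alpha + freq k y) * f y)).
  apply: (@bounded_torus_integrable _ _ _ (1 * M)).
    by apply: measurable_funM => //; exact: measurable_cos_freq.
  by move=> y; rewrite normrM ler_pM ?cos_max.
pose c k alpha := \int[tor]_y (cos (alpha + freq k y) * f y).
pose k j l := fejer_index j - fejer_index l.
pose term j l (x : 'rV[R]_d) := c (k j l) 0 * cos (0 + freq (k j l) x) +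
  c (k j l) (- (pi / 2)) * cos (- (pi / 2) + freq (k j l) x).
suff -> : fejer_mean f = (fun x => fejer_card^-1 * \sum_(j : J) \sum_(l : J) term j l x).
  apply: (WZ _ (fun x => \sum_(j : J) \sum_(l : J) term j l x)); apply: (Wsum _ _ (fun j x => \sum_(l : J) term j l x)) => j.
  by apply: (Wsum _ _ (term j)) => l; apply: Wlin => //; exact: WZ.
apply/funext => x.
transitivity (\int[tor]_y (fejer_kernel (x - y) * f y)).
  rewrite -(@Rintegral_torus_reflect (fun y => fejer_kernel (x - y) * f y) x).
  - by apply: eq_Rintegral => y _; rewrite subKr.
  - apply: measurable_funM => //.
    by apply: (measurableT_comp measurable_fejer); exact: measurable_rV_sub.
  - move=> y i; rewrite pf; congr (_ * _).
    by rewrite -[LHS](fejer_periodic _ i) opprD addrA subrK.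
transitivity (\int[tor]_y (fejer_card^-1 * \sum_(j : J) \sum_(l : J)
   (cos (0 + freq (k j l) x) * (cos (0 + freq (k j l) y) * f y) +
    cos (- (pi / 2) + freq (k j l) x) * (cos (- (pi / 2) + freq (k j l) y) * f y)))).
  apply: eq_Rintegral => y _; rewrite fejer_kernelE -mulrA; congr (_ * _).
  rewrite mulr_suml; apply: eq_bigr => j _; rewrite mulr_suml; apply: eq_bigr => l _.
  rewrite -/(k j l) !add0r freqD freqN cosB.
  have sE t : cos (- (pi / 2) + t) = sin t :> R by rewrite addrC -sinDpihalf subrK.
  by rewrite !sE; ring.
have i2 j l : tor.-integrable setT (EFin \o (fun y =>
   cos (0 + freq (k j l) x) * (cos (0 + freq (k j l) y) * f y) +
    cos (- (pi / 2) + freq (k j l) x) * (cos (- (pi / 2) + freq (k j l) y) * f y))).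
  by apply: integrableD_EFin => //; apply: integrableZ_EFin.
rewrite RintegralZl//; last by apply: integrable_sum_EFin => // j; exact: integrable_sum_EFin.
congr (_ * _); rewrite Rintegral_sum//; last by move=> j; exact: integrable_sum_EFin.
apply: eq_bigr => j _; rewrite Rintegral_sum//; apply: eq_bigr => l _.
rewrite RintegralD ?RintegralZl//; try exact: integrableZ_EFin.
by rewrite /c -/(k j l) [c in c + _]mulrC [c in _ + c]mulrC.
Qed.

(** The difference quotient of the mean is the mean of the difference quotients, with error C h^2 by
    [torus_smooth_quotient] and averaging. *)
Lemma partial_fejer_mean i f x : torus_smooth f ->
  partial i (fejer_mean f) x = fejer_mean (partial i f) x.
Proof.
move=> tf; have bf := torus_smooth_bounded_measurable tf.
have bp := torus_smooth_bounded_measurable (torus_smooth_partial i tf).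
have [C C0 HC] := torus_smooth_quotient tf.
have est h : `|fejer_mean f (x + h *: basis_vec i) - fejer_mean f x - h * fejer_mean (partial i f) x| <= C * h ^+ 2.
  have bs := bounded_measurable_shift (h *: basis_vec i) bf.
  have -> : fejer_mean f (x + h *: basis_vec i) - fejer_mean f x - h * fejer_mean (partial i f) x =
    fejer_mean (fun y => (- h) * partial i f y + ((-1) * f y + f (y + h *: basis_vec i))) x.
    rewrite fejer_mean_linear//; last exact: bounded_measurable_linear.
    by rewrite fejer_mean_linear// -fejer_mean_shift; ring.
  apply: fejer_mean_le.
    by apply: bounded_measurable_linear => //; exact: bounded_measurable_linear.
  move=> y; apply: le_trans (HC i y h); rewrite le_eqVlt; apply/orP; left; apply/eqP.
  by congr `|_|; ring.
rewrite /partial /derive; apply: cvg_lim => //.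
apply/cvgrPdist_le => e e0; near=> h.
have h0 : h != 0 by near: h; exact: nbhs_dnbhs_neq.
rewrite /= distrC [h *: _ + x]addrC.
have h0' : 0 < `|h| by rewrite normr_gt0.
rewrite [X in `|X|](_ : _ = h^-1 * (fejer_mean f (x + h *: basis_vec i) - fejer_mean f x -
    h * fejer_mean (partial i f) x)); last by rewrite [in RHS]mulrBr mulKf.
rewrite normrM normfV ler_pdivrMl//; apply: le_trans (est h) _.
rewrite -(real_normK (num_real h)) expr2 mulrA mulrC ler_wpM2l//.
have : `|h| < e / (C + 1).
  by near: h; apply: dnbhs0_lt; rewrite divr_gt0// ltr_pwDr.
rewrite ltr_pdivlMr ?ltr_pwDr// => /ltW; apply: le_trans.
by rewrite mulrC ler_wpM2l// lerDl.
Unshelve. all: end_near. Qed.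

End fejer.

(** * Uniform convergence of Fejer means *)

Section fejer_convergence.
Context {R : realType} (d : nat).
Implicit Types (f : 'rV[R]_d -> R).

(** Beyond delta the ratio of the two (1 - cos) factors is at least 1, as cos decreases on [0, pi],
    so the second term is at least 1/2. Thus control of the moment of 1 - cos replaces localisation
    of the kernel. *)
Lemma norm_le_one_sub_cos (delta t : R) : 0 < delta < 2^-1 -> `|t| <= 2^-1 ->
  `|t| <= delta + 2^-1 / (1 - cos (2 * pi * delta)) * (1 - cos (2 * pi * t)).
Proof.
move=> /andP[d0 d1] t1; have p0 := @pi_gt0 R.
have tE : cos (2 * pi * t) = cos (2 * pi * `|t|).
  by case: (ger0P t) => _; rewrite ?mulrN ?cosN.
have lt1 : cos (2 * pi * delta) < 1.
  have b1 : 0 < 2 * pi * delta by rewrite !mulr_gt0.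
  have b2 : 2 * pi * delta < pi by nra.
  by rewrite -[ltRHS]cos0 ltr_cos// in_itv/= ?lexx ltW// ltW.
have c0 : 0 < 1 - cos (2 * pi * delta) by rewrite subr_gt0.
have k0 : 0 <= 2^-1 / (1 - cos (2 * pi * delta)) by rewrite divr_ge0// ltW.
have [td|td] := leP `|t| delta.
  by apply: le_trans td _; rewrite lerDl mulr_ge0// subr_ge0 cos_le1.
apply: (le_trans t1); apply: (@le_trans _ _ (2^-1 / (1 - cos (2 * pi * delta)) * (1 - cos (2 * pi * delta)))).
  by rewrite divfK// gt_eqF.
apply: (@le_trans _ _ (2^-1 / (1 - cos (2 * pi * delta)) * (1 - cos (2 * pi * t)))); last first.
  by rewrite lerDr ltW.
rewrite ler_wpM2l// lerD2l lerN2 tE ltW// ltr_cos.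
- by rewrite ltr_pM2l// mulr_gt0.
- by rewrite in_itv/=; apply/andP; split; [rewrite !mulr_ge0// ltW|nra].
- by rewrite in_itv/=; apply/andP; split; [rewrite !mulr_ge0// ltW|nra].
Qed.

Lemma torus_smooth_modulus f : torus_smooth f -> exists2 L, 0 <= L & forall delta, 0 < delta < 2^-1 ->
  forall x y : 'rV[R]_d, `|f (x - y) - f x| <= L * \sum_i (delta +
    2^-1 / (1 - cos (2 * pi * delta)) * (1 - cos (2 * pi * y ord0 i))).
Proof.
move=> tf; have [L L0 HL] := torus_smooth_lipschitz tf; exists L => // delta d01 x y.
(* The lattice translation that brings each coordinate of y to within 1/2 of 0; neither f nor the
   cosines notice it. *)
pose m i := - Num.floor (y ord0 i + 2^-1).
pose y' := y + \row_i (m i)%:~R.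
have fE : f (x - y) = f (x - y').
  rewrite -[RHS](periodic_lattice m); last by case: tf.
  by rewrite /y' opprD addrA subrK.
have y'E i : y' ord0 i = y ord0 i + (m i)%:~R by rewrite rV_addE mxE.
have cosE i : cos (2 * pi * y ord0 i) = cos (2 * pi * y' ord0 i).
  have := periodic_lattice m y (@cos_freq_periodic R d (unit_index i) 0).
  by rewrite !add0r !freq_unit_index -/y' => ->.
rewrite fE; apply: le_trans (HL _ _) _; rewrite l1normN ler_wpM2l//.
apply: ler_sum => i _; rewrite cosE; apply: norm_le_one_sub_cos => //.
rewrite y'E /m intrN; have /andP[] := floor_itv (y ord0 i + 2^-1); rewrite intrD => h1 h2.
by rewrite ler_norml; apply/andP; split; lra.
Qed.

(** First delta makes the term L d delta at most e / 2, then N makes the moment term, of order 1 /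
    (N + 1) by [fejer_moment], at most e / 2. *)
Lemma fejer_mean_cvg f e : torus_smooth f -> 0 < e ->
  exists N0, forall N x, (N0 <= N)%N -> `|fejer_mean N f x - f x| <= e.
Proof.
move=> tf e0; have [L L0 HL] := torus_smooth_modulus tf.
have bf := torus_smooth_bounded_measurable tf.
have Ld0 : 0 <= L * d%:R by rewrite mulr_ge0.
pose delta := Num.min (4^-1) (e / 2 / (L * d%:R + 1)).
have dl0 : 0 < delta by rewrite lt_min invr_gt0 ltr0n/= !divr_gt0// ltr_pwDr.
have dl1 : delta < 2^-1 by rewrite gt_min; apply/orP; left; lra.
have d01 : 0 < delta < 2^-1 by rewrite dl0.
pose kappa := 2^-1 / (1 - cos (2 * pi * delta)).
have k0 : 0 <= kappa by rewrite divr_ge0// subr_ge0 cos_le1.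
have dle : L * d%:R * delta <= e / 2.
  have : delta <= e / 2 / (L * d%:R + 1) by rewrite ge_min lexx orbT.
  rewrite ler_pdivlMr ?ltr_pwDr//; apply: le_trans.
  by rewrite mulrC ler_wpM2l ?(ltW dl0)// lerDl.
pose B := L * d%:R * kappa.
have B0 : 0 <= B by rewrite mulr_ge0.
exists (Num.bound (B / (e / 2))) => N x N0N.
have e20 : 0 < e / 2 by rewrite divr_gt0.
have NB : B / N.+1%:R <= e / 2.
  rewrite ler_pdivrMr// mulrC -ler_pdivrMr//.
  apply: (@le_trans _ _ (Num.bound (B / (e / 2)))%:R).
    by apply/ltW/archi_boundP; rewrite divr_ge0// ltW.
  by rewrite ler_nat ltnW.
pose C i y := fejer_kernel N y * (1 - cos (2 * pi * (y : 'rV[R]_d) ord0 i)).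
have mc i : measurable_fun setT (fun y : 'rV[R]_d => cos (2 * pi * y ord0 i)).
  apply: eq_measurable_fun (measurable_cos_freq (unit_index i) 0) => y _.
  by rewrite add0r freq_unit_index.
have iC i : (@torus_measure R d).-integrable setT (EFin \o C i).
  apply: (@bounded_torus_integrable _ _ _ (fejer_card d N * 2)).
    by apply: measurable_funM; [exact: measurable_fejer|exact: measurable_funB].
  move=> y; rewrite normrM ler_pM ?fejer_le//.
  by rewrite ger0_norm ?subr_ge0 ?cos_le1//; have := cos_geN1 (2 * pi * y ord0 i); lra.
have i1 : (@torus_measure R d).-integrable setT (EFin \o (fun y => fejer_kernel N y * f (x - y))).
  exact: fejer_mean_integrable.
have i2 : (@torus_measure R d).-integrable setT (EFin \o (fun y => fejer_kernel N y * f x)).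
  by have := fejer_mean_integrable N x (f := fun=> f x); apply; split => //; exists `|f x|.
rewrite -[f x](@fejer_mean_cst R d N _ x) /fejer_mean -RintegralB//.
have i3 := integrableB_EFin measurableT i1 i2.
apply: le_trans (le_normr_Rintegral _ i3) _ => //.
apply: (@le_trans _ _ (\int[torus_measure]_y (L * d%:R * delta * fejer_kernel N y +
    L * kappa * \sum_(i < d) C i y))).
  apply: le_Rintegral => //.
  - by have := integrable_abse i3; apply: eq_integrable.
  - apply: integrableD_EFin => //; apply: integrableZ_EFin => //; first exact: fejer_integrable.
    exact: integrable_sum_EFin.
  - move=> y _; rewrite -mulrBr normrM (ger0_norm (fejer_kernel_ge0 _ _)).
    apply: le_trans (ler_wpM2l (fejer_kernel_ge0 _ _) (HL delta d01 x y)) _.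
    rewrite big_split/= sumr_const card_ord -mulr_sumr -/kappa.
    rewrite /C -mulr_sumr -[delta *+ d]mulr_natr le_eqVlt; apply/orP; left; apply/eqP; ring.
rewrite RintegralD//; last 2 first.
- by apply: integrableZ_EFin => //; exact: fejer_integrable.
- by apply: integrableZ_EFin => //; exact: integrable_sum_EFin.
rewrite (RintegralZl (L * d%:R * delta))//; last exact: fejer_integrable.
rewrite (RintegralZl (L * kappa))//; last exact: integrable_sum_EFin.
rewrite fejer_mass mulr1 Rintegral_sum//.
have : \sum_(i < d) \int[torus_measure]_y C i y <= d%:R / N.+1%:R.
  apply: (@le_trans _ _ (\sum_(i < d) N.+1%:R^-1)).
    by apply: ler_sum => i _; exact: fejer_moment.
  by rewrite sumr_const card_ord -[leLHS]mulr_natl.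
move=> /(ler_wpM2l (mulr_ge0 L0 k0)).
have -> : L * kappa * (d%:R / N.+1%:R) = B / N.+1%:R by rewrite /B; ring.
by move=> h; apply: le_trans (lerD dle (le_trans h NB)) _; lra.
Qed.

End fejer_convergence.

Section trigonometric_calculus.
Context {R : realType} (d : nat).
Implicit Types (k : {ffun 'I_d -> int}) (f g : 'rV[R]_d -> R).

Lemma partial_linear i c f g : (forall x, differentiable f x) -> (forall x, differentiable g x) ->
  partial i (fun x => c * f x + g x) = (fun x => c * partial i f x + partial i g x).
Proof.
move=> df dg; apply/funext => x; rewrite /partial.
have hf : derivable f x (basis_vec i) by exact: diff_derivable.
have hg : derivable g x (basis_vec i) by exact: diff_derivable.
transitivity ('D_(basis_vec i) ((c \*: f) + g) x); first by [].
have hz : derivable (c \*: f) x (basis_vec i) by exact: derivableZ.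
rewrite (@deriveD R _ _ (c \*: f) g x (basis_vec i) hz hg).
by rewrite (@deriveZ R _ _ f c x (basis_vec i) hf).
Qed.

Lemma smooth_linear c f g : smooth f -> smooth g -> smooth (fun x => c * f x + g x).
Proof.
move=> sf sg s.
suff -> : foldr partial (fun x => c * f x + g x) s =
    (fun x => c * foldr partial f s x + foldr partial g s x).
  move=> x; apply: differentiableD; last exact: sg.
  by apply: differentiableZ; exact: sf.
by elim: s => //= i s ->; rewrite (partial_linear i c (sf s) (sg s)).
Qed.

Lemma smooth0 : smooth (fun _ : 'rV[R]_d => 0 : R).
Proof.
move=> s; suff -> : foldr partial (fun _ : 'rV[R]_d => 0 : R) s = fun=> 0 by [].
by elim: s => //= i s ->; apply/funext => x; exact: derive_cst.
Qed.

Lemma differentiable_cos_freq k alpha x :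
  differentiable (fun x : 'rV[R]_d => cos (alpha + freq k x)) x.
Proof.
have df : differentiable (fun x : 'rV[R]_d => alpha + freq k x) x.
  apply: differentiableD => //; apply: differentiableZ.
  rewrite (_ : (fun _ => _) = \sum_(i < d) (fun x : 'rV[R]_d => (k i)%:~R * x ord0 i)).
    apply: differentiable_sum => i; apply: differentiableZ.
    exact: differentiable_coord.
  by apply/funext => y; rewrite fct_sumE.
apply: (@differentiable_comp _ _ _ _ (fun x : 'rV[R]_d => alpha + freq k x) cos) => //.
by apply/derivable1_diffP; exact: derivable_cos.
Qed.

Lemma freqZ k c (x : 'rV[R]_d) : freq k (c *: x) = c * freq k x.
Proof.
rewrite /freq mulrCA; congr (_ * _); rewrite mulr_sumr; apply: eq_bigr => i _.
by rewrite mxE mulrCA.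
Qed.

Lemma freq_basis k i : freq k (basis_vec i : 'rV[R]_d) = 2 * pi * (k i)%:~R.
Proof.
rewrite /freq (bigD1 i)//= basis_vecE eqxx mulr1 big1 ?addr0// => j ji.
by rewrite basis_vecE (negbTE ji) mulr0.
Qed.

Lemma partial_cos_freq k alpha i (x : 'rV[R]_d) :
  partial i (fun x => cos (alpha + freq k x)) x =
  2 * pi * (k i)%:~R * cos (alpha + pi / 2 + freq k x).
Proof.
pose f (x : 'rV[R]_d) := cos (alpha + freq k x).
have d1 := @is_derive_line R d f x (basis_vec i) 0 (differentiable_cos_freq _ _ _).
have d2 : is_derive (0 : R) 1 (fun t : R => f (x + t *: basis_vec i)) (- sin (alpha + freq k x) * (2 * pi * (k i)%:~R)).
  rewrite (_ : (fun _ => _) = cos \o (fun t : R => alpha + freq k x + 2 * pi * (k i)%:~R * t)).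
    apply: is_derive1_comp.
      by rewrite mulr0 addr0; exact: is_derive_cos.
    have := is_deriveD (is_derive_cst (alpha + freq k x) (0 : R) 1) (is_deriveZ (2 * pi * (k i)%:~R) (is_derive_id (0 : R) (1 : R))).
    by rewrite /GRing.scale/= mulr1 add0r.
  by apply/funext => t; rewrite /f /= freqD freqZ freq_basis addrA [t * _]mulrC.
have := @derive_val _ _ _ _ _ _ _ d1; rewrite (@derive_val _ _ _ _ _ _ _ d2) (bigD1 i)//= basis_vecE eqxx mul1r scale0r addr0.
rewrite big1 ?addr0; last by move=> j ji; rewrite basis_vecE (negbTE ji) mul0r.
by rewrite /f => <-; rewrite addrAC cosDpihalf mulrC.
Qed.

Lemma partial0 i : partial i (fun _ : 'rV[R]_d => 0 : R) = fun=> 0.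
Proof. by apply/funext => x; exact: derive_cst. Qed.

Lemma smooth_cos_freq k alpha : smooth (fun x : 'rV[R]_d => cos (alpha + freq k x)).
Proof.
move=> s; suff [c [beta ->]] : exists c beta, foldr partial (fun x => cos (alpha + freq k x)) s =
    (fun x => c * cos (beta + freq k x)).
  by move=> x; apply: differentiableZ; exact: differentiable_cos_freq.
elim: s => [|i s [c [beta E]]] /=.
  by exists 1, alpha; apply/funext => x; rewrite mul1r.
rewrite E; exists (c * (2 * pi * (k i)%:~R)), (beta + pi / 2).
have := @partial_linear i c (fun x => cos (beta + freq k x)) (fun=> 0)
  (fun x => differentiable_cos_freq _ _ _) (fun x => differentiable_cst _ _).
rewrite partial0 (_ : (fun x => _ + 0) = (fun x => c * cos (beta + freq k x))); last first.
  by apply/funext => x; rewrite addr0.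
by move=> ->; apply/funext => x; rewrite addr0 partial_cos_freq mulrA.
Qed.

Lemma partial2_cos_freq k alpha i (x : 'rV[R]_d) :
  partial i (partial i (fun x => cos (alpha + freq k x))) x =
  - ((2 * pi) ^+ 2 * (k i)%:~R ^+ 2) * cos (alpha + freq k x).
Proof.
have -> : partial i (fun x => cos (alpha + freq k x)) = fun x : 'rV[R]_d =>
    2 * pi * (k i)%:~R * cos (alpha + pi / 2 + freq k x) + (fun=> 0) x.
  by apply/funext => y; rewrite partial_cos_freq addr0.
rewrite (partial_linear i _ (differentiable_cos_freq k (alpha + pi / 2)) (fun x => differentiable_cst _ x)).
rewrite partial0 addr0 partial_cos_freq.
have -> : alpha + pi / 2 + pi / 2 + freq k x = alpha + freq k x + pi.
  by rewrite -(addrA alpha) -splitr addrAC.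
by rewrite cosDpi; ring.
Qed.

Lemma laplacian_cos_freq k alpha (x : 'rV[R]_d) :
  laplacian (fun x => cos (alpha + freq k x)) x =
  - laplace_symbol k * cos (alpha + freq k x).
Proof.
rewrite /laplacian (eq_bigr (fun i => - ((2 * pi) ^+ 2 * (k i)%:~R ^+ 2) * cos (alpha + freq k x))).
  by rewrite -mulr_suml sumrN -mulr_sumr.
by move=> i _; rewrite partial2_cos_freq.
Qed.

(** The last clause is an interpolation: the second differences of the error are small in sup norm
    and of order |z|^2 with a constant independent of N, so the geometric mean with exponents 1 - a
    and a is small and of order |z|^(2 a). *)
Theorem torus_smooth_approx a (W : ('rV[R]_d -> R) -> Prop) f e : 0 < a < 1 ->
  (forall c f g, W f -> W g -> W (fun x => c * f x + g x)) -> W (fun=> 0) ->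
  (forall k alpha, W (fun x => cos (alpha + freq k x))) ->
  torus_smooth f -> 0 < e -> exists g, [/\ W g,
    forall x, `|g x - f x| <= e,
    forall i x, `|partial i g x - partial i f x| <= e,
    forall i x, `|partial i (partial i g) x - partial i (partial i f) x| <= e &
    forall x z, `|second_diff (fun y => g y - f y) x z| <= e * Num.min 1 (enorm z `^ (2 * a))].
Proof.
move=> /andP[a0 a1] Wlin W0 Wcos tf e0.
have tp i := torus_smooth_partial i tf.
have tpp i := torus_smooth_partial i (tp i).
have bf := torus_smooth_bounded_measurable tf.
have [C C0 HC] := torus_smooth_second_diff tf.
pose B := 2 * (C * d%:R ^+ 2).
have B0 : 0 <= B by rewrite !mulr_ge0// sqr_ge0.
(* Chosen so that q^(1 - a) B^a = e B^a / (B^a + 1) <= e; the bound 4 e1 <= q then closes the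
   interpolation. *)
pose q := (e / (B `^ a + 1)) `^ (1 - a)^-1.
have Ba0 : 0 < B `^ a + 1 by rewrite ltr_wpDl ?powR_ge0.
have q0 : 0 < q by rewrite powR_gt0// divr_gt0.
pose e1 := Num.min e (Num.min (e / 4) (q / 4)).
have e10 : 0 < e1 by rewrite !lt_min e0 !divr_gt0.
have e1e : e1 <= e by rewrite ge_min lexx.
have e1e4 : 4 * e1 <= e.
  rewrite mulrC -ler_pdivlMr//; by rewrite !ge_min lexx orbT.
have e1q : 4 * e1 <= q.
  rewrite mulrC -ler_pdivlMr//; by rewrite !ge_min lexx !orbT.
have [N0 HN0] := fejer_mean_cvg tf e10.
have /choice [N1 HN1] i := fejer_mean_cvg (tp i) e10.
have /choice [N2 HN2] i := fejer_mean_cvg (tpp i) e10.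
pose N := maxn N0 (maxn (\max_i N1 i) (\max_i N2 i)).
have N0N : (N0 <= N)%N by rewrite leq_maxl.
have N1N i : (N1 i <= N)%N.
  by apply: (leq_trans (leq_bigmax i)); rewrite /N maxnCA leq_maxl.
have N2N i : (N2 i <= N)%N.
  by apply: (leq_trans (leq_bigmax i)); rewrite /N maxnA leq_maxr.
have pE i : partial i (fejer_mean N f) = fejer_mean N (partial i f).
  by apply/funext => x; exact: partial_fejer_mean.
exists (fejer_mean N f); split.
- by apply: fejer_mean_trig => //; case: tf.
- by move=> x; apply: le_trans (HN0 N x N0N) e1e.
- by move=> i x; rewrite pE; apply: le_trans (HN1 i N x (N1N i)) e1e.
- by move=> i x; rewrite pE partial_fejer_mean//; apply: le_trans (HN2 i N x (N2N i)) e1e.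
move=> x z; set g := fun y => _.
have g1 y : `|g y| <= e1 by exact: HN0.
have s1 : `|second_diff g x z| <= 4 * e1.
  rewrite /second_diff; apply: le_trans (ler_normB _ _) _; rewrite normrM (ger0_norm (ler0n _ 2)).
  have := ler_normD (g (x + z)) (g (x - z)); have := g1 (x + z); have := g1 (x - z); have := g1 x.
  lra.
have s2 : `|second_diff g x z| <= B * enorm z ^+ 2.
  have bz y : `|second_diff f y z| <= C * d%:R ^+ 2 * enorm z ^+ 2.
    apply: le_trans (HC y z) _; rewrite -mulrA ler_wpM2l// -exprMn.
    by rewrite lerXn2r ?nnegrE ?l1norm_ge0 ?mulr_ge0 ?enorm_ge0 ?l1norm_le_enorm.
  have bF : bounded_measurable (fun y => (-2) * f y + (1 * f (y - z) + f (y + z))).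
    by apply: bounded_measurable_linear => //; apply: bounded_measurable_linear; exact: bounded_measurable_shift.
  have E : second_diff (fejer_mean N f) x z =
      fejer_mean N (fun y => (-2) * f y + (1 * f (y - z) + f (y + z))) x.
    rewrite fejer_mean_linear//; last first.
      by apply: bounded_measurable_linear; exact: bounded_measurable_shift.
    rewrite fejer_mean_linear//; [|exact: bounded_measurable_shift..].
    by rewrite -!fejer_mean_shift /second_diff; ring.
  have : `|second_diff (fejer_mean N f) x z| <= C * d%:R ^+ 2 * enorm z ^+ 2.
    rewrite E; apply: fejer_mean_le => // y; apply: le_trans (bz y).
    by rewrite le_eqVlt; apply/orP; left; apply/eqP; congr `|_|; rewrite /second_diff; ring.
  have -> : second_diff g x z = second_diff (fejer_mean N f) x z - second_diff f x z.
    by rewrite /g /second_diff; ring.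
  move=> h; apply: le_trans (ler_normB _ _) _; apply: le_trans (lerD h (bz x)) _.
  by rewrite /B; lra.
have [z1|z1] := leP 1 (enorm z `^ (2 * a)); first by rewrite mulr1; exact: le_trans e1e4.
set S := `|_| in s1 s2 *; have S0 : 0 <= S by exact: normr_ge0.
have [->|Sn0] := eqVneq S 0; first by rewrite mulr_ge0 ?powR_ge0// ltW.
have SE : S = S `^ (1 - a) * S `^ a.
  by rewrite -powRD ?subrK ?powRr1// Sn0 implybT.
rewrite SE; apply: (@le_trans _ _ ((4 * e1) `^ (1 - a) * (B * enorm z ^+ 2) `^ a)).
  apply: ler_pM; rewrite ?powR_ge0// ge0_ler_powR ?nnegrE ?mulr_ge0 ?subr_ge0 ?sqr_ge0 ?enorm_ge0 ?exprn_ge0 ?enorm_ge0 ?(ltW a0) ?(ltW a1) ?(ltW e10)//.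
rewrite (powRM a B0 (sqr_ge0 _)) -(powR_mulrn 2 (enorm_ge0 z)) -powRrM mulrA ler_wpM2r ?powR_ge0//.
apply: (@le_trans _ _ (q `^ (1 - a) * B `^ a)).
  rewrite ler_wpM2r ?powR_ge0// ge0_ler_powR ?nnegrE ?mulr_ge0 ?subr_ge0 ?(ltW a1) ?(ltW e10) ?(ltW q0)//.
rewrite /q -powRrM mulVf ?gt_eqF ?subr_gt0// powRr1 ?divr_ge0 ?(ltW e0) ?(ltW Ba0)//.
rewrite mulrAC ler_pdivrMr// ler_wpM2l ?(ltW e0)// lerDl//.
Qed.

End trigonometric_calculus.

(** * The noise coefficient *)

Section square_summable.
Context {R : realType}.

Lemma l2_series (a b : nat -> R) (A B : R) : 0 <= A -> 0 <= B ->
  (forall n, \sum_(0 <= k < n) a k ^+ 2 <= A ^+ 2) ->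
  (forall n, \sum_(0 <= k < n) b k ^+ 2 <= B ^+ 2) ->
  cvgn (series (fun k => a k * b k)) /\
  `|limn (series (fun k => a k * b k))| <= A * B.
Proof.
move=> A0 B0 ha hb.
have bd n : \sum_(0 <= k < n) `|a k * b k| <= A * B.
  under eq_bigr do rewrite normrM.
  apply: le_trans (sum_cauchy_schwarz _ _ _) _; apply: ler_pM; rewrite ?sqrtr_ge0//.
    by rewrite -(ger0_norm A0) -sqrtr_sqr ler_wsqrtr.
  by rewrite -(ger0_norm B0) -sqrtr_sqr ler_wsqrtr.
have cv : cvgn (series (fun k => a k * b k)).
  apply: normed_cvg; apply: nondecreasing_is_cvgn.
    apply/nondecreasing_seqP => n; rewrite /= /series/= big_nat_recr//= lerDl//.
  by exists (A * B) => _ [n _ <-]; exact: bd.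
split => //; rewrite ler_norml; apply/andP; split.
  apply: limr_ge => //; near=> n.
  have := le_trans (ler_norm_sum _ _ _) (bd n).
  by rewrite ler_norml => /andP[].
apply: limr_le => //; near=> n.
have := le_trans (ler_norm_sum _ _ _) (bd n).
by rewrite ler_norml => /andP[].
Unshelve. all: end_near. Qed.

Lemma series_sub (a b : nat -> R) : series a - series b = series (fun k => a k - b k).
Proof. by apply/funext => n; rewrite [RHS]/series /= sumrB. Qed.

Lemma nneseries_sqr_le (a : nat -> R) (K : R) :
  (\sum_(0 <= k <oo) (`|a k| ^+ 2)%:E <= K%:E)%E ->
  forall n, \sum_(0 <= k < n) a k ^+ 2 <= K.
Proof.
move=> h n; rewrite -lee_fin; apply: le_trans h.
have -> : (\sum_(0 <= k < n) a k ^+ 2)%:E = (\sum_(0 <= k < n) (`|a k| ^+ 2)%:E)%E :> \bar R.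
  by rewrite sumEFin; congr EFin; apply: eq_bigr => k _; rewrite real_normK ?num_real.
by apply: nneseries_lim_ge => k _ _; rewrite lee_fin sqr_ge0.
Qed.

End square_summable.

Section hilbert_bessel.
Context {R : realType} {H : completeNormedModType R}.
Variables (dp : {dot H for idfun}) (e : nat -> H).
Hypothesis hdp : hilbert_norm dp.
Hypothesis dp_e : forall j k, dp (e j) (e k) = (j == k)%:R.

Lemma dot_sym u v : dp u v = dp v u.
Proof. by have := @hermC _ _ _ _ dp u v; rewrite expr0 mul1r. Qed.

(** Each subtraction of a component lowers the squared norm of the remainder by exactly the square
    of its coefficient. *)
Lemma dot_bessel v n : \sum_(0 <= k < n) dp v (e k) ^+ 2 <= `|v| ^+ 2.
Proof.
pose w n := v - \sum_(0 <= k < n) dp v (e k) *: e k.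
have w_e j m : (m <= j)%N -> dp (w m) (e j) = dp v (e j).
  elim: m => [|m IH] mj; first by rewrite /w big_geq// subr0.
  have -> : w m.+1 = w m - dp v (e m) *: e m by rewrite /w big_nat_recr//= opprD addrA.
  by rewrite linearBl linearZl_LR /= dp_e (ltn_eqF mj) mulr0 subr0 IH// ltnW.
suff -> : \sum_(0 <= k < n) dp v (e k) ^+ 2 = `|v| ^+ 2 - `|w n| ^+ 2.
  by rewrite gerBl sqr_ge0.
elim: n => [|n IH]; first by rewrite /w !big_geq// subr0 subrr.
rewrite big_nat_recr//= IH.
have -> : w n.+1 = w n - dp v (e n) *: e n by rewrite /w big_nat_recr//= opprD addrA.
have sqr_sub u x c : dp (u - c *: x) (u - c *: x) = dp u u - c * dp u x *+ 2 + c ^+ 2 * dp x x.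
  have subl y z : dp (y - c *: x) z = dp y z - c * dp x z by rewrite linearBl linearZl_LR.
  by rewrite subl [dp u _]dot_sym subl [dp x (_ - _)]dot_sym subl (dot_sym x u); ring.
by rewrite !hdp sqr_sub dp_e eqxx w_e//=; ring.
Qed.

End hilbert_bessel.

(** Rounding x to a grid leaves countably many measurable functions of v(x) on measurable pieces;
    continuity in the first variable removes the rounding in the limit. *)
Lemma measurable_caratheodory {R : realType} n (G : 'rV[R]_n -> R -> R) (v : 'rV[R]_n -> R) :
  (forall x, measurable_fun setT (G x)) -> (forall y, continuous (G ^~ y)) ->
  measurable_fun setT v -> measurable_fun setT (fun x => G x (v x)).
Proof.
move=> mG cG mv; apply: (@measurable_fun_cvg _ _ _ _ (fun N x => G (grid N x) (v x))); last first.
  move=> x _; apply: (@cvg_comp _ _ _ (fun N => grid N x) (G ^~ (v x)) _ (nbhs x)).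
    exact: cvg_grid.
  exact: cG.
move=> N _ A mA; rewrite setTI.
pose z (q : {ffun 'I_n -> int}) : 'rV[R]_n := \row_i ((q i)%:~R / N.+1%:R).
pose fiber (q : {ffun 'I_n -> int}) :=
  [set x : 'rV[R]_n | forall i, Num.floor (N.+1%:R * x ord0 i) = q i].
rewrite (_ : _ @^-1` _ = \bigcup_q (fiber q `&` (G (z q) \o v) @^-1` A)).
  apply: countable_bigcupT_measurable; first exact: countableP.
  move=> q; apply: measurableI; first exact: measurable_grid_fiber.
  by rewrite -[X in measurable X]setTI; apply: measurableT_comp => //; exact: mG.
have zE q x : fiber q x -> grid N x = z q.
  by move=> xq; apply/rowP => i; rewrite !mxE xq.
apply/seteqP; split => x /=; last by move=> [q _ [xq]] /=; rewrite (zE q).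
move=> Ax; have xq : fiber [ffun i => Num.floor (N.+1%:R * x ord0 i)] x by move=> i; rewrite ffunE.
by exists [ffun i => Num.floor (N.+1%:R * x ord0 i)] => //; split => //=; rewrite -(zE _ _ xq).
Qed.

Section noise_coefficient.
Context {R : realType} {d : nat} {H : completeNormedModType R}.
Variables (dp : {dot H for idfun}) (e : nat -> H) (h : nat -> 'rV[R]_d -> R -> R).
Hypothesis hdp : hilbert_norm dp.
Hypothesis dp_e : forall j k, dp (e j) (e k) = (j == k)%:R.
Variable C : R.
Hypothesis hcont : forall k, continuous (fun p : 'rV[R]_d * R => h k p.1 p.2).
Hypothesis h_growth : forall x y,
  (\sum_(0 <= k <oo) (`|h k x y| ^+ 2)%:E <= (C * (1 + `|y| ^+ 2))%:E)%E.
Hypothesis h_lip : forall x x' y y',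
  (\sum_(0 <= k <oo) (`|h k x y - h k x' y'| ^+ 2)%:E <=
    (C * (torus_dist x x' ^+ 2 + `|y - y'| ^+ 2))%:E)%E.

Lemma torus_dist_xx (x : 'rV[R]_d) : torus_dist x x = 0.
Proof.
rewrite /torus_dist; apply/eqP; rewrite eq_le; apply/andP; split.
  apply: ge_inf; first by exists 0 => _ [m _ <-]; exact: enorm_ge0.
  exists (fun=> 0) => //; rewrite subrr add0r.
  by rewrite (_ : \row_i _ = 0) ?enorm0//; apply/rowP => i; rewrite !mxE.
apply: lb_le_inf; first by exists (enorm (x - x + \row_i (0 : int)%:~R)), (fun=> 0).
by move=> _ [m _ <-]; exact: enorm_ge0.
Qed.

Lemma noise_const_ge0 : 0 <= C.
Proof.
have := nneseries_sqr_le (h_growth 0 0) 0; rewrite big_geq// normr0 expr0n/= addr0 mulr1.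
exact.
Qed.

Let sC := Num.sqrt C.

Let h_growth' x y n : \sum_(0 <= k < n) h k x y ^+ 2 <= (sC * (1 + `|y|)) ^+ 2.
Proof.
apply: le_trans (nneseries_sqr_le (h_growth x y) n) _.
rewrite exprMn sqr_sqrtr ?noise_const_ge0// ler_wpM2l ?noise_const_ge0//.
by rewrite sqrrD expr1n mul1r; have := normr_ge0 y; lra.
Qed.

Let h_lip' x y y' n : \sum_(0 <= k < n) (h k x y - h k x y') ^+ 2 <= (sC * `|y - y'|) ^+ 2.
Proof.
apply: le_trans (nneseries_sqr_le (h_lip x x y y') n) _.
by rewrite torus_dist_xx expr0n/= add0r exprMn sqr_sqrtr ?noise_const_ge0.
Qed.

Let sC0 : 0 <= sC. Proof. exact: sqrtr_ge0. Qed.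

Lemma noise_cvg v l x : cvgn (series (fun k => h k x (v x) * dp l (e k))).
Proof.
have [] := l2_series _ _ (h_growth' x (v x)) (dot_bessel hdp dp_e l) => //.
by rewrite mulr_ge0// addr_ge0.
Qed.

Lemma noise_le v l x : `|noise dp e h v l x| <= sC * `|l| * (1 + `|v x|).
Proof.
have [] := l2_series _ _ (h_growth' x (v x)) (dot_bessel hdp dp_e l) => //.
  by rewrite mulr_ge0// addr_ge0.
by rewrite mulrAC.
Qed.

Lemma noise_lip v v' l x :
  `|noise dp e h v l x - noise dp e h v' l x| <= sC * `|l| * `|v x - v' x|.
Proof.
have [] := l2_series _ _ (h_lip' x (v x) (v' x)) (dot_bessel hdp dp_e l) => //.
  by rewrite mulr_ge0.
rewrite mulrAC => _; congr (_ <= _); congr `|_|.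
rewrite /noise -limB; [|exact: noise_cvg|exact: noise_cvg]; congr (limn _).
rewrite series_sub; congr (series _); apply/funext => k.
by rewrite mulrBl.
Qed.

Lemma noiseB v l l' x :
  noise dp e h v l x - noise dp e h v l' x = noise dp e h v (l - l') x.
Proof.
rewrite /noise -limB; [|exact: noise_cvg|exact: noise_cvg]; congr (limn _).
rewrite series_sub; congr (series _); apply/funext => k.
by rewrite linearBl mulrBr.
Qed.

Lemma measurable_noise v l : measurable_fun setT v -> measurable_fun setT (noise dp e h v l).
Proof.
move=> mv; apply: (@measurable_fun_cvg _ _ _ _
    (fun n x => series (fun k => h k x (v x) * dp l (e k)) n)).
  move=> n; rewrite /series /=; apply: measurable_sum => k; apply: measurable_funM => //.
  apply: measurable_caratheodory => // [x|y].
    apply: continuous_measurable_fun => y.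
    apply: (@continuous_comp _ _ _ (fun y => (x, y)) (fun p : 'rV[R]_d * R => h k p.1 p.2)).
      by rewrite /continuous_at; exact: (@cvg_pair _ _ _ _ (nbhs x) (nbhs y) _ _ _ (fun=> x) id (cvg_cst _) cvg_id).
    exact: hcont.
  move=> x.
  apply: (@continuous_comp _ _ _ (fun x => (x, y)) (fun p : 'rV[R]_d * R => h k p.1 p.2)).
    by rewrite /continuous_at; exact: (@cvg_pair _ _ _ _ (nbhs x) (nbhs y) _ _ _ id (fun=> y) cvg_id (cvg_cst _)).
  exact: hcont.
by move=> x _; exact: noise_cvg.
Qed.

Local Notation tor := (@torus_measure R d).
Local Notation L2 := (Lfun tor 2%:E).

Lemma torus_nrm_one_add v : v \in L2 -> (fun x => 1 + `|v x|) \in L2 /\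
  nrm tor (fun x => 1 + `|v x|) <= 1 + nrm tor v.
Proof.
move=> vL; have mv := L2_measurable vL.
have aL : (fun x => `|v x|) \in L2.
  apply: (@L2_le _ _ _ tor _ v 1) => //; first exact: measurableT_comp.
  by move=> x; rewrite normr_id mul1r.
split; first exact: L2D (@one_L2 R d) aL.
apply: le_trans (nrm_triangle (@one_L2 R d) aL) _; apply: lerD.
  by rewrite /nrm /ip; under eq_Rintegral do rewrite mulr1; rewrite Rintegral_torus_cst sqrtr1.
apply: (le_trans (@nrm_le _ _ _ tor _ v 1 ler01 _ vL _)); last by rewrite mul1r.
  exact: measurableT_comp.
by move=> x; rewrite normr_id mul1r.
Qed.

Lemma noise_L2 v l : v \in L2 -> noise dp e h v l \in L2.
Proof.
move=> vL; have [aL _] := torus_nrm_one_add vL.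
apply: (@L2_le _ _ _ tor _ _ (sC * `|l|)) aL _; first exact: measurable_noise (L2_measurable vL).
by move=> x; apply: le_trans (noise_le v l x) _; rewrite [`|1 + _|]ger0_norm// addr_ge0.
Qed.

Lemma nrm_noise_le v l : v \in L2 -> nrm tor (noise dp e h v l) <= sC * `|l| * (1 + nrm tor v).
Proof.
move=> vL; have [aL an] := torus_nrm_one_add vL.
have c0 : 0 <= sC * `|l| by rewrite mulr_ge0.
apply: le_trans (ler_wpM2l c0 an); apply: nrm_le => //.
  exact: measurable_noise (L2_measurable vL).
by move=> x; apply: le_trans (noise_le v l x) _; rewrite [`|1 + _|]ger0_norm// addr_ge0.
Qed.

Lemma nrm_noise_lip v v' l : v \in L2 -> v' \in L2 ->
  nrm tor (fun x => noise dp e h v l x - noise dp e h v' l x) <=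
  sC * `|l| * nrm tor (fun x => v x - v' x).
Proof.
move=> vL vL'; apply: nrm_le; rewrite ?mulr_ge0//.
- by apply: measurable_funB; [exact: measurable_noise (L2_measurable vL)|exact: measurable_noise (L2_measurable vL')].
- exact: L2B.
- by move=> x; exact: noise_lip.
Qed.

End noise_coefficient.

Section nemytskii.
Context {R : realType} {d : nat}.
Local Notation tor := (@torus_measure R d).
Local Notation L2 := (Lfun tor 2%:E).
Variables (G : R -> R) (K : R).
Hypothesis K0 : 0 <= K.
Hypothesis GK : forall y z, `|G y - G z| <= K * `|y - z|.

Lemma lipschitz_measurable : measurable_fun setT G.
Proof.
apply: continuous_measurable_fun => y; apply/cvgrPdist_lt => e e0; near=> z.
apply: le_lt_trans (GK y z) _.
apply: (@le_lt_trans _ _ ((K + 1) * `|y - z|)); first by rewrite ler_wpM2r// lerDl.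
rewrite mulrC -ltr_pdivlMr ?ltr_wpDl//.
by near: z; apply: cvgr_dist_lt; rewrite ?divr_gt0 ?ltr_wpDl//; exact: cvg_id.
Unshelve. all: end_near. Qed.

Lemma nemytskii_growth y : `|G y| <= (`|G 0| + K) * (1 + `|y|).
Proof.
have := ler_normD (G 0) (G y - G 0); rewrite addrC subrK => /le_trans; apply.
have := GK y 0; rewrite subr0 => h; apply: le_trans (lerD (lexx _) h) _.
rewrite -subr_ge0 (_ : _ - _ = `|G 0| * `|y| + K); last by ring.
by rewrite addr_ge0// mulr_ge0.
Qed.

Lemma nemytskii_L2 v : v \in L2 -> (G \o v) \in L2 /\
  nrm tor (G \o v) <= (`|G 0| + K) * (1 + nrm tor v).
Proof.
move=> vL; have [aL an] := torus_nrm_one_add vL.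
have mG : measurable_fun setT (G \o v).
  exact: measurableT_comp lipschitz_measurable (L2_measurable vL).
have b x : `|(G \o v) x| <= (`|G 0| + K) * `|1 + `|v x| |.
  by rewrite [`|1 + _|]ger0_norm ?addr_ge0//; exact: nemytskii_growth.
have c0 : 0 <= `|G 0| + K by rewrite addr_ge0.
split; first exact: L2_le aL b.
by apply: le_trans (ler_wpM2l c0 an); exact: nrm_le.
Qed.

Lemma nemytskii_lip v v' : v \in L2 -> v' \in L2 ->
  nrm tor (fun x => G (v x) - G (v' x)) <= K * nrm tor (fun x => v x - v' x).
Proof.
move=> vL vL'; apply: nrm_le => //; last exact: L2B.
by apply: measurable_funB; [exact: measurableT_comp lipschitz_measurable (L2_measurable vL)|
  exact: measurableT_comp lipschitz_measurable (L2_measurable vL')].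
Qed.

End nemytskii.

(** * Measurability in time *)

Section null_sets.
Import HBNNSimple.
Context {dX : measure_display} {X : measurableType dX} {R : realType}.
Variable mu : {measure set X -> \bar R}.
Variable N : set X.
Hypothesis mN : measurable N.
Hypothesis N0 : mu N = 0%E.

(* No measurability of [f] or [g] is assumed: the integral is the supremum of the
   integrals of the simple functions below. *)
Lemma ge0_le_integral_null (f g : X -> \bar R) : (forall x, (0 <= f x)%E) ->
  (forall x, (0 <= g x)%E) -> (forall x, ~ N x -> (f x <= g x)%E) ->
  (\int[mu]_x f x <= \int[mu]_x g x)%E.
Proof.
move=> f0 g0 fg; rewrite (ge0_integralTE mu f0) (ge0_integralTE mu g0).
apply: ge_ereal_sup => _ [h hf <-].
have mNC : measurable (~` N) by exact: measurableC.
(* Killing the simple function on the null set keeps its integral and puts it below g everywhere. *)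
pose h' := proj_nnsfun h mNC.
have h'E x : h' x = h x * \1_(~` N) x by [].
apply: (@le_trans _ _ (sintegral mu h')); last first.
  apply: ereal_sup_ubound; exists h' => // x; rewrite h'E indicE.
  have [xN|xN] := boolP (x \in ~` N); last by rewrite mulr0.
  by rewrite mulr1; apply: le_trans (hf x) _; apply: fg; move: xN; rewrite inE.
rewrite -!integralT_nnsfun le_eqVlt; apply/orP; left; apply/eqP.
rewrite (@ge0_negligible_integral _ _ _ mu setT N)//; last 2 first.
- by apply/measurable_EFinP; exact: measurable_funP.
- by move=> x _; rewrite lee_fin.
rewrite setTD integral_mkcond; apply: eq_integral => x _; rewrite patchE h'E indicE.
by case: ifP => _; rewrite ?mulr1 ?mulr0.
Qed.

Lemma eq_integral_null (D : set X) (f g : X -> \bar R) :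
  (forall x, D x -> ~ N x -> f x = g x) ->
  (\int[mu]_(x in D) f x = \int[mu]_(x in D) g x)%E.
Proof.
move=> fg; rewrite [LHS]integral_mkcond [RHS]integral_mkcond.
have E x : ~ N x -> (f \_ D) x = (g \_ D) x.
  by move=> Nx; rewrite !patchE; case: ifPn => //; rewrite inE => Dx; exact: fg.
rewrite [LHS]integralE [RHS]integralE; congr (_ - _)%E; apply/eqP; rewrite eq_le.
- apply/andP; split; apply: ge0_le_integral_null => // x Nx.
    by rewrite !funeposE E.
  by rewrite !funeposE E.
- apply/andP; split; apply: ge0_le_integral_null => // x Nx.
    by rewrite !funenegE E.
  by rewrite !funenegE E.
Qed.

(** Serves to put [l] back in place of its regular version in the weak equation, where measurability
    of the integrand with [l] itself has not been established. *)
Lemma eq_Rintegral_null (D : set X) (f g : X -> R) : (forall x, D x -> ~ N x -> f x = g x) ->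
  \int[mu]_(x in D) f x = \int[mu]_(x in D) g x.
Proof.
move=> fg; rewrite /Rintegral (eq_integral_null (g := fun x => (g x)%:E))//.
by move=> x Dx Nx; rewrite fg.
Qed.

End null_sets.

Section step_functions.
Context {R : realType}.

Definition step_index (T : R) (m : nat) (t : R) : int := Num.floor (m.+1%:R * (t / T)).

Definition step_time (T : R) (m : nat) (j : int) : R := T * (j%:~R / m.+1%:R).

Lemma measurable_step_index (T : R) m (j : int) :
  measurable [set t : measurableTypeR R | step_index T m t = j].
Proof.
have mf : measurable_fun setT (fun t : measurableTypeR R => m.+1%:R * (t / T) : measurableTypeR R).
  by apply: measurable_funM => //; apply: measurable_funM.
rewrite (_ : [set t | _] = (fun t => m.+1%:R * (t / T)) @^-1` `[j%:~R, j%:~R + 1[).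
  by rewrite -[X in measurable X]setTI; apply: mf.
apply/seteqP; split => t /=; rewrite in_itv/= /step_index => H.
  by have := floor_itv (m.+1%:R * (t / T)); rewrite H intrD.
by apply: floor_def; rewrite intrD.
Qed.

Lemma measurable_finite_range (V : Type) (s : measurableTypeR R -> V) (A : set V) :
  finite_set (range s) -> (forall v, measurable (s @^-1` [set v])) ->
  measurable (s @^-1` A).
Proof.
move=> fs ms; rewrite (_ : s @^-1` A = \bigcup_(v in range s `&` A) s @^-1` [set v]).
  by apply: fin_bigcup_measurable => //; exact: finite_setIl.
apply/seteqP; split => t /=; first by move=> At; exists (s t) => //; split => //; exists t.
by move=> [v [_ Av]] /= ->.
Qed.

(** Countably many time steps and finitely many values of s cut the line into countably many
    measurable pieces, on each of which the expression is constant, whatever G is. *)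
Lemma measurable_step_pair (T : R) m (V W : Type) (s : measurableTypeR R -> V)
    (G : int -> V -> W) (A : set W) :
  finite_set (range s) -> (forall v, measurable (s @^-1` [set v])) ->
  measurable [set t | A (G (step_index T m t) (s t))].
Proof.
move=> fs ms; rewrite (_ : [set t | _] = \bigcup_j
   ([set t | step_index T m t = j] `&` s @^-1` [set v | A (G j v)])).
  apply: countable_bigcupT_measurable; first exact: countableP.
  move=> j; apply: measurableI; first exact: measurable_step_index.
  exact: measurable_finite_range.
apply/seteqP; split => t /=; first by move=> At; exists (step_index T m t).
by move=> [j _ [/= ->]].
Qed.

Lemma step_time_itv (T t : R) m : 0 < T -> 0 <= t <= T ->
  0 <= step_time T m (step_index T m t) <= t.
Proof.
move=> T0 /andP[t0 tT]; have m0 : 0 < m.+1%:R :> R by rewrite ltr0n.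
rewrite /step_time /step_index; have /andP[h1 h2] := floor_itv (m.+1%:R * (t / T)).
apply/andP; split.
  by rewrite mulr_ge0 ?(ltW T0)// divr_ge0// ler0z floor_ge0 mulr_ge0// divr_ge0// ltW.
by rewrite mulrC -ler_pdivlMr// ler_pdivrMr// [leRHS]mulrC.
Qed.

Lemma step_time_close (T t : R) m : 0 < T ->
  t - step_time T m (step_index T m t) <= T / m.+1%:R.
Proof.
move=> T0; have m0 : 0 < m.+1%:R :> R by rewrite ltr0n.
rewrite /step_time /step_index; have /andP[_] := floor_itv (m.+1%:R * (t / T)).
rewrite intrD => /ltW h; rewrite lerBlDr -[T / _]mulr1 -mulrA -mulrDr.
rewrite -[leLHS](divfK (lt0r_neq0 T0)) mulrC ler_pM2l//.
by rewrite mulr1 -[X in X + _]mul1r -mulrDl addrC ler_pdivlMr// mulrC.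
Qed.

Lemma cvg_step_time (T t : R) : 0 < T -> 0 <= t <= T ->
  step_time T m (step_index T m t) @[m --> \oo] --> t.
Proof.
move=> T0 t0T; apply/cvgrPdist_le => e e0; near=> m.
have /andP[_ h1] := step_time_itv m T0 t0T; have h2 := step_time_close t m T0.
rewrite ger0_norm ?subr_ge0//; apply: (le_trans h2).
rewrite ler_pdivrMr// mulrC -ler_pdivrMr//.
apply: (@le_trans _ _ m%:R); last by rewrite ler_nat.
by apply/ltW; near: m; exact: nbhs_infty_gtr.
Unshelve. all: end_near. Qed.

Lemma finite_step_range (T : R) m (V : Type) (G : int -> V) (z : V) : 0 < T ->
  finite_set (range (fun t : measurableTypeR R =>
    if 0 <= t <= T then G (step_index T m t) else z)).
Proof.
move=> T0; apply: (@sub_finite_set _ _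
   ([set G (k%:Z) | k in `I_m.+2] `|` [set z])).
  move=> _ [t _ <-]; case: ifP => [/andP[t0 tT]|_]; [left|by right].
  have h0 : 0 <= step_index T m t.
    by rewrite /step_index floor_ge0 mulr_ge0// divr_ge0// ltW.
  exists `|step_index T m t|%N; last by rewrite gez0_abs.
  rewrite /= -ltz_nat gez0_abs// -(ltr_int R).
  have /andP[h1 _] := floor_itv (m.+1%:R * (t / T)); apply: (le_lt_trans h1).
  apply: (@le_lt_trans _ _ (m.+1%:R * 1)); last by rewrite mulr1 ltr_nat.
  by rewrite ler_wpM2l// ler_pdivrMr// mul1r.
rewrite finite_setU; split; last exact: finite_set1.
exact/finite_image/finite_II.
Qed.

End step_functions.

(** * A regular version of the control l *)

Section bochner_regularization.
Context {R : realType} {H : completeNormedModType R}.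
Local Notation leb := (@lebesgue_measure R).
Variables (T : R) (l : R -> H).
Hypothesis hl : bochner_L (@hnorm R H) setT 2%:E T l.

Definition time_simple (s : measurableTypeR R -> H) :=
  finite_set (range s) /\ forall v, measurable (s @^-1` [set v]).

Lemma time_simple_restrict s (D : set (measurableTypeR R)) : measurable D ->
  time_simple s -> time_simple (fun t => if t \in D then s t else 0).
Proof.
move=> mD [fs ms]; split.
  apply: (@sub_finite_set _ _ (range s `|` [set 0])).
    by move=> _ [t _ <-]; case: ifP => _; [left; exists t|right].
  by rewrite finite_setU; split => //; exact: finite_set1.
move=> v; rewrite (_ : _ @^-1` _ = (D `&` s @^-1` [set v]) `|` (~` D `&` [set _ | 0 = v])).
  apply: measurableU; first exact: measurableI.
  apply: measurableI; first exact: measurableC.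
  by have [->|v0] := eqVneq 0 v; [rewrite (_ : [set _ | _] = setT)//; apply/seteqP|
    rewrite (_ : [set _ | _] = set0)//; apply/seteqP; split => // x /eqP; rewrite (negbTE v0)].
apply/seteqP; split => t /=.
  by case: ifPn; [rewrite inE => Dt sv; left|rewrite notin_setE => Dt sv; right].
case=> -[Dt sv]; first by rewrite mem_set.
by rewrite memNset.
Qed.

(* [l] is only a limit of simple functions almost everywhere; off a Borel null set it
   agrees with an everywhere limit. *)
Lemma bochner_regularize : exists (N : set (measurableTypeR R)) (lt : R -> H)
    (s : nat -> R -> H), [/\ measurable N, leb N = 0%E,
    forall t, 0 <= t <= T -> ~ N t -> l t = lt t,
    (forall n, time_simple (s n)) /\ forall t, `|s n t - lt t| @[n --> \oo] --> 0 &
    leb.-integrable `[0, T] (EFin \o (fun t => `|lt t| ^+ 2))].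
Proof.
case: hl => _ [s ss [N [mN N0 sN]]] lfin.
pose D : set (measurableTypeR R) := `[0, T]%classic `\` N.
have mD : measurable D by exact: measurableD.
pose lt t := if t \in D then l t else 0.
pose st n t := if t \in D then s n t else 0.
have sst n : time_simple (st n).
  by apply: time_simple_restrict => //; case: (ss n).
have scv t : `|st n t - lt t| @[n --> \oo] --> 0.
  rewrite /st /lt; case: ifPn => [|_]; last first.
    by under eq_fun do rewrite subrr normr0; exact: cvg_cst.
  rewrite inE => -[_ Nt]; have := contra_notP (sN t) Nt => /= cv.
  have := @fine_cvg _ _ _ _ (fun n => (`|s n t - l t|)%:E) 0.
  exact.
have mnorm n : measurable_fun setT (fun t : measurableTypeR R => `|st n t| : measurableTypeR R).
  move=> _ A mA; rewrite setTI.
  exact: (@measurable_finite_range _ _ (st n) [set v | A `|v|] (sst n).1 (sst n).2).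
have mlt : measurable_fun setT (fun t : measurableTypeR R => `|lt t| : R).
  apply: (@measurable_fun_cvg _ _ _ _ (fun n t => `|st n t|)) => // t _.
  apply/cvgrPdist_le => e e0; near=> n.
  apply: le_trans (ler_dist_dist _ _) _; rewrite distrC.
  near: n; move/cvgrPdist_le : (scv t) => /(_ e e0); apply: filterS => n.
  by rewrite sub0r normrN normr_id.
(* N is null for Lebesgue measure restricted to [0, T], so only its part inside [0, T] is known to
   be Lebesgue null. *)
pose N' := N `&` `[0, T]%classic.
exists N', lt, st; split => //.
- exact: measurableI.
- by move=> t tT Nt; rewrite /lt mem_set//; split; [rewrite /= in_itv|move=> Nt'; apply: Nt; split => //; rewrite /= in_itv].
apply/integrableP; split.
  by apply/measurable_EFinP; apply: measurable_funTS; exact: measurable_funX.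
have l2 : (\int[time_measure T]_t (hnorm (l t) `^ 2) < +oo)%E.
  have := @poweR_Lnorm _ _ _ (time_measure T) (@hnorm R H \o l) 2 _.
  rewrite (_ : (\int[_]_x _)%E = \int[time_measure T]_t (hnorm (l t) `^ 2))%E; last first.
    by apply: eq_integral => t _; rewrite /= ger0_norm.
  by move=> <-//; exact: poweR_lty.
have m2 : measurable_fun setT (fun t : measurableTypeR R => (`|lt t| ^+ 2)%:E).
  by apply/measurable_EFinP; exact: measurable_funX.
rewrite (eq_integral (fun t : measurableTypeR R => (`|lt t| ^+ 2)%:E)); last first.
  by move=> t _ /=; rewrite ger0_norm ?sqr_ge0.
rewrite -(ge0_integral_mrestr leb (measurable_itv `[0, T]) m2); last by move=> t; rewrite lee_fin sqr_ge0.
(* Monotonicity is taken with the empty null set because the integrand built from [l] is not known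
   to be measurable. *)
apply: le_lt_trans l2; apply: (@ge0_le_integral_null _ _ _ (time_measure T) set0) => //.
- by move=> t; exact: poweR_ge0.
- move=> t _; rewrite /lt; case: ifP => _; last by rewrite normr0 expr0n; exact: poweR_ge0.
  by rewrite /hnorm poweR_EFin powR_mulrn.
Unshelve. all: end_near. Qed.

End bochner_regularization.

Section time_regularity.
Context {R : realType} {d : nat}.
Local Notation tor := (@torus_measure R d).
Local Notation L2 := (Lfun tor 2%:E).
Variables (T : R) (u : R -> 'rV[R]_d -> R) (B : R).
Hypothesis T0 : 0 < T.
Hypothesis uc : L2cont tor T u.
Hypothesis uB : forall t, 0 <= t <= T -> nrm tor (u t) <= B.

Lemma step_time_in m t : 0 <= t <= T -> 0 <= step_time T m (step_index T m t) <= T.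
Proof.
move=> tT; have /andP[h1 h2] := step_time_itv m T0 tT.
by case/andP: tT => _ tT; rewrite h1 (le_trans h2).
Qed.

Lemma cvg_step_L2 t : 0 <= t <= T ->
  nrm tor (fun x => u t x - u (step_time T m (step_index T m t)) x) @[m --> \oo] --> 0.
Proof.
move=> tT; apply/cvgrPdist_le => e e0.
have [dl dl0 Hd] := uc.2 t tT e e0.
near=> m; rewrite sub0r normrN ger0_norm ?nrm_ge0//; apply: Hd; first exact: step_time_in.
by near: m; move/cvgrPdist_lt : (cvg_step_time T0 tT); exact.
Unshelve. all: end_near. Qed.

Lemma torus_L2normE f : f \in L2 -> torus_L2norm f = (nrm tor f)%:E.
Proof.
move=> fL; have := @poweR_Lnorm _ _ _ tor (EFin \o f) 2 _.
have n2 : 2 != 0 :> R by rewrite pnatr_eq0.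
rewrite /torus_L2norm => /(_ n2) H.
have E : (\int[tor]_x (`|(EFin \o f) x| `^ 2) = (nrm tor f ^+ 2)%:E)%E.
  rewrite sqr_nrm /ip /Rintegral fineK; last first.
    by apply: integrable_fin_num => //; exact: ip_integrable.
  apply: eq_integral => x _ /=; rewrite ?poweR_EFin powR_mulrn//.
  by rewrite real_normK ?num_real// expr2.
move: H; rewrite E => H.
have N0 := Lnorm_ge0 tor 2%:E (EFin \o f).
have : ('N[tor]_2%:E[EFin \o f] `^ 2 `^ 2^-1 = ((nrm tor f ^+ 2)%:E `^ 2^-1))%E by rewrite H.
rewrite -poweRrM mulfV// poweRe1// => ->.
by rewrite poweR_EFin powR12_sqrt ?sqr_ge0// sqrtr_sqr ger0_norm ?nrm_ge0.
Qed.

(** The simple functions freeze u at the grid time before t and vanish outside [0, T]; continuity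
    gives convergence at every t in [0, T]. *)
Lemma L2cont_bochner : (forall t, 0 <= t <= T -> Defs.periodic (u t)) ->
  bochner_L (@torus_L2norm R d) torus_L2 +oo%E T u.
Proof.
move=> up; have uL2 t : 0 <= t <= T -> torus_L2 (u t).
  by move=> tT; split; [exact: up|exact: uc.1].
have z2 : torus_L2 (fun _ : 'rV[R]_d => 0 : R) by split => //; exact: L2_0.
split => //; last first.
  rewrite unlock; case: ifPn => // mu0; apply: (@le_lt_trans _ _ B%:E); last exact: ltry.
  apply/ess_supP; exists (~` `[0, T]%classic); split.
  - by apply: measurableC; exact: measurable_itv.
  - by rewrite /time_measure/= /mrestr setICl measure0.
  - move=> t Nt /=; rewrite in_itv/= => tT; apply: Nt.
    by rewrite /= torus_L2normE ?uc.1//= lee_fin ger0_norm ?nrm_ge0 ?uB.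
exists (fun m t => if 0 <= t <= T then u (step_time T m (step_index T m t)) else fun=> 0).
  move=> m; split; first exact: (finite_step_range m (fun j => u (step_time T m j)) (fun=> 0) T0).
    by move=> _ [t _ <-]; case: ifP => // tT; apply: uL2; exact: step_time_in.
  move=> v.
  apply: (@measurable_step_pair _ T m bool _ (fun t => 0 <= t <= T)
    (fun j b => if b then u (step_time T m j) else fun=> 0) [set v]).
    apply: (@sub_finite_set _ _ [set true; false]); last exact: finite_set2.
    by move=> _ [t _ <-]; case: (_ && _); [left|right].
  move=> b; rewrite (_ : _ @^-1` _ = if b then `[0, T]%classic else ~` `[0, T]%classic).
    by case: b; [exact: measurable_itv|apply: measurableC; exact: measurable_itv].
  apply/seteqP; split => t /=; case: b; rewrite /= in_itv/= => //.
    by move=> ->.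
  by move/negP/negbTE.
exists (~` `[0, T]%classic); split.
- by apply: measurableC; exact: measurable_itv.
- by rewrite /time_measure/= /mrestr setICl measure0.
- move=> t Nt /=; rewrite in_itv/= => tT; apply: Nt; rewrite /= tT.
  rewrite (_ : (fun n => _) = (fun m => (nrm tor (fun x => u t x - u (step_time T m (step_index T m t)) x))%:E)).
    by apply: cvg_EFin; [exact: nearW|exact: cvg_step_L2].
  apply/funext => m; rewrite torus_L2normE; first by congr EFin; exact: nrmB.
  by apply: L2B; [apply: uc.1; exact: step_time_in|exact: uc.1].
Qed.

Context {H : completeNormedModType R}.
Variables (dp : {dot H for idfun}) (e : nat -> H) (h : nat -> 'rV[R]_d -> R -> R).
Hypothesis hdp : hilbert_norm dp.
Hypothesis dp_e : forall j k, dp (e j) (e k) = (j == k)%:R.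
Variable C : R.
Hypothesis hcont : forall k, continuous (fun p : 'rV[R]_d * R => h k p.1 p.2).
Hypothesis h_growth : forall x y,
  (\sum_(0 <= k <oo) (`|h k x y| ^+ 2)%:E <= (C * (1 + `|y| ^+ 2))%:E)%E.
Hypothesis h_lip : forall x x' y y',
  (\sum_(0 <= k <oo) (`|h k x y - h k x' y'| ^+ 2)%:E <=
    (C * (torus_dist x x' ^+ 2 + `|y - y'| ^+ 2))%:E)%E.

(** Freeze u at grid times and replace [lt] by simple functions: the pairing then takes countably
    many values on measurable sets. The error splits into one part linear in the l-variable and one
    Lipschitz in u. *)
Lemma measurable_noise_time (lt : R -> H) (s : nat -> R -> H) (f : 'rV[R]_d -> R) :
  f \in L2 -> (forall n, time_simple (s n)) ->
  (forall t, `|s n t - lt t| @[n --> \oo] --> 0) ->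
  measurable_fun `[0, T] (fun t : measurableTypeR R => ip tor (noise dp e h (u t) (lt t)) f).
Proof.
move=> fL ss scv; pose tau m t := step_time T m (step_index T m t).
have nL v l : v \in L2 -> noise dp e h v l \in L2 by exact: (noise_L2 hdp dp_e hcont h_growth).
apply: (@measurable_fun_cvg _ _ _ _ (fun m t => ip tor (noise dp e h (u (tau m t)) (s m t)) f)).
  move=> m; apply: measurable_funTS => _ A mA; rewrite setTI.
  exact: (@measurable_step_pair _ T m H _ (s m)
    (fun j l => ip tor (noise dp e h (u (step_time T m j)) l) f) A (ss m).1 (ss m).2).
move=> t; rewrite /= in_itv/= => tT.
have uL := uc.1 t tT; have tauT m := step_time_in m tT.
have tauL m : u (tau m t) \in L2 by apply: uc.1; exact: tauT.
pose b m := (Num.sqrt C * (1 + B) * `|s m t - lt t| +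
  Num.sqrt C * `|lt t| * nrm tor (fun x => u t x - u (tau m t) x)) * nrm tor f.
have bound m : `|ip tor (noise dp e h (u (tau m t)) (s m t)) f - ip tor (noise dp e h (u t) (lt t)) f| <= b m.
  rewrite -ipBl ?nL//; apply: le_trans (cauchy_schwarz _ fL) _; first by apply: L2B; exact: nL.
  rewrite ler_wpM2r ?nrm_ge0//.
  apply: le_trans (nrm_dist_triangle (nL _ _ (tauL m)) (nL _ (lt t) (tauL m)) (nL _ _ uL)) _.
  apply: lerD.
    rewrite (_ : (fun x => _) = noise dp e h (u (tau m t)) (s m t - lt t)); last first.
      by apply/funext => x; rewrite (noiseB hdp dp_e h_growth).
    apply: le_trans (nrm_noise_le hdp dp_e hcont h_growth _ (tauL m)) _.
    rewrite mulrAC ler_wpM2r// ler_wpM2l ?sqrtr_ge0// lerD2l.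
    by apply: uB; exact: tauT.
  rewrite [X in _ <= _ * X]nrmB.
  exact: (nrm_noise_lip hdp dp_e hcont h_growth h_lip).
have b0 : b m @[m --> \oo] --> 0.
  rewrite -[X in _ --> X](mul0r (nrm tor f)); apply: cvgM; last exact: cvg_cst.
  rewrite -[X in _ --> X]addr0; apply: cvgD.
    by rewrite -[X in _ --> X](mulr0 (Num.sqrt C * (1 + B))); apply: cvgM; [exact: cvg_cst|exact: scv].
  rewrite -[X in _ --> X](mulr0 (Num.sqrt C * `|lt t|)); apply: cvgM; first exact: cvg_cst.
  exact: cvg_step_L2.
apply/cvgrPdist_le => eps eps0; near=> m; rewrite distrC; apply: le_trans (bound m) _.
apply: le_trans (ler_norm _) _; rewrite -[b m]subr0 distrC.
by near: m; move/cvgrPdist_le : b0; exact.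
Unshelve. all: end_near. Qed.

End time_regularity.

(** * The equation in Fourier modes *)

Section modes.
Context {R : realType} (d : nat).
Local Notation tor := (@torus_measure R d).
Local Notation L2 := (Lfun tor 2%:E).
Local Notation phi := (@trig_family R d cos_phase).
Local Notation chi := (@trig_family R d sin_phase).
Local Notation lam := (@mode_eigenvalue R d).

Definition mode_freq (n : nat) (i : 'I_d) : R :=
  oapp (fun kb : {ffun 'I_d -> int} * bool => 2 * pi * (kb.1 i)%:~R) 0 (pickle_inv n).

Lemma mode_form n : (phi n = (fun=> 0) /\ chi n = (fun=> 0)) \/
  exists (c alpha : R) (kb : {ffun 'I_d -> int} * bool), [/\ pickle_inv n = Some kb,
    phi n = (fun x => c * cos (alpha + freq kb.1 x)) &
    chi n = (fun x => c * cos (alpha + pi / 2 + freq kb.1 x))].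
Proof.
rewrite /trig_family; case: (pickle_inv n) => [[k b]|] /=; last by left.
have [hk|hk] := boolP (half_freq k); last first.
  by left; split; apply/funext => x; rewrite /trig_mode /= (negbTE hk).
right; exists (trig_weight k), (cos_phase b), (k, b); split => //.
  by apply/funext => x; rewrite /trig_mode /= hk.
by apply/funext => x; rewrite /trig_mode /= hk.
Qed.

Let cosZ c alpha k : (fun x : 'rV[R]_d => c * cos (alpha + freq k x)) =
  (fun x => c * cos (alpha + freq k x) + (fun=> 0) x).
Proof. by apply/funext => x; rewrite addr0. Qed.

Lemma partial_cosZ c alpha (k : {ffun 'I_d -> int}) i :
  partial i (fun x : 'rV[R]_d => c * cos (alpha + freq k x)) =
  (fun x => 2 * pi * (k i)%:~R * (c * cos (alpha + pi / 2 + freq k x))).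
Proof.
rewrite cosZ (partial_linear i c (differentiable_cos_freq k alpha) (fun x => differentiable_cst _ x)).
by rewrite partial0; apply/funext => x; rewrite addr0 partial_cos_freq; ring.
Qed.

Lemma partial_mode n i : partial i (phi n) = (fun x => mode_freq n i * chi n x).
Proof.
case: (mode_form n) => [[-> ->]|[c [alpha [[k b] [kbE -> ->]]]]].
  by rewrite partial0; apply/funext => x; rewrite mulr0.
by rewrite /mode_freq kbE partial_cosZ.
Qed.

Lemma laplacian_mode n : laplacian (phi n) = (fun x => - lam n * phi n x).
Proof.
apply/funext => x; rewrite /laplacian.
case: (mode_form n) => [[-> _]|[c [alpha [[k b] [kbE -> _]]]]].
  by rewrite mulr0 big1// => i _; rewrite !partial0.
rewrite /mode_eigenvalue kbE /=.
rewrite (eq_bigr (fun i => c * partial i (partial i (fun x => cos (alpha + freq k x))) x)).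
  by rewrite -mulr_sumr -/(laplacian _ x) laplacian_cos_freq mulrCA.
move=> i _; rewrite partial2_cos_freq partial_cosZ.
rewrite (_ : (fun x => _) = (fun x => 2 * pi * (k i)%:~R * c * cos (alpha + pi / 2 + freq k x))).
  rewrite partial_cosZ.
  have -> : alpha + pi / 2 + pi / 2 + freq k x = alpha + freq k x + pi.
    by rewrite -(addrA alpha) -splitr addrAC.
  by rewrite cosDpi; ring.
by apply/funext => y; rewrite mulrA.
Qed.

Lemma torus_smooth_mode n : torus_smooth (phi n).
Proof.
case: (mode_form n) => [[-> _]|[c [alpha [kb [_ -> _]]]]].
  by split => //; exact: smooth0.
split; first by move=> x i; rewrite cos_freq_periodic.
by rewrite cosZ; apply: smooth_linear; [exact: smooth_cos_freq|exact: smooth0].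
Qed.

Variables (theta a : R).
Hypothesis hd : (0 < d)%N.
Hypothesis theta0 : 0 < theta.
Hypothesis theta_a : theta < a.
Hypothesis a1 : a < 1.
Hypothesis a2 : 2^-1 <= a.

Definition mode_symbol (n : nat) : R :=
  oapp (fun kb : {ffun 'I_d -> int} * bool => frac_symbol theta kb.1) 0 (pickle_inv n).

Lemma frac_laplacian0 x : frac_laplacian theta (fun _ : 'rV[R]_d => 0) x = 0.
Proof.
have := frac_laplacian_le hd theta0 theta_a a1 (C := 0) (x := x) (@frac_admissible0 R d a).
rewrite mul0r normr_le0 => /(_ _)/eqP; apply => z.
by rewrite /second_diff addr0 mulr0 subr0 normr0 mul0r.
Qed.

Lemma frac_laplacian_mode n : frac_laplacian theta (phi n) = (fun x => mode_symbol n * phi n x).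
Proof.
apply/funext => x; case: (mode_form n) => [[-> _]|[c [alpha [[k b] [kbE -> _]]]]].
  by rewrite mulr0 frac_laplacian0.
rewrite /mode_symbol kbE /=.
rewrite cosZ (frac_laplacian_linear hd theta0 theta_a a1 _ _ (frac_admissible_cos theta0 theta_a a1 k alpha) (@frac_admissible0 R d a)).
by rewrite frac_laplacian0 addr0 (frac_laplacian_cos hd theta0 theta_a a1) mulrCA.
Qed.

(* The inverse of the weight that multiplies [mode_flux] in the mild equation. *)
Definition mode_scale n : R := (1 + lam n) `^ (- a).

Let lam1 n : 1 <= 1 + lam n. Proof. by rewrite lerDl mode_eigenvalue_ge0. Qed.

Lemma mode_scale_ge0 n : 0 <= mode_scale n. Proof. exact: powR_ge0. Qed.

Lemma mode_scaleK n : (1 + lam n) `^ a * mode_scale n = 1.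
Proof.
by rewrite /mode_scale powRN mulfV// gt_eqF// powR_gt0// (lt_le_trans ltr01).
Qed.

(** |2 pi k_i| <= lam_n^(1/2) <= (1 + lam_n)^a, the last step by 1/2 <= a: one derivative costs at
    most the weight. *)
Lemma mode_freq_le n i : `|mode_scale n * mode_freq n i| <= 1.
Proof.
have l1 := lam1 n; have l0 : 0 < 1 + lam n by apply: lt_le_trans l1.
have fl : `|mode_freq n i| <= (1 + lam n) `^ a.
  apply: (@le_trans _ _ ((1 + lam n) `^ 2^-1)); last by rewrite ler_powR.
  rewrite powR12_sqrt ?(ltW l0)// -[leLHS]ger0_norm// -sqrtr_sqr ler_wsqrtr//.
  rewrite real_normK ?num_real// /mode_freq /mode_eigenvalue.
  case: (pickle_inv n) => [[k b]|] /=; last by rewrite expr0n/= addr_ge0.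
  apply: (@le_trans _ _ (laplace_symbol k)); last by rewrite lerDr.
  rewrite exprMn ler_wpM2l ?sqr_ge0// (bigD1 i)//= lerDl.
  by apply: sumr_ge0 => j _; exact: sqr_ge0.
rewrite normrM ger0_norm ?mode_scale_ge0//.
by apply: le_trans (ler_wpM2l (mode_scale_ge0 n) fl) _; rewrite mulrC mode_scaleK.
Qed.

Lemma mode_symbol_le n : `|mode_scale n * mode_symbol n| <= 4 * frac_mass d theta a.
Proof.
have M0 : 0 <= 4 * frac_mass d theta a.
  by rewrite mulr_ge0//; exact: frac_mass_ge0.
have fl : `|mode_symbol n| <= 4 * frac_mass d theta a * (1 + lam n) `^ a.
  rewrite /mode_symbol /mode_eigenvalue; case: (pickle_inv n) => [[k b]|] /=; last first.
    by rewrite normr0 mulr_ge0 ?powR_ge0.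
  by rewrite ger0_norm ?frac_symbol_ge0// frac_symbol_le.
rewrite normrM ger0_norm ?mode_scale_ge0//.
apply: le_trans (ler_wpM2l (mode_scale_ge0 n) fl) _.
by rewrite mulrCA [mode_scale n * _]mulrC mode_scaleK mulr1.
Qed.

(** The pairing of (g, g0) with the gradient and the fractional Laplacian of phi n, divided by the
    weight. The gradient appears through the shifted family, so no derivative falls on g. *)
Definition mode_flux (g : 'I_d -> 'rV[R]_d -> R) (g0 : 'rV[R]_d -> R) n : R :=
  mode_scale n * (\sum_i mode_freq n i * ip tor (g i) (chi n) - mode_symbol n * ip tor g0 (phi n)).

Lemma sqr_sum_le (m : nat) (z : 'I_m -> R) : (\sum_i z i) ^+ 2 <= m%:R * \sum_i z i ^+ 2.
Proof.
have := sum_cauchy_schwarz (index_enum 'I_m) z (fun=> 1).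
rewrite (eq_bigr (fun i => `|z i|)); last by move=> i _; rewrite normr1 mulr1.
have -> : \sum_(i < m) (1 : R) ^+ 2 = m%:R.
  by under eq_bigr do rewrite expr1n; rewrite sumr_const card_ord.
move=> h; have S0 : 0 <= \sum_i z i ^+ 2 by apply: sumr_ge0 => i _; exact: sqr_ge0.
have := le_trans (ler_norm_sum _ _ _) h; rewrite -ler_sqr ?nnegrE ?mulr_ge0 ?sqrtr_ge0//.
by rewrite real_normK ?num_real// exprMn !sqr_sqrtr// mulrC.
Qed.

(** After rescaling, both multipliers are bounded, so Bessel's inequality applies to each family.
    The factor 2 comes from (x - y)^2 <= 2 x^2 + 2 y^2, the factor d from squaring a sum of d
    terms. *)
Lemma mode_flux_bessel g g0 (s : seq nat) : uniq s -> (forall i, g i \in L2) -> g0 \in L2 ->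
  \sum_(n <- s) mode_flux g g0 n ^+ 2 <= 2 * d%:R * (\sum_i nrm tor (g i) ^+ 2) +
    2 * (4 * frac_mass d theta a) ^+ 2 * nrm tor g0 ^+ 2.
Proof.
move=> us gL g0L.
have bchi f : f \in L2 -> \sum_(n <- s) ip tor f (chi n) ^+ 2 <= nrm tor f ^+ 2.
  move=> fL; apply: bessel => //; [exact: trig_family_L2|by move=> m n; apply: trig_family_orth; [exact: sin_phase_sub|exact: sin_phase_add]|exact: trig_family_le1].
have bphi f : f \in L2 -> \sum_(n <- s) ip tor f (phi n) ^+ 2 <= nrm tor f ^+ 2.
  move=> fL; apply: bessel => //; [exact: trig_family_L2|by move=> m n; apply: trig_family_orth; [exact: cos_phase_sub|exact: cos_phase_add]|exact: trig_family_le1].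
apply: (@le_trans _ _ (\sum_(n <- s) (2 * d%:R * \sum_i ip tor (g i) (chi n) ^+ 2 +
    2 * (4 * frac_mass d theta a) ^+ 2 * ip tor g0 (phi n) ^+ 2))).
  apply: ler_sum => n _.
  pose x := \sum_i (mode_scale n * mode_freq n i * ip tor (g i) (chi n)).
  pose y := mode_scale n * mode_symbol n * ip tor g0 (phi n).
  have -> : mode_flux g g0 n = x - y.
    by rewrite /mode_flux /x /y mulrBr mulr_sumr mulrA; congr (_ - _); apply: eq_bigr => i _; rewrite mulrA.
  have hx : x ^+ 2 <= d%:R * \sum_i ip tor (g i) (chi n) ^+ 2.
    apply: le_trans (sqr_sum_le _) _; rewrite ler_wpM2l//; apply: ler_sum => i _.
    rewrite exprMn ler_piMl ?sqr_ge0// -real_normK ?num_real//.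
    by rewrite exprn_ile1 ?mode_freq_le.
  have hy : y ^+ 2 <= (4 * frac_mass d theta a) ^+ 2 * ip tor g0 (phi n) ^+ 2.
    rewrite /y exprMn ler_wpM2r ?sqr_ge0// -[leLHS]real_normK ?num_real//.
    by rewrite lerXn2r ?nnegrE ?mode_symbol_le// (le_trans _ (mode_symbol_le n)).
  have := sqr_ge0 (x + y); rewrite sqrrD sqrrB; lra.
rewrite big_split/= -!mulr_sumr; apply: lerD; last by rewrite ler_wpM2l ?bphi// mulr_ge0 ?sqr_ge0.
rewrite ler_wpM2l ?mulr_ge0// exchange_big/=.
by apply: ler_sum => i _; exact: bchi.
Qed.

Lemma mode_fluxB g g' g0 g0' n : (forall i, g i \in L2) -> (forall i, g' i \in L2) ->
  g0 \in L2 -> g0' \in L2 ->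
  mode_flux g g0 n - mode_flux g' g0' n =
  mode_flux (fun i x => g i x - g' i x) (fun x => g0 x - g0' x) n.
Proof.
move=> gL gL' g0L g0L'; rewrite /mode_flux ipBl ?trig_family_L2//.
rewrite [X in _ = _ * (X - _)](eq_bigr (fun i => mode_freq n i * ip tor (g i) (chi n) - mode_freq n i * ip tor (g' i) (chi n))).
  by rewrite sumrB; ring.
by move=> i _; rewrite ipBl ?trig_family_L2// mulrBr.
Qed.

End modes.

Lemma L2cont_bounded {dX : measure_display} {X : measurableType dX} {R : realType}
    (mu : {measure set X -> \bar R}) (T : R) (u : R -> X -> R) : L2cont mu T u ->
  exists B, forall t, 0 <= t <= T -> nrm mu (u t) <= B.
Proof.
move=> uc; have cn : {within `[0, T], continuous (fun t => nrm mu (u t))}.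
  apply: (@lipschitz_L2cont _ _ _ mu T (nrm mu) u 1) => // v v' vL vL'.
  rewrite mul1r ler_norml; apply/andP; split.
    have := ler_nrm_add vL' vL; rewrite nrmB; lra.
  have := ler_nrm_add vL vL'; lra.
have /compact_bounded [M [_ HM]] := continuous_compact cn (@segment_compact R 0 T).
exists (M + 1) => t tT; apply: le_trans (ler_norm _) _; apply: (HM (M + 1)); first by rewrite ltrDl.
by exists t => //; rewrite /= in_itv.
Qed.

(** [lipschitz] asserts the bound for all constants near +oo, that is beyond some K0; K0 + 1 is one,
    and the maximum with 0 makes it nonnegative. *)
Lemma lipschitz_const {R : realType} (V : normedModType R) (f : R -> V) : lipschitz f ->
  exists2 K, 0 <= K & forall y z, `|f y - f z| <= K * `|y - z|.
Proof.
move=> [K0 [_ HK]]; pose K := Num.max 0 (K0 + 1).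
have KK : K0 < K by rewrite lt_max; apply/orP; right; rewrite ltrDl.
exists K; first by rewrite le_max lexx.
by move=> y z; have := HK K KK (y, z); apply.
Qed.

(** * From single modes to all smooth test functions *)

Section weak_formulation.
Context {R : realType} {d : nat} {H : completeNormedModType R}.
Local Notation tor := (@torus_measure R d).
Local Notation L2 := (Lfun tor 2%:E).
Local Notation leb := (@lebesgue_measure R).
Variables (dp : {dot H for idfun}) (e : nat -> H) (h : nat -> 'rV[R]_d -> R -> R).
Hypothesis hdp : hilbert_norm dp.
Hypothesis dp_e : forall j k, dp (e j) (e k) = (j == k)%:R.
Variable C : R.
Hypothesis hcont : forall k, continuous (fun p : 'rV[R]_d * R => h k p.1 p.2).
Hypothesis h_growth : forall x y,
  (\sum_(0 <= k <oo) (`|h k x y| ^+ 2)%:E <= (C * (1 + `|y| ^+ 2))%:E)%E.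
Hypothesis h_lip : forall x x' y y',
  (\sum_(0 <= k <oo) (`|h k x y - h k x' y'| ^+ 2)%:E <=
    (C * (torus_dist x x' ^+ 2 + `|y - y'| ^+ 2))%:E)%E.
Variables (F : R -> 'rV[R]_d) (Phi : R -> R) (K : R).
Hypothesis K0 : 0 <= K.
Hypothesis F_lip : forall i y z, `|F y ord0 i - F z ord0 i| <= K * `|y - z|.
Hypothesis Phi_lip : forall y z, `|Phi y - Phi z| <= K * `|y - z|.
Variables (T theta a eps : R).
Hypothesis hd : (0 < d)%N.
Hypothesis T0 : 0 < T.
Hypothesis theta0 : 0 < theta.
Hypothesis theta_a : theta < a.
Hypothesis a1 : a < 1.
Variables (lt : R -> H) (sl : nat -> R -> H).
Hypothesis sl_simple : forall n, time_simple (sl n).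
Hypothesis sl_cvg : forall t, `|sl n t - lt t| @[n --> \oo] --> 0.
Hypothesis lt2 : leb.-integrable `[0, T] (EFin \o (fun t => `|lt t| ^+ 2)).
Variables (u : R -> 'rV[R]_d -> R) (B : R) (u0 : 'rV[R]_d -> R).
Hypothesis u0L : u0 \in L2.
Hypothesis uc : L2cont tor T u.
Hypothesis uB : forall t, 0 <= t <= T -> nrm tor (u t) <= B.

Definition flux (i : 'I_d) (v : 'rV[R]_d -> R) : 'rV[R]_d -> R := fun x => F (v x) ord0 i.

(** The integrand of the weak equation with the gradient, fractional Laplacian, Laplacian and value
    of the test function as four independent slots: it is linear in them and L^2-continuous. *)
Definition pairing s (p : 'I_d -> 'rV[R]_d -> R) (q r z : 'rV[R]_d -> R) : R :=
  \sum_i ip tor (flux i (u s)) (p i) - ip tor (Phi \o u s) q + eps * ip tor (u s) r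
  + ip tor (noise dp e h (u s) (lt s)) z.

Let uL t : 0 <= t <= T -> u t \in L2. Proof. exact: uc.1. Qed.

Lemma flux_L2 i v : v \in L2 -> flux i v \in L2.
Proof. by move=> vL; exact: (nemytskii_L2 K0 (F_lip i) vL).1. Qed.

Lemma Phi_L2 v : v \in L2 -> (Phi \o v) \in L2.
Proof. by move=> vL; exact: (nemytskii_L2 K0 Phi_lip vL).1. Qed.

Lemma noiseL2 v l : v \in L2 -> noise dp e h v l \in L2.
Proof. by move=> vL; exact: (noise_L2 hdp dp_e hcont h_growth). Qed.

Lemma pairing_linear s c p q r z p' q' r' z' : 0 <= s <= T ->
  (forall i, p i \in L2) -> q \in L2 -> r \in L2 -> z \in L2 ->
  (forall i, p' i \in L2) -> q' \in L2 -> r' \in L2 -> z' \in L2 ->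
  pairing s (fun i x => c * p i x + p' i x) (fun x => c * q x + q' x)
    (fun x => c * r x + r' x) (fun x => c * z x + z' x) =
  c * pairing s p q r z + pairing s p' q' r' z'.
Proof.
move=> sT pL qL rL zL pL' qL' rL' zL'; have us := uL sT.
have ipr f g g' : f \in L2 -> g \in L2 -> g' \in L2 ->
    ip tor f (fun x => c * g x + g' x) = c * ip tor f g + ip tor f g'.
  by move=> fL gL gL'; rewrite ipC ip_linear// (ipC _ g) (ipC _ g').
rewrite /pairing (eq_bigr (fun i => c * ip tor (flux i (u s)) (p i) + ip tor (flux i (u s)) (p' i))).
  rewrite big_split/= -mulr_sumr !ipr ?Phi_L2 ?noiseL2//; ring.
by move=> i _; rewrite ipr ?flux_L2.
Qed.

Definition pairing_const1 : R := (1 + B) * (\sum_i (`|F 0 ord0 i| + K) + (`|Phi 0| + K) + `|eps|).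
Definition pairing_const2 : R := Num.sqrt C * (1 + B).

Let B0 : 0 <= B.
Proof. by apply: le_trans (uB (t := 0) _); rewrite ?nrm_ge0// lexx ltW. Qed.

(** The bound is affine in |lt s|, hence integrable in time, so approximation errors of test
    functions survive the time integral. *)
Lemma pairing_le s p q r z eta : 0 <= s <= T -> 0 <= eta ->
  (forall i, p i \in L2) -> q \in L2 -> r \in L2 -> z \in L2 ->
  (forall i, nrm tor (p i) <= eta) -> nrm tor q <= eta -> nrm tor r <= eta -> nrm tor z <= eta ->
  `|pairing s p q r z| <= eta * (pairing_const1 + pairing_const2 * `|lt s|).
Proof.
move=> sT eta0 pL qL rL zL pe qe re ze; have us := uL sT; have ub := uB sT.
have cs f g M : f \in L2 -> g \in L2 -> 0 <= M -> nrm tor f <= M * (1 + nrm tor (u s)) ->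
    nrm tor g <= eta -> `|ip tor f g| <= M * (1 + B) * eta.
  move=> fL gL M0 fM ge; apply: le_trans (cauchy_schwarz fL gL) _.
  apply: ler_pM; rewrite ?nrm_ge0//; apply: le_trans fM _.
  by rewrite ler_wpM2l// lerD2l.
have t1 i : `|ip tor (flux i (u s)) (p i)| <= (`|F 0 ord0 i| + K) * (1 + B) * eta.
  apply: cs; rewrite ?flux_L2 ?addr_ge0//.
  exact: (nemytskii_L2 K0 (F_lip i) us).2.
have t2 : `|ip tor (Phi \o u s) q| <= (`|Phi 0| + K) * (1 + B) * eta.
  apply: cs; rewrite ?Phi_L2 ?addr_ge0//.
  exact: (nemytskii_L2 K0 Phi_lip us).2.
have t3 : `|eps * ip tor (u s) r| <= `|eps| * ((1 + B) * eta).
  rewrite normrM ler_wpM2l//; have := cs (u s) r 1 us rL ler01; rewrite !mul1r; apply => //.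
  by rewrite lerDr.
have t4 : `|ip tor (noise dp e h (u s) (lt s)) z| <= Num.sqrt C * `|lt s| * (1 + B) * eta.
  apply: cs; rewrite ?noiseL2 ?mulr_ge0 ?sqrtr_ge0//.
  exact: (nrm_noise_le hdp dp_e hcont h_growth).
have t1' : `|\sum_i ip tor (flux i (u s)) (p i)| <= (\sum_i (`|F 0 ord0 i| + K)) * (1 + B) * eta.
  apply: le_trans (ler_norm_sum _ _ _) _; rewrite -mulrA mulr_suml.
  by apply: ler_sum => i _; rewrite mulrA.
rewrite /pairing; apply: le_trans (ler_normD _ _) _.
apply: (le_trans (lerD (ler_normD _ _) t4)); apply: (le_trans (lerD (lerD (ler_normB _ _) t3) (lexx _))).
apply: (le_trans (lerD (lerD (lerD t1' t2) (lexx _)) (lexx _))).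
rewrite le_eqVlt; apply/orP; left; apply/eqP; rewrite /pairing_const1 /pairing_const2; ring.
Qed.

Lemma integrable_norm_lt : leb.-integrable `[0, T] (EFin \o (fun t => `|lt t|)).
Proof.
have mlt : measurable_fun `[0, T] (fun t : measurableTypeR R => `|lt t|).
  have := measurable_int _ lt2 => /measurable_EFinP m2.
  have ms : measurable_fun setT (@Num.sqrt R).
    by apply: continuous_measurable_fun; exact: sqrt_continuous.
  have := measurableT_comp ms m2; apply: eq_measurable_fun => t _ /=.
  by rewrite sqrtr_sqr ger0_norm.
apply: (@le_integrable_EFin _ _ _ leb _ _ _ (fun t => 1 + `|lt t| ^+ 2)) => //.
- move=> t _; rewrite normr_id; have := sqr_ge0 (`|lt t| - 1); have := normr_ge0 (lt t); rewrite sqrrB expr1n mulr1; lra.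
- by apply: integrableD_EFin => //; exact: integrable_cst_itv.
Qed.

Lemma flux_integrable i p : p \in L2 ->
  leb.-integrable `[0, T] (EFin \o (fun s => ip tor (flux i (u s)) p)).
Proof.
move=> pL; apply: continuous_compact_integrable; first exact: segment_compact.
apply: (@lipschitz_L2cont _ _ _ tor T (fun v => ip tor (flux i v) p) u (K * nrm tor p)) => //.
  by rewrite mulr_ge0 ?nrm_ge0.
move=> v v' vL vL'; rewrite -ipBl ?flux_L2//; apply: le_trans (cauchy_schwarz (L2B (flux_L2 i vL) (flux_L2 i vL')) pL) _.
rewrite mulrAC ler_wpM2r ?nrm_ge0//.
exact: (nemytskii_lip K0 (F_lip i)).
Qed.

Lemma Phi_integrable q : q \in L2 ->
  leb.-integrable `[0, T] (EFin \o (fun s => ip tor (Phi \o u s) q)).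
Proof.
move=> qL; apply: continuous_compact_integrable; first exact: segment_compact.
apply: (@lipschitz_L2cont _ _ _ tor T (fun v => ip tor (Phi \o v) q) u (K * nrm tor q)) => //.
  by rewrite mulr_ge0 ?nrm_ge0.
move=> v v' vL vL'; rewrite -ipBl ?Phi_L2//; apply: le_trans (cauchy_schwarz (L2B (Phi_L2 vL) (Phi_L2 vL')) qL) _.
rewrite mulrAC ler_wpM2r ?nrm_ge0//.
exact: (nemytskii_lip K0 Phi_lip).
Qed.

Lemma u_integrable r : r \in L2 -> leb.-integrable `[0, T] (EFin \o (fun s => ip tor (u s) r)).
Proof.
move=> rL; apply: continuous_compact_integrable; first exact: segment_compact.
apply: (@lipschitz_L2cont _ _ _ tor T (fun v => ip tor v r) u (nrm tor r)) => //.
  exact: nrm_ge0.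
move=> v v' vL vL'; rewrite -ipBl// mulrC; exact: cauchy_schwarz (L2B vL vL') rL.
Qed.

Lemma noise_integrable z : z \in L2 ->
  leb.-integrable `[0, T] (EFin \o (fun s => ip tor (noise dp e h (u s) (lt s)) z)).
Proof.
move=> zL; apply: (@le_integrable_EFin _ _ _ leb _ _ _ (fun s => Num.sqrt C * (1 + B) * nrm tor z * `|lt s|)) => //.
- exact: (measurable_noise_time T0 uc uB hdp dp_e hcont h_growth h_lip).
- move=> s; rewrite /= in_itv/= => sT; have us := uL sT.
  apply: le_trans (cauchy_schwarz (noiseL2 _ us) zL) _.
  rewrite -[leRHS]mulrA [nrm tor z * _]mulrC mulrA ler_wpM2r ?nrm_ge0//.
  apply: le_trans (nrm_noise_le hdp dp_e hcont h_growth _ us) _.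
  by rewrite mulrAC ler_wpM2r// ler_wpM2l ?sqrtr_ge0// lerD2l uB.
- by apply: integrableZ_EFin => //; exact: integrable_norm_lt.
Qed.

Lemma pairing_integrable p q r z : (forall i, p i \in L2) -> q \in L2 -> r \in L2 -> z \in L2 ->
  leb.-integrable `[0, T] (EFin \o (fun s => pairing s p q r z)).
Proof.
move=> pL qL rL zL; apply: integrableD_EFin => //; last exact: noise_integrable.
apply: integrableD_EFin => //; last by apply: integrableZ_EFin => //; exact: u_integrable.
apply: integrableB_EFin => //; last exact: Phi_integrable.
by apply: integrable_sum_EFin => // i; exact: flux_integrable.
Qed.

(** Bounded measurability of the fractional Laplacian is part of the class so that every pairing is
    integrable and the class is closed under linear combinations. *)
Definition weak_test (psi : 'rV[R]_d -> R) :=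
  [/\ torus_smooth psi, bounded_measurable (frac_laplacian theta psi) &
    forall t, 0 <= t <= T -> ip tor (u t) psi - ip tor u0 psi =
      \int[leb]_(s in `[0, t])
        pairing s (fun i => partial i psi) (frac_laplacian theta psi) (laplacian psi) psi].

Lemma bounded_measurable_L2 (f : 'rV[R]_d -> R) : bounded_measurable f -> f \in L2.
Proof. by move=> [mf [M fM]]; exact: bounded_L2 fM. Qed.

Lemma torus_smooth_L2 (psi : 'rV[R]_d -> R) : torus_smooth psi ->
  [/\ psi \in L2, forall i, partial i psi \in L2 & laplacian psi \in L2].
Proof.
move=> tpsi; split.
- exact/bounded_measurable_L2/torus_smooth_bounded_measurable.
- by move=> i; exact/bounded_measurable_L2/torus_smooth_bounded_measurable/torus_smooth_partial.
- apply: L2_sum => i _; apply: bounded_measurable_L2; apply: torus_smooth_bounded_measurable.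
  by do 2 apply: torus_smooth_partial.
Qed.

Lemma integrable_sub_itv (f : R -> R) t : 0 <= t <= T ->
  leb.-integrable `[0, T] (EFin \o f) -> leb.-integrable `[0, t] (EFin \o f).
Proof.
move=> /andP[_ tT]; apply: integrableS => //.
by move=> s /=; rewrite !in_itv/= => /andP[-> /le_trans]; apply.
Qed.

Lemma sub_itv s t : 0 <= t <= T -> `[0, t]%classic s -> 0 <= s <= T.
Proof. by move=> /andP[_ tT] /=; rewrite in_itv/= => /andP[-> /le_trans]; apply. Qed.

Let ha : 0 < a < 1. Proof. by rewrite a1 (lt_trans theta0). Qed.

Lemma weak_test_linear c f g : weak_test f -> weak_test g -> weak_test (fun x => c * f x + g x).
Proof.
move=> [tf bf If] [tg bg Ig].
have [fL pfL lfL] := torus_smooth_L2 tf; have [gL pgL lgL] := torus_smooth_L2 tg.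
have fbL := bounded_measurable_L2 bf; have gbL := bounded_measurable_L2 bg.
have df x := smooth_differentiable x tf.2; have dg x := smooth_differentiable x tg.2.
have fracE : frac_laplacian theta (fun x => c * f x + g x) =
    (fun x => c * frac_laplacian theta f x + frac_laplacian theta g x).
  apply/funext => x; apply: (frac_laplacian_linear hd theta0 theta_a a1).
    exact: torus_smooth_frac_admissible ha tf.
  exact: torus_smooth_frac_admissible ha tg.
have pE i : partial i (fun x => c * f x + g x) = (fun x => c * partial i f x + partial i g x).
  exact: partial_linear.
have lE : laplacian (fun x => c * f x + g x) = (fun x => c * laplacian f x + laplacian g x).
  apply/funext => x; rewrite /laplacian mulr_sumr -big_split; apply: eq_bigr => i _ /=.
  rewrite pE partial_linear// => y; apply: smooth_differentiable.
    exact: (torus_smooth_partial i tf).2.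
  exact: (torus_smooth_partial i tg).2.
split.
- split; first by move=> x i; rewrite tf.1 tg.1.
  by apply: smooth_linear; [exact: tf.2|exact: tg.2].
- by rewrite fracE; exact: bounded_measurable_linear.
move=> t tT; have ut := uL tT.
have ipr v : v \in L2 -> ip tor v (fun x => c * f x + g x) = c * ip tor v f + ip tor v g.
  by move=> vL; rewrite ipC ip_linear// (ipC _ f) (ipC _ g).
have i1 := integrable_sub_itv tT (pairing_integrable pfL fbL lfL fL).
have i2 := integrable_sub_itv tT (pairing_integrable pgL gbL lgL gL).
transitivity (c * (ip tor (u t) f - ip tor u0 f) + (ip tor (u t) g - ip tor u0 g)).
  by rewrite !ipr//; ring.
rewrite If// Ig// -RintegralZl// -RintegralD//; last exact: integrableZ_EFin.
apply: eq_Rintegral => s; rewrite inE => /(sub_itv tT) sT.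
rewrite -(pairing_linear c sT pfL fbL lfL fL pgL gbL lgL gL) fracE lE.
by rewrite (_ : (fun i => partial i _) = (fun i x => c * partial i f x + partial i g x)) //; apply/funext.
Qed.

Lemma weak_test0 : weak_test (fun=> 0).
Proof.
have fE : frac_laplacian theta (fun _ : 'rV[R]_d => 0) = fun=> 0.
  by apply/funext => x; exact: (frac_laplacian0 hd theta0 theta_a a1).
split; first by split => //; exact: smooth0.
  by rewrite fE; split => //; exists 0 => x; rewrite normr0.
have ip0r v : ip tor v (fun=> 0) = 0 by rewrite ipC ip0l.
have lE : laplacian (fun _ : 'rV[R]_d => 0 : R) = fun=> 0.
  by apply/funext => x; rewrite /laplacian big1// => i _; rewrite !partial0.
move=> t tT; rewrite !ip0r subrr fE lE.
transitivity (\int[leb]_(s in `[0, t]) (0 : R)); first by rewrite Rintegral_cst// mul0r.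
apply: eq_Rintegral => s _; apply/esym; rewrite /pairing !ip0r mulr0 subr0 !addr0 big1// => i _.
by rewrite partial0 ip0r.
Qed.

Lemma nrm_bounded (f : 'rV[R]_d -> R) eta : 0 <= eta -> measurable_fun setT f ->
  (forall x, `|f x| <= eta) -> nrm tor f <= eta.
Proof.
move=> eta0 mf fe; rewrite -[leRHS]mulr1.
have -> : 1 = nrm tor (fun=> 1).
  by rewrite /nrm /ip; under eq_Rintegral do rewrite mulr1; rewrite Rintegral_torus_cst sqrtr1.
by apply: nrm_le => //; [exact: one_L2|move=> x; rewrite normr1 mulr1].
Qed.

Hypothesis test_mode : forall n, ip tor (trig_family cos_phase n) (trig_family cos_phase n) = 1 ->
  weak_test (trig_family cos_phase n).

Lemma weak_test_approx (psi : 'rV[R]_d -> R) eta : torus_smooth psi -> 0 < eta -> exists g, [/\ weak_test g,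
  forall x, `|g x - psi x| <= eta,
  forall i x, `|partial i g x - partial i psi x| <= eta,
  forall x, `|laplacian g x - laplacian psi x| <= d%:R * eta &
  forall x, `|frac_laplacian theta g x - frac_laplacian theta psi x| <= eta * frac_mass d theta a].
Proof.
move=> tpsi eta0.
have [g [tg g0 g1 g2 g3]] := torus_smooth_approx ha weak_test_linear weak_test0
  (trig_span weak_test_linear weak_test0 test_mode) tpsi eta0.
exists g; split => //.
  move=> x; rewrite /laplacian -sumrB; apply: le_trans (ler_norm_sum _ _ _) _.
  apply: (@le_trans _ _ (\sum_(i < d) eta)); first by apply: ler_sum => i _; exact: g2.
  by rewrite sumr_const card_ord mulr_natl.
move=> x; have adg : frac_admissible a g by case: tg => tg _ _; exact: torus_smooth_frac_admissible.
have adp := torus_smooth_frac_admissible ha tpsi.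
have E : (fun y => g y - psi y) = (fun y => -1 * psi y + g y) by apply/funext => y; ring.
have -> : frac_laplacian theta g x - frac_laplacian theta psi x =
    frac_laplacian theta (fun y => g y - psi y) x.
  by rewrite E (frac_laplacian_linear hd theta0 theta_a a1)//; ring.
apply: (frac_laplacian_le hd theta0 theta_a a1); last by move=> z; exact: g3.
by rewrite E; exact: frac_admissible_linear.
Qed.

(** Boundedness comes from second differences. Measurability is inherited as a limit from
    trigonometric approximations, for which it is part of [weak_test]. *)
Lemma frac_laplacian_bounded_measurable (psi : 'rV[R]_d -> R) : torus_smooth psi ->
  bounded_measurable (frac_laplacian theta psi).
Proof.
move=> tpsi; split; last first.
  have adp := torus_smooth_frac_admissible ha tpsi.
  have [_ _ [D HD]] := adp; exists (D * frac_mass d theta a) => x.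
  by apply: (frac_laplacian_le hd theta0 theta_a a1).
have /choice [g Hg] : forall n : nat, exists g, weak_test g /\
    forall x, `|frac_laplacian theta g x - frac_laplacian theta psi x| <= n.+1%:R^-1 * frac_mass d theta a.
  move=> n; have [|g [? _ _ _ ?]] := @weak_test_approx psi n.+1%:R^-1 tpsi; first by rewrite invr_gt0.
  by exists g.
apply: (@measurable_fun_cvg _ _ _ _ (fun n => frac_laplacian theta (g n))).
  by move=> n; have [[_ [m _] _] _] := Hg n.
move=> x _; apply/cvgrPdist_le => eta eta0; near=> n; rewrite distrC.
apply: le_trans ((Hg n).2 x) _; rewrite mulrC ler_pdivrMr// mulrC -ler_pdivrMr//.
apply: (@le_trans _ _ n%:R); last by rewrite ler_nat.
by apply/ltW; near: n; exact: nbhs_infty_gtr.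
Unshelve. all: end_near. Qed.

(** Both sides of the equation move by at most a constant times eta when psi is replaced by an
    approximating test function, for which they agree. *)
Lemma weak_test_smooth (psi : 'rV[R]_d -> R) : torus_smooth psi -> weak_test psi.
Proof.
move=> tpsi; have bfrac := frac_laplacian_bounded_measurable tpsi.
split => // t tT.
have [pL ppL lpL] := torus_smooth_L2 tpsi; have fpL := bounded_measurable_L2 bfrac.
have iM := integrable_sub_itv tT integrable_norm_lt.
have ut := uL tT.
pose M := frac_mass d theta a; have M0 : 0 <= M := frac_mass_ge0 d theta a.
pose W s := pairing_const1 + pairing_const2 * `|lt s|.
have iW : leb.-integrable `[0, t] (EFin \o W).
  apply: integrableD_EFin => //; last exact: integrableZ_EFin.
  by apply: (integrable_sub_itv tT); exact: integrable_cst_itv.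
pose KW := \int[leb]_(s in `[0, t]) W s.
pose Lpsi := ip tor (u t) psi - ip tor u0 psi.
pose Rpsi := \int[leb]_(s in `[0, t])
  pairing s (fun i => partial i psi) (frac_laplacian theta psi) (laplacian psi) psi.
have key eta : 0 < eta -> `|Lpsi - Rpsi| <= eta * (B + nrm tor u0 + (1 + d%:R + M) * `|KW|).
  move=> eta0; have [g [[tg bg Ig] g0 g1 g2 g3]] := weak_test_approx tpsi eta0.
  have [gL pgL lgL] := torus_smooth_L2 tg; have fgL := bounded_measurable_L2 bg.
  (* A common bound for the four errors eta, eta, d eta and M eta. *)
  pose zeta := (1 + d%:R + M) * eta.
  have zeta0 : 0 <= zeta by rewrite mulr_ge0 ?(ltW eta0)// addr_ge0.
  have ez : eta <= zeta by rewrite ler_peMl ?(ltW eta0)// -addrA lerDl addr_ge0.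
  have subE (f f' : 'rV[R]_d -> R) : (fun x => -1 * f x + f' x) = (fun x => f' x - f x).
    by apply/funext => x; ring.
  have nb (f f' : 'rV[R]_d -> R) : f \in L2 -> f' \in L2 -> (forall x, `|f' x - f x| <= zeta) ->
      nrm tor (fun x => -1 * f x + f' x) <= zeta.
    move=> fL fL' ff; rewrite subE; apply: nrm_bounded => //.
    exact: L2_measurable (L2B fL' fL).
  have lin (f f' : 'rV[R]_d -> R) : f \in L2 -> f' \in L2 -> (fun x => -1 * f x + f' x) \in L2.
    by move=> fL fL'; rewrite subE; exact: L2B.
  have Eg : Lpsi - Rpsi = (Lpsi - (ip tor (u t) g - ip tor u0 g)) +
      (\int[leb]_(s in `[0, t]) pairing s (fun i => partial i g) (frac_laplacian theta g) (laplacian g) g - Rpsi).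
    by rewrite Ig//; ring.
  rewrite Eg mulrDr; apply: le_trans (ler_normD _ _) _; apply: lerD.
    have -> : Lpsi - (ip tor (u t) g - ip tor u0 g) =
        ip tor (u t) (fun x => psi x - g x) - ip tor u0 (fun x => psi x - g x).
      have ipBr v : v \in L2 -> ip tor v (fun x => psi x - g x) = ip tor v psi - ip tor v g.
        by move=> vL; rewrite ipC ipBl// (ipC _ psi) (ipC _ g).
      by rewrite !ipBr// /Lpsi; ring.
    have nd : nrm tor (fun x => psi x - g x) <= eta.
      apply: nrm_bounded; [exact: ltW|exact: L2_measurable (L2B pL gL)|].
      by move=> x; rewrite distrC.
    have dL := L2B pL gL.
    apply: le_trans (ler_normB _ _) _; rewrite mulrDr; apply: lerD.
      apply: le_trans (cauchy_schwarz ut dL) _; rewrite mulrC; apply: ler_pM; rewrite ?nrm_ge0//.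
      exact: uB.
    apply: le_trans (cauchy_schwarz u0L dL) _; rewrite mulrC; apply: ler_pM; rewrite ?nrm_ge0//.
  have i1 := integrable_sub_itv tT (pairing_integrable pgL fgL lgL gL).
  have i2 := integrable_sub_itv tT (pairing_integrable ppL fpL lpL pL).
  rewrite /Rpsi -RintegralB//.
  have i3 := @integrableB_EFin _ _ _ leb _ (measurable_itv `[0, t]) _ _ i1 i2.
  apply: le_trans (le_normr_Rintegral _ i3) _ => //.
  apply: (@le_trans _ _ (\int[leb]_(s in `[0, t]) (zeta * W s))).
    apply: le_Rintegral => //.
    - by have := integrable_abse i3; apply: eq_integrable.
    - exact: integrableZ_EFin.
    move=> s /(sub_itv tT) sT.
    have -> : pairing s (fun i => partial i g) (frac_laplacian theta g) (laplacian g) g -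
        pairing s (fun i => partial i psi) (frac_laplacian theta psi) (laplacian psi) psi =
        pairing s (fun i x => -1 * partial i psi x + partial i g x)
          (fun x => -1 * frac_laplacian theta psi x + frac_laplacian theta g x)
          (fun x => -1 * laplacian psi x + laplacian g x) (fun x => -1 * psi x + g x).
      by rewrite (pairing_linear (-1) sT ppL fpL lpL pL pgL fgL lgL gL); ring.
    apply: (pairing_le sT zeta0 (fun i => lin _ _ (ppL i) (pgL i)) (lin _ _ fpL fgL)
      (lin _ _ lpL lgL) (lin _ _ pL gL)).
    - by move=> i; apply: nb => // x; exact: le_trans (g1 i x) ez.
    - apply: nb => // x; apply: le_trans (g3 x) _; rewrite mulrC ler_wpM2r ?(ltW eta0)//.
      by rewrite lerDr addr_ge0.
    - apply: nb => // x; apply: le_trans (g2 x) _; rewrite ler_wpM2r ?(ltW eta0)//.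
      by rewrite addrAC lerDr addr_ge0.
    - by apply: nb => // x; exact: le_trans (g0 x) ez.
  rewrite RintegralZl// -/KW /zeta [_ * eta]mulrC -mulrA ler_wpM2l ?(ltW eta0)// ler_wpM2l ?ler_norm//.
  by rewrite addr_ge0.
(* A positive gap would be at most eta (D - 1) for every eta > 0; taking eta to be the gap divided
   by 2 D is contradictory. *)
apply/eqP; rewrite -subr_eq0 -normr_le0 leNgt; apply/negP => pos.
have D0 : 0 <= B + nrm tor u0 + (1 + d%:R + M) * `|KW|.
  by rewrite !addr_ge0 ?nrm_ge0 ?mulr_ge0 ?addr_ge0.
pose D := B + nrm tor u0 + (1 + d%:R + M) * `|KW| + 1.
have Dp : 0 < D by rewrite ltr_pwDr.
have := key (`|Lpsi - Rpsi| / 2 / D).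
rewrite !divr_gt0// => /(_ isT); apply/negP; rewrite -ltNge.
apply: (@le_lt_trans _ _ (`|Lpsi - Rpsi| / 2)); last by rewrite ltr_pdivrMr// ltr_pMr// ltr1n.
rewrite -[leRHS](divfK (lt0r_neq0 Dp)) ler_wpM2l ?lerDl//.
by rewrite !divr_ge0// ltW.
Qed.

End weak_formulation.

Lemma rV_coord_le_norm {R : realType} n (x : 'rV[R]_n) i : `|x ord0 i| <= `|x|.
Proof.
rewrite [leRHS](_ : _ = mx_norm x)// mx_normrE.
exact: (le_bigmax _ (fun ij : 'I_1 * 'I_n => `|x ij.1 ij.2|) (ord0, i)).
Qed.

Section mode_flux_bound.
Context {R : realType} (d : nat).
Local Notation tor := (@torus_measure R d).
Local Notation L2 := (Lfun tor 2%:E).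
Variables (theta a : R).
Hypothesis hd : (0 < d)%N.
Hypothesis theta0 : 0 < theta.
Hypothesis theta_a : theta < a.
Hypothesis a1 : a < 1.
Hypothesis a2 : 2^-1 <= a.

Definition flux_const : R := Num.sqrt (2 * d%:R * d%:R + 2 * (4 * frac_mass d theta a) ^+ 2).

Lemma mode_flux_le g g0 kappa (s : seq nat) : uniq s -> (forall i, g i \in L2) -> g0 \in L2 ->
  (forall i, nrm tor (g i) <= kappa) -> nrm tor g0 <= kappa ->
  \sum_(n <- s) mode_flux theta a g g0 n ^+ 2 <= (flux_const * kappa) ^+ 2.
Proof.
move=> us gL g0L gk g0k; have kap0 : 0 <= kappa by apply: le_trans g0k; exact: nrm_ge0.
apply: le_trans (mode_flux_bessel hd theta0 theta_a a1 a2 us gL g0L) _.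
have -> : (flux_const * kappa) ^+ 2 =
    2 * d%:R * d%:R * kappa ^+ 2 + 2 * (4 * frac_mass d theta a) ^+ 2 * kappa ^+ 2.
  rewrite exprMn -mulrDl /flux_const; congr (_ * _); apply: sqr_sqrtr.
  apply: addr_ge0; first by rewrite -mulrA mulr_ge0 ?mulr_ge0 ?ler0n.
  by apply: mulr_ge0; [exact: ler0n|exact: sqr_ge0].
apply: lerD.
  rewrite -[leRHS]mulrA ler_wpM2l ?mulr_ge0//.
  apply: (@le_trans _ _ (\sum_(i < d) kappa ^+ 2)).
    by apply: ler_sum => i _; rewrite lerXn2r ?nnegrE ?nrm_ge0.
  by rewrite sumr_const card_ord mulr_natl.
apply: ler_wpM2l; first by apply: mulr_ge0; [exact: ler0n|exact: sqr_ge0].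
by rewrite lerXn2r ?nnegrE ?nrm_ge0.
Qed.

End mode_flux_bound.

(** * Construction of the solution *)

Section existence.
Context {R : realType} {d : nat} {H : completeNormedModType R}.
Local Notation tor := (@torus_measure R d).
Local Notation L2 := (Lfun tor 2%:E).
Local Notation leb := (@lebesgue_measure R).
Local Notation phi := (@trig_family R d cos_phase).
Local Notation lam := (@mode_eigenvalue R d).
Variables (dp : {dot H for idfun}) (e : nat -> H) (h : nat -> 'rV[R]_d -> R -> R).
Hypothesis hdp : hilbert_norm dp.
Hypothesis dp_e : forall j k, dp (e j) (e k) = (j == k)%:R.
Variable C : R.
Hypothesis hcont : forall k, continuous (fun p : 'rV[R]_d * R => h k p.1 p.2).
Hypothesis h_growth : forall x y,
  (\sum_(0 <= k <oo) (`|h k x y| ^+ 2)%:E <= (C * (1 + `|y| ^+ 2))%:E)%E.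
Hypothesis h_lip : forall x x' y y',
  (\sum_(0 <= k <oo) (`|h k x y - h k x' y'| ^+ 2)%:E <=
    (C * (torus_dist x x' ^+ 2 + `|y - y'| ^+ 2))%:E)%E.
Variables (F : R -> 'rV[R]_d) (Phi : R -> R) (K : R).
Hypothesis K0 : 0 <= K.
Hypothesis F_lip : forall i y z, `|F y ord0 i - F z ord0 i| <= K * `|y - z|.
Hypothesis Phi_lip : forall y z, `|Phi y - Phi z| <= K * `|y - z|.
Variables (T theta a eps : R).
Hypothesis hd : (0 < d)%N.
Hypothesis T0 : 0 < T.
Hypothesis theta0 : 0 < theta.
Hypothesis theta_a : theta < a.
Hypothesis a1 : a < 1.
Hypothesis a2 : 2^-1 <= a.
Hypothesis eps0 : 0 < eps.
Variables (lt : R -> H) (sl : nat -> R -> H).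
Hypothesis sl_simple : forall n, time_simple (sl n).
Hypothesis sl_cvg : forall t, `|sl n t - lt t| @[n --> \oo] --> 0.
Hypothesis lt2 : leb.-integrable `[0, T] (EFin \o (fun t => `|lt t| ^+ 2)).
Variable u0 : 'rV[R]_d -> R.
Hypothesis u0L : u0 \in L2.

(** The mild problem is used with w_n = (1 + lam_n)^a and A_n = eps lam_n; the factor divided out in
    [mode_flux] is restored by w_n. *)
Let P n v := mode_flux theta a (fun i => flux F i v) (Phi \o v) n.
Let Q n t v := ip tor (noise dp e h v (lt t)) (phi n).
Let KG := \sum_i (`|F 0 ord0 i| + K) + (`|Phi 0| + K).
Let S := flux_const d theta a.
Let L := S * KG + Num.sqrt C.

Let KG1 i : `|F 0 ord0 i| + K <= KG.
Proof.
rewrite /KG (bigD1 i)//= -[leRHS]addrA lerDl addr_ge0 ?addr_ge0//.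
by apply: sumr_ge0 => j _; rewrite addr_ge0.
Qed.

Let KG2 : `|Phi 0| + K <= KG.
Proof. by rewrite /KG lerDr; apply: sumr_ge0 => j _; rewrite addr_ge0. Qed.

Let KK : K <= KG. Proof. by apply: le_trans KG2; rewrite lerDr. Qed.
Let KG0 : 0 <= KG. Proof. exact: le_trans KK. Qed.
Let S0 : 0 <= S. Proof. exact: sqrtr_ge0. Qed.
Let SL : S * KG <= L. Proof. by rewrite lerDl sqrtr_ge0. Qed.
Let CL : Num.sqrt C <= L. Proof. by rewrite lerDr mulr_ge0. Qed.
Let L0 : 0 <= L. Proof. by rewrite addr_ge0 ?mulr_ge0 ?sqrtr_ge0. Qed.

Let fluxL i v : v \in L2 -> flux F i v \in L2. Proof. exact: (flux_L2 K0 F_lip). Qed.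
Let PhiL v : v \in L2 -> (Phi \o v) \in L2. Proof. exact: (Phi_L2 K0 Phi_lip). Qed.
Let noL v l : v \in L2 -> noise dp e h v l \in L2.
Proof. exact: (noise_L2 hdp dp_e hcont h_growth). Qed.

Let phi_orth m n : m != n -> ip tor (phi m) (phi n) = 0.
Proof. by apply: trig_family_orth; [exact: cos_phase_sub|exact: cos_phase_add]. Qed.
Let phiL m : phi m \in L2. Proof. exact: trig_family_L2. Qed.
Let phi1 m : ip tor (phi m) (phi m) <= 1. Proof. exact: trig_family_le1. Qed.

Let bes f (s : seq nat) : uniq s -> f \in L2 ->
  \sum_(n <- s) ip tor f (phi n) ^+ 2 <= nrm tor f ^+ 2.
Proof. by move=> us fL; apply: bessel. Qed.

Let sqle (x y : R) : 0 <= x -> x <= y -> x ^+ 2 <= y ^+ 2.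
Proof. by move=> x0 xy; rewrite lerXn2r ?nnegrE// (le_trans x0). Qed.

Let P_lip s v v' : uniq s -> v \in L2 -> v' \in L2 ->
  \sum_(n <- s) (P n v - P n v') ^+ 2 <= (L * nrm tor (fun x => v x - v' x)) ^+ 2.
Proof.
move=> us vL vL'; set D := nrm tor _; have D0 : 0 <= D by exact: nrm_ge0.
rewrite (eq_bigr (fun n => mode_flux theta a (fun i x => flux F i v x - flux F i v' x)
    (fun x => (Phi \o v) x - (Phi \o v') x) n ^+ 2)); last first.
  by move=> n _; rewrite /P mode_fluxB// => [i|i||]; [exact: fluxL|exact: fluxL|exact: PhiL|exact: PhiL].
apply: (@le_trans _ _ ((S * (KG * D)) ^+ 2)); last first.
  by apply: sqle; rewrite ?mulr_ge0// mulrA ler_wpM2r.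
have KD : K * D <= KG * D by rewrite ler_wpM2r.
apply: (mode_flux_le hd theta0 theta_a a1 a2 us).
- by move=> i; apply: L2B; exact: fluxL.
- by apply: L2B; exact: PhiL.
- by move=> i; apply: le_trans KD; exact: (nemytskii_lip K0 (F_lip i)).
- by apply: le_trans KD; exact: (nemytskii_lip K0 Phi_lip).
Qed.

Let P_growth s v : uniq s -> v \in L2 ->
  \sum_(n <- s) P n v ^+ 2 <= (L * (1 + nrm tor v)) ^+ 2.
Proof.
move=> us vL; set D := 1 + nrm tor v; have D0 : 0 <= D by rewrite addr_ge0 ?nrm_ge0.
apply: (@le_trans _ _ ((S * (KG * D)) ^+ 2)); last first.
  by apply: sqle; rewrite ?mulr_ge0// mulrA ler_wpM2r.
apply: (mode_flux_le hd theta0 theta_a a1 a2 us).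
- by move=> i; exact: fluxL.
- exact: PhiL.
- move=> i; apply: le_trans (nemytskii_L2 K0 (F_lip i) vL).2 _.
  by rewrite ler_wpM2r// KG1.
- apply: le_trans (nemytskii_L2 K0 Phi_lip vL).2 _.
  by rewrite ler_wpM2r// KG2.
Qed.

Let Q_lip s t v v' : uniq s -> 0 <= t <= T -> v \in L2 -> v' \in L2 ->
  \sum_(n <- s) (Q n t v - Q n t v') ^+ 2 <= (L * `|lt t| * nrm tor (fun x => v x - v' x)) ^+ 2.
Proof.
move=> us tT vL vL'; set D := nrm tor _; have D0 : 0 <= D by exact: nrm_ge0.
rewrite (eq_bigr (fun n => ip tor (fun x => noise dp e h v (lt t) x - noise dp e h v' (lt t) x) (phi n) ^+ 2)); last first.
  by move=> n _; rewrite /Q ipBl// noL.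
apply: le_trans (bes us (L2B (noL _ vL) (noL _ vL'))) _; apply: sqle; first exact: nrm_ge0.
apply: le_trans (nrm_noise_lip hdp dp_e hcont h_growth h_lip _ vL vL') _.
by rewrite ler_wpM2r// ler_wpM2r.
Qed.

Let Q_growth s t v : uniq s -> 0 <= t <= T -> v \in L2 ->
  \sum_(n <- s) Q n t v ^+ 2 <= (L * `|lt t| * (1 + nrm tor v)) ^+ 2.
Proof.
move=> us tT vL; apply: le_trans (bes us (noL (lt t) vL)) _; apply: sqle; first exact: nrm_ge0.
apply: le_trans (nrm_noise_le hdp dp_e hcont h_growth _ vL) _.
by rewrite ler_wpM2r ?addr_ge0 ?nrm_ge0// ler_wpM2r.
Qed.

Let Q_measurable n u : L2cont tor T u -> measurable_fun `[0, T] (fun t => Q n t (u t)).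
Proof.
move=> uc; have [B uB] := L2cont_bounded uc.
exact: (measurable_noise_time T0 uc uB hdp dp_e hcont h_growth h_lip (phiL n) sl_simple sl_cvg).
Qed.

(** Since 1 + lam <= (1 + 1 / eps) (1 + eps lam), the weight is controlled by the viscous decay
    rate, with a constant that depends on eps. *)
Let w_le n : `|(1 + lam n) `^ a| <= (1 + eps^-1) `^ a * (1 + eps * lam n) `^ a.
Proof.
have l0 : 0 <= lam n by exact: mode_eigenvalue_ge0.
have e0 := ltW eps0.
have ei : 0 <= eps^-1 by rewrite invr_ge0.
have el : 0 <= eps * lam n by rewrite mulr_ge0.
have a0 : 0 <= a by apply: le_trans a2.
rewrite ger0_norm ?powR_ge0// -powRM ?addr_ge0// ge0_ler_powR ?nnegrE ?mulr_ge0 ?addr_ge0//.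
rewrite mulrDl mul1r mulrDr mulr1 mulKf ?gt_eqF//; lra.
Qed.

Lemma spectral_solution : exists (u : R -> 'rV[R]_d -> R) (B : R),
  [/\ L2cont tor T u, forall t, 0 <= t <= T -> nrm tor (u t) <= B,
      forall t, Defs.periodic (u t) &
      forall psi, torus_smooth psi -> weak_test dp e h F Phi T theta eps lt u u0 psi].
Proof.
(* The choice c = (1 - a) / 2 gives a + c = (1 + a) / 2 < 1, and c <= 1/4 <= a because a >= 1/2. *)
have c0 : 0 < (1 - a) / 2 by rewrite divr_gt0// subr_gt0.
have ca : (1 - a) / 2 <= a by move: a2; lra.
have ac1 : a + (1 - a) / 2 < 1 by move: a1; lra.
have A0 n : 0 <= eps * lam n by rewrite mulr_ge0 ?(ltW eps0)// mode_eigenvalue_ge0.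
have Aunb Th : exists N, forall n, (N <= n)%N -> Th <= eps * lam n.
  have [N HN] := mode_eigenvalue_unbounded d (Th / eps).
  by exists N => n /HN; rewrite ler_pdivrMr// mulrC.
have k0b s : uniq s -> \sum_(n <- s) ip tor u0 (phi n) ^+ 2 <= nrm tor u0 ^+ 2.
  by move=> us; exact: bes.
have [u [[uc [B uB]] uper ueq]] := mild_solution (@one_L2 R d) phiL phi_orth phi1
  T0 c0 ca ac1 A0 Aunb w_le (fun t => normr_ge0 (lt t)) lt2 L0 P_lip P_growth Q_lip Q_growth
  Q_measurable (nrm_ge0 _ _) k0b.
exists u, B; split => //.
  (* Every mode takes equal values at x and at x shifted by a period, hence so does u. *)
  by move=> t x i; apply: uper => n; exact: (torus_smooth_mode d n).1.
apply: (weak_test_smooth hdp dp_e hcont h_growth h_lip K0 F_lip Phi_lip hd T0 theta0 theta_a a1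
  sl_simple sl_cvg lt2 u0L uc uB) => n n1.
have ts : torus_smooth (phi n) := torus_smooth_mode d n.
split => //.
  rewrite (frac_laplacian_mode hd theta0 theta_a a1).
  have s0 : @bounded_measurable R d (fun=> 0).
    by apply: torus_smooth_bounded_measurable; split => //; exact: smooth0.
  have := bounded_measurable_linear (mode_symbol d theta n) (torus_smooth_bounded_measurable ts)
    s0.
  by under eq_fun do rewrite addr0.
move=> t tT; rewrite ueq//; apply: eq_Rintegral => s.
rewrite inE => /(sub_itv tT) sT; have us := uc.1 s sT.
have ipZr f g c : f \in L2 -> g \in L2 -> ip tor f (fun x => c * g x) = c * ip tor f g.
  by move=> fL gL; rewrite ipC ipZl// ipC.
have chiL m : trig_family sin_phase m \in L2 by exact: trig_family_L2.
rewrite /pairing /forcing laplacian_mode (frac_laplacian_mode hd theta0 theta_a a1).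
(* The weight w_n cancels the scale of [mode_flux], leaving exactly the unscaled pairings with
   derivatives of phi n. *)
rewrite /P /mode_flux mulrA mode_scaleK mul1r /Q.
rewrite !ipZr ?PhiL//.
have -> : \sum_i ip tor (flux F i (u s)) (partial i (phi n)) =
    \sum_i mode_freq n i * ip tor (flux F i (u s)) (trig_family sin_phase n).
  by apply: eq_bigr => i _; rewrite partial_mode ipZr// fluxL.
by ring.
Qed.

End existence.

(** In the theorem the name [ip] is taken by the inner product of H. *)
Local Notation tdot := (ip (@torus_measure _ _)).

Theorem proposition3p6 (R : realType) (d : nat) (hd : (0 < d)%N)
    (T theta : R) (hT : 0 < T) (htheta : 0 < theta < 1)
    (H : completeNormedModType R) (ip : {dot H for idfun}) (e : nat -> H)
    (hip : hilbert_norm ip) (he : orthonormal_basis ip e)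
    (F : R -> 'rV[R]_d) (Phi : R -> R) (h : nat -> 'rV[R]_d -> R -> R)
    (hA1 : A1 F) (hA2 : A2 Phi) (hA3 : A3 h)
    (eps : R) (heps : 0 < eps)
    (u0 : 'rV[R]_d -> R) (hu0 : torus_H1 u0)
    (l : R -> H) (hl : bochner_L hnorm setT 2%:E T l) :
  exists u : R -> 'rV[R]_d -> R, weak_solution ip e T theta F Phi h eps u0 l u.
Proof.
have /andP[theta0 theta1] := htheta.
(* The midpoint of theta and 1; it is at least 1/2 because theta > 0. *)
pose a := (1 + theta) / 2.
have theta_a : theta < a by rewrite /a; lra.
have a1 : a < 1 by rewrite /a; lra.
have a2 : 2^-1 <= a by rewrite /a; lra.
have [_ _ _ /lipschitz_const[KF KF0 F_lip]] := hA1.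
have [_ /lipschitz_const[KP KP0 P_lip]] := hA2.
have [_ hcont [C [h_growth h_lip]]] := hA3.
have K0 : 0 <= KF + KP by rewrite addr_ge0.
have F_lip' i y z : `|F y ord0 i - F z ord0 i| <= (KF + KP) * `|y - z|.
  rewrite (_ : F y ord0 i - _ = (F y - F z) ord0 i); last by rewrite !mxE.
  apply: le_trans (rV_coord_le_norm _ _) (le_trans (F_lip y z) _).
  by rewrite ler_wpM2r// lerDl.
have P_lip' y z : `|Phi y - Phi z| <= (KF + KP) * `|y - z|.
  by apply: le_trans (P_lip y z) _; rewrite ler_wpM2r// lerDr.
have u0L := hu0.1.2.
have [N [lt [sl [mN N0 lE [ss sc] lt2]]]] := bochner_regularize hl.
have [u [B [uc uB up uw]]] := spectral_solution hip he.1 hcont h_growth h_lip K0 F_lip' P_lip'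
  hd hT theta0 theta_a a1 a2 heps ss sc lt2 u0L.
exists u; split; first by apply: (L2cont_bochner hT uc uB) => t _; exact: up.
move=> psi tpsi; have [_ bpsi psiE] := uw psi tpsi.
have [pL ppL lpL] := torus_smooth_L2 tpsi; have fpL := bounded_measurable_L2 bpsi.
(* The equation holds at every t in [0, T], so the exceptional set is the complement, which
   [time_measure T] does not charge. *)
exists (~` `[0, T]%classic); split.
- by apply: measurableC; exact: measurable_itv.
- by rewrite /time_measure/= /mrestr setICl measure0.
move=> t Nt /=; rewrite in_itv/= => tT; apply: Nt; have {}psiE := psiE t tT.
have fi i := integrable_sub_itv tT (flux_integrable K0 F_lip' uc i (ppL i)).
have Pi := integrable_sub_itv tT (Phi_integrable K0 P_lip' uc fpL).
have ui := integrable_sub_itv tT (u_integrable uc lpL).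
have ni := integrable_sub_itv tT (noise_integrable hip he.1 hcont h_growth h_lip hT ss sc lt2 uc uB pL).
have sfi : (@lebesgue_measure R).-integrable `[0, t]
    (EFin \o fun s => \sum_i tdot (flux F i (u s)) (partial i psi)).
  by apply: integrable_sum_EFin.
apply: (etrans psiE); rewrite /pairing.
have mI : measurable (`[0, t]%classic : set (measurableTypeR R)) by exact: measurable_itv.
have i1 := integrableB_EFin mI sfi Pi.
have i2 := integrableZ_EFin mI eps ui.
rewrite (RintegralD mI (integrableD_EFin mI i1 i2) ni) (RintegralD mI i1 i2).
rewrite (RintegralB mI sfi Pi) (RintegralZl eps mI ui).
have -> : \int[lebesgue_measure]_(s in `[0, t])
      (\sum_i tdot (flux F i (u s)) (partial i psi)) =
    \int[lebesgue_measure]_(s in `[0, t])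
      (\int[torus_measure]_x edot (F (u s x)) (grad psi x)).
  apply: eq_Rintegral => s; rewrite inE => /(sub_itv tT)/uc.1 us.
  transitivity (\int[@torus_measure R d]_x (\sum_i flux F i (u s) x * partial i psi x)).
    symmetry; apply: Rintegral_sum => [|i]; first exact: measurableT.
    by apply: ip_integrable; [exact: (flux_L2 K0 F_lip')|exact: ppL].
  by apply: eq_Rintegral => x _; apply: eq_bigr => i _; rewrite mxE.
(* The equation was solved with the regular version [lt]; it agrees with [l] off a null set of
   times. *)
have -> : \int[lebesgue_measure]_(s in `[0, t]) tdot (noise ip e h (u s) (lt s)) psi =
    \int[lebesgue_measure]_(s in `[0, t]) L2dot (noise ip e h (u s) (l s)) psi.
  apply: (eq_Rintegral_null mN N0) => s /(sub_itv tT) sT Ns.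
  by rewrite (lE s sT Ns).
reflexivity.
Qed.
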